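(* Up to homothety and rigid motion there are exactly two non-planar isotropic separable minimal surfaces in $\mathbb{R}^3$. In the normalization in which the separation constant $\kappa$ satisfies $|\kappa|=4$ and the coefficients are unit, their common separating function $\varphi$ satisfies $$\kappa=+4:\quad \varphi'(t)^2=1+2\cosh\bigl(2\varphi(t)\bigr),\qquad\qquad \kappa=-4:\quad \varphi'(t)^2=1+2\cos\bigl(2\varphi(t)\bigr),$$ and the surfaces $\varphi(x)+\varphi(y)+\varphi(z)=0$ are, respectively, Schwarz's diamond surface $\mathrm{D}$ and Schwarz's primitive surface $\mathrm{P}$, with $$\mathrm{D}:\quad \varphi(t)=\log\frac{\operatorname{sn}(t,\frac14)\operatorname{dn}(t,\frac14)}{\operatorname{cn}(t,\frac14)},$$ $$\mathrm{P}:\quad \varphi(t)=\operatorname{am}\bigl(\sqrt3\,t+a,\ \tfrac43\bigr)=\arctan\bigl(\sqrt3\,\operatorname{cn}(2t,\tfrac34)\bigr),\qquad a:=F[\pi/3\,|\,4/3]=\tfrac{\sqrt3}{2}K[\tfrac34].$$ There is no isotropic example with $\kappa=0$. The two surfaces are conjugate: $\mathrm{P}$ is the adjoint of $\mathrm{D}$.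
   Context: A surface $\Sigma\subset\mathbb{R}^3$ is separable if $\Sigma=\{(x,y,z): f(x)+g(y)+h(z)=0\}$ with $\nabla(f+g+h)\neq0$ on $\Sigma$; it is isotropic if moreover $f,g,h$ agree up to additive constants (so, after distributing the constants, one may take $f=g=h=\varphi$, the common separating function). Separation constant: write $u=f(x)$, $v=g(y)$, $w=h(z)$, so the surface is $u+v+w=0$, and set $X(u)=f'(x)^2$, $Y(v)=g'(y)^2$, $Z(w)=h'(z)^2$ as functions of $u,v,w$. Minimality is equivalent to $(Y+Z)X'+(Z+X)Y'+(X+Y)Z'=0$ on $u+v+w=0$, which forces $X'''/X'=Y'''/Y'=Z'''/Z'=\kappa$ for a constant $\kappa$, the separation constant. The normalization ''$|\kappa|=4$ with unit coefficients'' means that $X(u)=1+e^{2u}+e^{-2u}$ when $\kappa=4$ and $X(u)=1+e^{2iu}+e^{-2iu}$ when $\kappa=-4$. Elliptic functions use the parameter convention $m=k^2$: $F[\phi\,|\,m]=\int_0^{\phi}(1-m\sin^2\theta)^{-1/2}d\theta$, $K[m]=F[\pi/2\,|\,m]$, and $\operatorname{sn},\operatorname{cn},\operatorname{dn}(\cdot,m)$ are the Jacobi functions with parameter $m$. For $m>1$ the Jacobi amplitude is read in its bounded branch, $\operatorname{am}(u,m)=\arcsin\operatorname{sn}(u,m)$. The function $\varphi$ for $\mathrm{D}$ is defined only where $\operatorname{sn}\operatorname{dn}/\operatorname{cn}$ is positive. Schwarz's surfaces $\mathrm{P}$ and $\mathrm{D}$ are the classical triply periodic minimal surfaces with, up to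 homothety and rigid motion, the following Weierstrass representation: $\mathrm{P}$ is the analytic continuation of $\operatorname{Re}\int(1-\zeta^2,\ i(1+\zeta^2),\ 2\zeta)\,\frac{d\zeta}{\sqrt{1+14\zeta^4+\zeta^8}}$, and $\mathrm{D}$ is the analytic continuation of the same expression with the integrand multiplied by $i$. The adjoint (conjugate) of a minimal surface $\operatorname{Re}\int\Phi$ is, up to sign, $\operatorname{Re}\int i\Phi$.
   Formalization: Surfaces being classified are taken connected and are similar to open pieces of D or P (gluing on disconnected domains gives other examples); since φ for D is a logarithm, φ(x)+φ(y)+φ(z)=0 is identified with the part of D where sn·dn/cn is positive in each coordinate. *)

(* Defs.v *)
From Stdlib Require Import Reals.
From Coquelicot Require Import Coquelicot.
Open Scope R_scope.

Notation R3 := (R * R * R)%type.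

Definition dot (p q : R3) : R :=
  let '(x, y, z) := p in let '(x', y', z') := q in x * x' + y * y' + z * z'.

Definition cross (p q : R3) : R3 :=
  let '(x, y, z) := p in let '(x', y', z') := q in
  (y * z' - z * y', z * x' - x * z', x * y' - y * x').

(** Homotheties composed with orientation-preserving rigid motions:
    [(e1, e2, e3)] is a positively oriented orthonormal frame. *)
Definition similarity (T : R3 -> R3) : Prop :=
  exists (r : R) (b e1 e2 e3 : R3),
    0 < r /\ dot e1 e1 = 1 /\ dot e2 e2 = 1 /\ dot e1 e2 = 0 /\ e3 = cross e1 e2 /\
    forall x y z : R,
      T (x, y, z) = plus b (scal r (plus (scal x e1) (plus (scal y e2) (scal z e3)))).

Definition similar (S S' : R3 -> Prop) : Prop :=
  exists T, similarity T /\ forall p, S p <-> S' (T p).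

Definition similar_to_piece (S S' : R3 -> Prop) : Prop :=
  exists T (O : R3 -> Prop), similarity T /\ open O /\ forall p, S p <-> O p /\ S' (T p).

Definition connected (S : R3 -> Prop) : Prop :=
  forall U V : R3 -> Prop, open U -> open V ->
    (forall p, S p -> U p \/ V p) -> (forall p, S p -> ~ (U p /\ V p)) ->
    (forall p, S p -> U p) \/ (forall p, S p -> V p).

Definition closure (S : R3 -> Prop) (p : R3) : Prop :=
  forall O : R3 -> Prop, locally p O -> exists q, O q /\ S q.

Definition nonplanar (S : R3 -> Prop) : Prop :=
  ~ exists (n : R3) (d : R), n <> (0, 0, 0) /\ forall p, S p -> dot n p = d.

Definition grad (F : R3 -> R) (p : R3) : R3 :=
  let '(x, y, z) := p in
  (Derive (fun s => F (s, y, z)) x,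
   Derive (fun s => F (x, s, z)) y,
   Derive (fun s => F (x, y, s)) z).

Definition divergence (V : R3 -> R3) (p : R3) : R :=
  let '(x, y, z) := p in
  Derive (fun s => fst (fst (V (s, y, z)))) x
  + Derive (fun s => snd (fst (V (x, s, z)))) y
  + Derive (fun s => snd (V (x, y, s))) z.

Definition unit_normal (F : R3 -> R) (p : R3) : R3 :=
  scal (/ sqrt (dot (grad F p) (grad F p))) (grad F p).

Definition mean_curvature (F : R3 -> R) (p : R3) : R :=
  / 2 * divergence (unit_normal F) p.

Definition sep_fun (f g h : R -> R) (p : R3) : R :=
  let '(x, y, z) := p in f x + g y + h z.

(** [f], [g], [h] are only meaningful on their domains [A], [B], [C]. *)
Definition sep_surface (A B C : R -> Prop) (f g h : R -> R) (p : R3) : Prop :=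
  let '(x, y, z) := p in A x /\ B y /\ C z /\ sep_fun f g h p = 0.

Definition smooth_on (A : R -> Prop) (f : R -> R) : Prop :=
  forall x n, A x -> ex_derive_n f n x.

Definition separable_minimal (A B C : R -> Prop) (f g h : R -> R) : Prop :=
  open A /\ open B /\ open C /\ smooth_on A f /\ smooth_on B g /\ smooth_on C h /\
  forall p, sep_surface A B C f g h p ->
    grad (sep_fun f g h) p <> (0, 0, 0) /\ mean_curvature (sep_fun f g h) p = 0.

Definition isotropic (A B C : R -> Prop) (f g h : R -> R) : Prop :=
  (forall t, (A t <-> B t) /\ (A t <-> C t)) /\
  exists c c' : R, forall t, A t -> g t = f t + c /\ h t = f t + c'.

(** Connectedness makes this a single surface: level sets over a disconnected
    domain may have unrelated components. *)
Definition isotropic_example (A B C : R -> Prop) (f g h : R -> R) : Prop :=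
  separable_minimal A B C f g h /\ isotropic A B C f g h /\
  connected (sep_surface A B C f g h) /\ nonplanar (sep_surface A B C f g h).

(** [X'''/X' = kappa], cleared of the denominator so that zeros of [X'] are allowed. *)
Definition third_order (X : R -> R) (kappa u : R) : Prop :=
  (forall k : nat, (k <= 3)%nat -> ex_derive_n X k u) /\
  Derive_n X 3 u = kappa * Derive X u.

(** [X], [Y], [Z] are the squared derivatives of [f], [g], [h] as functions of the
    values [u = f x], [v = g y], [w = h z]. *)
Definition separation_constant
    (A B C : R -> Prop) (f g h : R -> R) (kappa : R) : Prop :=
  exists X Y Z : R -> R, forall x y z, sep_surface A B C f g h (x, y, z) ->
    X (f x) = (Derive f x) ^ 2 /\ Y (g y) = (Derive g y) ^ 2 /\
    Z (h z) = (Derive h z) ^ 2 /\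
    third_order X kappa (f x) /\ third_order Y kappa (g y) /\ third_order Z kappa (h z).

(** The homothety of ratio [r], a rescaling by [lambda] of the separating functions
    and a distribution of constants turn the surface into
    [phi x + phi y + phi z = 0] with [phi'^2 = X phi] at every coordinate value
    occurring on it. *)
Definition normalizes_to (X : R -> R) (A B C : R -> Prop) (f g h : R -> R) : Prop :=
  exists (lambda r c1 c2 c3 : R) (phi : R -> R),
    0 < lambda /\ 0 < r /\ c1 + c2 + c3 = 0 /\
    (forall t, A t -> phi (r * t) = lambda * (f t + c1)) /\
    (forall t, B t -> phi (r * t) = lambda * (g t + c2)) /\
    (forall t, C t -> phi (r * t) = lambda * (h t + c3)) /\
    forall x y z, sep_surface A B C f g h (x, y, z) ->
      (Derive phi (r * x)) ^ 2 = X (phi (r * x)) /\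
      (Derive phi (r * y)) ^ 2 = X (phi (r * y)) /\
      (Derive phi (r * z)) ^ 2 = X (phi (r * z)).

(** Unit coefficients: [X u = 1 + e^(2u) + e^(-2u)] and
    [X u = 1 + e^(2iu) + e^(-2iu)]. *)
Definition X_pos (u : R) : R := 1 + 2 * cosh (2 * u).
Definition X_neg (u : R) : R := 1 + 2 * cos (2 * u).

(** [m = k^2] is the parameter, not the modulus. The integral may be improper at its
    endpoint, as at [phi = PI / 3], [m = 4 / 3]. *)
Definition ellF (phi m : R) : R :=
  let I psi :=
    RInt_gen (fun theta => / sqrt (1 - m * (sin theta) ^ 2)) (at_point 0) (at_left psi) in
  if Rle_dec 0 phi then I phi else - I (- phi).

Definition ellK (m : R) : R := ellF (PI / 2) m.

(** Inverse of [ellF _ m], for [m < 1]. *)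
Definition am_lt1 (u m : R) : R := iota (fun phi : R => ellF phi m = u).

(** For [m > 1] these are the values given by Jacobi's real transformation;
    [m = 1] is not used. *)
Definition sn (u m : R) : R :=
  if Rlt_dec m 1 then sin (am_lt1 u m)
  else sin (am_lt1 (sqrt m * u) (/ m)) / sqrt m.

Definition cn (u m : R) : R :=
  if Rlt_dec m 1 then cos (am_lt1 u m)
  else sqrt (1 - / m * (sin (am_lt1 (sqrt m * u) (/ m))) ^ 2).

Definition dn (u m : R) : R :=
  if Rlt_dec m 1 then sqrt (1 - m * (sin (am_lt1 u m)) ^ 2)
  else cos (am_lt1 (sqrt m * u) (/ m)).

(** Bounded branch when [m > 1]. *)
Definition am (u m : R) : R :=
  if Rlt_dec m 1 then am_lt1 u m else asin (sn u m).

Definition ratioD (t : R) : R := sn t (1 / 4) * dn t (1 / 4) / cn t (1 / 4).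

(** [/ 0 = 0], so this excludes the zeros of [cn]. *)
Definition domD (t : R) : Prop := 0 < ratioD t.
Definition cellD (t : R) : Prop := 0 < t < ellK (1 / 4).
Definition phiD (t : R) : R := ln (ratioD t).

Definition shiftP : R := ellF (PI / 3) (4 / 3).
Definition domP (t : R) : Prop := True.
Definition phiP (t : R) : R := am (sqrt 3 * t + shiftP) (4 / 3).

Definition surfaceD : R3 -> Prop := sep_surface domD domD domD phiD phiD phiD.
Definition surfaceP : R3 -> Prop := sep_surface domP domP domP phiP phiP phiP.

(** Endpoints of the analytic continuations of
    [p0 + Re (int (a1, a2, a3) dzeta / sqrt rad)] from [z0] along C^1 paths [zeta],
    [0 <= t <= 1]; [w] is the continuous branch of [sqrt rad] along the path that
    starts at [w0]. *)
Definition continuation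
    (rad a1 a2 a3 : C -> C) (z0 w0 : C) (p0 : R3) (p : R3) : Prop :=
  exists zeta dzeta w : R -> C,
    zeta 0 = z0 /\ w 0 = w0 /\
    (forall t, 0 <= t <= 1 ->
       is_derive (K := R_AbsRing) (V := C_R_NormedModule) zeta t (dzeta t) /\
       continuous dzeta t /\ continuous w t /\
       w t <> 0%C /\ (w t * w t)%C = rad (zeta t)) /\
    let coord (a : C -> C) := RInt (fun t => Re (a (zeta t) * dzeta t / w t)%C) 0 1 in
    p = plus p0 (coord a1, coord a2, coord a3).

(** The closure adds the points over the zeros of [rad] and over [zeta = infinity],
    which no path above reaches. *)
Definition weierstrass
    (rad a1 a2 a3 : C -> C) (z0 w0 : C) (p0 : R3) : R3 -> Prop :=
  closure (continuation rad a1 a2 a3 z0 w0 p0).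

Definition entire (a : C -> C) : Prop :=
  forall z : C, ex_derive (K := C_AbsRing) (V := C_NormedModule) a z.

(** The one-form is null and nowhere zero, so its real part integrates to a
    conformal minimal immersion. *)
Definition weierstrass_data (rad a1 a2 a3 : C -> C) (z0 w0 : C) : Prop :=
  entire rad /\ entire a1 /\ entire a2 /\ entire a3 /\
  (forall z, (a1 z * a1 z + a2 z * a2 z + a3 z * a3 z)%C = 0%C) /\
  (forall z, ~ (a1 z = 0%C /\ a2 z = 0%C /\ a3 z = 0%C)) /\
  w0 <> 0%C /\ (w0 * w0)%C = rad z0.

(** [S'] is [Re (int i Phi)], up to sign and translation, where [S] is
    [Re (int Phi)]. *)
Definition adjoint (S S' : R3 -> Prop) : Prop :=
  exists (rad a1 a2 a3 : C -> C) (z0 w0 : C) (p0 p0' : R3) (s : C),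
    weierstrass_data rad a1 a2 a3 z0 w0 /\ (s = Ci \/ s = (- Ci)%C) /\
    (forall p, S p <-> weierstrass rad a1 a2 a3 z0 w0 p0 p) /\
    (forall p, S' p <->
       weierstrass rad (fun z => s * a1 z)%C (fun z => s * a2 z)%C
         (fun z => s * a3 z)%C z0 w0 p0' p).

Definition schwarz (c : C) : R3 -> Prop :=
  weierstrass (fun z => 1 + 14 * z ^ 4 + z ^ 8)%C
    (fun z => c * (1 - z ^ 2))%C (fun z => c * (Ci * (1 + z ^ 2)))%C
    (fun z => c * (2 * z))%C 0%C 1%C (0, 0, 0).

Definition schwarzP : R3 -> Prop := schwarz 1%C.
Definition schwarzD : R3 -> Prop := schwarz Ci.

(* Main.v *)
Require Import Defs.
From Stdlib Require Import Reals ZArith List Ranalysis5 Nsatz Lra Lia Psatz Classical ClassicalEpsilon.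
From Coquelicot Require Import Coquelicot.
Open Scope R_scope.

(* Let [X] be the squared slope of the separating function [F], as a function of the value of [F].
   Minimality of [F x + F y + F z = 0] is the functional equation [(X v + X w) X' u + (X w + X u) X'
   v + (X u + X v) X' w = 0] on [u + v + w = 0] ([mean_curvature_sep]). Connectedness provides a
   zero of [F], where the slope cannot vanish; there [F] is a local coordinate and the equation
   integrates to [X'' = kappa (X - X 0 / 3)], so that [X] is [a / 3 (1 + 2 cosh (sqrt kappa u))] or
   its trigonometric counterpart ([functional_equation], [local_model]). Connectedness again spreads
   this from one point to every coordinate value that occurs ([propagate_model]). For [kappa = 0]
   the function [F] is affine and the surface planar. Otherwise a rescaling gives the two normalized
   equations, and uniqueness for differential equations identifies [F] with [phiD] or [phiP], up to
   a factor and an affine change of variable ([conjugacy_D], [conjugacy_P], [classification]).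

   The two surfaces are told apart by their Hopf differentials. On null tangent vectors [a], the
   square of the second fundamental form is a positive multiple of [e (a1^4 + a2^4 + a3^4)], with
   [e = 1] for P and [e = -1] for D ([hopf_quartic]). A similarity that carries a piece of D into P
   would turn this quartic into a negative multiple of itself, on infinitely many tangent planes and
   hence on the whole null cone; a bound for orthogonal matrices forbids that
   ([anti_invariant_absurd], [no_similar_piece]).

   At the null vector [(1 - z^2, i (1 + z^2), 2 z)] the same quartic is [2 (1 + 14 z^4 + z^8)].
   Hence the root [w] in Schwarz's integrand is, up to a unit factor, the Hopf differential divided
   by the length of the gradient, and a regular point of either surface yields a Gauss coordinate
   [z] together with [w] ([hopf_lift]). In the other direction, the separating function and its
   slope have explicit expressions in [z], [w] and their conjugates. Along every path these solve
   the same second-order equation as the functions themselves, so they agree with them throughout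
   ([hat_P], [hat_D], [hatP_path], [hatD_path]). Continuations therefore stay on the surface, and
   regular curves on the surface lift to continuations ([lift_P], [lift_D]).

   What remains is to reach everything. The planes over a lattice in each coordinate cut the
   surfaces into cells; inside a cell straight segments of values can be followed, and explicit
   curves cross from one cell to the next ([crossingP], [crossingD]). The closure adds the flat
   points and, for P, the cell boundaries ([closure_reachedP], [closure_reachedD]). The complete
   surface D satisfies [cD x + cD y + cD u + cD x cD y cD u = 0], of which the logarithm sees the
   part over [domD]. Conjugacy is then the identity [- i * 2 i = 2] between the constants of the two
   representations. *)
Tactic Notation "have" ident(H) ":" lconstr(T) "by" tactic3(t) := assert (H : T) by t.
Tactic Notation "have" ident(H) ":" lconstr(T) := assert (H : T).
Tactic Notation "have" ident(H) ":=" lconstr(t) := assert (H := t).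

(** * Real analysis in one variable *)

Lemma is_derive_continuous (f : R -> R) (x l : R) : is_derive f x l -> continuous f x.
Proof.
 intros H. apply (ex_derive_continuous (K := R_AbsRing) (V := R_NormedModule)). now exists l.
Qed.

Ltac weaken H := generalize H; apply filter_imp; let s := fresh in let Hs := fresh in intros s Hs; apply Hs.

Ltac pos := solve [repeat first [assumption|lra|lazymatch goal with
 | |- 0 < _ * _ => apply Rmult_lt_0_compat
 | |- 0 < _ / _ => apply Rdiv_lt_0_compat
 | |- 0 < / _ => apply Rinv_0_lt_compat
 | |- 0 < sqrt _ => apply sqrt_lt_R0
 | |- 0 < _ ^ _ => first [apply pow_lt; pos|apply pow2_gt_0]
 | |- 0 <= _ ^ 2 => apply pow2_ge_0
 | |- 0 <= sqrt _ => apply sqrt_pos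
 | |- 0 <= _ * _ => apply Rmult_le_pos
 | |- _ * _ <> 0 => apply Rmult_integral_contrapositive_currified
 | |- _ / _ <> 0 => apply Rmult_integral_contrapositive_currified
 | |- / _ <> 0 => apply Rinv_neq_0_compat
 | |- _ ^ _ <> 0 => apply pow_nonzero
 end|auto]].

Ltac by_derivative := apply (ex_derive_continuous (K := R_AbsRing) (V := R_NormedModule)); auto_derive.

(* Unification does not find the functions in the library lemmas by itself. *)
Ltac cont := first [assumption|lazymatch goal with
 | |- continuous (fun _ => ?c) _ => apply continuous_const
 | |- continuous (fun s => s) _ => apply continuous_id
 | |- continuous (fun s => @?f s + @?g s) _ => apply (continuous_plus (V := R_NormedModule) f g); cont
 | |- continuous (fun s => @?f s - @?g s) _ => apply (continuous_minus (V := R_NormedModule) f g); cont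
 | |- continuous (fun s => - @?f s) _ => apply (continuous_opp (V := R_NormedModule) f); cont
 | |- continuous (fun s => @?f s * @?g s) _ => apply (continuous_mult (K := R_AbsRing) f g); cont
 | |- continuous (fun s => @?f s / @?g s) _ => apply (continuous_mult (K := R_AbsRing) f (fun s => / g s)); cont
 | |- continuous (fun s => / @?f s) _ => apply (continuous_comp f Rinv); [cont|apply continuous_Rinv; auto]
 | |- continuous (fun s => fst (@?f s)) _ => apply (continuous_comp f fst); [cont|apply continuous_fst]
 | |- continuous (fun s => snd (@?f s)) _ => apply (continuous_comp f snd); [cont|apply continuous_snd]
 | |- continuous (fun s => ?F (@?f s)) _ => first [solve [auto]|apply (continuous_comp f F); [cont|auto]]
 | _ => auto
 end].

Lemma is_derive_eq (f : R -> R) (x l l' : R) : is_derive f x l -> l = l' -> is_derive f x l'.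
Proof. intros H <-; exact H. Qed.

(* [auto_derive] leaves eta-expanded [Derive (fun y => f y) x] behind. *)
Ltac derive_value H :=
 match type of H with
 | is_derive ?f ?x ?l =>
   try replace (Derive (fun y : R => f y) x) with l by (symmetry; exact (is_derive_unique f x l H))
 end.

Ltac derive_auto := auto_derive; [repeat split; auto; eexists; eassumption|
 repeat match goal with H : is_derive _ _ _ |- _ => progress derive_value H end].

Lemma nonincreasing_of_derive (f f' : R -> R) (a b : R) :
 a <= b -> (forall t, a <= t <= b -> is_derive f t (f' t)) ->
 (forall t, a <= t <= b -> f' t <= 0) -> f b <= f a.
Proof.
 intros Hab Hd Hn.
 destruct (MVT_gen f a b f') as [c [Hc Hf]].
 - intros x Hx; rewrite Rmin_left, Rmax_right in Hx by lra; apply Hd; lra.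
 - intros x Hx; rewrite Rmin_left, Rmax_right in Hx by lra.
  apply continuity_pt_filterlim. apply (is_derive_continuous f x (f' x)). apply Hd; lra.
 - rewrite Rmin_left, Rmax_right in Hc by lra. specialize (Hn c Hc). nra.
Qed.

Lemma nondecreasing_of_derive (f f' : R -> R) (a b : R) :
 a <= b -> (forall t, a <= t <= b -> is_derive f t (f' t)) ->
 (forall t, a <= t <= b -> 0 <= f' t) -> f a <= f b.
Proof.
 intros Hab Hd Hn.
 assert (- f b <= - f a); [|lra].
 apply (nonincreasing_of_derive (fun t => - f t) (fun t => - f' t)); auto.
 - intros t Ht. apply (is_derive_opp f t (f' t)); auto.
 - intros t Ht. specialize (Hn t Ht); lra.
Qed.

Lemma increasing_of_derive (f f' : R -> R) (a b : R) :
 a < b -> (forall t, a <= t <= b -> is_derive f t (f' t)) ->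
 (forall t, a < t < b -> 0 < f' t) -> f a < f b.
Proof.
 intros Hab Hd Hn.
 destruct (MVT_cor2 f f' a b Hab) as [c [Hf Hc]].
 - intros x Hx; apply is_derive_Reals; auto.
 - specialize (Hn c Hc). nra.
Qed.

Lemma constant_of_derive (f : R -> R) (a b : R) :
 a <= b -> (forall t, a <= t <= b -> is_derive f t 0) -> f a = f b.
Proof.
 intros Hab Hd. apply Rle_antisym.
 - apply (nondecreasing_of_derive f (fun _ => 0)); auto; intros; lra.
 - apply (nonincreasing_of_derive f (fun _ => 0)); auto; intros; lra.
Qed.

(** To the right of [t0] the product of [E] with [exp (- M (t - t0))] is nonincreasing, to the left
    the product with [exp (M (t - t0))] is nondecreasing; as [E] is nonnegative, it vanishes on both
    sides. In the uniqueness proofs [E] is a squared distance between two solutions. *)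
Lemma gronwall (E E' : R -> R) (a b t0 M : R) :
 a <= t0 <= b -> (forall t, a <= t <= b -> is_derive E t (E' t)) ->
 (forall t, a <= t <= b -> 0 <= E t) ->
 (forall t, a <= t <= b -> Rabs (E' t) <= M*E t) -> E t0 = 0 ->
 forall t, a <= t <= b -> E t = 0.
Proof.
 intros Ht0 Hd Hp Hb H0 t Ht.
 destruct (Rle_dec t0 t) as [Hle|Hgt].
 - have Hm : E t*exp (- M*(t-t0)) <= E t0*exp (- M*(t0-t0)).
  { apply (nonincreasing_of_derive (fun s => E s*exp (- M*(s-t0)))
    (fun s => (E' s-M*E s)*exp (- M*(s-t0)))); auto.
   - intros s Hs. have Hs' : a <= s <= b by lra. specialize (Hd s Hs').
    derive_auto. unfold Rminus. ring.
   - intros s Hs. have Hs' : a <= s <= b by lra. specialize (Hb s Hs').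
    apply Rabs_le_between in Hb. assert (0 < exp (- M*(s-t0))) by apply exp_pos. nra. }
  rewrite H0 in Hm. assert (0 < exp (- M*(t-t0))) by apply exp_pos.
  specialize (Hp t Ht). nra.
 - have Hm : E t*exp (M*(t-t0)) <= E t0*exp (M*(t0-t0)).
  { apply (nondecreasing_of_derive (fun s => E s*exp (M*(s-t0)))
    (fun s => (E' s+M*E s)*exp (M*(s-t0)))); try lra.
   - intros s Hs. have Hs' : a <= s <= b by lra. specialize (Hd s Hs').
    derive_auto. unfold Rminus. ring.
   - intros s Hs. have Hs' : a <= s <= b by lra. specialize (Hb s Hs').
    apply Rabs_le_between in Hb. assert (0 < exp (M*(s-t0))) by apply exp_pos. nra. }
  rewrite H0 in Hm. assert (0 < exp (M*(t-t0))) by apply exp_pos.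
  specialize (Hp t Ht). nra.
Qed.

Lemma bounded_on_segment (f : R -> R) (a b : R) :
 (forall t, a <= t <= b -> continuous f t) ->
 exists M, 0 <= M /\ forall t, a <= t <= b -> Rabs (f t) <= M.
Proof.
 intros Hc. destruct (Rle_dec a b) as [Hab|Hab].
 - destruct (continuity_ab_maj (fun t => Rabs (f t)) a b Hab) as [c [Hm Hc']].
  + intros t Ht. apply continuity_pt_filterlim.
   apply (continuous_comp f Rabs); [auto|apply continuous_Rabs].
  + exists (Rabs (f c)). split; [apply Rabs_pos|exact Hm].
 - exists 0. split; [lra|]. intros; lra.
Qed.

Lemma sum_sq_eq_0 (x y : R) : x^2+y^2 = 0 -> x = 0 /\ y = 0.
Proof. intros H. split; nra. Qed.

(** Two solutions of [u' = v m], [v' = G(u) m] with the same initial data agree. *)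
Lemma second_order_unique (G : R -> R) (L : R) (m u1 v1 u2 v2 : R -> R) (a b t0 : R) :
 a <= t0 <= b ->
 (forall t, a <= t <= b -> continuous m t) ->
 (forall t, a <= t <= b -> is_derive u1 t (v1 t*m t)) ->
 (forall t, a <= t <= b -> is_derive v1 t (G (u1 t)*m t)) ->
 (forall t, a <= t <= b -> is_derive u2 t (v2 t*m t)) ->
 (forall t, a <= t <= b -> is_derive v2 t (G (u2 t)*m t)) ->
 (forall t, a <= t <= b -> Rabs (G (u1 t)-G (u2 t)) <= L*Rabs (u1 t-u2 t)) ->
 u1 t0 = u2 t0 -> v1 t0 = v2 t0 ->
 forall t, a <= t <= b -> u1 t = u2 t /\ v1 t = v2 t.
Proof.
 intros Ht0 Hm Hu1 Hv1 Hu2 Hv2 HL Hu Hv.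
 destruct (bounded_on_segment m a b Hm) as [M [HM HMb]].
 pose (E := fun t => (u1 t-u2 t)^2+(v1 t-v2 t)^2).
 have HE : forall t, a <= t <= b -> E t = 0.
 { apply (gronwall E (fun t => 2*(u1 t-u2 t)*((v1 t-v2 t)*m t) +
    2*(v1 t-v2 t)*((G (u1 t)-G (u2 t))*m t)) a b t0 (M*(1+Rabs L))); auto.
  - intros t Ht. unfold E.
   specialize (Hu1 t Ht); specialize (Hv1 t Ht); specialize (Hu2 t Ht); specialize (Hv2 t Ht).
   auto_derive. { repeat split; eexists; eassumption. }
   derive_value Hu1; derive_value Hv1; derive_value Hu2; derive_value Hv2. ring.
  - intros t Ht. unfold E. apply Rplus_le_le_0_compat; apply pow2_ge_0.
  - intros t Ht. unfold E. specialize (HMb t Ht). specialize (HL t Ht).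
   set (x := u1 t-u2 t) in *. set (y := v1 t-v2 t) in *. set (g := G (u1 t)-G (u2 t)) in *.
   set (k := m t) in *.
   replace (2*x*(y*k)+2*y*(g*k)) with (k*(2*y*(x+g))) by ring.
   rewrite Rabs_mult.
   have H1 : Rabs (2*y*(x+g)) <= (1+Rabs L)*(x^2+y^2).
   { rewrite Rabs_mult, Rabs_mult, (Rabs_pos_eq 2) by lra.
    assert (Rabs (x+g) <= (1+Rabs L)*Rabs x).
    { eapply Rle_trans; [apply Rabs_triang|].
     assert (L*Rabs x <= Rabs L*Rabs x).
     { apply Rmult_le_compat_r; [apply Rabs_pos|apply Rle_abs]. }
     lra. }
    have Hx := Rabs_pos x. have Hy := Rabs_pos y. have HL0 := Rabs_pos L.
    rewrite <- (pow2_abs x), <- (pow2_abs y).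
    assert (0 <= (1+Rabs L)*(Rabs x-Rabs y)^2) by (apply Rmult_le_pos; [lra|apply pow2_ge_0]).
    assert (2*Rabs y*Rabs (x+g) <= 2*Rabs y*((1+Rabs L)*Rabs x)).
    { apply Rmult_le_compat_l; lra. }
    nra. }
   rewrite (Rmult_assoc M). apply Rmult_le_compat; try apply Rabs_pos; auto.
  - unfold E. rewrite Hu, Hv. ring. }
 intros t Ht. specialize (HE t Ht). apply sum_sq_eq_0 in HE. lra.
Qed.

(** Monotonicity squeezes [g (u + h)] between neighbours of [g u], which gives continuity; the
    difference quotient of [g] is then the reciprocal of one of [f]. *)
Lemma derive_inverse (f f' g : R -> R) (a b c e : R) :
 (forall x, a < x < b -> is_derive f x (f' x)) -> (forall x, a < x < b -> 0 < f' x) ->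
 (forall u, c < u < e -> a < g u < b /\ f (g u) = u) ->
 forall u, c < u < e -> is_derive g u (/ f' (g u)).
Proof.
 intros Hd Hp Hg u Hu.
 have Hinc : forall x y, a < x -> x < y -> y < b -> f x < f y.
 { intros x y Hx Hxy Hy. apply (increasing_of_derive f f'); auto; intros; [apply Hd|apply Hp]; lra. }
 destruct (Hg u Hu) as [Hx Hfx]. set (x := g u) in *.
 have Hcont : forall eps, 0 < eps -> exists del, 0 < del /\
      forall h, Rabs h < del -> c < u+h < e /\ Rabs (g (u+h)-x) < eps.
 { intros eps Heps.
  set (e' := Rmin eps (Rmin ((x-a)/2) ((b-x)/2))).
  have He' : 0 < e' by (unfold e'; repeat apply Rmin_pos; lra).
  assert (e' <= eps) by apply Rmin_l.
  assert (e' <= (x-a)/2) by (unfold e'; eapply Rle_trans; [apply Rmin_r|apply Rmin_l]).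
  assert (e' <= (b-x)/2) by (unfold e'; eapply Rle_trans; [apply Rmin_r|apply Rmin_r]).
  have Hlo : f (x-e') < f x by (apply Hinc; lra).
  have Hhi : f x < f (x+e') by (apply Hinc; lra).
  exists (Rmin (Rmin (u-c) (e-u)) (Rmin (f x-f (x-e')) (f (x+e')-f x))).
  split. { repeat apply Rmin_pos; lra. }
  intros h Hh.
  assert (Rabs h < u-c /\ Rabs h < e-u /\ Rabs h < f x-f (x-e') /\ Rabs h < f (x+e')-f x)
   as (h1 & h2 & h3 & h4).
  { repeat split; eapply Rlt_le_trans; try exact Hh.
   - eapply Rle_trans; [apply Rmin_l|apply Rmin_l].
   - eapply Rle_trans; [apply Rmin_l|apply Rmin_r].
   - eapply Rle_trans; [apply Rmin_r|apply Rmin_l].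
   - eapply Rle_trans; [apply Rmin_r|apply Rmin_r]. }
  apply Rabs_def2 in h1, h2, h3, h4.
  have Huh : c < u+h < e by lra. split; auto.
  destruct (Hg _ Huh) as [Hy Hfy].
  apply Rabs_def1.
  - destruct (Rlt_dec (g (u+h)) (x+e')) as [|Hn]; [lra|exfalso].
   assert (f (x+e') <= f (g (u+h))).
   { destruct (Rlt_dec (x+e') (g (u+h))); [left; apply Hinc; lra|].
    right; f_equal; lra. }
   lra.
  - destruct (Rlt_dec (x-e') (g (u+h))) as [|Hn]; [lra|exfalso].
   assert (f (g (u+h)) <= f (x-e')).
   { destruct (Rlt_dec (g (u+h)) (x-e')); [left; apply Hinc; lra|].
    right; f_equal; lra. }
   lra. }
 apply is_derive_Reals. intros eps Heps.
 have Hl : 0 < f' x by auto. set (l := f' x) in *.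
 have Hdx : derivable_pt_lim f x l by (apply is_derive_Reals; apply Hd; auto).
 (* The first bound keeps the quotient [q] above [l / 2], so that [q l > l^2 / 2]; the second then
    makes the distance of [1 / q] and [1 / l] smaller than [eps]. *)
 set (eta := Rmin (l/2) (eps*l*l/2)).
 have Heta : 0 < eta.
 { apply Rmin_pos; [lra|]. apply Rmult_lt_0_compat; [|lra]. repeat apply Rmult_lt_0_compat; lra. }
 destruct (Hdx eta Heta) as [d Hdd].
 destruct (Hcont d (cond_pos d)) as [del [Hdel Hc]].
 exists (mkposreal del Hdel). simpl. intros h Hh0 Hh.
 destruct (Hc h Hh) as [Huh Hgd]. destruct (Hg _ Huh) as [Hy Hfy].
 fold x. set (k := g (u+h)-x) in *.
 have Hfk : f (x+k) = u+h by (unfold k; replace (x+(g (u+h)-x)) with (g (u+h)) by ring; auto).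
 have Hk0 : k <> 0.
 { intros Hk. rewrite Hk, Rplus_0_r in Hfk. lra. }
 specialize (Hdd k Hk0 Hgd).
 replace (f (x+k)-f x) with h in Hdd by lra.
 have E1 : eta <= l/2 by apply Rmin_l. have E2 : eta <= eps*l*l/2 by apply Rmin_r.
 apply Rabs_def2 in Hdd. set (q := h/k) in *.
 have Hq : l/2 < q by lra.
 replace (k/h) with (/ q) by (unfold q; field; auto).
 replace (/ q - / l) with ((l-q)/(q*l)) by (field; lra).
 assert (0 < q*l) by nra.
 unfold Rdiv. rewrite Rabs_mult, (Rabs_pos_eq (/ (q*l))) by (left; apply Rinv_0_lt_compat; auto).
 apply (Rmult_lt_reg_r (q*l)); auto. rewrite Rmult_assoc, Rinv_l, Rmult_1_r by lra.
 assert (Rabs (l-q) < eta) by (apply Rabs_def1; lra).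
 assert (l*l/2 < q*l) by nra.
 assert (eps*(l*l/2) < eps*(q*l)) by (apply Rmult_lt_compat_l; lra). lra.
Qed.

Lemma IVT_value (f : R -> R) (a b y : R) :
 (forall t, Rmin a b <= t <= Rmax a b -> continuous f t) -> Rmin (f a) (f b) <= y <= Rmax (f a) (f b) ->
 exists t, Rmin a b <= t <= Rmax a b /\ f t = y.
Proof.
 have Hw : forall a b, a < b -> (forall t, a <= t <= b -> continuous f t) ->
  forall y, f a <= y <= f b -> exists t, a <= t <= b /\ f t = y.
 { clear. intros a b Hab Hc y Hy.
  destruct (Req_dec y (f a)) as [->|]; [exists a; split; auto; lra|].
  destruct (Req_dec y (f b)) as [->|]; [exists b; split; auto; lra|].
  destruct (IVT_interv (fun t => f t-y) a b) as [z [Hz Hfz]]; auto; try lra.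
  - intros t Ht. apply continuity_pt_filterlim.
   apply (continuous_minus f (fun _ => y)); [auto|apply continuous_const].
  - exists z. split; auto; lra. }
 have Hw' : forall a b, a < b -> (forall t, a <= t <= b -> continuous f t) ->
  forall y, f b <= y <= f a -> exists t, a <= t <= b /\ f t = y.
 { clear. intros a b Hab Hc y Hy.
  destruct (Req_dec y (f a)) as [->|]; [exists a; split; auto; lra|].
  destruct (Req_dec y (f b)) as [->|]; [exists b; split; auto; lra|].
  destruct (IVT_interv (fun t => y-f t) a b) as [z [Hz Hfz]]; auto; try lra.
  - intros t Ht. apply continuity_pt_filterlim.
   apply (continuous_minus (fun _ => y) f); [apply continuous_const|auto].
  - exists z. split; auto; lra. }
 intros Hc Hy. destruct (Rtotal_order a b) as [H|[H|H]].
 - rewrite Rmin_left, Rmax_right in Hc |- * by lra.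
  destruct (Rle_dec (f a) (f b)).
  + rewrite Rmin_left, Rmax_right in Hy by lra. auto.
  + rewrite Rmin_right, Rmax_left in Hy by lra. auto.
 - subst b. rewrite Rmin_left, Rmax_left in Hy by lra. exists a.
  rewrite Rmin_left, Rmax_left by lra. split; lra.
 - rewrite Rmin_right, Rmax_left in Hc |- * by lra.
  destruct (Rle_dec (f a) (f b)).
  + rewrite Rmin_left, Rmax_right in Hy by lra. auto.
  + rewrite Rmin_right, Rmax_left in Hy by lra. auto.
Qed.

(** The inverse [g] below is only specified on the values taken on the interval. *)
Lemma local_inverse (f f' : R -> R) (x0 d : R) :
 0 < d -> (forall x, Rabs (x-x0) < d -> is_derive f x (f' x)) ->
 (forall x, Rabs (x-x0) < d -> 0 < f' x) ->
 exists (g : R -> R) (e : R), 0 < e /\ g (f x0) = x0 /\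
  forall u, Rabs (u-f x0) < e ->
   Rabs (g u-x0) < d /\ f (g u) = u /\ is_derive g u (/ f' (g u)).
Proof.
 intros Hd Hdf Hpos.
 have Hab : forall x, x0-d < x < x0+d -> Rabs (x-x0) < d by (intros; apply Rabs_def1; lra).
 have Hinc : forall x y, x0-d < x -> x < y -> y < x0+d -> f x < f y.
 { intros x y Hx Hxy Hy. apply (increasing_of_derive f f'); auto; intros; [apply Hdf|apply Hpos]; apply Hab; lra. }
 set (e := Rmin (f x0-f (x0-d/2)) (f (x0+d/2)-f x0)).
 have He : 0 < e.
 { apply Rmin_pos; [assert (f (x0-d/2) < f x0)|assert (f x0 < f (x0+d/2))]; try apply Hinc; lra. }
 have Hex : forall u, Rabs (u-f x0) < e -> exists x, Rabs (x-x0) < d /\ f x = u.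
 { intros u Hu.
  assert (e <= f x0-f (x0-d/2)) by apply Rmin_l. assert (e <= f (x0+d/2)-f x0) by apply Rmin_r.
  apply Rabs_def2 in Hu.
  destruct (IVT_value f (x0-d/2) (x0+d/2) u) as [x [Hx Hfx]].
  - intros t Ht. rewrite Rmin_left, Rmax_right in Ht by lra.
   apply (is_derive_continuous f t (f' t)). apply Hdf, Hab; lra.
  - rewrite Rmin_left, Rmax_right; lra.
  - rewrite Rmin_left, Rmax_right in Hx by lra. exists x. split; auto. apply Hab; lra. }
 (* A preimage is chosen where one exists, with the default [x0] elsewhere. *)
 set (g := fun u => match excluded_middle_informative (exists x, Rabs (x-x0) < d /\ f x = u) with
          | left H => proj1_sig (constructive_indefinite_description _ H)
          | right _ => x0 end).
 have Hg : forall u, Rabs (u-f x0) < e -> Rabs (g u-x0) < d /\ f (g u) = u.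
 { intros u Hu. unfold g. destruct (excluded_middle_informative _) as [H|H].
  - destruct (constructive_indefinite_description _ H); auto.
  - destruct H; auto. }
 exists g, e. split; auto. split.
 - have H0 : Rabs (f x0-f x0) < e by (rewrite Rminus_diag, Rabs_R0; auto).
  destruct (Hg _ H0) as [H1 H2]. apply Rabs_def2 in H1.
  destruct (Rtotal_order (g (f x0)) x0) as [H|[H|H]]; auto; exfalso.
  + assert (f (g (f x0)) < f x0) by (apply Hinc; lra). lra.
  + assert (f x0 < f (g (f x0))) by (apply Hinc; lra). lra.
 - intros u Hu. destruct (Hg u Hu) as [H1 H2]. split; auto. split; auto.
  apply Rabs_def2 in Hu.
  apply (derive_inverse f f' g (x0-d) (x0+d) (f x0-e) (f x0+e)); try lra.
  + intros; apply Hdf, Hab; lra.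
  + intros; apply Hpos, Hab; lra.
  + intros v Hv. destruct (Hg v) as [H3 H4]; [apply Rabs_def1; lra|]. apply Rabs_def2 in H3.
   split; auto; lra.
Qed.

(** * Smoothness *)

(** Derivatives are peeled off from the inside, which turns the product and chain rules into
    inductions on [n]; [smooth_on_Ck] translates to iterated derivatives. *)
Fixpoint Ck (n : nat) (A : R -> Prop) (f : R -> R) : Prop :=
 match n with
 | O => True
 | S n => (forall x, A x -> ex_derive f x) /\ Ck n A (Derive f)
 end.

Lemma Ck_ext (n : nat) (A : R -> Prop) (f g : R -> R) :
 open A -> (forall x, A x -> f x = g x) -> Ck n A f -> Ck n A g.
Proof.
 intros HA. revert f g. induction n as [|n IH]; intros f g He; simpl; auto.
 intros [Hd HC]. split.
 - intros x Hx. apply (ex_derive_ext_loc f); auto.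
  apply (filter_imp A); auto.
 - apply (IH (Derive f)); auto. intros x Hx. apply Derive_ext_loc. apply (filter_imp A); auto.
Qed.

Lemma Ck_S (n : nat) (A : R -> Prop) (f : R -> R) : Ck (S n) A f -> Ck n A f.
Proof.
 revert f; induction n as [|n IH]; intros f; simpl; auto.
 intros [H [H1 H2]]. split; auto. apply IH. split; auto.
Qed.

Lemma Ck_derive (n : nat) (A : R -> Prop) (f f' : R -> R) :
 open A -> (forall x, A x -> is_derive f x (f' x)) -> Ck n A f' -> Ck (S n) A f.
Proof.
 intros HA Hd HC. split; [intros x Hx; exists (f' x); auto|].
 apply (Ck_ext n A f'); auto. intros x Hx. symmetry. apply is_derive_unique; auto.
Qed.

Lemma Ck_plus (n : nat) (A : R -> Prop) (f g : R -> R) :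
 open A -> Ck n A f -> Ck n A g -> Ck n A (fun x => f x+g x).
Proof.
 intros HA; revert f g. induction n as [|n IH]; intros f g; [simpl; auto|].
 intros [Hf Hf'] [Hg Hg']. apply (Ck_derive n A _ (fun x => Derive f x+Derive g x)); auto.
 intros x Hx. apply (is_derive_plus f g x); apply Derive_correct; auto.
Qed.

Lemma Ck_mult (n : nat) (A : R -> Prop) (f g : R -> R) :
 open A -> Ck n A f -> Ck n A g -> Ck n A (fun x => f x*g x).
Proof.
 intros HA; revert f g. induction n as [|n IH]; intros f g; [simpl; auto|].
 intros Hf Hg. apply (Ck_derive n A _ (fun x => Derive f x*g x+f x*Derive g x)); auto.
 - intros x Hx. apply (is_derive_mult f g x); try (apply Derive_correct; now (apply Hf || apply Hg)).
  intros; apply Rmult_comm.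
 - apply Ck_plus; auto; apply IH; try apply Hf; try apply Hg; apply Ck_S; auto.
Qed.

Lemma Ck_comp (n : nat) (A : R -> Prop) (G f : R -> R) :
 open A -> Ck n (fun _ => True) G -> Ck n A f -> Ck n A (fun x => G (f x)).
Proof.
 intros HA; revert G f. induction n as [|n IH]; intros G f; [simpl; auto|].
 intros HG Hf. apply (Ck_derive n A _ (fun x => Derive f x*Derive G (f x))); auto.
 - intros x Hx. apply (is_derive_comp G f x); apply Derive_correct; [now apply HG|now apply Hf].
 - apply Ck_mult; auto; [apply Hf|]. apply (IH (Derive G)); [apply HG|now apply Ck_S].
Qed.

Lemma Ck_const (n : nat) (A : R -> Prop) (c : R) : open A -> Ck n A (fun _ => c).
Proof.
 intros HA; revert c. induction n as [|n IH]; intros c; [simpl; auto|].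
 apply (Ck_derive n A _ (fun _ => 0)); auto. intros x _. apply (is_derive_const c x).
Qed.

Lemma smooth_on_Ck (A : R -> Prop) (f : R -> R) : (forall n, Ck n A f) -> smooth_on A f.
Proof.
 intros H x n Hx. destruct n as [|n]; simpl; auto.
 generalize (H (S n)). clear H. revert f. induction n as [|n IH]; intros f Hf; simpl.
 - now apply Hf.
 - destruct Hf as [_ Hf]. apply (ex_derive_ext (Derive_n (Derive f) n)).
  + intros t. change (Derive f) with (Derive_n f 1). rewrite Derive_n_comp.
   now rewrite Nat.add_comm.
  + now apply IH.
Qed.

(** Bootstrapping: if the second derivative is as regular as [f], each round gains two orders of
    differentiability. *)
Lemma Ck_second_order (A : R -> Prop) (f f1 f2 : R -> R) :
 open A -> (forall x, A x -> is_derive f x (f1 x)) -> (forall x, A x -> is_derive f1 x (f2 x)) ->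
 (forall n, Ck n A f -> Ck n A f2) -> forall n, Ck n A f.
Proof.
 intros HA H1 H2 Hb n. induction n as [|n IH]; [simpl; auto|].
 apply Ck_S. apply (Ck_derive _ A f f1); auto. apply (Ck_derive _ A f1 f2); auto.
Qed.

Lemma open_full : open (fun _ : R => True).
Proof. apply open_true. Qed.

Lemma Ck_sin2 (n : nat) : Ck n (fun _ => True) (fun u => - 2*sin (2*u)).
Proof.
 apply (Ck_second_order _ _ (fun u => - 4*cos (2*u)) (fun u => (- 4)*(- 2*sin (2*u)))).
 - apply open_full.
 - intros x _. auto_derive; auto. ring.
 - intros x _. auto_derive; auto. ring.
 - intros k Hk. apply Ck_mult; auto using Ck_const, open_full.
Qed.

Lemma Ck_sinh2 (n : nat) : Ck n (fun _ => True) (fun u => 2*sinh (2*u)).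
Proof.
 apply (Ck_second_order _ _ (fun u => 4*cosh (2*u)) (fun u => 4*(2*sinh (2*u)))).
 - apply open_full.
 - intros x _. unfold sinh, cosh. auto_derive; auto. lra.
 - intros x _. unfold sinh, cosh. auto_derive; auto. lra.
 - intros k Hk. apply Ck_mult; auto using Ck_const, open_full.
Qed.

Lemma smooth_of_second_order (A : R -> Prop) (f f1 G : R -> R) :
 open A -> (forall n, Ck n (fun _ => True) G) ->
 (forall x, A x -> is_derive f x (f1 x)) -> (forall x, A x -> is_derive f1 x (G (f x))) ->
 smooth_on A f.
Proof.
 intros HA HG H1 H2. apply smooth_on_Ck.
 apply (Ck_second_order A f f1 (fun x => G (f x))); auto. intros n Hn. apply Ck_comp; auto.
Qed.

(** * Mean curvature of a separable surface *)

Lemma Derive_plus_const (f : R -> R) (c x : R) : Derive (fun s => f s+c) x = Derive f x.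
Proof.
 unfold Derive. apply (f_equal real). apply Lim_ext. intros h. f_equal. ring.
Qed.

Lemma grad_sep (f g h : R -> R) (x y z : R) :
 grad (sep_fun f g h) (x, y, z) = (Derive f x, Derive g y, Derive h z).
Proof.
 unfold grad, sep_fun. f_equal; [f_equal|].
 - rewrite (Derive_ext _ (fun s => f s+(g y+h z))) by (intros; ring). apply Derive_plus_const.
 - rewrite (Derive_ext _ (fun s => g s+(f x+h z))) by (intros; ring). apply Derive_plus_const.
 - rewrite (Derive_ext _ (fun s => h s+(f x+g y))) by (intros; ring). apply Derive_plus_const.
Qed.

(** One summand of the divergence of the unit normal; [k] collects the two squared slopes that do
    not move. *)
Lemma Derive_normalized (f1 : R -> R) (x f2 k W : R) :
 is_derive f1 x f2 -> 0 < W -> W = f1 x^2+k ->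
 Derive (fun s => / sqrt (f1 s^2+k)*f1 s) x = k*f2/(W*sqrt W).
Proof.
 intros Hd HW Hk. apply is_derive_unique. subst W.
 have Hs := sqrt_lt_R0 _ HW.
 auto_derive.
 - repeat split; try (now exists f2); rewrite ?Rmult_1_r; try (replace (f1 x*f1 x+k) with (f1 x^2+k) by ring); lra.
 - derive_value Hd.
  replace (f1 x*(f1 x*1)+k) with (f1 x^2+k) by ring.
  set (S := sqrt (f1 x^2+k)) in *.
  have HS : f1 x^2+k = S*S by (symmetry; apply sqrt_sqrt; lra).
  rewrite HS. replace k with (S*S-f1 x^2) by lra. field. lra.
Qed.

(** A separable function has a diagonal Hessian, so the divergence of the normal is a sum of three
    one-variable derivatives over the common positive factor [W sqrt W]. *)
Lemma mean_curvature_sep (f g h : R -> R) (x y z f2 g2 h2 : R) :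
 is_derive (Derive f) x f2 -> is_derive (Derive g) y g2 -> is_derive (Derive h) z h2 ->
 (Derive f x, Derive g y, Derive h z) <> (0, 0, 0) ->
 (mean_curvature (sep_fun f g h) (x, y, z) = 0 <->
 f2*(Derive g y^2+Derive h z^2)+g2*(Derive h z^2+Derive f x^2)
 + h2*(Derive f x^2+Derive g y^2) = 0).
Proof.
 intros Hf Hg Hh Hn.
 set (a := Derive f x) in *. set (b := Derive g y) in *. set (c := Derive h z) in *.
 set (W := a^2+b^2+c^2).
 have HW : 0 < W.
 { unfold W. destruct (Req_dec a 0) as [Ha|Ha].
  - destruct (Req_dec b 0) as [Hb|Hb].
   + destruct (Req_dec c 0) as [Hc|Hc]; [exfalso; apply Hn; congruence|].
    assert (0 < c^2) by (apply pow2_gt_0; auto). nra.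
   + assert (0 < b^2) by (apply pow2_gt_0; auto). nra.
  - assert (0 < a^2) by (apply pow2_gt_0; auto). nra. }
 have E : mean_curvature (sep_fun f g h) (x, y, z) =
  / 2*((b^2+c^2)*f2/(W*sqrt W)+(c^2+a^2)*g2/(W*sqrt W)
     + (a^2+b^2)*h2/(W*sqrt W)).
 { unfold mean_curvature, divergence. f_equal. f_equal; [f_equal|].
  - rewrite <- (Derive_normalized (Derive f) x f2 (b^2+c^2) W); auto; [|unfold W, a; ring].
   apply Derive_ext. intros s. unfold unit_normal. rewrite grad_sep. simpl.
   unfold scal; simpl; unfold mult; simpl. fold b c.
   f_equal. f_equal. f_equal. ring.
  - rewrite <- (Derive_normalized (Derive g) y g2 (c^2+a^2) W); auto; [|unfold W, b; ring].
   apply Derive_ext. intros s. unfold unit_normal. rewrite grad_sep. simpl.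
   unfold scal; simpl; unfold mult; simpl. fold a c.
   f_equal. f_equal. f_equal. ring.
  - rewrite <- (Derive_normalized (Derive h) z h2 (a^2+b^2) W); auto; [|unfold W, c; ring].
   apply Derive_ext. intros s. unfold unit_normal. rewrite grad_sep. simpl.
   unfold scal; simpl; unfold mult; simpl. fold b a.
   f_equal. f_equal. f_equal. ring. }
 rewrite E. have Hs := sqrt_lt_R0 _ HW.
 have HWs : 0 < W*sqrt W by (apply Rmult_lt_0_compat; auto).
 replace (/ 2*((b^2+c^2)*f2/(W*sqrt W)+(c^2+a^2)*g2/(W*sqrt W) +
  (a^2+b^2)*h2/(W*sqrt W))) with
 ((f2*(b^2+c^2)+g2*(c^2+a^2)+h2*(a^2+b^2)) * / (2*(W*sqrt W)))
 by (field; split; lra).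
 split; intros H.
 - apply Rmult_integral in H. destruct H as [H|H]; auto.
  exfalso. revert H. apply Rinv_neq_0_compat. lra.
 - rewrite H. ring.
Qed.

Lemma global_inverse (f f' : R -> R) (a b : R) :
 (forall x, a < x < b -> is_derive f x (f' x)) -> (forall x, a < x < b -> 0 < f' x) ->
 (forall u, exists x, a < x < b /\ f x = u) ->
 exists g : R -> R, (forall u, a < g u < b /\ f (g u) = u /\ is_derive g u (/ f' (g u))) /\
  forall x, a < x < b -> g (f x) = x.
Proof.
 intros Hd Hp Hs.
 destruct (choice _ Hs) as [g Hg]. exists g. split.
 - intros u. destruct (Hg u) as [Hg1 Hg2]. split; [auto|]. split; [auto|].
  apply (derive_inverse f f' g a b (u-1) (u+1)); auto; lra.
 - intros x Hx. destruct (Hg (f x)) as [H1 H2].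
  have Hinc : forall x y, a < x -> x < y -> y < b -> f x < f y.
  { intros y z Hy Hyz Hz. apply (increasing_of_derive f f'); auto; intros; [apply Hd|apply Hp]; lra. }
  destruct (Rtotal_order (g (f x)) x) as [H|[H|H]]; auto; exfalso.
  + assert (f (g (f x)) < f x) by (apply Hinc; lra). lra.
  + assert (f x < f (g (f x))) by (apply Hinc; lra). lra.
Qed.

(** * Elliptic integrals and Jacobi functions *)

(** [ellF] is a limit from the left at its endpoint. A primitive that converges there evaluates it,
    both in the regular case [m < 1] and at the singular endpoint in [shiftP]. *)
Lemma is_RInt_gen_at_left (f G : R -> R) (c L : R) :
 at_left c (fun x => is_RInt f 0 x (G x)) -> filterlim G (at_left c) (locally L) ->
 is_RInt_gen f (at_point 0) (at_left c) L.
Proof.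
 intros HG HL P HP.
 apply (Filter_prod _ _ _ (fun a => a = 0) (fun x => is_RInt f 0 x (G x) /\ P (G x))).
 - reflexivity.
 - apply filter_and; [exact HG|apply HL, HP].
 - intros x y -> [H1 H2]. exists (G y). split; auto.
Qed.

Definition ell_density (m theta : R) : R := / sqrt (1-m*sin theta^2).

Lemma ell_radicand_pos (m t : R) : 0 < m < 1 -> 0 < 1-m*sin t^2 <= 1.
Proof. intros Hm. have H := sin2_cos2 t. unfold Rsqr in H. nra. Qed.

Lemma ell_density_ge1 (m t : R) : 0 < m < 1 -> 1 <= ell_density m t.
Proof.
 intros Hm. destruct (ell_radicand_pos m t Hm) as [H1 H2]. unfold ell_density.
 have Hs := sqrt_lt_R0 _ H1.
 assert (sqrt (1-m*sin t^2) <= 1).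
 { rewrite <- sqrt_1 at 2. apply sqrt_le_1_alt; auto. }
 rewrite <- Rinv_1 at 1. apply Rinv_le_contravar; auto.
Qed.

Lemma ell_density_continuous (m t : R) : 0 < m < 1 -> continuous (ell_density m) t.
Proof.
 intros Hm. destruct (ell_radicand_pos m t Hm) as [H1 H2]. have Hs := sqrt_lt_R0 _ H1.
 apply (ex_derive_continuous (K := R_AbsRing) (V := R_NormedModule)).
 unfold ell_density. auto_derive.
 replace (1 + - (m*(sin t*(sin t*1)))) with (1-m*sin t^2) by ring. repeat split; auto; lra.
Qed.

Lemma ellF_derive (m t : R) : 0 < m < 1 ->
 is_derive (RInt (ell_density m) 0) t (ell_density m t).
Proof.
 intros Hm. apply (is_derive_RInt (ell_density m) _ 0).
 - exists (mkposreal 1 Rlt_0_1). intros y _. apply (RInt_correct (ell_density m)).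
  apply (ex_RInt_continuous (V := R_CompleteNormedModule)). intros; apply ell_density_continuous; auto.
 - apply ell_density_continuous; auto.
Qed.

Lemma ellF_even (m t : R) : 0 < m < 1 -> RInt (ell_density m) 0 (- t) = - RInt (ell_density m) 0 t.
Proof.
 intros Hm.
 have H : forall t, 0 <= t -> RInt (ell_density m) 0 (- t) = - RInt (ell_density m) 0 t.
 { clear t. intros t Ht.
  have E : RInt (ell_density m) 0 (- 0)+RInt (ell_density m) 0 0 =
      RInt (ell_density m) 0 (- t)+RInt (ell_density m) 0 t.
  { apply (constant_of_derive (fun s => RInt (ell_density m) 0 (- s)+RInt (ell_density m) 0 s) 0 t Ht).
   intros s _.
   eapply is_derive_eq.
   - apply (is_derive_plus (fun s => RInt (ell_density m) 0 (- s)) (RInt (ell_density m) 0)).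
    + apply (is_derive_comp (RInt (ell_density m) 0) (fun s => - s)); [apply ellF_derive; auto|].
     apply (is_derive_opp (fun s : R => s)), (is_derive_id (K := R_AbsRing)).
    + apply ellF_derive; auto.
   - unfold ell_density, plus, scal, opp, one; simpl; unfold mult; simpl.
    rewrite sin_neg. replace (- sin s*(- sin s*1)) with (sin s*(sin s*1)) by ring. ring. }
  rewrite Ropp_0, RInt_point in E. unfold zero in E; simpl in E. lra. }
 destruct (Rle_dec 0 t); auto.
 have H' := H (- t). rewrite Ropp_involutive in H'. lra.
Qed.

Lemma ellF_RInt (phi m : R) : 0 < m < 1 -> ellF phi m = RInt (ell_density m) 0 phi.
Proof.
 intros Hm.
 have H : forall psi, RInt_gen (ell_density m) (at_point 0) (at_left psi) = RInt (ell_density m) 0 psi.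
 { intros psi. apply (is_RInt_gen_unique (Fa := at_point 0) (Fb := at_left psi)).
  apply (is_RInt_gen_at_left _ (RInt (ell_density m) 0)).
  - apply filter_forall. intros x. apply (RInt_correct (ell_density m)).
   apply (ex_RInt_continuous (V := R_CompleteNormedModule)). intros; apply ell_density_continuous; auto.
  - eapply filterlim_filter_le_1.
   + apply (filter_le_within (F := locally psi)).
   + apply (is_derive_continuous (RInt (ell_density m) 0) psi (ell_density m psi)).
    apply ellF_derive; auto. }
 unfold ellF. fold (ell_density m). destruct (Rle_dec 0 phi) as [Hp|Hp].
 - apply H.
 - transitivity (- RInt (ell_density m) 0 (- phi)).
  + f_equal. apply H.
  + rewrite ellF_even; auto. ring.
Qed.

Lemma ellF_derivative (m t : R) : 0 < m < 1 -> is_derive (fun phi => ellF phi m) t (ell_density m t).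
Proof.
 intros Hm. apply (is_derive_ext (RInt (ell_density m) 0)).
 - intros s. symmetry. apply ellF_RInt; auto.
 - apply ellF_derive; auto.
Qed.

Lemma ellF_0 (m : R) : 0 < m < 1 -> ellF 0 m = 0.
Proof. intros Hm. rewrite ellF_RInt by auto. apply (RInt_point 0 (ell_density m)). Qed.

Lemma ellF_opp (m t : R) : 0 < m < 1 -> ellF (- t) m = - ellF t m.
Proof. intros Hm. rewrite !ellF_RInt by auto. apply ellF_even; auto. Qed.

(** The density is at least 1. Strict monotonicity and surjectivity of the elliptic integral follow
    from this growth. *)
Lemma ellF_gap (m a b : R) : 0 < m < 1 -> a <= b -> b-a <= ellF b m-ellF a m.
Proof.
 intros Hm Hab.
 assert (ellF a m-a <= ellF b m-b); [|lra].
 apply (nondecreasing_of_derive (fun s => ellF s m-s) (fun s => ell_density m s-1)); auto.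
 - intros t _. apply (is_derive_minus (fun s => ellF s m) (fun s => s)).
  + apply ellF_derivative; auto.
  + apply (is_derive_id (K := R_AbsRing)).
 - intros t _. have H := ell_density_ge1 m t Hm. lra.
Qed.

Lemma ellF_lt (m a b : R) : 0 < m < 1 -> a < b -> ellF a m < ellF b m.
Proof. intros Hm Hab. have H := ellF_gap m a b Hm (Rlt_le _ _ Hab). lra. Qed.

Lemma ellF_inj (m a b : R) : 0 < m < 1 -> ellF a m = ellF b m -> a = b.
Proof.
 intros Hm H. destruct (Rtotal_order a b) as [H1|[H1|H1]]; auto;
  apply (ellF_lt m) in H1; auto; lra.
Qed.

Lemma ellF_continuous (m t : R) : 0 < m < 1 -> continuous (fun phi => ellF phi m) t.
Proof. intros Hm. apply (is_derive_continuous _ _ (ell_density m t)), ellF_derivative; auto. Qed.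

Lemma ellF_surj (m u : R) : 0 < m < 1 -> exists phi, ellF phi m = u.
Proof.
 intros Hm.
 destruct (IVT_value (fun phi => ellF phi m) (- Rabs u) (Rabs u) u) as [x [_ Hx]].
 - intros t _. apply ellF_continuous; auto.
 - have H := Rabs_pos u. have H0 := ellF_0 m Hm.
  have H1 := ellF_gap m 0 (Rabs u) Hm H. have H2 := ellF_opp m (Rabs u) Hm.
  have H3 := Rle_abs u. have H4 := Rle_abs (- u). rewrite Rabs_Ropp in H4.
  rewrite Rmin_left, Rmax_right by lra. lra.
 - now exists x.
Qed.

Lemma ellF_am (u m : R) : 0 < m < 1 -> ellF (am_lt1 u m) m = u.
Proof.
 intros Hm. unfold am_lt1.
 apply (iota_correct (V := R_CompleteNormedModule) (fun phi : R => ellF phi m = u)).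
 destruct (ellF_surj m u Hm) as [x Hx]. exists x. split; auto.
 intros y Hy. apply (ellF_inj m); auto. congruence.
Qed.

Lemma am_ellF (t m : R) : 0 < m < 1 -> am_lt1 (ellF t m) m = t.
Proof. intros Hm. apply (ellF_inj m); auto. apply ellF_am; auto. Qed.

Lemma ellK_pos (m : R) : 0 < m < 1 -> 0 < ellK m.
Proof.
 intros Hm. unfold ellK. have H := PI_RGT_0. rewrite <- (ellF_0 m Hm) at 1. apply ellF_lt; lra.
Qed.

(** The density has period [PI], so the increment over a period is constant; from [- PI / 2] to
    [PI / 2] it is [2 K] by oddness. *)
Lemma ellF_PI (t m : R) : 0 < m < 1 -> ellF (t+PI) m = ellF t m+2*ellK m.
Proof.
 intros Hm.
 have Hc : forall a b, a <= b -> ellF (a+PI) m-ellF a m = ellF (b+PI) m-ellF b m.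
 { intros a b Hab. apply (constant_of_derive (fun s => ellF (s+PI) m-ellF s m) a b Hab).
  intros s _. eapply is_derive_eq.
  - apply (is_derive_minus (fun s => ellF (s+PI) m) (fun s => ellF s m)).
   + apply (is_derive_comp (fun s => ellF s m) (fun s => s+PI)); [apply ellF_derivative; auto|].
    apply (is_derive_plus (fun s : R => s) (fun _ => PI));
     [apply (is_derive_id (K := R_AbsRing))|apply (is_derive_const (K := R_AbsRing))].
   + apply ellF_derivative; auto.
  - unfold ell_density, minus, plus, scal, opp, one, zero; simpl; unfold mult; simpl.
   rewrite neg_sin. replace (- sin s*(- sin s*1)) with (sin s*(sin s*1)) by ring. ring. }
 have H1 : ellF (t+PI) m-ellF t m = ellF (- (PI/2)+PI) m-ellF (- (PI/2)) m.
 { destruct (Rle_dec t (- (PI/2))); [|symmetry]; apply Hc; lra. }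
 replace (- (PI/2)+PI) with (PI/2) in H1 by field. rewrite ellF_opp in H1 by auto.
 unfold ellK. lra.
Qed.

Lemma ellF_IZR_PI2 (j : Z) (m : R) : 0 < m < 1 -> ellF (IZR j*(PI/2)) m = IZR j*ellK m.
Proof.
 intros Hm.
 have H0 : ellF (0*(PI/2)) m = 0*ellK m by (rewrite !Rmult_0_l; apply ellF_0; auto).
 have H1 : ellF (1*(PI/2)) m = 1*ellK m by (rewrite !Rmult_1_l; reflexivity).
 have Hs : forall k, ellF (IZR (k+2)*(PI/2)) m = ellF (IZR k*(PI/2)) m+2*ellK m.
 { intros k. rewrite <- ellF_PI by auto. f_equal. rewrite plus_IZR. field. }
 have Hn : forall n : nat, ellF (IZR (Z.of_nat n)*(PI/2)) m = IZR (Z.of_nat n)*ellK m /\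
          ellF (IZR (Z.of_nat (S n))*(PI/2)) m = IZR (Z.of_nat (S n))*ellK m.
 { induction n as [|n [IH1 IH2]]; [split; auto|]. split; auto.
  replace (Z.of_nat (S (S n))) with (Z.of_nat n+2)%Z by lia.
  rewrite Hs, IH1, plus_IZR. ring. }
 destruct (Z_le_dec 0 j) as [H|H].
 - rewrite <- (Z2Nat.id j H). apply Hn.
 - replace (IZR j) with (- IZR (Z.of_nat (Z.to_nat (- j)))).
  + rewrite Ropp_mult_distr_l_reverse, ellF_opp by auto.
   destruct (Hn (Z.to_nat (- j))) as [-> _]. ring.
  + rewrite Z2Nat.id by lia. rewrite opp_IZR. ring.
Qed.

Lemma am_lt (m u v : R) : 0 < m < 1 -> u < v -> am_lt1 u m < am_lt1 v m.
Proof.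
 intros Hm Huv. destruct (Rlt_dec (am_lt1 u m) (am_lt1 v m)) as [|H]; auto. exfalso.
 assert (ellF (am_lt1 v m) m <= ellF (am_lt1 u m) m).
 { destruct (Req_dec (am_lt1 v m) (am_lt1 u m)) as [->|]; [lra|]. left. apply ellF_lt; lra. }
 rewrite !ellF_am in H0 by auto. lra.
Qed.

Lemma am_0 (m : R) : 0 < m < 1 -> am_lt1 0 m = 0.
Proof. intros Hm. rewrite <- (ellF_0 m Hm) at 1. apply am_ellF; auto. Qed.

Lemma am_IZR_K (j : Z) (m : R) : 0 < m < 1 -> am_lt1 (IZR j*ellK m) m = IZR j*(PI/2).
Proof. intros Hm. rewrite <- ellF_IZR_PI2 by auto. apply am_ellF; auto. Qed.

Lemma am_derivative (m u : R) : 0 < m < 1 ->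
 is_derive (fun u => am_lt1 u m) u (sqrt (1-m*sin (am_lt1 u m)^2)).
Proof.
 intros Hm. eapply is_derive_eq.
 - apply (derive_inverse (fun t => ellF t m) (ell_density m) (fun u => am_lt1 u m)
   (am_lt1 (u-2) m) (am_lt1 (u+2) m) (u-1) (u+1)); try lra.
  + intros; apply ellF_derivative; auto.
  + intros x _. have H := ell_density_ge1 m x Hm. lra.
  + intros v Hv. split; [|apply ellF_am; auto]. split; apply am_lt; lra.
 - unfold ell_density. apply Rinv_inv.
Qed.

Lemma sn_lt1 (m : R) (Hm : 0 < m < 1) (u : R) : sn u m = sin (am_lt1 u m).
Proof. unfold sn. destruct (Rlt_dec m 1); auto; lra. Qed.

Lemma cn_lt1 (m : R) (Hm : 0 < m < 1) (u : R) : cn u m = cos (am_lt1 u m).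
Proof. unfold cn. destruct (Rlt_dec m 1); auto; lra. Qed.

Lemma dn_lt1 (m : R) (Hm : 0 < m < 1) (u : R) : dn u m = sqrt (1-m*sin (am_lt1 u m)^2).
Proof. unfold dn. destruct (Rlt_dec m 1); auto; lra. Qed.

Lemma sn2_cn2 (m : R) (Hm : 0 < m < 1) (u : R) : sn u m^2+cn u m^2 = 1.
Proof. rewrite (sn_lt1 m Hm), (cn_lt1 m Hm). have H := sin2_cos2 (am_lt1 u m). unfold Rsqr in H. lra. Qed.

Lemma dn_pos (m : R) (Hm : 0 < m < 1) (u : R) : 0 < dn u m.
Proof. rewrite (dn_lt1 m Hm). apply sqrt_lt_R0. apply ell_radicand_pos; auto. Qed.

Lemma dn2 (m : R) (Hm : 0 < m < 1) (u : R) : dn u m^2 = 1-m*sn u m^2.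
Proof.
 rewrite (dn_lt1 m Hm), (sn_lt1 m Hm), pow2_sqrt; auto. left. apply ell_radicand_pos; auto.
Qed.

Lemma is_derive_sn (m : R) (Hm : 0 < m < 1) (u : R) : is_derive (fun u => sn u m) u (cn u m*dn u m).
Proof.
 apply (is_derive_ext (fun u => sin (am_lt1 u m))); [intros; symmetry; apply (sn_lt1 m Hm)|].
 have H := am_derivative m u Hm. rewrite <- (dn_lt1 m Hm) in H.
 derive_auto. rewrite (cn_lt1 m Hm). ring.
Qed.

Lemma is_derive_cn (m : R) (Hm : 0 < m < 1) (u : R) : is_derive (fun u => cn u m) u (- (sn u m*dn u m)).
Proof.
 apply (is_derive_ext (fun u => cos (am_lt1 u m))); [intros; symmetry; apply (cn_lt1 m Hm)|].
 have H := am_derivative m u Hm. rewrite <- (dn_lt1 m Hm) in H.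
 derive_auto. rewrite (sn_lt1 m Hm). ring.
Qed.

Lemma is_derive_dn (m : R) (Hm : 0 < m < 1) (u : R) : is_derive (fun u => dn u m) u (- (m*(sn u m*cn u m))).
Proof.
 apply (is_derive_ext (fun u => sqrt (1-m*sn u m^2))).
 - intros t. rewrite (dn_lt1 m Hm), (sn_lt1 m Hm). auto.
 - have H := (is_derive_sn m Hm) u. have Hd := (dn2 m Hm) u. have Hp := (dn_pos m Hm) u.
  have Hq : sqrt (1-m*sn u m^2) = dn u m.
  { rewrite <- Hd. apply sqrt_pow2; lra. }
  auto_derive; replace (1 + - (m*(sn u m*(sn u m*1)))) with (1-m*sn u m^2) by ring.
  + split; [now eexists; eauto|]. split; auto. rewrite <- Hd. nra.
  + derive_value H. rewrite Hq. field. lra.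
Qed.

Lemma sn_bound (m : R) (Hm : 0 < m < 1) (u : R) : -1 <= sn u m <= 1.
Proof. rewrite (sn_lt1 m Hm). apply SIN_bound. Qed.

Lemma cn_bound (m : R) (Hm : 0 < m < 1) (u : R) : -1 <= cn u m <= 1.
Proof. rewrite (cn_lt1 m Hm). apply COS_bound. Qed.

Lemma dn_bound (m : R) (Hm : 0 < m < 1) (u : R) : 0 < dn u m <= 1.
Proof. split; [apply (dn_pos m Hm)|]. have H := (dn2 m Hm) u. have H' := (dn_pos m Hm) u. assert (0 <= sn u m^2) by apply pow2_ge_0. nra. Qed.

Lemma Jacobi_K (m : R) (Hm : 0 < m < 1) : sn (ellK m) m = 1 /\ cn (ellK m) m = 0 /\ dn (ellK m) m = sqrt (1-m).
Proof.
 have H : am_lt1 (ellK m) m = PI/2.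
 { unfold ellK. apply am_ellF; auto. }
 rewrite (sn_lt1 m Hm), (cn_lt1 m Hm), (dn_lt1 m Hm), H, sin_PI2, cos_PI2. repeat split; auto. f_equal. ring.
Qed.

Lemma Jacobi_0 (m : R) (Hm : 0 < m < 1) : sn 0 m = 0 /\ cn 0 m = 1 /\ dn 0 m = 1.
Proof.
 rewrite (sn_lt1 m Hm), (cn_lt1 m Hm), (dn_lt1 m Hm), am_0, sin_0, cos_0; auto. repeat split; auto.
 replace (1-m*0^2) with 1 by ring. apply sqrt_1.
Qed.

(** Both sides solve [x' = y z, y' = - x z, z' = - m x y] on the curve
    [x^2 + y^2 = 1, m x^2 + z^2 = 1]. *)
Lemma sn_shift_K (m : R) (Hm : 0 < m < 1) (u : R) : sn (u+ellK m) m = cn u m/dn u m.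
Proof.
 set (K := ellK m). set (k := sqrt (1-m)).
 have Hk : k^2 = 1-m by (apply pow2_sqrt; lra).
 pose (x1 := fun u => sn (u+K) m). pose (y1 := fun u => cn (u+K) m). pose (z1 := fun u => dn (u+K) m).
 pose (x2 := fun u => cn u m/dn u m). pose (y2 := fun u => - k*sn u m/dn u m). pose (z2 := fun u => k/dn u m).
 have Hsh : forall (f : R -> R) (u l : R), is_derive f (u+K) l -> is_derive (fun u => f (u+K)) u l.
 { intros f v l H. eapply is_derive_eq.
  - apply (is_derive_comp f (fun s => s+K)); [exact H|].
   apply (is_derive_plus (fun s : R => s) (fun _ => K));
     [apply (is_derive_id (K := R_AbsRing))|apply (is_derive_const (K := R_AbsRing))].
  - unfold scal, plus, one, zero; simpl; unfold mult; simpl. ring. }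
 have D1 : forall u, is_derive x1 u (y1 u*z1 u) by (intros; apply (Hsh (fun u => sn u m)), (is_derive_sn m Hm)).
 have D2 : forall u, is_derive y1 u (- (x1 u*z1 u)) by (intros; apply (Hsh (fun u => cn u m)), (is_derive_cn m Hm)).
 have D3 : forall u, is_derive z1 u (- (m*(x1 u*y1 u))) by (intros; apply (Hsh (fun u => dn u m)), (is_derive_dn m Hm)).
 have Hq : forall u, dn u m <> 0 by (intros v; have H := (dn_pos m Hm) v; lra).
 have D1' : forall u, is_derive x2 u (y2 u*z2 u).
 { intros v. have A := (is_derive_cn m Hm) v. have B := (is_derive_dn m Hm) v. unfold x2.
  auto_derive; [repeat split; auto; eexists; eauto|]. derive_value A. derive_value B.
  unfold y2, z2. have E := (dn2 m Hm) v. have E' := (sn2_cn2 m Hm) v.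
  apply (Rmult_eq_reg_r (dn v m^2)); [|apply pow_nonzero; auto]. field_simplify; auto.
  rewrite Hk. replace (cn v m^2) with (1-sn v m^2) by lra. rewrite E. ring. }
 have D2' : forall u, is_derive y2 u (- (x2 u*z2 u)).
 { intros v. have A := (is_derive_sn m Hm) v. have B := (is_derive_dn m Hm) v. unfold y2.
  auto_derive; [repeat split; auto; eexists; eauto|]. derive_value A. derive_value B.
  unfold x2, z2. have E := (dn2 m Hm) v. have E' := (sn2_cn2 m Hm) v.
  apply (Rmult_eq_reg_r (dn v m^2)); [|apply pow_nonzero; auto]. field_simplify; auto.
  rewrite E. ring. }
 have D3' : forall u, is_derive z2 u (- (m*(x2 u*y2 u))).
 { intros v. have B := (is_derive_dn m Hm) v. unfold z2.
  auto_derive; [repeat split; auto; eexists; eauto|]. derive_value B.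
  unfold x2, y2. field. auto. }
 have B1 : forall u, Rabs (x1 u) <= 1 by (intros v; apply Rabs_le, (sn_bound m Hm)).
 have B2 : forall u, Rabs (y1 u) <= 1 by (intros v; apply Rabs_le, (cn_bound m Hm)).
 have B3 : forall u, Rabs (z1 u) <= 1 by (intros v; apply Rabs_le; have H := (dn_bound m Hm) (v+K); unfold z1; lra).
 have C1 : forall u, x2 u^2+y2 u^2 = 1.
 { intros v. unfold x2, y2. have E := (dn2 m Hm) v. have E' := (sn2_cn2 m Hm) v.
  apply (Rmult_eq_reg_r (dn v m^2)); [|apply pow_nonzero; auto]. field_simplify; auto.
  rewrite Hk. nra. }
 have B2' : forall u, Rabs (y2 u) <= 1 by (intros v; apply Rabs_le; specialize (C1 v); nra).
 have B1' : forall u, Rabs (x2 u) <= 1 by (intros v; apply Rabs_le; specialize (C1 v); nra).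
 pose (E := fun u => (x1 u-x2 u)^2+(y1 u-y2 u)^2+(z1 u-z2 u)^2).
 have H : E u = 0.
 (* Each of the six cross terms in the derivative is at most a sum of two of the three squares in
    [E], so the constant 8 is ample. *)
 { apply (gronwall E (fun u =>
   2*(x1 u-x2 u)*(y1 u*z1 u-y2 u*z2 u)-2*(y1 u-y2 u)*(x1 u*z1 u-x2 u*z2 u)
   - 2*m*(z1 u-z2 u)*(x1 u*y1 u-x2 u*y2 u)) (- Rabs u) (Rabs u) 0 8).
  - have H := Rabs_pos u. lra.
  - intros t _. unfold E. specialize (D1 t); specialize (D2 t); specialize (D3 t).
   specialize (D1' t); specialize (D2' t); specialize (D3' t).
   auto_derive. { repeat split; eexists; eassumption. }
   derive_value D1; derive_value D2; derive_value D3; derive_value D1'; derive_value D2'; derive_value D3'. ring.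
  - intros t _. unfold E. repeat apply Rplus_le_le_0_compat; apply pow2_ge_0.
  - intros t _. unfold E.
   replace (y1 t*z1 t-y2 t*z2 t) with ((y1 t-y2 t)*z1 t+y2 t*(z1 t-z2 t)) by ring.
   replace (x1 t*z1 t-x2 t*z2 t) with ((x1 t-x2 t)*z1 t+x2 t*(z1 t-z2 t)) by ring.
   replace (x1 t*y1 t-x2 t*y2 t) with ((x1 t-x2 t)*y1 t+x2 t*(y1 t-y2 t)) by ring.
   specialize (B1 t); specialize (B2 t); specialize (B3 t); specialize (B1' t); specialize (B2' t).
   apply Rabs_le_between in B1, B2, B3, B1', B2'.
   set (a := x1 t-x2 t). set (b := y1 t-y2 t). set (c := z1 t-z2 t).
   have P : forall p q r : R, -1 <= r <= 1 -> Rabs (2*p*(q*r)) <= p^2+q^2.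
   { intros p q r Hr. apply Rabs_le.
    assert (0 <= (1-r)*(p^2+q^2)) by (apply Rmult_le_pos; [lra|nra]).
    assert (0 <= (1+r)*(p^2+q^2)) by (apply Rmult_le_pos; [lra|nra]).
    assert (0 <= (1-r)*(p+q)^2) by (apply Rmult_le_pos; [lra|apply pow2_ge_0]).
    assert (0 <= (1+r)*(p+q)^2) by (apply Rmult_le_pos; [lra|apply pow2_ge_0]).
    assert (0 <= (1-r)*(p-q)^2) by (apply Rmult_le_pos; [lra|apply pow2_ge_0]).
    assert (0 <= (1+r)*(p-q)^2) by (apply Rmult_le_pos; [lra|apply pow2_ge_0]).
    nra. }
   have Q1 := P a b (z1 t) B3. have Q2 := P a c (y2 t) B2'.
   have Q3 := P b a (z1 t) B3. have Q4 := P b c (x2 t) B1'.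
   have Q5 : Rabs (2*c*(a*(m*y1 t))) <= c^2+a^2 by (apply P; nra).
   have Q6 : Rabs (2*c*(b*(m*x2 t))) <= c^2+b^2 by (apply P; nra).
   apply Rabs_le_between in Q1, Q2, Q3, Q4, Q5, Q6.
   assert (0 <= a^2) by apply pow2_ge_0. assert (0 <= b^2) by apply pow2_ge_0. assert (0 <= c^2) by apply pow2_ge_0.
   apply Rabs_le. lra.
  - unfold E, x1, y1, z1, x2, y2, z2, K. rewrite Rplus_0_l.
   destruct (Jacobi_K m Hm) as (-> & -> & ->). destruct (Jacobi_0 m Hm) as (-> & -> & ->). fold k. field.
  - have H := Rle_abs u. have H' := Rle_abs (- u). rewrite Rabs_Ropp in H'. lra. }
 unfold E in H. assert (0 <= (y1 u-y2 u)^2) by apply pow2_ge_0. assert (0 <= (z1 u-z2 u)^2) by apply pow2_ge_0.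
 assert (x1 u-x2 u = 0); [|unfold x1, x2 in *; lra]. nra.
Qed.

(** For [0 <= b <= a <= PI]: [cos b - cos a >= 1 - cos (a - b)]. *)
Lemma acos_modulus (x y eps : R) :
 -1 <= x <= 1 -> -1 <= y <= 1 -> 0 < eps <= PI -> y-x < 1-cos eps -> acos x-acos y < eps.
Proof.
 intros Hx Hy He Hxy.
 destruct (Rlt_dec (acos x-acos y) eps) as [|Hn]; auto. exfalso.
 set (a := acos x) in *. set (b := acos y) in *.
 have Ha : 0 <= a <= PI by apply acos_bound. have Hb : 0 <= b <= PI by apply acos_bound.
 rewrite <- (cos_acos x Hx), <- (cos_acos y Hy) in Hxy. fold a b in Hxy.
 have H1 : cos (a-b) <= cos eps.
 { destruct (Req_dec (a-b) eps) as [->|]; [lra|]. left. apply cos_decreasing_1; lra. }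
 have H2 : cos b-cos a-(1-cos (a-b)) = 4*sin ((a-b)/2)*(cos (a/2)*sin (b/2)).
 { replace a with (a/2+a/2) at 1 2 by field. replace b with (b/2+b/2) at 1 2 by field.
  replace (a/2+a/2-(b/2+b/2)) with ((a/2-b/2)+(a/2-b/2)) by ring.
  replace ((a-b)/2) with (a/2-b/2) by field.
  rewrite !cos_plus, sin_minus, cos_minus.
  have E1 := sin2_cos2 (a/2). have E2 := sin2_cos2 (b/2). unfold Rsqr in E1, E2.
  set (p := sin (a/2)) in *. set (q := cos (a/2)) in *. set (r := sin (b/2)) in *. set (s := cos (b/2)) in *.
  replace (q*q) with (1-p*p) by lra. replace (s*s) with (1-r*r) by lra.
  replace ((q*s+p*r)*(q*s+p*r)) with ((q*q)*(s*s)+2*(p*q*r*s)+(p*p)*(r*r)) by ring.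
  replace ((p*s-q*r)*(p*s-q*r)) with ((p*p)*(s*s)-2*(p*q*r*s)+(q*q)*(r*r)) by ring.
  replace (4*(p*s-q*r)*(q*r)) with (4*(p*q*r*s)-4*(q*q)*(r*r)) by ring.
  replace (q*q) with (1-p*p) by lra. replace (s*s) with (1-r*r) by lra. ring. }
 assert (0 <= sin ((a-b)/2)) by (apply sin_ge_0; lra).
 assert (0 <= cos (a/2)) by (apply cos_ge_0; lra).
 assert (0 <= sin (b/2)) by (apply sin_ge_0; lra).
 assert (0 <= 4*sin ((a-b)/2)*(cos (a/2)*sin (b/2))) by (repeat apply Rmult_le_pos; lra).
 lra.
Qed.

(** [acos] is constant on either side of [[-1, 1]], so that its continuity on the whole line reduces
    to clamped arguments. *)
Lemma acos_clamp (x : R) : acos x = acos (Rmax (-1) (Rmin 1 x)).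
Proof.
 unfold Rmax, Rmin. destruct (Rle_dec 1 x).
 - destruct (Rle_dec (-1) 1); [|lra]. rewrite acos_1. unfold acos.
  destruct (Rle_dec x (-1)); [lra|]. destruct (Rle_dec 1 x); auto; lra.
 - destruct (Rle_dec (-1) x); auto. unfold acos.
  destruct (Rle_dec x (-1)); [|lra]. destruct (Rle_dec (-1) (-1)); auto; lra.
Qed.

(** The endpoints matter, although [acos] is not differentiable there: the substitution in
    [shiftP_eq] and the inverse branches [branchP] reach them. *)
Lemma acos_continuous (x : R) : continuous acos x.
Proof.
 intros P [eps HP].
 set (e := Rmin eps PI). have HPI := PI_RGT_0.
 have He : 0 < e <= PI by (split; [apply Rmin_pos; [apply cond_pos|auto]|apply Rmin_r]).
 have Hc : 0 < 1-cos e.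
 { have H : cos e < cos 0 by (apply cos_decreasing_1; lra). rewrite cos_0 in H. lra. }
 exists (mkposreal _ Hc). intros y Hy. apply HP.
 change (Rabs (y-x) < 1-cos e) in Hy. change (Rabs (acos y-acos x) < eps).
 apply Rabs_def2 in Hy.
 have Hcl : forall u v, Rmax (-1) (Rmin 1 u)-Rmax (-1) (Rmin 1 v) <= Rmax 0 (u-v).
 { intros u v. unfold Rmax, Rmin. destruct (Rle_dec 1 u), (Rle_dec 1 v);
  repeat match goal with |- context [Rle_dec ?a ?b] => destruct (Rle_dec a b) end; lra. }
 have Hr : forall u, -1 <= Rmax (-1) (Rmin 1 u) <= 1.
 { intros u. unfold Rmax, Rmin. destruct (Rle_dec 1 u);
  repeat match goal with |- context [Rle_dec ?a ?b] => destruct (Rle_dec a b) end; lra. }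
 rewrite (acos_clamp x), (acos_clamp y).
 assert (e <= eps) by apply Rmin_l.
 have M : forall u v, u-v < 1-cos e -> Rmax (-1) (Rmin 1 u)-Rmax (-1) (Rmin 1 v) < 1-cos e.
 { intros u v H'. eapply Rle_lt_trans; [apply Hcl|]. apply Rmax_lub_lt; lra. }
 have E1 := acos_modulus _ _ e (Hr x) (Hr y) He (M y x ltac:(lra)).
 have E2 := acos_modulus _ _ e (Hr y) (Hr x) He (M x y ltac:(lra)).
 apply Rabs_def1; lra.
Qed.

Lemma is_derive_acos (x : R) : -1 < x < 1 -> is_derive acos x (- / sqrt (1-x^2)).
Proof.
 intros Hx. apply is_derive_Reals.
 replace (- / sqrt (1-x^2)) with (derive_pt acos x (derivable_pt_acos x Hx)).
 - apply derive_pt_eq_1 with (derivable_pt_acos x Hx). reflexivity.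
 - rewrite derive_pt_acos. unfold Rsqr. replace (x*x) with (x^2) by ring.
  unfold Rdiv. ring.
Qed.

Lemma sqrt3_sq : sqrt 3*sqrt 3 = 3.
Proof. apply sqrt_sqrt; lra. Qed.

Lemma sqrt3_pos : 0 < sqrt 3.
Proof. apply sqrt_lt_R0; lra. Qed.

Lemma sin2_lt_of_lt_PI3 (t : R) : 0 <= t < PI/3 -> 0 <= sin t /\ sin t^2 < 3/4.
Proof.
 intros Ht. have HP := PI_RGT_0.
 assert (0 <= sin t) by (apply sin_ge_0; lra).
 assert (sin t < sin (PI/3)) by (apply sin_increasing_1; lra).
 rewrite sin_PI3 in *. have Hs := sqrt3_sq. have Hp := sqrt3_pos. split; auto. nra.
Qed.

(** The substitution [sin theta = (sqrt 3 / 2) sin psi]. *)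
Lemma shiftP_eq : shiftP = sqrt 3/2*ellK (3/4).
Proof.
 have HPI := PI_RGT_0. have Hs := sqrt3_sq. have Hp := sqrt3_pos.
 have Hm : 0 < 3/4 < 1 by lra.
 unfold shiftP, ellF at 1. destruct (Rle_dec 0 (PI/3)) as [_|H]; [|lra].
 set (f := fun theta : R => / sqrt (1-4/3*sin theta^2)).
 (* The angle [PI / 2 - acos y] is the arcsine of [y = 2 / sqrt 3 sin x]; it is written with [acos]
    so that [acos_continuous] covers the singular endpoint. *)
 pose (G := fun x => sqrt 3/2*ellF (PI/2-acos (2/sqrt 3*sin x)) (3/4)).
 apply (is_RInt_gen_unique (Fa := at_point 0) (Fb := at_left (PI/3))).
 have HG : forall x, continuous G x.
 { intros x. apply (continuous_mult (fun _ => sqrt 3/2)); [cont|].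
  apply (continuous_comp (fun x => PI/2-acos (2/sqrt 3*sin x)) (fun p => ellF p (3/4))); [|apply ellF_continuous; auto].
  cont; [apply continuous_sin|apply acos_continuous]. }
 have HG0 : G 0 = 0.
 { unfold G. rewrite sin_0, Rmult_0_r, acos_0, Rminus_diag, ellF_0; auto. ring. }
 have HG1 : G (PI/3) = sqrt 3/2*ellK (3/4).
 { unfold G. rewrite sin_PI3. replace (2/sqrt 3*(sqrt 3/2)) with 1 by (field; lra).
  rewrite acos_1. unfold ellK. do 2 f_equal. ring. }
 apply (is_RInt_gen_at_left f G).
 - exists (mkposreal (PI/3) ltac:(lra)). intros y Hy Hy'.
  change (Rabs (y-PI/3) < PI/3) in Hy. apply Rabs_def2 in Hy.
  replace (G y) with (minus (G y) (G 0)) by (rewrite HG0; unfold minus, plus, opp; simpl; ring).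
  have Hb : forall x, 0 <= x <= y -> 0 <= sin x /\ sin x^2 < 3/4.
  { intros x Hx; apply sin2_lt_of_lt_PI3; lra. }
  apply (is_RInt_derive G f).
  + intros x Hx. rewrite Rmin_left, Rmax_right in Hx by lra. destruct (Hb x Hx) as [S0 S1].
   set (u := 2/sqrt 3*sin x).
   have Hu : u^2 = 4/3*sin x^2.
   { unfold u. replace ((2/sqrt 3*sin x)^2) with (4/(sqrt 3*sqrt 3)*sin x^2) by (field; lra).
    rewrite Hs. field. }
   have Hu0 : 0 <= u by (unfold u; apply Rmult_le_pos; auto; left; apply Rdiv_lt_0_compat; lra).
   have Hu1 : u < 1 by nra.
   have Da : is_derive acos u (- / sqrt (1-u^2)) by (apply is_derive_acos; lra).
   have Df := ellF_derivative (3/4) (PI/2-acos u) Hm.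
   unfold G. fold u. eapply is_derive_eq.
   * apply (is_derive_scal (fun x => ellF (PI/2-acos (2/sqrt 3*sin x)) (3/4))).
    apply (is_derive_comp (fun p => ellF p (3/4)) (fun x => PI/2-acos (2/sqrt 3*sin x))); [exact Df|].
    apply (is_derive_minus (fun _ => PI/2) (fun x => acos (2/sqrt 3*sin x))).
    -- apply (is_derive_const (K := R_AbsRing)).
    -- apply (is_derive_comp acos (fun x => 2/sqrt 3*sin x)); [exact Da|].
     apply (is_derive_scal sin), is_derive_Reals, derivable_pt_lim_sin.
   * unfold ell_density, minus, plus, opp, scal, zero; simpl; unfold mult; simpl.
    replace (sin (PI/2-acos u)) with u.
    2:{ rewrite sin_minus, sin_PI2, cos_PI2, cos_acos by lra. ring. }
    unfold f. replace (u*(u*1)) with (4/3*sin x^2) by (rewrite <- Hu; ring).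
    replace (1-3/4*(4/3*sin x^2)) with (cos x^2).
    2:{ have E := sin2_cos2 x. unfold Rsqr in E. lra. }
    have Hc : 0 < cos x by (apply cos_gt_0; lra).
    rewrite sqrt_pow2 by lra.
    assert (0 < sqrt (1-4/3*sin x^2)) by (apply sqrt_lt_R0; lra).
    replace (sin x*(sin x*1)) with (sin x^2) by ring.
    field. repeat split; lra.
  + intros x Hx. rewrite Rmin_left, Rmax_right in Hx by lra. destruct (Hb x Hx) as [S0 S1].
   apply (ex_derive_continuous (K := R_AbsRing) (V := R_NormedModule)). unfold f.
   assert (0 < sqrt (1-4/3*sin x^2)) by (apply sqrt_lt_R0; lra).
   auto_derive. replace (1 + - (4/3*(sin x*(sin x*1)))) with (1-4/3*sin x^2) by ring.
   repeat split; auto; lra.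
 - rewrite <- HG1. eapply filterlim_filter_le_1; [|apply HG].
  apply (filter_le_within (F := locally (PI/3))).
Qed.

(** Jacobi's real transformation turns the sine of the bounded amplitude at parameter 4/3 into
    [sqrt 3 / 2] times [sn (2 t + K)] at parameter 3/4, which is [sqrt 3 / 2] times [cn / dn]. Since
    [4 dn^2 = 1 + 3 cn^2], this is the sine of the arctangent. *)
Lemma phiP_atan (t : R) : phiP t = atan (sqrt 3*cn (2*t) (3/4)).
Proof.
 have Hs := sqrt3_sq. have Hp := sqrt3_pos.
 have Hm : 0 < 3/4 < 1 by lra.
 unfold phiP, am. destruct (Rlt_dec (4/3) 1) as [H|_]; [lra|].
 unfold sn. destruct (Rlt_dec (4/3) 1) as [H|_]; [lra|].
 replace (/ (4/3)) with (3/4) by field.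
 have Hq : sqrt (4/3) = 2/sqrt 3.
 { apply sqrt_lem_1; [lra|left; apply Rdiv_lt_0_compat; lra|].
  replace (2/sqrt 3*(2/sqrt 3)) with (4/(sqrt 3*sqrt 3)) by (field; lra). rewrite Hs. auto. }
 rewrite Hq, shiftP_eq.
 replace (2/sqrt 3*(sqrt 3*t+sqrt 3/2*ellK (3/4))) with (2*t+ellK (3/4)) by (field; lra).
 rewrite <- (sn_lt1 _ Hm), (sn_shift_K _ Hm).
 set (c := cn (2*t) (3/4)). set (d := dn (2*t) (3/4)).
 have Hd : 0 < d by apply dn_pos, Hm.
 have Hd2 : 4*d^2 = 1+3*c^2.
 { unfold d, c. rewrite (dn2 _ Hm). have E := sn2_cn2 _ Hm (2*t). lra. }
 have Hy := atan_bound (sqrt 3*c).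
 rewrite <- (asin_sin (atan (sqrt 3*c))) by lra. f_equal. rewrite sin_atan.
 replace (1+(sqrt 3*c)²) with ((2*d)^2).
 2:{ unfold Rsqr. replace (sqrt 3*c*(sqrt 3*c)) with (sqrt 3*sqrt 3*c^2) by ring. rewrite Hs. lra. }
 rewrite sqrt_pow2 by lra. field. lra.
Qed.

Lemma sin_2atan (y : R) : sin (2*atan y) = 2*y/(1+y^2).
Proof.
 rewrite sin_2a, sin_atan, cos_atan. unfold Rsqr. replace (y*y) with (y^2) by ring.
 have H : 0 < 1+y^2 by (assert (0 <= y^2) by apply pow2_ge_0; lra).
 have Hs := sqrt_lt_R0 _ H. have E := sqrt_sqrt (1+y^2) ltac:(lra).
 rewrite <- E at 3. field. lra.
Qed.

Lemma cos_2atan (y : R) : cos (2*atan y) = (1-y^2)/(1+y^2).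
Proof.
 rewrite cos_2a, sin_atan, cos_atan. unfold Rsqr. replace (y*y) with (y^2) by ring.
 have H : 0 < 1+y^2 by (assert (0 <= y^2) by apply pow2_ge_0; lra).
 have Hs := sqrt_lt_R0 _ H. have E := sqrt_sqrt (1+y^2) ltac:(lra).
 rewrite <- E at 5. field. lra.
Qed.

(** * The separating function of P *)

Definition phiP1 (t : R) : R := - (sqrt 3/2)*sn (2*t) (3/4)/dn (2*t) (3/4).

Lemma m34 : 0 < 3/4 < 1. Proof. lra. Qed.

Lemma phiP_aux (t : R) : 4*dn (2*t) (3/4)^2 = 1+(sqrt 3*cn (2*t) (3/4))^2.
Proof.
 rewrite (dn2 _ m34). have E := sn2_cn2 _ m34 (2*t).
 replace ((sqrt 3*cn (2*t) (3/4))^2) with (sqrt 3*sqrt 3*cn (2*t) (3/4)^2) by ring.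
 rewrite sqrt3_sq. lra.
Qed.

Lemma sin_2phiP (t : R) : - 2*sin (2*phiP t) = - sqrt 3*cn (2*t) (3/4)/dn (2*t) (3/4)^2.
Proof.
 rewrite phiP_atan, sin_2atan, <- phiP_aux. have H := dn_pos _ m34 (2*t). field. lra.
Qed.

Lemma is_derive_double (f : R -> R) (t l : R) : is_derive f (2*t) l -> is_derive (fun t => f (2*t)) t (2*l).
Proof.
 intros H. eapply is_derive_eq.
 - apply (is_derive_comp f (fun s => 2*s)); [exact H|]. apply (is_derive_scal (fun s : R => s)), (is_derive_id (K := R_AbsRing)).
 - unfold scal, one; simpl; unfold mult; simpl. ring.
Qed.

Lemma is_derive_phiP (t : R) : is_derive phiP t (phiP1 t).
Proof.
 apply (is_derive_ext (fun t => atan (sqrt 3*cn (2*t) (3/4)))); [intros; symmetry; apply phiP_atan|].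
 have D := is_derive_double _ t _ (is_derive_cn _ m34 (2*t)). cbv beta in D.
 eapply is_derive_eq.
 - apply (is_derive_comp atan (fun t => sqrt 3*cn (2*t) (3/4))); [apply is_derive_atan|].
  apply (is_derive_scal (fun t => cn (2*t) (3/4))). exact D.
 - unfold scal; simpl; unfold mult; simpl. unfold Rsqr.
  replace (1+sqrt 3*cn (2*t) (3/4)*(sqrt 3*cn (2*t) (3/4))) with (4*dn (2*t) (3/4)^2)
   by (rewrite phiP_aux; ring).
  unfold phiP1. have H := dn_pos _ m34 (2*t). field. lra.
Qed.

(** The pendulum equation. Uniqueness arguments for P use it in place of the first-order equation,
    which degenerates at the turning values [PI / 3] and [- PI / 3]. *)
Lemma is_derive_phiP1 (t : R) : is_derive phiP1 t (- 2*sin (2*phiP t)).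
Proof.
 rewrite sin_2phiP.
 have D1 := is_derive_double _ t _ (is_derive_sn _ m34 (2*t)). cbv beta in D1.
 have D2 := is_derive_double _ t _ (is_derive_dn _ m34 (2*t)). cbv beta in D2.
 have H := dn_pos _ m34 (2*t). have E := dn2 _ m34 (2*t).
 eapply is_derive_eq.
 - unfold phiP1.
  apply (is_derive_div (fun t => - (sqrt 3/2)*sn (2*t) (3/4)) (fun t => dn (2*t) (3/4))); [|exact D2|lra].
  apply (is_derive_scal (fun t => sn (2*t) (3/4))). exact D1.
 - unfold scal, minus, plus, opp; simpl; unfold mult; simpl.
  set (s := sn (2*t) (3/4)) in *. set (c := cn (2*t) (3/4)) in *. set (d := dn (2*t) (3/4)) in *.
  replace (- (sqrt 3/2)*(2*(c*d))*d - - (sqrt 3/2)*s*(2 * - (3/4*(s*c))))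
   with (- sqrt 3*c*(d^2+3/4*s^2)) by field.
  replace (d^2+3/4*s^2) with 1 by lra. field. lra.
Qed.

Lemma phiP1_sq (t : R) : phiP1 t^2 = 1+2*cos (2*phiP t).
Proof.
 rewrite phiP_atan, cos_2atan, <- phiP_aux. unfold phiP1.
 have H := dn_pos _ m34 (2*t). have E := dn2 _ m34 (2*t). have E' := sn2_cn2 _ m34 (2*t).
 set (s := sn (2*t) (3/4)) in *. set (c := cn (2*t) (3/4)) in *. set (d := dn (2*t) (3/4)) in *.
 replace ((- (sqrt 3/2)*s/d)^2) with (sqrt 3*sqrt 3*s^2/(4*d^2)) by (field; lra).
 replace (1-(sqrt 3*c)^2) with (1-sqrt 3*sqrt 3*c^2) by ring. rewrite sqrt3_sq.
 apply (Rmult_eq_reg_r (4*d^2)); [|nra]. field_simplify; lra.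
Qed.

Lemma phiP_bound (t : R) : - (PI/3) <= phiP t <= PI/3.
Proof.
 rewrite phiP_atan.
 have Hs := sqrt3_pos. have Hc := cn_bound _ m34 (2*t).
 have E : atan (sqrt 3) = PI/3 by (rewrite <- tan_PI3; apply atan_tan; have H := PI_RGT_0; lra).
 rewrite <- E, <- atan_opp.
 have Hle : forall x y, x <= y -> atan x <= atan y.
 { intros x y [H| ->]; [left; apply atan_increasing; auto|lra]. }
 split; apply Hle; nra.
Qed.

(** * The separating function of D *)

Lemma m14 : 0 < 1/4 < 1. Proof. lra. Qed.

Ltac reduce_powers C4 D4 C3 D3 C2 D2 := field_simplify_eq; [|lra];
  rewrite ?C4, ?D4, ?C3, ?D3, ?C2, ?D2; field.

(** The duplication formulas for [sn], [cn], [dn] at [m = 1 / 4]. *)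
Lemma duplication (S C D : R -> R) (t : R) :
 let q := fun t => 1 - / 4*S t^4 in
 let s := fun t => 2*S t*C t*D t/q t in
 let c := fun t => 2*C t^2/q t-1 in
 let v := fun t => 2*D t^2/q t-1 in
 is_derive S t (C t*D t) -> is_derive C t (- (S t*D t)) ->
 is_derive D t (- (1/4*(S t*C t))) ->
 C t^2 = 1-S t^2 -> D t^2 = 1 - / 4*S t^2 -> q t <> 0 ->
 is_derive s t (2*c t*v t) /\ is_derive c t (- 2*s t*v t) /\
 is_derive v t (- / 2*s t*c t) /\ s t^2+c t^2 = 1 /\ v t^2 = 1 - / 4*s t^2.
Proof.
 intros q s c v D1 D2 D3 F2 F1 Hq. unfold q in Hq.
 have Hq' : 4-S t^4 <> 0 by lra.
 have Hq2 : 4-S t*(S t*(S t*(S t*1))) <> 0 by (simpl in Hq'; lra).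
 have C3 : C t^3 = C t*(1-S t^2) by (rewrite <- F2; ring).
 have D3' : D t^3 = D t*(1 - / 4*S t^2) by (rewrite <- F1; ring).
 have C4 : C t^4 = (1-S t^2)^2 by (rewrite <- F2; ring).
 have D4 : D t^4 = (1 - / 4*S t^2)^2 by (rewrite <- F1; ring).
 unfold s, c, v, q. cbv beta.
 refine (conj _ (conj _ (conj _ (conj _ _)))).
 - auto_derive; [repeat split; try (eexists; eassumption); simpl in Hq; lra|].
  derive_value D1; derive_value D2; derive_value D3. reduce_powers C4 D4 C3 D3' F2 F1.
 - auto_derive; [repeat split; try (eexists; eassumption); simpl in Hq; lra|].
  derive_value D1; derive_value D2; derive_value D3. reduce_powers C4 D4 C3 D3' F2 F1.
 - auto_derive; [repeat split; try (eexists; eassumption); simpl in Hq; lra|].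
  derive_value D1; derive_value D2; derive_value D3. reduce_powers C4 D4 C3 D3' F2 F1.
 - reduce_powers C4 D4 C3 D3' F2 F1.
 - reduce_powers C4 D4 C3 D3' F2 F1.
Qed.

(** [sn], [cn], [dn] at [2 t]. *)
Definition sD (t : R) : R :=
 2*sn t (1/4)*cn t (1/4)*dn t (1/4)/(1 - / 4*sn t (1/4)^4).
Definition cD (t : R) : R := 2*cn t (1/4)^2/(1 - / 4*sn t (1/4)^4)-1.
Definition vD (t : R) : R := 2*dn t (1/4)^2/(1 - / 4*sn t (1/4)^4)-1.

Lemma duplication_denominator (t : R) : 3/4 <= 1 - / 4*sn t (1/4)^4.
Proof.
 have H := sn_bound _ m14 t. set (s := sn t (1/4)) in *.
 assert (0 <= s^2 <= 1) by nra. nra.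
Qed.

Lemma Jacobi_D (t : R) : is_derive sD t (2*cD t*vD t) /\ is_derive cD t (- 2*sD t*vD t) /\
 is_derive vD t (- / 2*sD t*cD t) /\ sD t^2+cD t^2 = 1 /\ vD t^2 = 1 - / 4*sD t^2.
Proof.
 apply (duplication (fun t => sn t (1/4)) (fun t => cn t (1/4)) (fun t => dn t (1/4)) t).
 - apply is_derive_sn, m14.
 - apply is_derive_cn, m14.
 - apply is_derive_dn, m14.
 - have E := sn2_cn2 _ m14 t. lra.
 - have E := dn2 _ m14 t. lra.
 - have H := duplication_denominator t. lra.
Qed.

Definition parity (j : Z) : R := if Z.even j then 1 else -1.

Lemma parity_cases (j : Z) : parity j = 1 \/ parity j = -1.
Proof. unfold parity. destruct (Z.even j); auto. Qed.

Lemma parity_succ (j : Z) : parity (Z.succ j) = - parity j.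
Proof.
 unfold parity. rewrite Z.even_succ, <- Z.negb_even. destruct (Z.even j); simpl; ring.
Qed.

Lemma cos_sin_shift (j : Z) : forall x,
 cos (x+IZR j*PI) = parity j*cos x /\ sin (x+IZR j*PI) = parity j*sin x.
Proof.
 apply (Z.bi_induction (fun j => forall x,
  cos (x+IZR j*PI) = parity j*cos x /\ sin (x+IZR j*PI) = parity j*sin x)).
 - intros ? ? ->; reflexivity.
 - intros x. rewrite Rmult_0_l, Rplus_0_r. unfold parity; simpl. split; ring.
 - clear j. intros j. rewrite parity_succ, succ_IZR. split; intros H x.
  + replace (x+(IZR j+1)*PI) with (x+PI+IZR j*PI) by ring.
   destruct (H (x+PI)) as [-> ->]. rewrite neg_cos, neg_sin. split; ring.
  + replace (x+IZR j*PI) with (x-PI+(IZR j+1)*PI) by ring.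
   destruct (H (x-PI)) as [-> ->].
   replace (cos (x-PI)) with (- cos x) by (rewrite cos_minus, sin_PI, cos_PI; ring).
   replace (sin (x-PI)) with (- sin x) by (rewrite sin_minus, sin_PI, cos_PI; ring).
   split; ring.
Qed.

Lemma cell_index (k t : R) : 0 < k -> exists j : Z, IZR j*k <= t < IZR (j+1)*k.
Proof.
 intros Hk. destruct (archimed (t/k)) as [H1 H2]. exists (up (t/k)-1)%Z.
 replace (up (t/k)-1+1)%Z with (up (t/k)) by ring. rewrite minus_IZR.
 have E : t = t/k*k by (field; lra). split; nra.
Qed.

(** * The open cells of D *)

Definition KD : R := ellK (1/4).

(** The endpoints are the zeros of [sD]; there [cD] is 1 or -1. *)
Definition cell (j : Z) (t : R) : Prop := IZR j*KD < t < IZR (j+1)*KD.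

Lemma KD_pos : 0 < KD.
Proof. apply ellK_pos, m14. Qed.

(** [sD] is a positive multiple of [2 sn cn], so its sign can be read off from the amplitude. *)
Lemma sD_sin (t : R) : exists k, 0 < k /\ sD t = k*sin (2*am_lt1 t (1/4)).
Proof.
 have Hq := duplication_denominator t. have Hd := dn_pos _ m14 t.
 exists (dn t (1/4)/(1 - / 4*sn t (1/4)^4)). split.
 - apply Rdiv_lt_0_compat; lra.
 - unfold sD. rewrite sin_2a, <- (sn_lt1 _ m14), <- (cn_lt1 _ m14). field. lra.
Qed.

Lemma parity_sD (j : Z) (t : R) : cell j t -> 0 < parity j*sD t.
Proof.
 intros Ht. destruct (sD_sin t) as [k [Hk ->]].
 have H1 : am_lt1 (IZR j*KD) (1/4) < am_lt1 t (1/4) by (apply am_lt; [apply m14|apply Ht]).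
 have H2 : am_lt1 t (1/4) < am_lt1 (IZR (j+1)*KD) (1/4) by (apply am_lt; [apply m14|apply Ht]).
 unfold KD in H1, H2. rewrite am_IZR_K in H1, H2 by apply m14.
 rewrite plus_IZR in H2.
 set (a := am_lt1 t (1/4)) in *.
 replace (2*a) with (2*a-IZR j*PI+IZR j*PI) by ring.
 destruct (cos_sin_shift j (2*a-IZR j*PI)) as [_ ->].
 assert (0 < sin (2*a-IZR j*PI)) by (apply sin_gt_0; lra).
 destruct (parity_cases j) as [-> | ->]; nra.
Qed.

Lemma Jacobi_D_lattice (j : Z) : sD (IZR j*KD) = 0 /\ cD (IZR j*KD) = parity j.
Proof.
 have Hs : sD (IZR j*KD) = 0.
 { destruct (sD_sin (IZR j*KD)) as [k [Hk ->]]. unfold KD. rewrite am_IZR_K by apply m14.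
  replace (2*(IZR j*(PI/2))) with (0+IZR j*PI) by field.
  destruct (cos_sin_shift j 0) as [_ ->]. rewrite sin_0. ring. }
 split; auto.
 unfold cD. have Hq := duplication_denominator (IZR j*KD).
 have E := sn2_cn2 _ m14 (IZR j*KD).
 have C2 : 2*cn (IZR j*KD) (1/4)^2 = 1+parity j.
 { rewrite (cn_lt1 _ m14). unfold KD. rewrite am_IZR_K by apply m14.
  destruct (cos_sin_shift j 0) as [H _]. rewrite cos_0, Rplus_0_l in H.
  replace (IZR j*PI) with (2*(IZR j*(PI/2))) in H by field. rewrite cos_2a_cos in H. lra. }
 replace (sn (IZR j*KD) (1/4)^4) with ((sn (IZR j*KD) (1/4)^2)^2) in*by ring.
 replace (sn (IZR j*KD) (1/4)^2) with (1-cn (IZR j*KD) (1/4)^2) in*by lra.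
 destruct (parity_cases j) as [Hp|Hp]; rewrite Hp in *.
 - replace (cn (IZR j*KD) (1/4)^2) with 1 in*by lra. field.
 - replace (cn (IZR j*KD) (1/4)^2) with 0 in*by lra. field.
Qed.

Lemma vD_pos (t : R) : 0 < vD t.
Proof.
 unfold vD. have Hq := duplication_denominator t. have E := dn2 _ m14 t. have B := sn_bound _ m14 t.
 set (s := sn t (1/4)) in *. rewrite E.
 assert (0 <= s^2 <= 1) by nra.
 assert (1 < 2*(1-1/4*s^2)/(1 - / 4*s^4)); [|lra].
 apply (Rmult_lt_reg_r (1 - / 4*s^4)); [lra|]. unfold Rdiv. rewrite Rmult_assoc, Rinv_l by lra. nra.
Qed.

Lemma ratioD_eq (t : R) : sD t <> 0 -> 0 < cn t (1/4)^2 /\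
 ratioD t = sD t*(1 - / 4*sn t (1/4)^4)/(2*cn t (1/4)^2).
Proof.
 intros Hs. have Hq := duplication_denominator t.
 have Hc : cn t (1/4) <> 0.
 { intros Hc. apply Hs. unfold sD. rewrite Hc. field. lra. }
 split; [apply pow2_gt_0; auto|]. unfold ratioD, sD. field. split; auto; lra.
Qed.

(** Off the zeros of [sD] the ratio is a positive multiple of [sD]. At a zero of [sD] it is 0,
    either through its numerator or, where [cn] vanishes, through [/ 0 = 0]. *)
Lemma domD_iff (t : R) : domD t <-> 0 < sD t.
Proof.
 have Hq := duplication_denominator t. unfold domD. split.
 - intros H. destruct (Req_dec (sD t) 0) as [H0|H0].
  + exfalso. unfold sD in H0. unfold ratioD in H.
   have E : sn t (1/4)*dn t (1/4)*cn t (1/4) = 0.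
   { apply (Rmult_eq_reg_r (2/(1 - / 4*sn t (1/4)^4))).
    - rewrite Rmult_0_l, <- H0. field. lra.
    - apply Rgt_not_eq, Rdiv_lt_0_compat; lra. }
   apply Rmult_integral in E. destruct E as [E|E]; rewrite E in H; unfold Rdiv in H;
    rewrite ?Rinv_0, ?Rmult_0_l, ?Rmult_0_r in H; lra.
  + destruct (ratioD_eq t H0) as [Hc E]. rewrite E in H.
   destruct (Rlt_dec 0 (sD t)); auto. exfalso.
   assert (sD t*(1 - / 4*sn t (1/4)^4)/(2*cn t (1/4)^2) <= 0); [|lra].
   unfold Rdiv. assert (0 < / (2*cn t (1/4)^2)) by (apply Rinv_0_lt_compat; lra).
   assert (0 <= (- sD t)*((1 - / 4*sn t (1/4)^4) * / (2*cn t (1/4)^2))).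
   { apply Rmult_le_pos; [lra|]. apply Rmult_le_pos; lra. }
   lra.
 - intros H. destruct (ratioD_eq t) as [Hc ->]; [lra|].
  apply Rdiv_lt_0_compat; [apply Rmult_lt_0_compat; lra|lra].
Qed.

Lemma cD_lt1 (t : R) : sD t <> 0 -> -1 < cD t < 1.
Proof.
 intros H. destruct (Jacobi_D t) as (_ & _ & _ & E & _).
 assert (0 < sD t^2) by (apply pow2_gt_0; auto). split; nra.
Qed.

(** [etaD] extends the logarithm of the absolute value of the ratio to all open cells. *)
Definition etaD (t : R) : R := / 2*ln ((1-cD t)/(1+cD t)).
Definition etaD1 (t : R) : R := 2*vD t/sD t.

(** The half-argument formula [(1 - cn 2t) / (1 + cn 2t) = (sn dn / cn)^2]. *)
Lemma phiD_eta (t : R) : domD t -> phiD t = etaD t.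
Proof.
 intros H. have Hs := proj1 (domD_iff t) H. unfold domD in H.
 have Hq := duplication_denominator t.
 destruct (ratioD_eq t) as [Hc _]; [lra|]. destruct (cD_lt1 t) as [C1 C2]; [lra|].
 unfold phiD, etaD.
 have E : (1-cD t)/(1+cD t) = ratioD t^2.
 { unfold ratioD, cD in *. have E1 := dn2 _ m14 t. have E2 := sn2_cn2 _ m14 t.
  have Hc' : cn t (1/4) <> 0 by (intros E; rewrite E in Hc; simpl in Hc; lra).
  set (s := sn t (1/4)) in *. set (c := cn t (1/4)) in *. set (d := dn t (1/4)) in *.
  replace ((s*d/c)^2) with (s^2*d^2/c^2) by (field; auto). rewrite E1.
  have S2 : s^2 = 1-c^2 by lra.
  have S4 : s^4 = (1-c^2)^2 by (rewrite <- S2; ring).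
  rewrite S4 in Hq, C1, C2. rewrite S2, S4. field. repeat split; auto; lra. }
 rewrite E. replace (ratioD t^2) with (ratioD t*ratioD t) by ring. rewrite ln_mult by auto. field.
Qed.

Lemma is_derive_etaD (t : R) : sD t <> 0 -> is_derive etaD t (etaD1 t).
Proof.
 intros Hs. destruct (Jacobi_D t) as (_ & D & _ & E & _). destruct (cD_lt1 t Hs) as [C1 C2].
 assert (0 < (1-cD t)/(1+cD t)) by (apply Rdiv_lt_0_compat; lra).
 unfold etaD, etaD1. auto_derive.
 - repeat split; try (eexists; eassumption); try lra.
 - derive_value D. field_simplify_eq; [|split; auto; lra].
  replace (cD t^2) with (1-sD t^2) by lra. ring.
Qed.

Lemma exp_2eta (t : R) : sD t <> 0 -> exp (2*etaD t) = (1-cD t)/(1+cD t).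
Proof.
 intros Hs. destruct (cD_lt1 t Hs) as [C1 C2]. unfold etaD.
 replace (2*(/ 2*ln ((1-cD t)/(1+cD t)))) with (ln ((1-cD t)/(1+cD t))) by field.
 apply exp_ln. apply Rdiv_lt_0_compat; lra.
Qed.

Lemma sinh_cosh_2eta (t : R) : sD t <> 0 ->
 sinh (2*etaD t) = - 2*cD t/sD t^2 /\ cosh (2*etaD t) = (2-sD t^2)/sD t^2.
Proof.
 intros Hs. destruct (Jacobi_D t) as (_ & _ & _ & E & _). destruct (cD_lt1 t Hs) as [C1 C2].
 unfold sinh, cosh. rewrite exp_Ropp, exp_2eta by auto.
 replace (sD t^2) with ((1-cD t)*(1+cD t)) by (assert (sD t^2 = 1-cD t^2) by lra; rewrite H; ring).
 split; field; lra.
Qed.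

Lemma is_derive_etaD1 (t : R) : sD t <> 0 -> is_derive etaD1 t (2*sinh (2*etaD t)).
Proof.
 intros Hs. destruct (Jacobi_D t) as (D1 & _ & D3 & E & E'). destruct (sinh_cosh_2eta t Hs) as [-> _].
 unfold etaD1. auto_derive.
 - repeat split; try (eexists; eassumption); auto.
 - derive_value D1; derive_value D3. field_simplify_eq; auto. rewrite E'. field.
Qed.

Lemma etaD1_sq (t : R) : sD t <> 0 -> etaD1 t^2 = 1+2*cosh (2*etaD t).
Proof.
 intros Hs. destruct (Jacobi_D t) as (_ & _ & _ & E & E'). destruct (sinh_cosh_2eta t Hs) as [_ ->].
 unfold etaD1. field_simplify_eq; auto. rewrite E'. field.
Qed.

Lemma cell_sD (j : Z) (t : R) : cell j t -> sD t <> 0.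
Proof. intros H. have H' := parity_sD j t H. intros E. rewrite E in H'. lra. Qed.

Lemma sD_continuous (t : R) : continuous sD t.
Proof. destruct (Jacobi_D t) as (D & _). apply (is_derive_continuous _ _ _ D). Qed.

Lemma cD_continuous (t : R) : continuous cD t.
Proof. destruct (Jacobi_D t) as (_ & D & _). apply (is_derive_continuous _ _ _ D). Qed.

(** Across a cell [cD] runs from [parity j] to [- parity j], and [etaD t = u] asks for
    [cD t = (1 - exp (2 u)) / (1 + exp (2 u))]. *)
Lemma etaD_surj (j : Z) (u : R) : exists t, cell j t /\ etaD t = u.
Proof.
 set (e := exp (2*u)). have He : 0 < e by apply exp_pos.
 set (c := (1-e)/(1+e)).
 have Hc : -1 < c < 1.
 { unfold c. split; apply (Rmult_lt_reg_r (1+e)); try lra; unfold Rdiv; rewrite Rmult_assoc, Rinv_l; lra. }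
 have Hk := KD_pos. have Hj : IZR j*KD < IZR (j+1)*KD by (rewrite plus_IZR; nra).
 destruct (Jacobi_D_lattice j) as [_ Ej]. destruct (Jacobi_D_lattice (j+1)) as [_ Ej'].
 replace (j+1)%Z with (Z.succ j) in Ej' at 2 by lia. rewrite parity_succ in Ej'.
 destruct (IVT_value cD (IZR j*KD) (IZR (j+1)*KD) c) as [t [Ht Hct]].
 - intros; apply cD_continuous.
 - rewrite Ej, Ej'. destruct (parity_cases j) as [-> | ->].
  + rewrite Rmin_right, Rmax_left; lra.
  + rewrite Rmin_left, Rmax_right; lra.
 - rewrite Rmin_left, Rmax_right in Ht by lra. exists t.
  have Ht' : cell j t.
  { split.
   - destruct (Req_dec t (IZR j*KD)) as [E|]; [|lra]. exfalso. rewrite E, Ej in Hct.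
    destruct (parity_cases j) as [H|H]; rewrite H in Hct; lra.
   - destruct (Req_dec t (IZR (j+1)*KD)) as [E|]; [|lra]. exfalso. rewrite E, Ej' in Hct.
    destruct (parity_cases j) as [H|H]; rewrite H in Hct; lra. }
  split; auto. unfold etaD. rewrite Hct.
  replace ((1-c)/(1+c)) with e by (unfold c; field; lra).
  unfold e. rewrite ln_exp. field.
Qed.

(** On the cell of index [j] the function [parity j * etaD] is increasing and onto, so [etaD] has a
    differentiable inverse defined on the whole line. *)
Lemma etaD_inverse (j : Z) : exists psi : R -> R,
 (forall u, cell j (psi u) /\ etaD (psi u) = u /\ is_derive psi u (/ etaD1 (psi u))) /\
 forall t, cell j t -> psi (etaD t) = t.
Proof.
 have Hsg : forall t, cell j t -> 0 < parity j*etaD1 t.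
 { intros t Ht. have H := parity_sD j t Ht. have Hv := vD_pos t. have Hs := cell_sD j t Ht.
  replace (parity j*etaD1 t) with (2*vD t*(parity j*sD t)/(sD t^2)) by (unfold etaD1; field; auto).
  apply Rdiv_lt_0_compat; [nra|]. apply pow2_gt_0; auto. }
 destruct (global_inverse (fun t => parity j*etaD t) (fun t => parity j*etaD1 t)
  (IZR j*KD) (IZR (j+1)*KD)) as [g [Hg1 Hg2]].
 - intros t Ht. apply (is_derive_scal etaD). apply is_derive_etaD, (cell_sD j t Ht).
 - exact Hsg.
 - intros u. destruct (etaD_surj j (parity j*u)) as [t [Ht E]]. exists t. split; auto. rewrite E.
  destruct (parity_cases j) as [-> | ->]; ring.
 - exists (fun u => g (parity j*u)). split.
  + intros u. destruct (Hg1 (parity j*u)) as (H1 & H2 & H3). split; [exact H1|]. split.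
   * destruct (parity_cases j) as [E|E]; rewrite E in *; lra.
   * eapply is_derive_eq.
    -- apply (is_derive_comp g (fun u => parity j*u)); [exact H3|].
     apply (is_derive_scal (fun u : R => u)), (is_derive_id (K := R_AbsRing)).
    -- unfold scal, one; simpl; unfold mult; simpl.
     have H := Hsg _ H1. destruct (parity_cases j) as [E|E]; rewrite E in *; field; lra.
  + intros t Ht. apply Hg2, Ht.
Qed.

Lemma cell_open (j : Z) : open (cell j).
Proof. apply open_and; [apply open_gt|apply open_lt]. Qed.

Lemma domD_open : open domD.
Proof.
 apply (open_ext (fun t => 0 < sD t)).
 - intros t. rewrite domD_iff. reflexivity.
 - intros t Ht. apply (sD_continuous t). apply open_gt. exact Ht.
Qed.

Lemma cellD_iff (t : R) : cellD t <-> cell 0 t.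
Proof. unfold cellD, cell. change (IZR (0+1)) with 1. fold KD. split; lra. Qed.

Lemma cell_even_domD (j : Z) (t : R) : Z.even j = true -> cell j t -> domD t.
Proof. intros Hj Ht. apply domD_iff. have H := parity_sD j t Ht. unfold parity in H. rewrite Hj in H. lra. Qed.

Lemma cellD_domD (t : R) : cellD t -> domD t.
Proof. intros Ht. apply (cell_even_domD 0); auto. apply cellD_iff; auto. Qed.

Lemma domD_cell (t : R) : domD t -> exists j, Z.even j = true /\ cell j t.
Proof.
 intros Ht. apply domD_iff in Ht. destruct (cell_index KD t KD_pos) as [j Hj].
 have Hc : cell j t.
 { split; [|apply Hj]. destruct (Req_dec t (IZR j*KD)) as [E|]; [|lra].
  exfalso. destruct (Jacobi_D_lattice j) as [E' _]. rewrite E, E' in Ht. lra. }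
 exists j. split; auto. have H := parity_sD j t Hc. unfold parity in H.
 destruct (Z.even j); auto; lra.
Qed.

Lemma is_derive_phiD (t : R) : domD t -> is_derive phiD t (etaD1 t).
Proof.
 intros H. have Hs := proj1 (domD_iff t) H.
 apply (is_derive_ext_loc etaD); [|apply is_derive_etaD; lra].
 apply (filter_imp domD); [|apply domD_open, H]. intros s Hs'. symmetry. apply phiD_eta; auto.
Qed.

Lemma is_derive_phiD1 (t : R) : domD t -> is_derive etaD1 t (2*sinh (2*phiD t)).
Proof.
 intros H. have Hs := proj1 (domD_iff t) H. rewrite phiD_eta by auto. apply is_derive_etaD1. lra.
Qed.

Lemma phiD1_sq (t : R) : domD t -> etaD1 t^2 = 1+2*cosh (2*phiD t).
Proof.
 intros H. have Hs := proj1 (domD_iff t) H. rewrite phiD_eta by auto. apply etaD1_sq. lra.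
Qed.

(** * Connectedness of surfaces through paths *)

Lemma continuous_triple (a b c : R -> R) (t : R) :
 continuous a t -> continuous b t -> continuous c t ->
 continuous (fun t => (a t, b t, c t)) t.
Proof.
 intros Ha Hb Hc.
 apply (continuous_comp_2 (fun t => (a t, b t)) c (fun p q => (p, q))).
 - apply (continuous_comp_2 a b (fun p q => (p, q))); auto.
  apply (continuous_ext (fun x => x)); [intros []; auto|]. apply continuous_id.
 - auto.
 - apply (continuous_ext (fun x => x)); [intros []; auto|]. apply continuous_id.
Qed.

(** Points joined to [p0] inside [S] are only needed on a dense subset. *)
Lemma connected_of_paths (S T : R3 -> Prop) (p0 : R3) : S p0 ->
 (forall q, T q -> exists gamma : R -> R3, gamma 0 = p0 /\ gamma 1 = q /\ forall t, continuous gamma t /\ S (gamma t)) ->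
 (forall p, S p -> closure T p) -> connected S.
Proof.
 intros S0 Hp HT U V HU HV Hcov Hdis.
 have K : forall W1 W2 : R3 -> Prop, open W1 -> open W2 -> (forall p, S p -> W1 p \/ W2 p) ->
  (forall p, S p -> ~ (W1 p /\ W2 p)) -> W1 p0 -> forall p, S p -> W1 p.
 { clear U V HU HV Hcov Hdis. intros W1 W2 O1 O2 Hc Hd H0 p Sp. destruct (Hc p Sp) as [|H2]; auto. exfalso.
  destruct (HT p Sp W2 (O2 p H2)) as (q & Wq & Tq). destruct (Hp q Tq) as (g & G0 & G1 & G).
  (* The indicator of [W1] along the path would be a continuous function from 1 to 0 that omits the
     value 1/2. *)
  set (f := fun t => if excluded_middle_informative (W1 (g t)) then 1 else 0).
  destruct (IVT_value f 0 1 (1/2)) as [t [_ Ht]].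
  - intros t _. destruct (G t) as [Gc GS]. destruct (excluded_middle_informative (W1 (g t))) as [Hu|Hu].
   + apply (continuous_ext_loc f (fun _ : R => 1) t); [|apply continuous_const].
    apply (filter_imp (fun s => W1 (g s))); [|exact (Gc W1 (O1 _ Hu))]. intros s Hs. unfold f.
    destruct (excluded_middle_informative _); auto; contradiction.
   + have Hv : W2 (g t) by (destruct (Hc _ GS); tauto).
    apply (continuous_ext_loc f (fun _ : R => 0) t); [|apply continuous_const].
    apply (filter_imp (fun s => W2 (g s))); [|exact (Gc W2 (O2 _ Hv))]. intros s Hs. unfold f.
    destruct (excluded_middle_informative _); auto. exfalso. apply (Hd (g s)); [apply G|tauto].
  - have G1S := proj2 (G 1). unfold f. rewrite G1 in G1S. rewrite G0, G1.
   destruct (excluded_middle_informative (W1 p0)); [|tauto].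
   destruct (excluded_middle_informative (W1 q)); [exfalso; apply (Hd q); auto|]. rewrite Rmin_right, Rmax_left; lra.
  - unfold f in Ht. destruct (excluded_middle_informative _); lra. }
 destruct (Hcov p0 S0); [left; apply (K U V)|right; apply (K V U)]; auto; intros p Sp.
 - destruct (Hcov p Sp); auto.
 - specialize (Hdis p Sp). tauto.
Qed.

Definition clamp (t : R) : R := Rmax 0 (Rmin 1 t).

Lemma clamp_bound (t : R) : 0 <= clamp t <= 1.
Proof.
 unfold clamp, Rmax, Rmin. destruct (Rle_dec 1 t); destruct (Rle_dec 0 _); lra.
Qed.

Lemma clamp_id (t : R) : 0 <= t <= 1 -> clamp t = t.
Proof. intros H. unfold clamp. rewrite Rmin_right, Rmax_right; lra. Qed.

Lemma clamp_continuous (t : R) : continuous clamp t.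
Proof.
 intros P [eps HP]. exists eps. intros y Hy. apply HP.
 change (Rabs (y-t) < eps) in Hy. change (Rabs (clamp y-clamp t) < eps).
 eapply Rle_lt_trans; [|exact Hy].
 unfold clamp, Rmax, Rmin. destruct (Rle_dec 1 t), (Rle_dec 1 y);
  repeat match goal with |- context [Rle_dec ?a ?b] => destruct (Rle_dec a b) end;
  unfold Rabs; repeat destruct (Rcase_abs _); lra.
Qed.

(** * Minimality from a second-order equation, and the addition theorems *)

(** Both surfaces pass through this criterion. The equation [f'' = X1 (f) / 2] gives smoothness by
    bootstrapping, and it turns the vanishing of the mean curvature into the functional equation for
    [X] and [X1]. *)
Lemma minimal_of_second_order (A : R -> Prop) (f f1 X X1 : R -> R) :
 open A -> (forall n, Ck n (fun _ => True) (fun u => / 2*X1 u)) ->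
 (forall x, A x -> is_derive f x (f1 x)) -> (forall x, A x -> is_derive f1 x (/ 2*X1 (f x))) ->
 (forall x, A x -> f1 x^2 = X (f x)) ->
 (forall u v w, u+v+w = 0 -> (X v+X w)*X1 u+(X w+X u)*X1 v+(X u+X v)*X1 w = 0) ->
 (forall x y z, A x -> A y -> A z -> f x+f y+f z = 0 -> (f1 x, f1 y, f1 z) <> (0, 0, 0)) ->
 separable_minimal A A A f f f.
Proof.
 intros HA HC D1 D2 HX HXX Hn.
 have Hs : smooth_on A f by (apply (smooth_of_second_order A f f1 _ HA HC D1 D2)).
 have E : forall x, A x -> Derive f x = f1 x by (intros; apply is_derive_unique; auto).
 have D2' : forall x, A x -> is_derive (Derive f) x (/ 2*X1 (f x)).
 { intros x Hx. apply (is_derive_ext_loc f1); auto. apply (filter_imp A); auto.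
  intros; symmetry; auto. }
 repeat (split; [solve [auto]|]).
 intros [[x y] z] (Hx & Hy & Hz & Hsum). unfold sep_fun in Hsum.
 have Hg : (Derive f x, Derive f y, Derive f z) <> (0, 0, 0) by (rewrite !E by auto; auto).
 split; [rewrite grad_sep; auto|].
 apply (mean_curvature_sep f f f x y z _ _ _ (D2' x Hx) (D2' y Hy) (D2' z Hz) Hg).
 rewrite !E, !HX by auto. specialize (HXX _ _ _ Hsum). lra.
Qed.

Lemma cos2_addition (u v w : R) : u+v+w = 0 ->
 (1+2*cos (2*v)+(1+2*cos (2*w)))*(- 4*sin (2*u)) +
 (1+2*cos (2*w)+(1+2*cos (2*u)))*(- 4*sin (2*v)) +
 (1+2*cos (2*u)+(1+2*cos (2*v)))*(- 4*sin (2*w)) = 0.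
Proof.
 intros H. replace (2*w) with (- (2*u+2*v)) by lra.
 rewrite cos_neg, sin_neg, cos_plus, sin_plus.
 have E1 := sin2_cos2 (2*u). have E2 := sin2_cos2 (2*v). unfold Rsqr in *.
 set (p := sin (2*u)) in *. set (q := cos (2*u)) in *. set (r := sin (2*v)) in *. set (s := cos (2*v)) in *.
 replace (- 4 * - (p*s+q*r)) with (4*(p*s+q*r)) by ring.
 ring_simplify. replace (p^2) with (1-q*q) by lra. replace (r^2) with (1-s*s) by lra. ring.
Qed.

Lemma cosh_sq (x : R) : cosh x^2-sinh x^2 = 1.
Proof.
 unfold cosh, sinh. have E : exp x*exp (- x) = 1 by (rewrite <- exp_plus, Rplus_opp_r; apply exp_0).
 replace (((exp x+exp (- x))/2)^2-((exp x-exp (- x))/2)^2) with (exp x*exp (- x)) by field. auto.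
Qed.

Lemma cosh_plus (x y : R) : cosh (x+y) = cosh x*cosh y+sinh x*sinh y.
Proof. unfold cosh, sinh. rewrite Ropp_plus_distr, !exp_plus. field. Qed.

Lemma sinh_plus (x y : R) : sinh (x+y) = sinh x*cosh y+cosh x*sinh y.
Proof. unfold cosh, sinh. rewrite Ropp_plus_distr, !exp_plus. field. Qed.

Lemma cosh_neg (x : R) : cosh (- x) = cosh x.
Proof. unfold cosh. rewrite Ropp_involutive. field. Qed.

Lemma sinh_neg (x : R) : sinh (- x) = - sinh x.
Proof. unfold sinh. rewrite Ropp_involutive. field. Qed.

Lemma cosh_ge1 (x : R) : 1 <= cosh x.
Proof.
 have H := cosh_sq x. assert (0 < cosh x).
 { unfold cosh. have H1 := exp_pos x. have H2 := exp_pos (- x). lra. }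
 assert (0 <= sinh x^2) by apply pow2_ge_0. nra.
Qed.

Lemma cosh2_addition (u v w : R) : u+v+w = 0 ->
 (1+2*cosh (2*v)+(1+2*cosh (2*w)))*(4*sinh (2*u)) +
 (1+2*cosh (2*w)+(1+2*cosh (2*u)))*(4*sinh (2*v)) +
 (1+2*cosh (2*u)+(1+2*cosh (2*v)))*(4*sinh (2*w)) = 0.
Proof.
 intros H. replace (2*w) with (- (2*u+2*v)) by lra.
 rewrite cosh_neg, sinh_neg, cosh_plus, sinh_plus.
 have E1 := cosh_sq (2*u). have E2 := cosh_sq (2*v).
 set (p := sinh (2*u)) in *. set (q := cosh (2*u)) in *. set (r := sinh (2*v)) in *. set (s := cosh (2*v)) in *.
 ring_simplify. replace (p^2) with (q^2-1) by lra. replace (r^2) with (s^2-1) by lra. ring.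
Qed.

Lemma third_order_of_derive (X X1 X2 : R -> R) (X3 kappa u : R) :
 (forall v, is_derive X v (X1 v)) -> (forall v, is_derive X1 v (X2 v)) -> is_derive X2 u X3 ->
 X3 = kappa*X1 u -> third_order X kappa u.
Proof.
 intros D1 D2 D3 E.
 have E1 : forall v, Derive X v = X1 v by (intros; apply is_derive_unique; auto).
 have E2 : forall v, Derive_n X 2 v = X2 v.
 { intros v. simpl. rewrite (Derive_ext _ X1) by apply E1. apply is_derive_unique; auto. }
 split.
 - intros k Hk. destruct k as [|[|[|[|k]]]]; try lia.
  + simpl; auto.
  + exists (X1 u). apply D1.
  + exists (X2 u). apply (is_derive_ext X1); [intros; symmetry; apply E1|apply D2].
  + exists X3. apply (is_derive_ext X2); [intros; symmetry; apply E2|apply D3].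
 - change (Derive (Derive_n X 2) u = kappa*Derive X u).
  rewrite (Derive_ext _ X2) by apply E2. rewrite E1, <- E. apply is_derive_unique, D3.
Qed.

Lemma third_order_X_pos (u : R) : third_order X_pos 4 u.
Proof.
 apply (third_order_of_derive _ (fun u => 4*sinh (2*u)) (fun u => 8*cosh (2*u)) (16*sinh (2*u)));
  try (intros v); unfold X_pos, sinh, cosh; try (auto_derive; auto; lra). lra.
Qed.

Lemma third_order_X_neg (u : R) : third_order X_neg (-4) u.
Proof.
 apply (third_order_of_derive _ (fun u => - 4*sin (2*u)) (fun u => - 8*cos (2*u)) (16*sin (2*u)));
  try (intros v); unfold X_neg; try (auto_derive; auto; lra). lra.
Qed.

Lemma isotropic_diag (A : R -> Prop) (f : R -> R) : isotropic A A A f f f.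
Proof. split; [tauto|]. exists 0, 0. intros; split; ring. Qed.

(** * D *)

Lemma separable_minimal_D (A : R -> Prop) :
 open A -> (forall t, A t -> domD t) -> separable_minimal A A A phiD phiD phiD.
Proof.
 intros HA Hdom.
 apply (minimal_of_second_order A phiD etaD1 (fun u => 1+2*cosh (2*u)) (fun u => 4*sinh (2*u))); auto.
 - intros n. apply (Ck_ext n _ (fun u => 2*sinh (2*u))); [apply open_full| |apply Ck_sinh2].
  intros; lra.
 - intros x Hx. apply is_derive_phiD; auto.
 - intros x Hx. eapply is_derive_eq; [apply is_derive_phiD1; auto|]. lra.
 - intros x Hx. apply phiD1_sq; auto.
 - apply cosh2_addition.
 - intros x y z Hx _ _ _ H. injection H as H _ _. have E := phiD1_sq x (Hdom x Hx).
  have H' := cosh_ge1 (2*phiD x). rewrite H in E. simpl in E. lra.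
Qed.

(** The inverse of [etaD] parametrizes the surface over one cell by the plane [u + v + w = 0], which
    is star-shaped and so makes the surface path-connected. *)
Lemma sep_surface_cellD_param (psi : R -> R) :
 (forall u, cell 0 (psi u) /\ etaD (psi u) = u /\ is_derive psi u (/ etaD1 (psi u))) ->
 (forall t, cell 0 t -> psi (etaD t) = t) ->
 forall x y z, sep_surface cellD cellD cellD phiD phiD phiD (x, y, z) <->
 exists u v w, u+v+w = 0 /\ x = psi u /\ y = psi v /\ z = psi w.
Proof.
 intros H1 H2 x y z.
 have Hphi : forall t, cellD t -> phiD t = etaD t by (intros; apply phiD_eta, cellD_domD; auto).
 split.
 - intros (Hx & Hy & Hz & Hs). unfold sep_fun in Hs. rewrite !Hphi in Hs by auto.
  exists (etaD x), (etaD y), (etaD z). rewrite !H2 by (apply cellD_iff; auto). repeat split; auto.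
 - intros (u & v & w & E & -> & -> & ->).
  have Hc : forall u, cellD (psi u) by (intros; apply cellD_iff, H1).
  repeat split; try apply Hc. unfold sep_fun. rewrite !Hphi by apply Hc.
  destruct (H1 u) as (_ & -> & _), (H1 v) as (_ & -> & _), (H1 w) as (_ & -> & _). auto.
Qed.

Lemma isotropic_example_D : isotropic_example cellD cellD cellD phiD phiD phiD.
Proof.
 destruct (etaD_inverse 0) as [psi [H1 H2]].
 have HS := sep_surface_cellD_param psi H1 H2.
 have Dpsi : forall u, is_derive psi u (/ etaD1 (psi u)) by (intros; apply H1).
 split; [|split; [|split]].
 - apply separable_minimal_D; [|apply cellD_domD].
  apply (open_ext (cell 0)); [intros; symmetry; apply cellD_iff|apply cell_open].
 - apply isotropic_diag.
 - apply (connected_of_paths _ (sep_surface cellD cellD cellD phiD phiD phiD) (psi 0, psi 0, psi 0)).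
  + apply HS. exists 0, 0, 0. repeat split; auto. ring.
  + intros [[x y] z] Hq. apply HS in Hq. destruct Hq as (u & v & w & E & -> & -> & ->).
   exists (fun t => (psi (t*u), psi (t*v), psi (t*w))). rewrite !Rmult_0_l, !Rmult_1_l. split; [auto|]. split; [auto|].
   intros t. split.
   * have Cp : forall c, continuous (fun t => psi (t*c)) t.
    { intros c. apply (continuous_comp (fun t => t*c) psi); [cont|apply (is_derive_continuous _ _ _ (Dpsi _))]. }
    apply continuous_triple; apply Cp.
   * apply HS. exists (t*u), (t*v), (t*w). repeat split; auto. rewrite <- !Rmult_plus_distr_l, E. ring.
  + intros p Hp O HO. exists p. split; auto. apply locally_singleton, HO.
 - intros ([[n1 n2] n3] & d & Hn & Hpl).
  have Hp : forall a b, n1*psi a+n2*psi b+n3*psi (- a-b) = d.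
  { intros a b. apply (Hpl (psi a, psi b, psi (- a-b))). apply HS.
   exists a, b, (- a-b). repeat split; auto. ring. }
  (* An equation of a plane, differentiated in [a] and in [b], gives
     [n1 q a = n3 q (- a - b) = n2 q b]. As [q] is not constant, [n3 = 0], and then [n1] and [n2]
     vanish because [q] has no zero. *)
  set (q := fun u => / etaD1 (psi u)).
  have Ha : forall a b, n1*q a-n3*q (- a-b) = 0.
  { intros a b.
   have D : is_derive (fun a => n1*psi a+n2*psi b+n3*psi (- a-b)) a (n1*q a-n3*q (- a-b)).
   { have Da := Dpsi a. have Dc := Dpsi (- a-b). unfold Rminus in Dc.
    derive_auto. unfold q, Rminus. ring. }
   rewrite <- (is_derive_unique _ _ _ D).
   rewrite (Derive_ext _ (fun _ => d)) by (intros; apply Hp). apply Derive_const. }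
  have Hb : forall a b, n2*q b-n3*q (- a-b) = 0.
  { intros a b.
   have D : is_derive (fun b => n1*psi a+n2*psi b+n3*psi (- a-b)) b (n2*q b-n3*q (- a-b)).
   { have Da := Dpsi b. have Dc := Dpsi (- a-b). unfold Rminus in Dc.
    derive_auto. unfold q, Rminus. ring. }
   rewrite <- (is_derive_unique _ _ _ D).
   rewrite (Derive_ext _ (fun _ => d)) by (intros; apply Hp). apply Derive_const. }
  have Hq : forall u, etaD1 (psi u)^2 = 1+2*cosh (2*u).
  { intros u. destruct (H1 u) as (Hc & E & _). rewrite etaD1_sq by (apply (cell_sD 0); auto). now rewrite E. }
  have Hq0 : forall u, q u <> 0.
  { intros u. apply Rinv_neq_0_compat. intros E. specialize (Hq u). rewrite E in Hq.
   have H := cosh_ge1 (2*u). simpl in Hq. lra. }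
  have Hq1 : q 0 <> q (-1).
  { intros E. unfold q in E. apply Rinv_eq_reg in E.
   have Q0 := Hq 0. have Q1 := Hq (-1). rewrite E, Q1 in Q0.
   have C := cosh_sq (2 * -1). have C' := cosh_sq (2*0).
   have S0 : sinh (2*0) = 0 by (rewrite Rmult_0_r; apply sinh_0).
   have S1 : sinh (2 * -1) <> 0.
   { replace (2 * -1) with (- (2)) by lra. rewrite sinh_neg.
    assert (sinh 0 < sinh 2) by (apply sinh_lt; lra). rewrite sinh_0 in *. lra. }
   rewrite S0 in C'. assert (0 < sinh (2 * -1)^2) by (apply pow2_gt_0; auto).
   replace (cosh (2 * -1)) with (cosh (2*0)) in C by lra. lra. }
  have A1 := Ha 0 0. have A2 := Ha 0 1. have B1 := Hb 0 0.
  replace (- 0-0) with 0 in*by ring. replace (- 0-1) with (-1) in*by ring.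
  have N3 : n3 = 0.
  { assert (n3*(q 0-q (-1)) = 0) by lra. apply Rmult_integral in H. destruct H; auto. lra. }
  subst n3. apply Hn.
  have N1 : n1*q 0 = 0 by lra. have N2 : n2*q 0 = 0 by lra.
  apply Rmult_integral in N1, N2. destruct N1 as [->|]; [|exfalso; eapply Hq0; eauto].
  destruct N2 as [->|]; [|exfalso; eapply Hq0; eauto]. reflexivity.
Qed.

Lemma separation_constant_D : separation_constant domD domD domD phiD phiD phiD 4.
Proof.
 exists X_pos, X_pos, X_pos. intros x y z (Hx & Hy & Hz & _).
 have E : forall t, domD t -> X_pos (phiD t) = Derive phiD t^2.
 { intros t Ht. rewrite (is_derive_unique _ _ _ (is_derive_phiD t Ht)). unfold X_pos. symmetry.
  apply phiD1_sq; auto. }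
 repeat split; auto; apply third_order_X_pos.
Qed.

(** * P *)

Lemma cos2_zero_endpoint (u : R) : - (PI/3) <= u <= PI/3 -> 1+2*cos (2*u) = 0 -> u = PI/3 \/ u = - (PI/3).
Proof.
 intros Hu H. have HP := PI_RGT_0.
 have C : cos (2*(PI/3)) = - (1/2).
 { replace (2*(PI/3)) with (PI-PI/3) by field. rewrite cos_minus, cos_PI, sin_PI, cos_PI3. field. }
 destruct (Rle_dec 0 u).
 - left. destruct (Req_dec u (PI/3)); auto. exfalso.
  assert (cos (2*(PI/3)) < cos (2*u)) by (apply cos_decreasing_1; lra). lra.
 - right. destruct (Req_dec u (- (PI/3))); auto. exfalso.
  assert (cos (2*(PI/3)) < cos (2 * - u)) by (apply cos_decreasing_1; lra).
  replace (2 * - u) with (- (2*u)) in*by ring. rewrite cos_neg in *. lra.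
Qed.

(** The slopes of P do vanish, but only at the values [PI / 3] and [- PI / 3]; no three of these
    have sum zero, so the gradient has no zero on the surface. *)
Lemma separable_minimal_P : separable_minimal domP domP domP phiP phiP phiP.
Proof.
 apply (minimal_of_second_order domP phiP phiP1 (fun u => 1+2*cos (2*u)) (fun u => - 4*sin (2*u))).
 - apply open_full.
 - intros n. apply (Ck_ext n _ (fun u => - 2*sin (2*u))); [apply open_full| |apply Ck_sin2].
  intros; lra.
 - intros x _. apply is_derive_phiP.
 - intros x _. eapply is_derive_eq; [apply is_derive_phiP1|]. lra.
 - intros x _. apply phiP1_sq.
 - apply cos2_addition.
 - intros x y z _ _ _ Hs H. injection H as Hx Hy Hz.
  have Q : forall t, phiP1 t = 0 -> phiP t = PI/3 \/ phiP t = - (PI/3).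
  { intros t Ht. apply cos2_zero_endpoint; [apply phiP_bound|]. rewrite <- phiP1_sq, Ht. ring. }
  have HP := PI_RGT_0.
  destruct (Q x Hx), (Q y Hy), (Q z Hz); lra.
Qed.

Definition KP : R := ellK (3/4).

Lemma KP_pos : 0 < KP.
Proof. apply ellK_pos, m34. Qed.

(** The inverse of [phiP] on the closed cell from [j KP] to [(j + 1) KP]: it solves
    [cn (2 t) = tan u / sqrt 3] with amplitude between [j PI] and [(j + 1) PI]. *)
Definition branchP (j : Z) (u : R) : R :=
 / 2*ellF (IZR j*PI+acos (parity j*tan u/sqrt 3)) (3/4).

Lemma branchP_continuous (j : Z) (u : R) : - (PI/3) <= u <= PI/3 -> continuous (branchP j) u.
Proof.
 intros Hu. have HP := PI_RGT_0. unfold branchP.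
 apply (continuous_mult (fun _ => / 2)); [apply continuous_const|].
 apply (continuous_comp (fun u => IZR j*PI+acos (parity j*tan u/sqrt 3)) (fun t => ellF t (3/4)));
  [|apply ellF_continuous, m34].
 cont; [|apply acos_continuous].
 apply continuity_pt_filterlim, derivable_continuous_pt, derivable_pt_tan. lra.
Qed.

Lemma tan_PI3_bound (u : R) : - (PI/3) <= u <= PI/3 -> - sqrt 3 <= tan u <= sqrt 3.
Proof.
 intros Hu. have HP := PI_RGT_0. rewrite <- tan_PI3, <- tan_neg.
 have Hle : forall x y, - (PI/2) < x -> x <= y -> y < PI/2 -> tan x <= tan y.
 { intros x y Hx [H| ->] Hy; [left; apply tan_increasing; lra|lra]. }
 split; apply Hle; lra.
Qed.

Lemma parity_tan_bound (j : Z) (u : R) : - (PI/3) <= u <= PI/3 -> -1 <= parity j*tan u/sqrt 3 <= 1.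
Proof.
 intros Hu. have H := tan_PI3_bound u Hu. have H3 := sqrt3_pos.
 split; apply (Rmult_le_reg_r (sqrt 3)); auto; unfold Rdiv; rewrite Rmult_assoc, Rinv_l by lra;
  destruct (parity_cases j) as [-> | ->]; lra.
Qed.

Lemma branchP_spec (j : Z) (u : R) : - (PI/3) <= u <= PI/3 ->
 phiP (branchP j u) = u /\ IZR j*KP <= branchP j u <= IZR (j+1)*KP.
Proof.
 intros Hu. have Hb := parity_tan_bound j u Hu. have H3 := sqrt3_pos. have HP := PI_RGT_0.
 have Ha := acos_bound (parity j*tan u/sqrt 3).
 set (a := acos (parity j*tan u/sqrt 3)) in *.
 have E : 2*branchP j u = ellF (IZR j*PI+a) (3/4) by (unfold branchP; fold a; field).
 split.
 - rewrite phiP_atan, E, (cn_lt1 _ m34), am_ellF by apply m34.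
  rewrite Rplus_comm. destruct (cos_sin_shift j a) as [-> _]. unfold a. rewrite cos_acos by auto.
  replace (sqrt 3*(parity j*(parity j*tan u/sqrt 3))) with (tan u).
  + apply atan_tan; lra.
  + destruct (parity_cases j) as [-> | ->]; field; lra.
 - have Hmono : forall x y, x <= y -> ellF x (3/4) <= ellF y (3/4).
  { intros x y Hxy. have H := ellF_gap (3/4) x y m34 Hxy. lra. }
  have F1 := ellF_IZR_PI2 (2*j) (3/4) m34. have F2 := ellF_IZR_PI2 (2*(j+1)) (3/4) m34.
  rewrite !mult_IZR in F1, F2. fold KP in F1, F2.
  have G1 := Hmono (2*IZR j*(PI/2)) (IZR j*PI+a) ltac:(lra).
  have G2 := Hmono (IZR j*PI+a) (2*IZR (j+1)*(PI/2)) ltac:(rewrite plus_IZR; lra).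
  rewrite F1 in G1. rewrite F2 in G2. lra.
Qed.

Lemma branchP_phiP (j : Z) (t : R) : IZR j*KP <= t <= IZR (j+1)*KP -> branchP j (phiP t) = t.
Proof.
 intros Ht. have H3 := sqrt3_pos.
 have Ham : forall k s, IZR k*KP <= s -> IZR k*PI <= am_lt1 (2*s) (3/4).
 { intros k s Hs. replace (IZR k*PI) with (am_lt1 (IZR (2*k)*KP) (3/4)).
  - destruct (Req_dec (IZR (2*k)*KP) (2*s)) as [->|Hn]; [lra|]. left. apply am_lt; [apply m34|].
   rewrite mult_IZR in *. lra.
  - unfold KP. rewrite am_IZR_K by apply m34. rewrite mult_IZR. field. }
 have Ham' : forall k s, s <= IZR k*KP -> am_lt1 (2*s) (3/4) <= IZR k*PI.
 { intros k s Hs. replace (IZR k*PI) with (am_lt1 (IZR (2*k)*KP) (3/4)).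
  - destruct (Req_dec (IZR (2*k)*KP) (2*s)) as [->|Hn]; [lra|]. left. apply am_lt; [apply m34|].
   rewrite mult_IZR in *. lra.
  - unfold KP. rewrite am_IZR_K by apply m34. rewrite mult_IZR. field. }
 have A1 := Ham j t (proj1 Ht). have A2 := Ham' (j+1)%Z t (proj2 Ht). rewrite plus_IZR in A2.
 set (a := am_lt1 (2*t) (3/4)) in *.
 unfold branchP. rewrite phiP_atan, tan_atan, (cn_lt1 _ m34). fold a.
 replace a with (a-IZR j*PI+IZR j*PI) at 1 by ring.
 destruct (cos_sin_shift j (a-IZR j*PI)) as [-> _].
 replace (parity j*(sqrt 3*(parity j*cos (a-IZR j*PI)))/sqrt 3) with (cos (a-IZR j*PI)).
 - rewrite acos_cos by lra. replace (IZR j*PI+(a-IZR j*PI)) with a by ring.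
  unfold a. rewrite ellF_am by apply m34. field.
 - destruct (parity_cases j) as [-> | ->]; field; lra.
Qed.

Definition closed_cellP (i j k : Z) (p : R3) : Prop :=
 let '(x, y, z) := p in
 IZR i*KP <= x <= IZR (i+1)*KP /\ IZR j*KP <= y <= IZR (j+1)*KP /\
 IZR k*KP <= z <= IZR (k+1)*KP /\ phiP x+phiP y+phiP z = 0.

Lemma surfaceP_closed_cellP (p : R3) : surfaceP p -> exists i j k, closed_cellP i j k p.
Proof.
 destruct p as [[x y] z]. intros (_ & _ & _ & E).
 destruct (cell_index KP x KP_pos) as [i Hi], (cell_index KP y KP_pos) as [j Hj], (cell_index KP z KP_pos) as [k Hk].
 exists i, j, k. repeat split; auto; lra.
Qed.

Lemma phiP_periodic (t : R) : phiP (t+2*KP) = phiP t.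
Proof.
 rewrite !phiP_atan, !(cn_lt1 _ m34). do 2 f_equal.
 replace (2*(t+2*KP)) with (ellF (am_lt1 (2*t) (3/4)+PI+PI) (3/4)).
 - rewrite am_ellF by apply m34.
  replace (am_lt1 (2*t) (3/4)+PI+PI) with (am_lt1 (2*t) (3/4)+2*PI) by ring.
  apply cos_period with (k := 1%nat) || (rewrite cos_plus, cos_2PI, sin_2PI; ring).
 - rewrite !ellF_PI, ellF_am by apply m34. unfold KP. ring.
Qed.

Lemma separation_constant_P : separation_constant domP domP domP phiP phiP phiP (-4).
Proof.
 exists X_neg, X_neg, X_neg. intros x y z _.
 have E : forall t, X_neg (phiP t) = Derive phiP t^2.
 { intros t. rewrite (is_derive_unique _ _ _ (is_derive_phiP t)). unfold X_neg. symmetry. apply phiP1_sq. }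
 repeat split; auto; apply third_order_X_neg.
Qed.

(** * Classification *)

(** The solution of [X'' = kappa (X - a / 3)] with [X 0 = a] and [X' 0 = 0]. For [kappa = 0] the
    second branch reduces to the constant [a]. *)
Definition X_model (kappa a u : R) : R :=
 a/3*(1+2*(if Rlt_dec 0 kappa then cosh (sqrt kappa*u) else cos (sqrt (- kappa)*u))).

Definition X_model1 (kappa a u : R) : R :=
 a/3*(2*(if Rlt_dec 0 kappa then sqrt kappa*sinh (sqrt kappa*u)
        else-(sqrt (- kappa)*sin (sqrt (- kappa)*u)))).

Lemma X_model_derive (kappa a u : R) : is_derive (X_model kappa a) u (X_model1 kappa a u) /\
 is_derive (X_model1 kappa a) u (kappa*(X_model kappa a u-a/3)).
Proof.
 unfold X_model, X_model1. destruct (Rlt_dec 0 kappa) as [H|H].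
 - have E := sqrt_sqrt kappa ltac:(lra). split; unfold cosh, sinh; auto_derive; auto; try lra.
  set (s := sqrt kappa) in *. rewrite <- E. field.
 - have E := sqrt_sqrt (- kappa) ltac:(lra). split; auto_derive; auto; try lra.
  set (s := sqrt (- kappa)) in *. replace kappa with (- (s*s)) by lra. field.
Qed.

Lemma X_model_0 (kappa a : R) : X_model kappa a 0 = a /\ X_model1 kappa a 0 = 0.
Proof.
 unfold X_model, X_model1. rewrite !Rmult_0_r, cosh_0, sinh_0, cos_0, sin_0.
 destruct (Rlt_dec 0 kappa); split; field.
Qed.

Lemma X_model_addition (kappa a u v w : R) : u+v+w = 0 ->
 (X_model kappa a v+X_model kappa a w)*X_model1 kappa a u +
 (X_model kappa a w+X_model kappa a u)*X_model1 kappa a v +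
 (X_model kappa a u+X_model kappa a v)*X_model1 kappa a w = 0.
Proof.
 intros H. unfold X_model, X_model1. destruct (Rlt_dec 0 kappa) as [Hk|Hk].
 - set (s := sqrt kappa).
  have E := cosh2_addition (s*u/2) (s*v/2) (s*w/2)
   ltac:(replace (s*u/2+s*v/2+s*w/2) with (s*(u+v+w)/2) by field; rewrite H; field).
  replace (2*(s*u/2)) with (s*u) in E by field. replace (2*(s*v/2)) with (s*v) in E by field.
  replace (2*(s*w/2)) with (s*w) in E by field.
  match goal with |- ?L = 0 => match type of E with ?M = 0 => replace L with (a/3*(a/3)*s/2*M) by field end end.
  rewrite E. ring.
 - set (s := sqrt (- kappa)).
  have E := cos2_addition (s*u/2) (s*v/2) (s*w/2)
   ltac:(replace (s*u/2+s*v/2+s*w/2) with (s*(u+v+w)/2) by field; rewrite H; field).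
  replace (2*(s*u/2)) with (s*u) in E by field. replace (2*(s*v/2)) with (s*v) in E by field.
  replace (2*(s*w/2)) with (s*w) in E by field.
  match goal with |- ?L = 0 => match type of E with ?M = 0 => replace L with (a/3*(a/3)*s/2*M) by field end end.
  rewrite E. ring.
Qed.

Lemma X_model_even (kappa a u : R) : X_model kappa a (- u) = X_model kappa a u /\
 X_model1 kappa a (- u) = - X_model1 kappa a u.
Proof.
 unfold X_model, X_model1. rewrite !Ropp_mult_distr_r_reverse, cosh_neg, sinh_neg, cos_neg, sin_neg.
 destruct (Rlt_dec 0 kappa); split; ring.
Qed.

(** In the trigonometric case, nonnegativity from 0 to [u] keeps the phase of [u] within [2 PI / 3],
    so the cosine of half the phase is positive. Propagation uses the value [- u / 2] as a point
    where the squared slope cannot vanish. *)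
Lemma X_model_half_pos (kappa a u : R) : 0 < a ->
 (forall s, 0 <= s <= 1 -> 0 <= X_model kappa a (s*u)) -> 0 < X_model kappa a (- u/2).
Proof.
 intros Ha Hs. unfold X_model in *. destruct (Rlt_dec 0 kappa) as [Hk|Hk].
 - have H := cosh_ge1 (sqrt kappa*(- u/2)). apply Rmult_lt_0_compat; lra.
 - set (q := sqrt (- kappa)) in *. set (y := q*u).
  have HPI := PI_RGT_0.
  have Hy : Rabs y <= 2*PI/3.
  { destruct (Rle_dec (Rabs y) (2*PI/3)) as [|Hn]; auto. exfalso.
   (* Shrinking the phase to at most [PI] while keeping it above [2 PI / 3] exhibits a negative
      value of the model. *)
   set (s := Rmin 1 (PI/Rabs y)).
   have Hy0 : 0 < Rabs y by lra.
   have Hs1 : 0 < s <= 1.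
   { split; [apply Rmin_pos; [lra|apply Rdiv_lt_0_compat; lra]|apply Rmin_l]. }
   have Hsy : 2*PI/3 < s*Rabs y <= PI.
   { unfold s, Rmin. destruct (Rle_dec 1 (PI/Rabs y)) as [L|L].
    - apply (Rmult_le_compat_r (Rabs y)) in L; [|lra].
     replace (PI/Rabs y*Rabs y) with PI in L by (field; lra). lra.
    - replace (PI/Rabs y*Rabs y) with PI by (field; lra). lra. }
   specialize (Hs s ltac:(lra)).
   replace (q*(s*u)) with (s*y) in Hs by (unfold y; ring).
   have E : cos (s*y) = cos (s*Rabs y).
   { unfold Rabs. destruct (Rcase_abs y); auto. rewrite Ropp_mult_distr_r_reverse, cos_neg. auto. }
   rewrite E in Hs.
   assert (cos (s*Rabs y) < cos (2*PI/3)) by (apply cos_decreasing_1; lra).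
   have C : cos (2*PI/3) = - (1/2).
   { replace (2*PI/3) with (PI-PI/3) by field. rewrite cos_minus, cos_PI, sin_PI, cos_PI3. field. }
   assert (0 < a/3 * - (1+2*cos (s*Rabs y))) by (apply Rmult_lt_0_compat; lra).
   lra. }
  replace (q*(- u/2)) with (- (y/2)) by (unfold y; field). rewrite cos_neg.
  apply Rabs_le_between in Hy.
  assert (0 < cos (y/2)) by (apply cos_gt_0; lra).
  apply Rmult_lt_0_compat; lra.
Qed.

(** The functional equation [(X v + X w) X' u + (X w + X u) X' v + (X u + X v) X' w = 0] on
    [u + v + w = 0]: taking [w = 0] shows that [X] is even, and its [v]-derivative at [v = 0]
    is an ordinary differential equation that integrates to [X'' = kappa (X - X 0 / 3)]. *)
Lemma functional_equation (X X1 X2 : R -> R) (e : R) :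
 0 < e ->
 (forall u, Rabs u < e -> is_derive X u (X1 u)) -> (forall u, Rabs u < e -> is_derive X1 u (X2 u)) ->
 (forall u, Rabs u < e -> 0 < X u) ->
 (forall u v w, Rabs u < e -> Rabs v < e -> Rabs w < e -> u+v+w = 0 ->
  (X v+X w)*X1 u+(X w+X u)*X1 v+(X u+X v)*X1 w = 0) ->
 exists kappa, forall u, Rabs u < e/2 -> X u = X_model kappa (X 0) u /\ X1 u = X_model1 kappa (X 0) u.
Proof.
 intros He D1 D2 Hpos Heq. set (a := X 0).
 have Hin : forall u, - e < u < e -> Rabs u < e by (intros; apply Rabs_def1; lra).
 have Ha : 0 < a by (apply Hpos, Hin; lra).
 have H10 : X1 0 = 0.
 { have H := Heq 0 0 0 ltac:(apply Hin; lra) ltac:(apply Hin; lra) ltac:(apply Hin; lra) ltac:(lra).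
  fold a in H. nra. }
 have Heven : forall u, - e < u < e -> X (- u) = X u.
 { intros u Hu.
  (* The functional equation at [(t, -t, 0)] is the vanishing of the derivative of this quotient. *)
  set (h := fun t => (X t+a)/(X (- t)+a)).
  have Dh : forall t, - e < t < e -> is_derive h t 0.
  { intros t Ht. have A1 := D1 t (Hin t Ht). have A2 := D1 (- t) ltac:(apply Hin; lra).
   have P1 := Hpos t (Hin t Ht). have P2 := Hpos (- t) ltac:(apply Hin; lra).
   have E := Heq t (- t) 0 (Hin t Ht) ltac:(apply Hin; lra) ltac:(apply Hin; lra) ltac:(ring).
   rewrite H10 in E. fold a in E. unfold h. auto_derive.
   - repeat split; try (eexists; eassumption); lra.
   - derive_value A1. derive_value A2. field_simplify_eq; [|lra]. lra. }
  have Hh : forall t, - e < t < e -> h t = 1.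
  { intros t Ht. replace 1 with (h 0) by (unfold h; rewrite Ropp_0; fold a; field; lra).
   destruct (Rle_dec 0 t); [symmetry|]; apply constant_of_derive; try lra; intros; apply Dh; lra. }
  specialize (Hh u Hu). unfold h in Hh.
  have P2 := Hpos (- u) ltac:(apply Hin; lra).
  apply (f_equal (fun q => q*(X (- u)+a))) in Hh.
  unfold Rdiv in Hh. rewrite Rmult_assoc, Rinv_l in Hh by lra. lra. }
 have Hodd : forall u, - e < u < e -> X1 (- u) = - X1 u.
 { intros u Hu. have E := Heq u (- u) 0 (Hin u Hu) ltac:(apply Hin; lra) ltac:(apply Hin; lra) ltac:(ring).
  rewrite H10, Heven in E by auto. fold a in E. have P := Hpos u (Hin u Hu).
  assert ((X u+a)*(X1 u+X1 (- u)) = 0) by lra. apply Rmult_integral in H. destruct H; lra. }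
 set (b := X2 0).
 have Hode : forall u, - e < u < e -> X1 u^2+2*b*X u = (X u+a)*X2 u.
 { intros u Hu.
  (* With [w = - (u + v)], [X] even and [X1] odd, the functional equation says that [P] vanishes
     near 0; its derivative at 0 is the differential equation. *)
  set (P := fun v => (X v+X (u+v))*X1 u+(X (u+v)+X u)*X1 v-(X u+X v)*X1 (u+v)).
  have DP : is_derive P 0 (X1 u^2+2*b*X u-(X u+a)*X2 u).
  { have A1 := D1 0 ltac:(apply Hin; lra). have A2 := D2 0 ltac:(apply Hin; lra).
   have A3 := D1 u (Hin u Hu). have A4 := D2 u (Hin u Hu). rewrite <- (Rplus_0_r u) in A3, A4 at 1.
   unfold P. auto_derive.
   - repeat split; eexists; eassumption.
   - derive_value A1. derive_value A2. derive_value A3. derive_value A4. rewrite !Rplus_0_r, H10.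
    fold a b. ring. }
  have D0 : is_derive P 0 0.
  { apply (is_derive_ext_loc (fun _ => 0)); [|apply (is_derive_const (K := R_AbsRing) (V := R_NormedModule))].
   have Hr : 0 < Rmin (e-u) (e+u) by (apply Rmin_pos; lra).
   exists (mkposreal _ Hr). intros v Hv. change (Rabs (v-0) < Rmin (e-u) (e+u)) in Hv.
   assert (Rmin (e-u) (e+u) <= e-u) by apply Rmin_l. assert (Rmin (e-u) (e+u) <= e+u) by apply Rmin_r.
   rewrite Rminus_0_r in Hv. apply Rabs_def2 in Hv.
   have Hv' : - e < v < e.
   { destruct (Rle_dec 0 u); split; lra. }
   have E := Heq u v (- (u+v)) (Hin u Hu) (Hin v Hv') ltac:(apply Hin; lra) ltac:(ring).
   rewrite Heven, Hodd in E by lra. unfold P. lra. }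
  have Q : X1 u^2+2*b*X u-(X u+a)*X2 u = 0.
  { rewrite <- (is_derive_unique _ _ _ DP). apply is_derive_unique. exact D0. }
  lra. }
 set (k := 3*b/(2*a)).
 have Hlin : forall u, - e < u < e -> X2 u = k*(X u-a/3).
 { intros u Hu.
  (* A first integral of [(X + a) X'' = X'^2 + 2 b X]; its value at 0 is [k]. *)
  set (Y := fun t => (X1 t^2+4*b*X t+2*b*a)/(X t+a)^2).
  have DY : forall t, - e < t < e -> is_derive Y t 0.
  { intros t Ht. have A1 := D1 t (Hin t Ht). have A2 := D2 t (Hin t Ht). have P := Hpos t (Hin t Ht).
   have O := Hode t Ht. unfold Y. auto_derive.
   - repeat split; try (eexists; eassumption). apply Rgt_not_eq. nra.
   - derive_value A1. derive_value A2.
    replace (X2 t) with ((X1 t^2+2*b*X t)/(X t+a)) by (rewrite O; field; lra).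
    field. lra. }
  have HY : Y u = Y 0.
  { destruct (Rle_dec 0 u); [symmetry|]; apply constant_of_derive; try lra; intros; apply DY; lra. }
  unfold Y in HY. fold a in HY. rewrite H10 in HY. have P := Hpos u (Hin u Hu). have O := Hode u Hu.
  replace (X1 u^2) with ((X u+a)*X2 u-2*b*X u) in HY by lra.
  replace (((X u+a)*X2 u-2*b*X u+4*b*X u+2*b*a)/(X u+a)^2)
   with ((X2 u+2*b)/(X u+a)) in HY by (field; lra).
  replace ((0^2+4*b*a+2*b*a)/(a+a)^2) with k in HY by (unfold k; field; lra).
  have HY' : X2 u+2*b = k*(X u+a).
  { rewrite <- HY. field. lra. }
  assert (2*b = k*a*4/3) by (unfold k; field; lra). lra. }
 exists k. intros u Hu. apply Rabs_def2 in Hu.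
 apply (second_order_unique (fun x => k*(x-a/3)) (Rabs k) (fun _ => 1) X X1 (X_model k a) (X_model1 k a)
  (- (e/2)) (e/2) 0); try lra.
 - intros; apply continuous_const.
 - intros t Ht. rewrite Rmult_1_r. apply D1, Hin; lra.
 - intros t Ht. rewrite Rmult_1_r, <- Hlin by lra. apply D2, Hin; lra.
 - intros t Ht. rewrite Rmult_1_r. apply X_model_derive.
 - intros t Ht. rewrite Rmult_1_r. apply X_model_derive.
 - intros t Ht. rewrite <- Rabs_mult. right. f_equal. ring.
 - symmetry. apply X_model_0.
 - rewrite H10. symmetry. apply X_model_0.
Qed.

(** Where the slope is positive, [F] is a local coordinate, so the squared slope becomes a function
    of the value. All small triples of values with sum zero are taken near [x0], hence the
    functional equation holds for them. *)
Lemma local_model_pos (A : R -> Prop) (F F1 F2 F3 : R -> R) (x0 : R) :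
 open A -> (forall x, A x -> is_derive F x (F1 x)) -> (forall x, A x -> is_derive F1 x (F2 x)) ->
 (forall x, A x -> is_derive F2 x (F3 x)) ->
 (forall x y z, A x -> A y -> A z -> F x+F y+F z = 0 ->
  F2 x*(F1 y^2+F1 z^2)+F2 y*(F1 z^2+F1 x^2)+F2 z*(F1 x^2+F1 y^2) = 0) ->
 A x0 -> F x0 = 0 -> 0 < F1 x0 ->
 exists kappa d, 0 < d /\ forall x, Rabs (x-x0) < d ->
  A x /\ F1 x^2 = X_model kappa (F1 x0^2) (F x) /\ 2*F2 x = X_model1 kappa (F1 x0^2) (F x).
Proof.
 intros HA D1 D2 D3 Hpde Ax0 F0 Hp.
 have Hc : continuous F1 x0 by (apply (is_derive_continuous _ _ _ (D2 x0 Ax0))).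
 have Hloc : locally x0 (fun x => A x /\ 0 < F1 x).
 { apply filter_and; [apply HA; auto|]. apply (Hc (fun y => 0 < y)). apply open_gt; auto. }
 destruct Hloc as [d Hd].
 have Hd' : forall x, Rabs (x-x0) < d -> A x /\ 0 < F1 x by (intros x Hx; apply Hd; exact Hx).
 destruct (local_inverse F F1 x0 d (cond_pos d)) as (g & e & He & Hg0 & Hg).
 { intros x Hx. apply D1, Hd'; auto. }
 { intros x Hx. apply Hd'; auto. }
 rewrite F0 in Hg, Hg0.
 have Hg' : forall u, Rabs u < e -> Rabs (g u-x0) < d /\ F (g u) = u /\ is_derive g u (/ F1 (g u)).
 { intros u Hu. apply Hg. rewrite Rminus_0_r. auto. }
 destruct (functional_equation (fun u => F1 (g u)^2) (fun u => 2*F2 (g u)) (fun u => 2*F3 (g u)/F1 (g u)) e He)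
  as [kappa Hk].
 - intros u Hu. destruct (Hg' u Hu) as (G1 & G2 & G3). destruct (Hd' _ G1) as [A1 P1].
  have B := D2 _ A1. derive_auto. field. lra.
 - intros u Hu. destruct (Hg' u Hu) as (G1 & G2 & G3). destruct (Hd' _ G1) as [A1 P1].
  have B := D3 _ A1. derive_auto. field. lra.
 - intros u Hu. destruct (Hg' u Hu) as (G1 & _). destruct (Hd' _ G1) as [A1 P1]. apply pow2_gt_0. lra.
 - intros u v w Hu Hv Hw E.
  destruct (Hg' u Hu) as (G1 & G2 & _), (Hg' v Hv) as (G1' & G2' & _), (Hg' w Hw) as (G1'' & G2'' & _).
  have Q := Hpde (g u) (g v) (g w) (proj1 (Hd' _ G1)) (proj1 (Hd' _ G1')) (proj1 (Hd' _ G1'')).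
  rewrite G2, G2', G2'' in Q. specialize (Q E). lra.
 - cbv beta in Hk. rewrite Hg0 in Hk.
  have HFc : continuous F x0 by (apply (is_derive_continuous _ _ _ (D1 x0 Ax0))).
  have Hl : locally x0 (fun x => Rabs (x-x0) < d /\ Rabs (F x) < e/2).
  { apply filter_and; [exists d; intros y Hy; exact Hy|].
   apply (HFc (fun y => Rabs y < e/2)). rewrite F0.
   exists (mkposreal (e/2) ltac:(lra)). intros y Hy. change (Rabs (y-0) < e/2) in Hy.
   rewrite Rminus_0_r in Hy. exact Hy. }
  destruct Hl as [d' Hd'']. exists kappa, d'. split; [apply cond_pos|].
  intros x Hx. destruct (Hd'' x Hx) as [Q1 Q2]. destruct (Hd' x Q1) as [A1 P1]. split; auto.
  destruct (Hk (F x) Q2) as [E1 E2].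
  destruct (Hg' (F x)) as (G1 & G2 & _); [lra|].
  have Hgx : g (F x) = x.
  { destruct (Hd' _ G1) as [A2 P2].
   have Hinc : forall s t, Rabs (s-x0) < d -> Rabs (t-x0) < d -> s < t -> F s < F t.
   { intros s t Hs Ht Hst. apply Rabs_def2 in Hs, Ht.
    apply (increasing_of_derive F F1); auto; intros r Hr;
     [apply D1|]; apply (Hd' r), Rabs_def1; lra. }
   destruct (Rtotal_order (g (F x)) x) as [H|[H|H]]; auto; exfalso; apply Hinc in H; auto; lra. }
  rewrite Hgx in E1, E2. auto.
Qed.

(** A negative slope is reduced to a positive one by passing to [- F], since the model is even. *)
Lemma local_model (A : R -> Prop) (F F1 F2 F3 : R -> R) (x0 : R) :
 open A -> (forall x, A x -> is_derive F x (F1 x)) -> (forall x, A x -> is_derive F1 x (F2 x)) ->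
 (forall x, A x -> is_derive F2 x (F3 x)) ->
 (forall x y z, A x -> A y -> A z -> F x+F y+F z = 0 ->
  F2 x*(F1 y^2+F1 z^2)+F2 y*(F1 z^2+F1 x^2)+F2 z*(F1 x^2+F1 y^2) = 0) ->
 A x0 -> F x0 = 0 -> F1 x0 <> 0 ->
 exists kappa d, 0 < d /\ forall x, Rabs (x-x0) < d ->
  A x /\ F1 x^2 = X_model kappa (F1 x0^2) (F x) /\ 2*F2 x = X_model1 kappa (F1 x0^2) (F x).
Proof.
 intros HA D1 D2 D3 Hpde Ax0 F0 Hp.
 destruct (Rlt_dec 0 (F1 x0)) as [H|H].
 - apply (local_model_pos A F F1 F2 F3 x0); auto.
 - destruct (local_model_pos A (fun x => - F x) (fun x => - F1 x) (fun x => - F2 x) (fun x => - F3 x) x0)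
   as (kappa & d & Hd & Hk); auto; try lra.
  + intros x Hx. apply (is_derive_opp F x (F1 x)); auto.
  + intros x Hx. apply (is_derive_opp F1 x (F2 x)); auto.
  + intros x Hx. apply (is_derive_opp F2 x (F3 x)); auto.
  + intros x y z Hx Hy Hz E. have Q := Hpde x y z Hx Hy Hz ltac:(lra). lra.
  + exists kappa, d. split; auto. intros x Hx. destruct (Hk x Hx) as (H1 & H2 & H3). split; auto.
   destruct (X_model_even kappa ((- F1 x0)^2) (F x)) as [E1 E2]. rewrite E1 in H2. rewrite E2 in H3.
   replace ((- F1 x0)^2) with (F1 x0^2) in*by ring. split; lra.
Qed.

(** * Propagation of the model along a connected surface *)

Lemma limit_eq (G : R -> R) (P : R -> Prop) (t : R) :
 continuous G t -> (forall eps, 0 < eps -> exists s, P s /\ Rabs (s-t) < eps) ->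
 (forall s, P s -> G s = 0) -> G t = 0.
Proof.
 intros Hc Hcl Hz. destruct (Req_dec (G t) 0) as [|Hn]; auto. exfalso.
 have Hl : locally t (fun s => G s <> 0) by (apply (Hc (fun y => y <> 0)); apply open_neq; auto).
 destruct Hl as [d Hd]. destruct (Hcl d (cond_pos d)) as (s & Hs & Hst). exact (Hd s Hst (Hz s Hs)).
Qed.

(** A function with nonzero slope is locally open; dividing by [F1 y0] makes the slope positive. *)
Lemma local_values (A : R -> Prop) (F F1 : R -> R) (y0 d : R) :
 open A -> (forall x, A x -> is_derive F x (F1 x)) -> continuous F1 y0 -> A y0 -> F1 y0 <> 0 -> 0 < d ->
 exists e, 0 < e /\ forall v, Rabs (v-F y0) < e -> exists y, Rabs (y-y0) < d /\ F y = v.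
Proof.
 intros HA D1 C Ay0 HF Hd.
 have Hl : locally y0 (fun s => A s /\ 0 < F1 s/F1 y0).
 { apply filter_and; [apply HA; auto|].
  have C' : continuous (fun s => F1 s/F1 y0) y0.
  { cont. }
  apply (C' (fun y => 0 < y)). apply open_gt. unfold Rdiv. rewrite Rinv_r; auto; lra. }
 destruct Hl as [d' Hd'].
 have Hr : 0 < Rmin d d' by (apply Rmin_pos; [auto|apply cond_pos]).
 assert (Rmin d d' <= d) by apply Rmin_l. assert (Rmin d d' <= d') by apply Rmin_r.
 have Hin : forall s, Rabs (s-y0) < Rmin d d' -> A s /\ 0 < F1 s/F1 y0.
 { intros s Hs. apply Hd'. eapply Rlt_le_trans; eauto. }
 destruct (local_inverse (fun s => F s/F1 y0) (fun s => F1 s/F1 y0) y0 (Rmin d d') Hr) as (g & e & He & _ & Hg).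
 - intros s Hs. have B := D1 s (proj1 (Hin s Hs)).
  derive_auto. unfold Rdiv. ring.
 - intros s Hs. apply Hin; auto.
 - assert (0 < Rabs (F1 y0)) by (apply Rabs_pos_lt; auto).
  exists (e*Rabs (F1 y0)). split; [apply Rmult_lt_0_compat; auto|].
  intros v Hv. exists (g (v/F1 y0)). destruct (Hg (v/F1 y0)) as (G1 & G2 & _).
  + replace (v/F1 y0-F y0/F1 y0) with ((v-F y0)/F1 y0) by (field; auto).
   unfold Rdiv. rewrite Rabs_mult, Rabs_inv.
   apply (Rmult_lt_reg_r (Rabs (F1 y0))); auto. rewrite Rmult_assoc, Rinv_l by lra. lra.
  + split; [lra|]. apply (f_equal (fun q => q*F1 y0)) in G2.
   unfold Rdiv in G2. rewrite !Rmult_assoc, Rinv_l, !Rmult_1_r in G2 by auto. exact G2.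
Qed.

(** [Om] is the largest interval around [x0] on which the model equations hold. The surface points
    with all coordinates in [Om] form an open set, and the heart of the proof is that this set is
    also closed in the surface. If a coordinate [t] of a surface point is a limit of [Om], one
    freezes a point [y0] of [Om] with [F y0 = - F t / 2], where the slope is not zero, and lets a
    second point of [Om] absorb the variation of [F] near [t]. Minimality becomes a linear
    differential equation for the defect [F1^2 - X (F)], which vanishes at [t] and therefore around
    it. Connectedness concludes. *)
Lemma propagate_model (A : R -> Prop) (F F1 F2 F3 X X1 X2 : R -> R) (x0 : R) :
 open A -> (forall x, A x -> is_derive F x (F1 x)) -> (forall x, A x -> is_derive F1 x (F2 x)) ->
 (forall x, A x -> is_derive F2 x (F3 x)) ->
 (forall x y z, A x -> A y -> A z -> F x+F y+F z = 0 ->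
  F2 x*(F1 y^2+F1 z^2)+F2 y*(F1 z^2+F1 x^2)+F2 z*(F1 x^2+F1 y^2) = 0) ->
 A x0 -> F x0 = 0 ->
 (exists d, 0 < d /\ forall x, Rabs (x-x0) < d -> A x /\ F1 x^2 = X (F x) /\ 2*F2 x = X1 (F x)) ->
 (forall u, is_derive X u (X1 u)) -> (forall u, is_derive X1 u (X2 u)) ->
 (forall u v w, u+v+w = 0 -> (X v+X w)*X1 u+(X w+X u)*X1 v+(X u+X v)*X1 w = 0) ->
 (forall u, (forall s, 0 <= s <= 1 -> 0 <= X (s*u)) -> 0 < X (- u/2)) ->
 connected (sep_surface A A A F F F) ->
 exists Om : R -> Prop, open Om /\ (forall a b t, Om a -> Om b -> a <= t <= b -> Om t) /\ Om x0 /\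
  (forall t, Om t -> A t /\ F1 t^2 = X (F t) /\ 2*F2 t = X1 (F t)) /\
  (forall x y z, sep_surface A A A F F F (x, y, z) -> Om x /\ Om y /\ Om z).
Proof.
 intros HA D1 D2 D3 Hpde Ax0 F0 (d0 & Hd0 & Hloc) DX DX1 HXX Hhalf Hconn.
 set (eqs := fun t => A t /\ F1 t^2 = X (F t) /\ 2*F2 t = X1 (F t)).
 set (good := fun l r => l < x0 < r /\ forall t, l < t < r -> eqs t).
 set (Om := fun t => exists l r, good l r /\ l < t < r).
 have CF : forall x, A x -> continuous F x by (intros x Hx; apply (is_derive_continuous _ _ _ (D1 x Hx))).
 have CF1 : forall x, A x -> continuous F1 x by (intros x Hx; apply (is_derive_continuous _ _ _ (D2 x Hx))).
 have CF2 : forall x, A x -> continuous F2 x by (intros x Hx; apply (is_derive_continuous _ _ _ (D3 x Hx))).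
 have CX : forall x, continuous X x by (intros x; apply (is_derive_continuous _ _ _ (DX x))).
 have CX1 : forall x, continuous X1 x by (intros x; apply (is_derive_continuous _ _ _ (DX1 x))).
 have Homo : open Om.
 { intros t (l & r & Hg & Ht).
  have H : 0 < Rmin (t-l) (r-t) by (apply Rmin_pos; lra).
  exists (mkposreal _ H). intros s Hs. change (Rabs (s-t) < Rmin (t-l) (r-t)) in Hs.
  exists l, r. split; auto.
  assert (Rmin (t-l) (r-t) <= t-l) by apply Rmin_l. assert (Rmin (t-l) (r-t) <= r-t) by apply Rmin_r.
  apply Rabs_def2 in Hs. lra. }
 have Hconv : forall a b t, Om a -> Om b -> a <= t <= b -> Om t.
 { intros a b t (l & r & Hg & Ha) (l' & r' & Hg' & Hb) Ht.
  destruct (Rle_dec t x0).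
  - exists l, r. split; auto. destruct Hg. lra.
  - exists l', r'. split; auto. destruct Hg'. lra. }
 have Hx0 : Om x0.
 { exists (x0-d0), (x0+d0). split; [|lra]. split; [lra|]. intros t Ht. apply Hloc. apply Rabs_def1; lra. }
 have Hom : forall t, Om t -> eqs t by (intros t (l & r & [_ Hg] & Ht); apply Hg; auto).
 set (cl := fun t => A t /\ forall eps, 0 < eps -> exists s, Om s /\ Rabs (s-t) < eps).
 have Hcleq : forall t, cl t -> eqs t.
 { intros t [At Hcl]. split; auto. split.
  - have E : F1 t^2-X (F t) = 0; [|lra].
   apply (limit_eq (fun t => F1 t^2-X (F t)) Om t); auto.
   + simpl. cont.
   + intros s Hs. destruct (Hom s Hs) as (_ & E & _). lra.
  - have E : 2*F2 t-X1 (F t) = 0; [|lra].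
   apply (limit_eq (fun t => 2*F2 t-X1 (F t)) Om t); auto.
   + cont.
   + intros s Hs. destruct (Hom s Hs) as (_ & _ & E). lra. }
  (* values strictly between two values on the closure are taken on [Om] *)
 have Hivt : forall a b v, cl a -> cl b -> F a < v < F b -> exists y, Om y /\ F y = v.
 { intros a b v [Aa Ha] [Ab Hb] Hv.
  have La : locally a (fun s => F s < v) by (apply (CF a Aa (fun y => y < v)), open_lt; lra).
  have Lb : locally b (fun s => v < F s) by (apply (CF b Ab (fun y => v < y)), open_gt; lra).
  destruct La as [ea Hea]. destruct Lb as [eb Heb].
  destruct (Ha ea (cond_pos ea)) as (a' & Oa & Da). destruct (Hb eb (cond_pos eb)) as (b' & Ob & Db).
  have Va := Hea a' Da. have Vb := Heb b' Db. cbv beta in Va, Vb.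
  have Hbt : forall t, Rmin a' b' <= t <= Rmax a' b' -> Om t.
  { intros t Ht. destruct (Rle_dec a' b').
   - rewrite Rmin_left, Rmax_right in Ht by lra. apply (Hconv a' b'); auto.
   - rewrite Rmin_right, Rmax_left in Ht by lra. apply (Hconv b' a'); auto. }
  destruct (IVT_value F a' b' v) as (y & Hy & Ey).
  - intros t Ht. apply CF, (Hom t), Hbt, Ht.
  - rewrite Rmin_left, Rmax_right; lra.
  - exists y. split; auto. }
 have Hom_cl : forall t, Om t -> cl t.
 { intros t Ht. split; [apply (Hom t Ht)|]. intros eps Heps. exists t. rewrite Rminus_diag, Rabs_R0. auto. }
 (* Every value strictly between [F x0 = 0] and [F t] is taken on [Om], where the model equals a
    square; so the hypothesis on half values applies. *)
 have Hpos : forall t, cl t -> 0 < X (- F t/2).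
 { intros t Ht. apply Hhalf. intros s Hs.
  destruct (Req_dec (F t) 0) as [E|E].
  - rewrite E, Rmult_0_r. destruct (Hom x0 Hx0) as (_ & Q & _). rewrite F0 in Q. rewrite <- Q. apply pow2_ge_0.
  - destruct (Req_dec s 0) as [->|Hs0].
   { rewrite Rmult_0_l. destruct (Hom x0 Hx0) as (_ & Q & _). rewrite F0 in Q. rewrite <- Q. apply pow2_ge_0. }
   destruct (Req_dec s 1) as [->|Hs1].
   { rewrite Rmult_1_l. destruct (Hcleq t Ht) as (_ & Q & _). rewrite <- Q. apply pow2_ge_0. }
   have Hy : exists y, Om y /\ F y = s*F t.
   { destruct (Rlt_dec 0 (F t)).
    - apply (Hivt x0 t); auto. rewrite F0. split; nra.
    - destruct (Hivt t x0 (s*F t)) as (y & Hy & Ey); auto.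
     + rewrite F0. split; nra.
     + exists y; auto. }
   destruct Hy as (y & Hy & <-). destruct (Hom y Hy) as (_ & Q & _). rewrite <- Q. apply pow2_ge_0. }
 (* The three values [F t], [w], [w] have sum zero. For [x] near [t] there is [y] in [Om] with
    [F y = - F x - w], and subtracting the functional equation from minimality at [(x, y, y0)]
    leaves an equation linear in the defect. Its leading coefficient is at least [X w > 0]. *)
 have Hext : forall t y0, cl t -> Om y0 -> F y0 = - F t/2 -> Om t.
 { intros t y0 Ht Hy0 Ey0. set (w := F y0).
  have Hw : 0 < X w by (unfold w; rewrite Ey0; apply Hpos; auto).
  destruct (Hom y0 Hy0) as (Ay0 & Q1 & _). fold w in Q1.
    (* near [y0] the function takes all values near [w] inside [Om] *)
  have Hval : exists e, 0 < e /\ forall v, Rabs (v-w) < e -> exists y, Om y /\ F y = v.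
  { have HF : F1 y0 <> 0 by (intros E; rewrite E in Q1; simpl in Q1; lra).
   destruct (Homo y0 Hy0) as [e1 He1].
   destruct (local_values A F F1 y0 e1 HA D1 (CF1 y0 Ay0) Ay0 HF (cond_pos e1)) as (e & He & Hv).
   exists e. split; auto. intros v Hvw. destruct (Hv v Hvw) as (y & Hy & Ey).
   exists y. split; [apply He1, Hy|auto]. }
  destruct Hval as (e & He & Hval).
  destruct Ht as [At Hcl]. have Et := Hcleq t (conj At Hcl).
  have Hl : locally t (fun x => A x /\ Rabs (F x-F t) < e).
  { apply filter_and; [apply HA; auto|]. apply (CF t At (fun y => Rabs (y-F t) < e)).
   exists (mkposreal e He). intros y Hy. exact Hy. }
  destruct Hl as [d Hd].
  set (h := d/2). have Hh : 0 < h < d by (unfold h; have P := cond_pos d; lra).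
  have Hn : forall x, t-h <= x <= t+h -> A x /\ Rabs (F x-F t) < e.
  { intros x Hx. apply Hd. change (Rabs (x-t) < d). apply Rabs_def1; lra. }
    (* linear equation for [Q = F'^2 - X(F)] *)
  have Hlin : forall x, t-h <= x <= t+h -> exists v, v = - F x-w /\ 0 <= X v /\
   (2*F2 x-X1 (F x))*(X v+X w)+(F1 x^2-X (F x))*(X1 v+X1 w) = 0.
  { intros x Hx. destruct (Hn x Hx) as [Ax Vx].
   destruct (Hval (- F x-w)) as (y & Oy & Ey).
   { unfold w in *. rewrite Ey0. replace (- F x - - F t/2 - - F t/2) with (- (F x-F t)) by field.
    rewrite Rabs_Ropp. auto. }
   destruct (Hom y Oy) as (Ay & E1 & E2). destruct (Hom y0 Hy0) as (_ & E1' & E2'). fold w in E1', E2'.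
   exists (- F x-w). split; auto. rewrite <- Ey. split; [rewrite <- E1; apply pow2_ge_0|].
   have P := Hpde x y y0 Ax Ay Ay0 ltac:(rewrite Ey; unfold w; ring).
   have P' := HXX (F x) (F y) w ltac:(rewrite Ey; ring).
   rewrite E1, E1' in P.
   replace (F2 y) with (X1 (F y)/2) in P by lra. replace (F2 y0) with (X1 w/2) in P by lra. lra. }
  have HM : exists M, 0 <= M /\ forall x, t-h <= x <= t+h -> Rabs (F1 x*(X1 (- F x-w)+X1 w)) <= M.
  { apply bounded_on_segment. intros x Hx. destruct (Hn x Hx) as [Ax _].
   cont. }
  destruct HM as (M & HM0 & HM).
  have HQ : forall x, t-h <= x <= t+h -> (F1 x^2-X (F x))^2 = 0.
  { apply (gronwall (fun x => (F1 x^2-X (F x))^2)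
    (fun x => 2*(F1 x^2-X (F x))*(F1 x*(2*F2 x-X1 (F x)))) (t-h) (t+h) t (2*M/X w)).
   - lra.
   - intros x Hx. destruct (Hn x Hx) as [Ax _]. have B1 := D1 x Ax. have B2 := D2 x Ax. have B3 := DX (F x).
    derive_auto. ring.
   - intros; apply pow2_ge_0.
   - intros x Hx. destruct (Hlin x Hx) as (v & Ev & Hv & L). specialize (HM x Hx). rewrite <- Ev in HM.
    set (Q := F1 x^2-X (F x)) in *.
    replace (2*F2 x-X1 (F x)) with (- (Q*(X1 v+X1 w))/(X v+X w)).
    2:{ apply (Rmult_eq_reg_r (X v+X w)); [|lra]. unfold Rdiv. rewrite Rmult_assoc, Rinv_l by lra. lra. }
    replace (2*Q*(F1 x*(- (Q*(X1 v+X1 w))/(X v+X w)))) with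
     (- (Q^2*(2*(F1 x*(X1 v+X1 w))) * / (X v+X w))) by (field; lra).
    rewrite Rabs_Ropp, !Rabs_mult.
    rewrite (Rabs_pos_eq (Q^2)) by apply pow2_ge_0. rewrite (Rabs_pos_eq 2) by lra.
    rewrite (Rabs_pos_eq (/ (X v+X w))) by (left; apply Rinv_0_lt_compat; lra).
    rewrite Rabs_mult in HM.
    assert (/ (X v+X w) <= / X w) by (apply Rinv_le_contravar; lra).
    assert (0 < / (X v+X w)) by (apply Rinv_0_lt_compat; lra).
    assert (0 <= Q^2) by apply pow2_ge_0.
    unfold Rdiv. replace (2*M * / X w*Q^2) with (Q^2*(2*M) * / X w) by ring.
    apply Rmult_le_compat; try lra.
    + apply Rmult_le_pos; [auto|]. apply Rmult_le_pos; [lra|]. apply Rmult_le_pos; apply Rabs_pos.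
    + apply Rmult_le_compat_l; lra.
   - destruct Et as (_ & E & _). rewrite E. ring. }
  have Hall : forall x, t-h <= x <= t+h -> eqs x.
  { intros x Hx. destruct (Hn x Hx) as [Ax _]. specialize (HQ x Hx).
   have Q0 : F1 x^2-X (F x) = 0 by nra.
   split; auto. split; [lra|]. destruct (Hlin x Hx) as (v & _ & Hv & L). rewrite Q0, Rmult_0_l, Rplus_0_r in L.
   apply Rmult_integral in L. destruct L; lra. }
  destruct (Hcl h) as (s & (l & r & [Hg1 Hg2] & Hs) & Hst); [lra|]. apply Rabs_def2 in Hst.
  exists (Rmin l (t-h)), (Rmax r (t+h)).
  assert (Rmin l (t-h) <= l) by apply Rmin_l. assert (Rmin l (t-h) <= t-h) by apply Rmin_r.
  assert (r <= Rmax r (t+h)) by apply Rmax_l. assert (t+h <= Rmax r (t+h)) by apply Rmax_r.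
  split; [|lra]. split; [lra|]. intros x Hx.
  destruct (Rlt_dec (t-h) x) as [X1'|X1']; [destruct (Rlt_dec x (t+h)) as [X2'|X2']|].
  - apply Hall; lra.
  - apply Hg2. split; [lra|]. unfold Rmax in Hx. destruct (Rle_dec r (t+h)); lra.
  - apply Hg2. split; [|lra]. unfold Rmin in Hx. destruct (Rle_dec l (t-h)); lra. }
 (* [- F x / 2] is the mean of [F y] and [F z]. If these differ it is taken on [Om] between them. If
    they agree, then [F y] is this value, but [y] is only a limit of [Om]; [y] is first moved into
    [Om] using a point with value [F x / 4]. *)
 have Hone : forall x y z, cl x -> cl y -> cl z -> F x+F y+F z = 0 -> Om x.
 { intros x y z Cx Cy Cz E.
  have Hmid : forall a b v, cl a -> cl b -> (F a < v < F b \/ F b < v < F a) -> exists y, Om y /\ F y = v.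
  { intros a b v Ca Cb [H|H]; [apply (Hivt a b)|apply (Hivt b a)]; auto. }
  destruct (Req_dec (F y) (F z)) as [Eyz|Nyz].
  - destruct (Req_dec (F x) 0) as [Ex|Nx].
   + apply (Hext x x0); auto. rewrite F0, Ex. field.
   + have Oy : Om y.
    { destruct (Hmid x0 x (F x/4)) as (y1 & O1 & E1); auto.
     - rewrite F0. destruct (Rlt_dec 0 (F x)); [left|right]; lra.
     - apply (Hext y y1); auto. lra. }
    apply (Hext x y); auto. lra.
  - destruct (Hmid y z (- F x/2)) as (y1 & O1 & E1); auto.
   + destruct (Rlt_dec (F y) (F z)); [left|right]; lra.
   + apply (Hext x y1); auto. }
 set (U := fun p : R3 => let '(x, y, z) := p in Om x /\ Om y /\ Om z).
 (* [V] is the interior of the complement of [U]. A surface point outside [V] has all coordinates in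
    the closure of [Om], so [Hone] puts it into [U]. *)
 set (V := fun p : R3 => locally p (fun q => ~ U q)).
 have HU : open U.
 { intros [[x y] z] (Ox & Oy & Oz).
  destruct (Homo x Ox) as [ex Hx]. destruct (Homo y Oy) as [ey Hy]. destruct (Homo z Oz) as [ez Hz].
  have He : 0 < Rmin ex (Rmin ey ez) by (repeat apply Rmin_pos; apply cond_pos).
  exists (mkposreal _ He). intros [[x' y'] z'] [[Bx By] Bz]. simpl in *.
  assert (Rmin ex (Rmin ey ez) <= ex) by apply Rmin_l.
  assert (Rmin ex (Rmin ey ez) <= ey) by (eapply Rle_trans; [apply Rmin_r|apply Rmin_l]).
  assert (Rmin ex (Rmin ey ez) <= ez) by (eapply Rle_trans; [apply Rmin_r|apply Rmin_r]).
  repeat split; [apply Hx|apply Hy|apply Hz]; eapply ball_le; eauto. }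
 have HV : open V by (intros p Hp; apply locally_locally; exact Hp).
 have Hcov : forall p, sep_surface A A A F F F p -> U p \/ V p.
 { intros [[x y] z] (Ax & Ay & Az & E). unfold sep_fun in E.
  destruct (classic (V (x, y, z))) as [|HnV]; auto. left.
  have Hcl : cl x /\ cl y /\ cl z.
  { have Hnear : forall eps, 0 < eps -> exists x' y' z', (Om x' /\ Om y' /\ Om z') /\
    Rabs (x'-x) < eps /\ Rabs (y'-y) < eps /\ Rabs (z'-z) < eps.
   { intros eps Heps. apply NNPP. intros Hno. apply HnV. exists (mkposreal eps Heps).
    intros [[x' y'] z'] [[Bx By] Bz] HUq. apply Hno. exists x', y', z'. split; auto. }
   repeat split; auto; intros eps Heps; destruct (Hnear eps Heps) as (x' & y' & z' & (O1 & O2 & O3) & B1 & B2 & B3).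
   - exists x'; auto.
   - exists y'; auto.
   - exists z'; auto. }
  destruct Hcl as (Cx & Cy & Cz).
  repeat split; [apply (Hone x y z)|apply (Hone y z x)|apply (Hone z x y)]; auto; lra. }
 have Hdis : forall p, sep_surface A A A F F F p -> ~ (U p /\ V p).
 { intros p _ [H1 H2]. apply locally_singleton in H2. auto. }
 exists Om. split; auto. split; auto. split; auto. split; auto.
 destruct (Hconn U V HU HV Hcov Hdis) as [H|H].
 - intros x y z Hp. apply (H (x, y, z) Hp).
 - exfalso. have Hp : sep_surface A A A F F F (x0, x0, x0).
  { repeat split; auto. unfold sep_fun. lra. }
  specialize (H _ Hp). apply locally_singleton in H. apply H. repeat split; auto.
Qed.

Lemma connected_ext (S S' : R3 -> Prop) : (forall p, S p <-> S' p) -> connected S -> connected S'.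
Proof.
 intros E H U V HU HV Hc Hd. destruct (H U V HU HV).
 - intros p Hp. apply Hc, E, Hp.
 - intros p Hp. apply Hd, E, Hp.
 - left. intros p Hp. apply H0, E, Hp.
 - right. intros p Hp. apply H0, E, Hp.
Qed.

(** Without a zero, the sign of [F] at the first coordinate would be constant on the connected
    surface. Cyclic permutations preserve the surface, so all three values at a point would have
    that sign and could not have sum zero. *)
Lemma zero_of_connected (A : R -> Prop) (F : R -> R) :
 open A -> (forall x, A x -> continuous F x) -> connected (sep_surface A A A F F F) ->
 (exists p, sep_surface A A A F F F p) -> exists x0, A x0 /\ F x0 = 0.
Proof.
 intros HA HF Hc [[[x y] z] (Hx & Hy & Hz & E)]. unfold sep_fun in E.
 apply NNPP. intros Hno.
 have Hsgn : forall P : R -> Prop, open P -> open (fun p : R3 => A (fst (fst p)) /\ P (F (fst (fst p)))).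
 { intros P HP [[a b] c] [Ha Hpa]. simpl in *.
  have L : locally a (fun s => A s /\ P (F s)) by (apply filter_and; [auto|apply (HF a Ha P), HP, Hpa]).
  destruct L as [e He]. exists e. intros [[a' b'] c'] [[Ba _] _]. apply He. exact Ba. }
 destruct (Hc _ _ (Hsgn _ (open_lt 0)) (Hsgn _ (open_gt 0))) as [H|H].
 - intros [[a b] c] (Ha & _). simpl. destruct (Rtotal_order (F a) 0) as [?|[?|?]]; auto.
  exfalso. apply Hno. exists a; auto.
 - intros [[a b] c] _. simpl. lra.
 - have H1 := H (x, y, z). have H2 := H (y, z, x). have H3 := H (z, x, y). simpl in *.
  unfold sep_fun in *.
  destruct H1 as [_ H1]; [repeat split; auto; lra|]. destruct H2 as [_ H2]; [repeat split; auto; lra|].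
  destruct H3 as [_ H3]; [repeat split; auto; lra|]. lra.
 - have H1 := H (x, y, z). have H2 := H (y, z, x). have H3 := H (z, x, y). simpl in *.
  unfold sep_fun in *.
  destruct H1 as [_ H1]; [repeat split; auto; lra|]. destruct H2 as [_ H2]; [repeat split; auto; lra|].
  destruct H3 as [_ H3]; [repeat split; auto; lra|]. lra.
Qed.

Lemma third_order_X_model (kappa a s u : R) : third_order (fun v => X_model kappa a (v+s)) kappa u.
Proof.
 have Hsh : forall (f : R -> R) (v l : R), is_derive f (v+s) l -> is_derive (fun v => f (v+s)) v l.
 { intros f v l H. eapply is_derive_eq.
  - apply (is_derive_comp f (fun t => t+s)); [exact H|].
   apply (is_derive_plus (fun t : R => t) (fun _ => s));
     [apply (is_derive_id (K := R_AbsRing))|apply (is_derive_const (K := R_AbsRing))].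
  - unfold scal, plus, one, zero; simpl; unfold mult; simpl. ring. }
 apply (third_order_of_derive _ (fun v => X_model1 kappa a (v+s))
  (fun v => kappa*(X_model kappa a (v+s)-a/3)) (kappa*X_model1 kappa a (u+s))); auto.
 - intros v. apply (Hsh (X_model kappa a)), X_model_derive.
 - intros v. apply (Hsh (X_model1 kappa a)), X_model_derive.
 - apply (Hsh (fun v => kappa*(X_model kappa a v-a/3))).
  have D := proj1 (X_model_derive kappa a (u+s)).
  derive_auto. ring.
Qed.

(** Everything the classification needs to know about an isotropic example, expressed through
    [F = f + s] with [3 s = c + c']. *)
Lemma isotropic_structure (A B C : R -> Prop) (f g h : R -> R) :
 isotropic_example A B C f g h ->
 exists (c c' : R) (F F1 F2 : R -> R) (x0 kappa : R) (Om : R -> Prop),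
  (forall t, A t -> F t = f t+(c+c')/3 /\ F t = g t-c+(c+c')/3 /\ F t = h t-c'+(c+c')/3) /\
  (forall t, (A t <-> B t) /\ (A t <-> C t)) /\
  (forall t, A t -> is_derive f t (F1 t) /\ is_derive g t (F1 t) /\ is_derive h t (F1 t) /\
    is_derive F t (F1 t) /\ is_derive F1 t (F2 t)) /\
  open A /\ open Om /\ (forall a b t, Om a -> Om b -> a <= t <= b -> Om t) /\ Om x0 /\ F x0 = 0 /\ F1 x0 <> 0 /\
  (forall t, Om t -> A t /\ F1 t^2 = X_model kappa (F1 x0^2) (F t) /\
           2*F2 t = X_model1 kappa (F1 x0^2) (F t)) /\
  (forall x y z, sep_surface A B C f g h (x, y, z) <-> A x /\ A y /\ A z /\ F x+F y+F z = 0) /\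
  (forall x y z, A x -> A y -> A z -> F x+F y+F z = 0 -> Om x /\ Om y /\ Om z).
Proof.
 intros ((HA & HB & HC & Sf & Sg & Sh & Hmin) & [Hdom (c & c' & Hgh)] & Hconn & Hnp).
 set (s := (c+c')/3). set (F := fun t => f t+s).
 set (F1 := Derive_n f 1). set (F2 := Derive_n f 2). set (F3 := Derive_n f 3).
 have D0 : forall t, A t -> is_derive f t (F1 t) by (intros t Ht; apply Derive_correct, (Sf t 1%nat Ht)).
 have D2 : forall t, A t -> is_derive F1 t (F2 t) by (intros t Ht; apply Derive_correct, (Sf t 2%nat Ht)).
 have D3 : forall t, A t -> is_derive F2 t (F3 t) by (intros t Ht; apply Derive_correct, (Sf t 3%nat Ht)).
 have D1 : forall t, A t -> is_derive F t (F1 t).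
 { intros t Ht. have H := D0 t Ht. unfold F. derive_auto. ring. }
 have Dsh : forall k (w : R -> R), (forall t, A t -> w t = f t+k) -> forall t, A t -> is_derive w t (F1 t).
 { intros k w Hw t Ht. apply (is_derive_ext_loc (fun t => f t+k)).
  - apply (filter_imp A); [intros; symmetry; auto|apply HA, Ht].
  - have H := D0 t Ht. derive_auto. ring. }
 have Dg : forall t, A t -> is_derive g t (F1 t) by (apply (Dsh c); intros; apply Hgh; auto).
 have Dh : forall t, A t -> is_derive h t (F1 t) by (apply (Dsh c'); intros; apply Hgh; auto).
 have D2' : forall w, (forall t, A t -> is_derive w t (F1 t)) -> forall t, A t -> is_derive (Derive w) t (F2 t).
 { intros w Hw t Ht. apply (is_derive_ext_loc F1); [|apply D2, Ht].
  apply (filter_imp A); [|apply HA, Ht]. intros; symmetry; apply is_derive_unique, Hw; auto. }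
 have HS : forall x y z, sep_surface A B C f g h (x, y, z) <-> A x /\ A y /\ A z /\ F x+F y+F z = 0.
 { intros x y z. unfold sep_surface, sep_fun. rewrite <- (proj1 (Hdom y)), <- (proj2 (Hdom z)).
  split; intros (Hx & Hy & Hz & E); repeat split; auto;
   destruct (Hgh y Hy) as [Gy _]; destruct (Hgh z Hz) as [_ Hz']; unfold F, s in *; lra. }
 have Hpde : forall x y z, A x -> A y -> A z -> F x+F y+F z = 0 -> (F1 x, F1 y, F1 z) <> (0, 0, 0) /\
  F2 x*(F1 y^2+F1 z^2)+F2 y*(F1 z^2+F1 x^2)+F2 z*(F1 x^2+F1 y^2) = 0.
 { intros x y z Hx Hy Hz E. destruct (Hmin (x, y, z)) as [Hg Hm]; [apply HS; auto|].
  rewrite grad_sep in Hg.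
  have E1 := is_derive_unique _ _ _ (D0 x Hx). have E2 := is_derive_unique _ _ _ (Dg y Hy).
  have E3 := is_derive_unique _ _ _ (Dh z Hz).
  apply (mean_curvature_sep f g h x y z _ _ _ (D2' f D0 x Hx) (D2' g Dg y Hy) (D2' h Dh z Hz) Hg) in Hm.
  rewrite E1, E2, E3 in Hg, Hm. auto. }
 have Hconn' : connected (sep_surface A A A F F F).
 { apply (connected_ext (sep_surface A B C f g h)); auto.
  intros [[x y] z]. rewrite HS. unfold sep_surface, sep_fun. tauto. }
 destruct (zero_of_connected A F HA) as (x0 & Ax0 & F0); auto.
 { intros x Hx. apply (is_derive_continuous _ _ _ (D1 x Hx)). }
 { apply NNPP. intros Hno. apply Hnp. exists (1, 0, 0), 0. split.
  - intros H. injection H. lra.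
  - intros [[x y] z] Hp. exfalso. apply Hno. exists (x, y, z). apply HS in Hp. exact Hp. }
 have Hx0 : F1 x0 <> 0.
 { intros E. destruct (Hpde x0 x0 x0) as [H _]; auto; [lra|]. apply H. rewrite E. auto. }
 destruct (local_model A F F1 F2 F3 x0) as (kappa & d & Hd & Hloc); auto.
 { intros; apply Hpde; auto. }
 have Ha : 0 < F1 x0^2 by (apply pow2_gt_0; auto).
 destruct (propagate_model A F F1 F2 F3 (X_model kappa (F1 x0^2)) (X_model1 kappa (F1 x0^2))
  (fun u => kappa*(X_model kappa (F1 x0^2) u-F1 x0^2/3)) x0) as (Om & O1 & O2 & O3 & O4 & O5); auto.
 { intros; apply Hpde; auto. }
 { exists d; auto. }
 { intros; apply X_model_derive. }
 { intros; apply X_model_derive. }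
 { intros; apply X_model_addition; auto. }
 { intros u Hu. apply X_model_half_pos; auto. }
 exists c, c', F, F1, F2, x0, kappa, Om.
 split. { intros t Ht. destruct (Hgh t Ht). unfold F, s. lra. }
 split; [exact Hdom|].
 split. { intros t Ht. split; [auto|]. split; [auto|]. split; [auto|]. split; auto. }
 repeat (split; [solve [auto]|]).
 intros x y z Hx Hy Hz E. apply O5. repeat split; auto.
Qed.

(** * Similarities and the identification of the separating functions *)

Lemma plus_R3 (a b c a' b' c' : R) :
 plus ((a, b, c) : R3) (a', b', c') = (a+a', b+b', c+c').
Proof. reflexivity. Qed.

Lemma scal_R3 (k a b c : R) : scal k ((a, b, c) : R3) = (k*a, k*b, k*c).
Proof. reflexivity. Qed.

Lemma similarity_scale (r b : R) : 0 < r ->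
 similarity (fun p => let '(x, y, z) := p in (r*x+b, r*y+b, r*z+b)).
Proof.
 intros Hr. exists r, (b, b, b), (1, 0, 0), (0, 1, 0), (0, 0, 1).
 split; auto. unfold dot, cross. repeat split; try ring.
 - f_equal; [f_equal|]; ring.
 - intros x y z. rewrite !scal_R3, !plus_R3, scal_R3, plus_R3.
  f_equal; [f_equal|]; ring.
Qed.

Lemma open_cube (P : R -> Prop) : open P -> open (fun p : R3 => let '(x, y, z) := p in P x /\ P y /\ P z).
Proof.
 intros HP [[x y] z] (Hx & Hy & Hz).
 destruct (HP x Hx) as [ex Ex]. destruct (HP y Hy) as [ey Ey]. destruct (HP z Hz) as [ez Ez].
 have He : 0 < Rmin ex (Rmin ey ez) by (repeat apply Rmin_pos; apply cond_pos).
 exists (mkposreal _ He). intros [[x' y'] z'] [[Bx By] Bz]. simpl in *.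
 assert (Rmin ex (Rmin ey ez) <= ex) by apply Rmin_l.
 assert (Rmin ex (Rmin ey ez) <= ey) by (eapply Rle_trans; [apply Rmin_r|apply Rmin_l]).
 assert (Rmin ex (Rmin ey ez) <= ez) by (eapply Rle_trans; [apply Rmin_r|apply Rmin_r]).
 repeat split; [apply Ex|apply Ey|apply Ez]; eapply ball_le; eauto.
Qed.

(** All coordinates on the surface lie in [Om], so the open cube over [Om] cuts the piece out of the
    model surface; the factor [k] does not change the zero set. *)
Lemma piece_of_conjugacy (A B C Om dom : R -> Prop) (f g h F phi : R -> R) (r b k : R) :
 0 < r -> k <> 0 -> open Om -> (forall t, Om t -> A t) ->
 (forall x y z, sep_surface A B C f g h (x, y, z) <-> A x /\ A y /\ A z /\ F x+F y+F z = 0) ->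
 (forall x y z, A x -> A y -> A z -> F x+F y+F z = 0 -> Om x /\ Om y /\ Om z) ->
 (forall t, Om t -> dom (r*t+b) /\ phi (r*t+b) = k*F t) ->
 similar_to_piece (sep_surface A B C f g h) (sep_surface dom dom dom phi phi phi).
Proof.
 intros Hr Hk HO OA HS HOm Hphi.
 exists (fun p => let '(x, y, z) := p in (r*x+b, r*y+b, r*z+b)),
  (fun p => let '(x, y, z) := p in Om x /\ Om y /\ Om z).
 split; [apply similarity_scale; auto|]. split; [apply open_cube; auto|].
 intros [[x y] z]. rewrite HS. unfold sep_surface, sep_fun. split.
 - intros (Ax & Ay & Az & E). destruct (HOm x y z Ax Ay Az E) as (Ox & Oy & Oz).
  destruct (Hphi x Ox) as [? ->], (Hphi y Oy) as [? ->], (Hphi z Oz) as [? ->].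
  repeat split; auto. replace (k*F x+k*F y+k*F z) with (k*(F x+F y+F z)) by ring. rewrite E. ring.
 - intros ((Ox & Oy & Oz) & _ & _ & _ & E).
  destruct (Hphi x Ox) as [? Ex], (Hphi y Oy) as [? Ey], (Hphi z Oz) as [? Ez]. rewrite Ex, Ey, Ez in E.
  repeat split; auto. have E' : k*(F x+F y+F z) = 0 by lra.
  apply Rmult_integral in E'. tauto.
Qed.

Lemma sin2_lipschitz (u v : R) : Rabs (- 2*sin (2*u) - - 2*sin (2*v)) <= 4*Rabs (u-v).
Proof.
 destruct (MVT_gen (fun t => - 2*sin (2*t)) v u (fun t => - 4*cos (2*t))) as [c [_ ->]].
 - intros t _. auto_derive; auto. ring.
 - intros t _. apply continuity_pt_filterlim.
  apply (is_derive_continuous (fun t => - 2*sin (2*t)) t (- 4*cos (2*t))). auto_derive; auto. ring.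
 - rewrite Rabs_mult. apply Rmult_le_compat_r; [apply Rabs_pos|].
  have H := COS_bound (2*c). apply Rabs_le. lra.
Qed.

(** Separation of variables: the slope has no zero, hence a constant sign [s], and the inverse of
    [etaD] applied to [s lam F] has constant derivative [r]. *)
Lemma conjugacy_D (Om : R -> Prop) (F F1 : R -> R) (x0 lam r : R) :
 0 < lam -> 0 < r -> (forall a b t, Om a -> Om b -> a <= t <= b -> Om t) -> Om x0 -> F x0 = 0 ->
 (forall t, Om t -> is_derive F t (F1 t) /\ continuous F1 t) ->
 (forall t, Om t -> lam^2*F1 t^2 = r^2*(1+2*cosh (2*(lam*F t)))) ->
 exists b k, k <> 0 /\ forall t, Om t -> domD (r*t+b) /\ phiD (r*t+b) = k*F t.
Proof.
 intros Hl Hr Hconv Ox0 F0 HD HX.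
 destruct (etaD_inverse 0) as [psi [Hpsi _]].
 have Hne : forall t, Om t -> F1 t <> 0.
 { intros t Ht E. specialize (HX t Ht). rewrite E in HX. have H := cosh_ge1 (2*(lam*F t)).
  assert (0 < r^2) by (apply pow2_gt_0; lra). nra. }
 set (s := if Rlt_dec 0 (F1 x0) then 1 else -1).
 have Hs : s = 1 \/ s = -1 by (unfold s; destruct (Rlt_dec 0 (F1 x0)); auto).
 have Hseg : forall a b t, Om a -> Om b -> Rmin a b <= t <= Rmax a b -> Om t.
 { intros a b t Ha Hb Ht. destruct (Rle_dec a b).
  - rewrite Rmin_left, Rmax_right in Ht by lra. apply (Hconv a b); auto.
  - rewrite Rmin_right, Rmax_left in Ht by lra. apply (Hconv b a); auto. }
 have Hsg : forall t, Om t -> 0 < s*F1 t.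
 { intros t Ht. destruct (Rlt_dec 0 (s*F1 t)) as [|Hn]; auto. exfalso.
  have H0 : 0 < s*F1 x0 by (unfold s; destruct (Rlt_dec 0 (F1 x0)); [lra|]; have H := Hne x0 Ox0; lra).
  destruct (IVT_value (fun t => s*F1 t) x0 t 0) as (y & Hy & Ey).
  - intros z Hz. apply (continuous_mult (fun _ => s) F1); [apply continuous_const|apply HD, (Hseg x0 t); auto].
  - rewrite Rmin_right, Rmax_left; lra.
  - have Oy : Om y by (apply (Hseg x0 t); auto). apply Rmult_integral in Ey.
   destruct Ey as [E|E]; [lra|]. exact (Hne y Oy E). }
 set (q := fun t => psi (s*lam*F t)).
 have Dq : forall t, Om t -> is_derive q t r.
 { intros t Ht. destruct (Hpsi (s*lam*F t)) as (Hc & He & Hd). destruct (HD t Ht) as [Hf _].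
  set (e := etaD1 (psi (s*lam*F t))) in *.
  have Ee : e^2 = 1+2*cosh (2*(lam*F t)).
  { unfold e. rewrite etaD1_sq by (apply (cell_sD 0); auto). rewrite He. do 2 f_equal.
   destruct Hs as [-> | ->].
   - f_equal. ring.
   - rewrite <- cosh_neg. f_equal. ring. }
  have Hep : 0 < e.
  { unfold e, etaD1. apply Rdiv_lt_0_compat; [have H := vD_pos (psi (s*lam*F t)); lra|].
   apply domD_iff. apply (cell_even_domD 0); auto. }
  have E : lam*(s*F1 t) = r*e.
  { have P1 : 0 < lam*(s*F1 t) by (apply Rmult_lt_0_compat; auto).
   have P2 : 0 < r*e by (apply Rmult_lt_0_compat; auto).
   have Q : (lam*(s*F1 t))^2 = (r*e)^2.
   { replace ((r*e)^2) with (r^2*e^2) by ring. rewrite Ee, <- HX by auto.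
    destruct Hs as [-> | ->]; ring. }
   nra. }
  unfold q. eapply is_derive_eq.
  - apply (is_derive_comp psi (fun t => s*lam*F t)); [exact Hd|]. apply (is_derive_scal F). exact Hf.
  - unfold scal; simpl; unfold mult; simpl. fold e.
   replace (s*lam*F1 t) with (r*e) by lra. field. lra. }
 exists (psi 0-r*x0), (s*lam). split; [destruct Hs as [-> | ->]; lra|].
 intros t Ht.
 have E : q t = r*t+(psi 0-r*x0).
 { have Hc : q t-r*t = q x0-r*x0.
  { have Dc : forall y, Om y -> is_derive (fun t => q t-r*t) y 0.
   { intros y Hy. have B := Dq y Hy. derive_auto. ring. }
   destruct (Rle_dec t x0).
   - apply (constant_of_derive (fun t => q t-r*t)); auto. intros y Hy. apply Dc, (Hconv t x0); auto.
   - symmetry. apply (constant_of_derive (fun t => q t-r*t)); try lra. intros y Hy. apply Dc, (Hconv x0 t); auto. }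
  unfold q at 2 in Hc. rewrite F0, Rmult_0_r in Hc. lra. }
 rewrite <- E. destruct (Hpsi (s*lam*F t)) as (Hc & He & _).
 have Hdom : domD (q t) by (apply (cell_even_domD 0); auto).
 split; auto. rewrite phiD_eta by auto. exact He.
Qed.

(** Here the slope may vanish, so the second-order equation is used. Initial data are matched at a
    zero [t0] of [phiP], where both slopes squared are 3 after scaling; the sign [s] makes the
    slopes equal. *)
Lemma conjugacy_P (Om : R -> Prop) (F F1 F2 : R -> R) (x0 lam r : R) :
 0 < lam -> 0 < r -> (forall a b t, Om a -> Om b -> a <= t <= b -> Om t) -> Om x0 -> F x0 = 0 ->
 (forall t, Om t -> is_derive F t (F1 t) /\ is_derive F1 t (F2 t)) ->
 lam^2*F1 x0^2 = 3*r^2 ->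
 (forall t, Om t -> lam*F2 t = - 2*r^2*sin (2*(lam*F t))) ->
 exists b k, k <> 0 /\ forall t, Om t -> phiP (r*t+b) = k*F t.
Proof.
 intros Hl Hr Hconv Ox0 F0 HD Hx0 HX. have HPI := PI_RGT_0.
 destruct (branchP_spec 0 0) as [E0 _]; [lra|]. set (t0 := branchP 0 0) in *.
 have Q0 := phiP1_sq t0. rewrite E0, Rmult_0_r, cos_0 in Q0.
 have Hs : exists s, (s = 1 \/ s = -1) /\ s*lam*F1 x0/r = phiP1 t0.
 { have H : (lam*F1 x0/r-phiP1 t0)*(lam*F1 x0/r+phiP1 t0) = 0.
  { replace ((lam*F1 x0/r-phiP1 t0)*(lam*F1 x0/r+phiP1 t0))
    with (lam^2*F1 x0^2/r^2-phiP1 t0^2) by (field; lra).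
   rewrite Hx0, Q0. field. lra. }
  apply Rmult_integral in H. destruct H as [H|H].
  - exists 1. split; auto. rewrite Rmult_1_l. lra.
  - exists (-1). split; auto. replace (-1*lam*F1 x0/r) with (- (lam*F1 x0/r)) by (field; lra). lra. }
 destruct Hs as (s & Hs & Es).
 exists (t0-r*x0), (s*lam). split; [destruct Hs as [-> | ->]; lra|].
 intros t Ht.
 have Hin : forall y, Rmin t x0 <= y <= Rmax t x0 -> Om y.
 { intros y Hy. destruct (Rle_dec t x0).
  - rewrite Rmin_left, Rmax_right in Hy by lra. apply (Hconv t x0); auto.
  - rewrite Rmin_right, Rmax_left in Hy by lra. apply (Hconv x0 t); auto. }
 destruct (second_order_unique (fun u => - 2*sin (2*u)) 4 (fun _ => r)
  (fun y => phiP (r*y+(t0-r*x0))) (fun y => phiP1 (r*y+(t0-r*x0)))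
  (fun y => s*lam*F y) (fun y => s*lam*F1 y/r) (Rmin t x0) (Rmax t x0) x0) with (t := t) as [H _]; auto.
 - split; [apply Rmin_r|apply Rmax_r].
 - intros; apply continuous_const.
 - intros y _. have B := is_derive_phiP (r*y+(t0-r*x0)). unfold Rminus in *.
  derive_auto. ring.
 - intros y _. have B := is_derive_phiP1 (r*y+(t0-r*x0)). unfold Rminus in *.
  derive_auto. ring.
 - intros y Hy. destruct (HD y (Hin y Hy)) as [B _].
  derive_auto. field. lra.
 - intros y Hy. destruct (HD y (Hin y Hy)) as [_ B].
  derive_auto. have E := HX y (Hin y Hy).
  replace (s*lam*(1*F2 y) * / r) with (s*(lam*F2 y)/r) by (field; lra). rewrite E.
  destruct Hs as [-> | ->].
  + replace (2*(1*lam*F y)) with (2*(lam*F y)) by ring. field. lra.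
  + replace (2*(-1*lam*F y)) with (- (2*(lam*F y))) by ring. rewrite sin_neg. field. lra.
 - intros; apply sin2_lipschitz.
 - replace (r*x0+(t0-r*x0)) with t0 by ring. rewrite E0, F0. ring.
 - replace (r*x0+(t0-r*x0)) with t0 by ring. auto.
 - split; [apply Rmin_l|apply Rmax_l].
Qed.

Lemma classification (A B C : R -> Prop) (f g h : R -> R) :
 isotropic_example A B C f g h ->
 (exists kappa, separation_constant A B C f g h kappa) /\
 forall kappa, separation_constant A B C f g h kappa ->
  kappa <> 0 /\
  (0 < kappa -> normalizes_to X_pos A B C f g h /\ similar_to_piece (sep_surface A B C f g h) surfaceD) /\
  (kappa < 0 -> normalizes_to X_neg A B C f g h /\ similar_to_piece (sep_surface A B C f g h) surfaceP).
Proof.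
 intros Hex. have Hnp : nonplanar (sep_surface A B C f g h) by apply Hex.
 destruct (isotropic_structure A B C f g h Hex)
  as (c & c' & F & F1 & F2 & x0 & k0 & Om & HF & Hdom & HD & HA & HO & Hconv & Ox0 & F0 & Hx0 & Hom & HS & HOm).
 set (s := (c+c')/3) in *. set (a := F1 x0^2) in *.
 have Ha : 0 < a by (apply pow2_gt_0; auto).
 have Hin : forall x y z, sep_surface A B C f g h (x, y, z) -> Om x /\ Om y /\ Om z.
 { intros x y z Hp. apply HS in Hp. destruct Hp as (Hx & Hy & Hz & E). apply (HOm x y z Hx Hy Hz E). }
 have Hf : forall t, A t -> Derive f t = F1 t /\ Derive g t = F1 t /\ Derive h t = F1 t.
 { intros t Ht. destruct (HD t Ht) as (E1 & E2 & E3 & _). repeat split; apply is_derive_unique; auto. }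
 (* For [k0 = 0] the second derivative of [F] vanishes on [Om]; [F] is affine there and the surface
    lies in [x + y + z = 3 x0]. *)
 have Hk0 : k0 <> 0.
 { intros Hk. have HX1 : forall u, X_model1 k0 a u = 0.
  { intros u. unfold X_model1. destruct (Rlt_dec 0 k0); [lra|]. rewrite Hk, Ropp_0, sqrt_0. ring. }
  have HF1 : forall t, Om t -> F1 t = F1 x0.
  { have Dz : forall t, Om t -> is_derive F1 t 0.
   { intros t Ht. destruct (Hom t Ht) as (At & _ & E). rewrite HX1 in E. destruct (HD t At) as (_ & _ & _ & _ & Bd).
    replace 0 with (F2 t) by lra. exact Bd. }
   intros t Ht. destruct (Rle_dec t x0); [|symmetry]; apply constant_of_derive; try lra; intros y Hy; apply Dz.
   - apply (Hconv t x0); auto.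
   - apply (Hconv x0 t); auto. }
  have HFa : forall t, Om t -> F t = F1 x0*(t-x0).
  { have Dz : forall t, Om t -> is_derive (fun t => F t-F1 x0*(t-x0)) t 0.
   { intros t Ht. destruct (Hom t Ht) as (At & _). destruct (HD t At) as (_ & _ & _ & Bd & _).
    derive_auto. rewrite HF1 by auto. ring. }
   intros t Ht.
   have E : F t-F1 x0*(t-x0) = F x0-F1 x0*(x0-x0).
   { destruct (Rle_dec t x0); [|symmetry]; apply (constant_of_derive (fun t => F t-F1 x0*(t-x0)));
     try lra; intros y Hy; apply Dz.
    - apply (Hconv t x0); auto.
    - apply (Hconv x0 t); auto. }
   rewrite F0 in E. lra. }
  apply Hnp. exists (1, 1, 1), (3*x0). split; [intros H; injection H; lra|].
  intros [[x y] z] Hp. destruct (Hin x y z Hp) as (Ox & Oy & Oz). apply HS in Hp. destruct Hp as (_ & _ & _ & E).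
  rewrite (HFa x), (HFa y), (HFa z) in E by auto.
  have E' : F1 x0*(x+y+z-3*x0) = 0 by lra. apply Rmult_integral in E'. unfold dot.
  destruct E'; [contradiction|]. lra. }
 have Hsc : separation_constant A B C f g h k0.
 (* The shifts undo [F = f + s], [F = g - c + s] and [F = h - c' + s]. *)
 { exists (fun v => X_model k0 a (v+s)), (fun v => X_model k0 a (v+(s-c))), (fun v => X_model k0 a (v+(s-c'))).
  intros x y z Hp. destruct (Hin x y z Hp) as (Ox & Oy & Oz).
  destruct (Hom x Ox) as (Ax & Ex & _), (Hom y Oy) as (Ay & Ey & _), (Hom z Oz) as (Az & Ez & _).
  destruct (HF x Ax) as (Fx & _), (HF y Ay) as (_ & Fy & _), (HF z Az) as (_ & _ & Fz).
  destruct (Hf x Ax) as (-> & _), (Hf y Ay) as (_ & -> & _), (Hf z Az) as (_ & _ & ->).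
  replace (f x+s) with (F x) by lra. replace (g y+(s-c)) with (F y) by lra.
  replace (h z+(s-c')) with (F z) by lra.
  repeat (split; [solve [auto]|]). repeat split; apply third_order_X_model. }
 have Huniq : forall kappa, separation_constant A B C f g h kappa -> kappa = k0.
 { intros kappa (X & Y & Z & HXYZ).
  have Ax0 : A x0 by (apply Hom; auto).
  destruct (HO x0 Ox0) as [d Hd].
  destruct (local_values A F F1 x0 d HA) as (e & He & Hval); auto using cond_pos.
  { intros x Hx. apply HD; auto. }
  { destruct (HD x0 Ax0) as (_ & _ & _ & _ & Bd). apply (is_derive_continuous _ _ _ Bd). }
  rewrite F0 in Hval.
  (* Points with values [u], [- u], 0 lie on the surface for all small [u], so [X] is known on an
     interval and its derivatives can be compared with those of the model. *)
  have Hpt : forall u, Rabs u < e -> X (u-s) = X_model k0 a u /\ third_order X kappa (u-s).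
  { intros u Hu. destruct (Hval u) as (x & Hx & Ex); [rewrite Rminus_0_r; auto|].
   destruct (Hval (- u)) as (y & Hy & Ey); [rewrite Rminus_0_r, Rabs_Ropp; auto|].
   have Ox : Om x by (apply Hd; exact Hx). have Oy : Om y by (apply Hd; exact Hy).
   destruct (Hom x Ox) as (Ax & Qx & _). destruct (Hom y Oy) as (Ay & _).
   destruct (HXYZ x y x0) as (H1 & _ & _ & H2 & _); [apply HS; repeat split; auto; lra|].
   destruct (HF x Ax) as (Fx & _). destruct (Hf x Ax) as (Dx & _).
   replace (u-s) with (f x) by lra. rewrite H1, Dx, Qx, Ex. auto. }
  have Heq : forall u, Rabs u < e -> k0*X_model1 k0 a u = kappa*X_model1 k0 a u.
  { intros u Hu. destruct (Hpt u Hu) as [_ [_ H3]].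
   have Hloc : locally (u-s) (fun v => X v = X_model k0 a (v+s)).
   { have Hr : 0 < e-Rabs u by lra. exists (mkposreal _ Hr).
    enough (Hv : forall v : R, Rabs (v-(u-s)) < e-Rabs u -> X v = X_model k0 a (v+s)) by exact Hv.
    intros v Hv. destruct (Hpt (v+s)) as [E _].
    - replace (v+s) with ((v-(u-s))+u) by ring. eapply Rle_lt_trans; [apply Rabs_triang|]. lra.
    - replace (v+s-s) with v in E by ring. exact E. }
   assert (E3 : Derive_n X 3 (u-s) = Derive_n (fun v : R => X_model k0 a (v+s)) 3 (u-s))
    by (apply Derive_n_ext_loc; exact Hloc).
   assert (E1 : Derive X (u-s) = Derive (fun v : R => X_model k0 a (v+s)) (u-s))
    by (apply Derive_ext_loc; exact Hloc).
   rewrite E3, E1 in H3.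
   destruct (third_order_X_model k0 a s (u-s)) as [_ H4]. rewrite H4 in H3.
   have E : Derive (fun v => X_model k0 a (v+s)) (u-s) = X_model1 k0 a u.
   { apply is_derive_unique. have Bd := proj1 (X_model_derive k0 a u).
    replace u with (u-s+s) in Bd by ring. unfold Rminus in *.
    derive_auto. replace (u + - s+s) with u by ring. ring. }
   rewrite E in H3. exact H3. }
  destruct (Req_dec kappa k0) as [|Hne]; auto. exfalso.
  have Hz : forall u, Rabs u < e -> X_model1 k0 a u = 0.
  { intros u Hu. specialize (Heq u Hu). have H : (k0-kappa)*X_model1 k0 a u = 0 by lra.
   apply Rmult_integral in H. destruct H; auto; lra. }
  (* The first derivative of the model cannot vanish near 0, because its own derivative at 0 is
     [2 k0 a / 3]. *)
  have Dz : is_derive (X_model1 k0 a) 0 0.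
  { apply (is_derive_ext_loc (fun _ => 0)); [|apply (is_derive_const (K := R_AbsRing) (V := R_NormedModule))].
   exists (mkposreal e He). intros v Hv. change (Rabs (v-0) < e) in Hv. rewrite Rminus_0_r in Hv.
   symmetry. apply Hz, Hv. }
  have Dz' := proj2 (X_model_derive k0 a 0). rewrite (proj1 (X_model_0 k0 a)) in Dz'.
  apply is_derive_unique in Dz. apply is_derive_unique in Dz'. rewrite Dz in Dz'.
  have H : k0*(2*a/3) = 0 by lra. apply Rmult_integral in H. destruct H; lra. }
 have Hnorm : forall (lam r : R) (X : R -> R), 0 < lam -> 0 < r ->
   (forall t, Om t -> lam^2*F1 t^2 = r^2*X (lam*F t)) -> normalizes_to X A B C f g h.
 { intros lam r X Hl Hr HX. exists lam, r, s, (s-c), (s-c'), (fun t => lam*F (t/r)).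
  have Er : forall t, r*t/r = t by (intros; field; lra).
  split; auto. split; auto. split; [unfold s; field|].
  split. { intros t Ht. rewrite Er. destruct (HF t Ht) as (-> & _). auto. }
  split. { intros t Ht. rewrite Er. apply (Hdom t) in Ht. destruct (HF t Ht) as (_ & -> & _). ring. }
  split. { intros t Ht. rewrite Er. apply (Hdom t) in Ht. destruct (HF t Ht) as (_ & _ & ->). ring. }
  have Hd : forall t, Om t -> Derive (fun t => lam*F (t/r)) (r*t)^2 = X (lam*F (r*t/r)).
  { intros t Ht. rewrite Er. destruct (Hom t Ht) as (At & _). destruct (HD t At) as (_ & _ & _ & Bd & _).
   have D : is_derive (fun t => lam*F (t/r)) (r*t) (lam*F1 t/r).
   { have Bd' : is_derive F (r*t * / r) (F1 t) by (replace (r*t * / r) with t by (field; lra); exact Bd).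
    derive_auto. field. lra. }
   apply is_derive_unique in D.
   transitivity ((lam*F1 t/r)^2); [f_equal; exact D|].
   replace ((lam*F1 t/r)^2) with (lam^2*F1 t^2/r^2) by (field; lra). rewrite HX by auto. field. lra. }
  intros x y z Hp. destruct (Hin x y z Hp) as (Ox & Oy & Oz). auto. }
 split; [exists k0; auto|].
 intros kappa Hkap. apply Huniq in Hkap. subst kappa. split; auto. split; intros Hsgn.
 (* [2 lam] is the frequency of the model, and [r] absorbs its amplitude [a / 3]; the rescaled
    squared slope has unit coefficients. *)
 - set (lam := sqrt k0/2). set (r := lam*sqrt (a/3)).
  have Hl : 0 < lam by (unfold lam; have H := sqrt_lt_R0 _ Hsgn; lra).
  have Hr : 0 < r by (apply Rmult_lt_0_compat; auto; apply sqrt_lt_R0; lra).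
  have Hr2 : r^2 = lam^2*(a/3).
  { unfold r. rewrite Rpow_mult_distr, (pow2_sqrt (a/3)) by lra. auto. }
  have HX : forall t, Om t -> lam^2*F1 t^2 = r^2*(1+2*cosh (2*(lam*F t))).
  { intros t Ht. destruct (Hom t Ht) as (_ & -> & _). rewrite Hr2. unfold X_model.
   destruct (Rlt_dec 0 k0); [|lra]. replace (2*(lam*F t)) with (sqrt k0*F t) by (unfold lam; field). ring. }
  split; [apply (Hnorm lam r X_pos Hl Hr HX)|].
  destruct (conjugacy_D Om F F1 x0 lam r) as (b & k & Hk & Hphi); auto.
  { intros t Ht. destruct (Hom t Ht) as (At & _). destruct (HD t At) as (_ & _ & _ & Bd & Bd').
   split; auto. apply (is_derive_continuous _ _ _ Bd'). }
  apply (piece_of_conjugacy A B C Om domD f g h F phiD r b k); auto. intros t Ht; apply Hom; auto.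
 - set (lam := sqrt (- k0)/2). set (r := lam*sqrt (a/3)).
  have Hl : 0 < lam by (unfold lam; have H : 0 < sqrt (- k0) by (apply sqrt_lt_R0; lra); lra).
  have Hr : 0 < r by (apply Rmult_lt_0_compat; auto; apply sqrt_lt_R0; lra).
  have Hr2 : r^2 = lam^2*(a/3).
  { unfold r. rewrite Rpow_mult_distr, (pow2_sqrt (a/3)) by lra. auto. }
  have HX : forall t, Om t -> lam^2*F1 t^2 = r^2*(1+2*cos (2*(lam*F t))).
  { intros t Ht. destruct (Hom t Ht) as (_ & -> & _). rewrite Hr2. unfold X_model.
   destruct (Rlt_dec 0 k0); [lra|]. replace (2*(lam*F t)) with (sqrt (- k0)*F t) by (unfold lam; field). ring. }
  split; [apply (Hnorm lam r X_neg Hl Hr HX)|].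
  destruct (conjugacy_P Om F F1 F2 x0 lam r) as (b & k & Hk & Hphi); auto.
  { intros t Ht. destruct (Hom t Ht) as (At & _). destruct (HD t At) as (_ & _ & _ & Bd & Bd'). auto. }
  { rewrite Hr2. fold a. field. }
  { intros t Ht. destruct (Hom t Ht) as (_ & _ & E). unfold X_model1 in E.
   destruct (Rlt_dec 0 k0); [lra|]. replace (sqrt (- k0)) with (2*lam) in E by (unfold lam; field).
   replace (2*lam*F t) with (2*(lam*F t)) in E by ring. rewrite Hr2.
   apply (Rmult_eq_reg_l 2); [|lra]. replace (2*(lam*F2 t)) with (lam*(2*F2 t)) by ring. rewrite E. field. }
  apply (piece_of_conjugacy A B C Om domP f g h F phiP r b k); auto.
  + intros t Ht; apply Hom; auto.
  + intros t Ht. split; [exact I|auto].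
Qed.

Ltac RtoC_push := repeat (rewrite RtoC_plus || rewrite RtoC_mult || rewrite RtoC_minus || rewrite RtoC_opp || rewrite RtoC_pow).

(** * The Hopf differential on null tangent vectors *)

(** [e = 1] is the case of P and [e = - 1] the case of D: there [c_i] is the derivative of the
    separating function, [C_i] and [s_i] the (hyperbolic) cosine and sine of twice its value.
    With [a3^2 = - a1^2 - a2^2] the difference of both sides is [- e / 2] times the quadratic form
    in the [a_i^2] that vanishes because [c1 a1 + c2 a2 + c3 a3 = 0]. *)
Lemma hopf_quartic (a1 a2 a3 c1 c2 c3 s1 s2 s3 C1 C2 C3 e : C) :
 (a1^2+a2^2+a3^2 = 0)%C -> (c1*a1+c2*a2+c3*a3 = 0)%C ->
 (c1^2 = 1+2*C1)%C -> (c2^2 = 1+2*C2)%C -> (c3^2 = 1+2*C3)%C ->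
 (s1^2 = e*(1-C1^2))%C -> (s2^2 = e*(1-C2^2))%C -> (s3^2 = e*(1-C3^2))%C ->
 (s1*s2 = e*(C1*C2-C3))%C -> (s2*s3 = e*(C2*C3-C1))%C -> (s3*s1 = e*(C3*C1-C2))%C ->
 (2*(s1*a1^2+s2*a2^2+s3*a3^2)^2 =
 e*(c1^2+c2^2+c3^2)*(a1^4+a2^4+a3^4))%C.
Proof.
 intros Hn Ht X1 X2 X3 S1 S2 S3 S12 S23 S31.
 have A3 : (a3^2 = - (a1^2+a2^2))%C by (rewrite <- (Cplus_0_l (- _)%C), <- Hn; ring).
 (* The product of the tangency condition over all relative signs involves only the squares of the
    [c_i a_i]. *)
 have Q : ((c3^2*a3^2-c1^2*a1^2-c2^2*a2^2)^2-4*(c1^2*a1^2)*(c2^2*a2^2) = 0)%C.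
 { replace ((c3^2*a3^2-c1^2*a1^2-c2^2*a2^2)^2-4*(c1^2*a1^2)*(c2^2*a2^2))%C
   with ((c1*a1+c2*a2+c3*a3)*((c1*a1+c2*a2-c3*a3)*(c1*a1-c2*a2+c3*a3)*(c1*a1-c2*a2-c3*a3)))%C by ring.
  rewrite Ht. ring. }
 rewrite X1, X2, X3, A3 in Q.
 replace (2*(s1*a1^2+s2*a2^2+s3*a3^2)^2)%C with
  (2*(s1^2*(a1^2)^2+s2^2*(a2^2)^2+s3^2*(a3^2)^2+2*(s1*s2)*a1^2*a2^2
   + 2*(s2*s3)*a2^2*a3^2+2*(s3*s1)*a3^2*a1^2))%C by ring.
 replace (a3^4)%C with ((a3^2)^2)%C by ring.
 rewrite S1, S2, S3, S12, S23, S31, X1, X2, X3, A3.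
 match goal with |- ?L = ?R => assert (H : (2*(L-R) = 0)%C) end.
 { match type of Q with ?q = _ => transitivity (- e*q)%C; [ring|rewrite Q; ring] end. }
 apply (f_equal (fun z => (/ 2*z)%C)) in H.
 match goal with |- ?L = ?R => transitivity (R + / 2*(2*(L-R)))%C; [field|rewrite H; ring] end.
 all: intros E; apply (f_equal fst) in E; simpl in E; lra.
Qed.

(** Polynomial functions, as coefficient lists. *)
Fixpoint peval (l : list C) (z : C) : C :=
 match l with nil => 0%C | c :: l => (c+z*peval l z)%C end.

Definition polyfun (f : C -> C) : Prop := exists l, forall z, f z = peval l z.

Lemma polyfun_ext (f g : C -> C) : (forall z, f z = g z) -> polyfun f -> polyfun g.
Proof. intros E [l H]. exists l. intros z. rewrite <- E. apply H. Qed.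

Lemma polyfun_const (c : C) : polyfun (fun _ => c).
Proof. exists (c :: nil). intros z. simpl. ring. Qed.

Lemma polyfun_id : polyfun (fun z => z).
Proof. exists (RtoC 0 :: RtoC 1 :: nil). intros z. simpl. ring. Qed.

Lemma polyfun_plus (f g : C -> C) : polyfun f -> polyfun g -> polyfun (fun z => f z+g z)%C.
Proof.
 intros [l Hl] [k Hk]. enough (exists n, forall z, peval n z = (peval l z+peval k z)%C) as [n Hn].
 { exists n. intros z. rewrite Hn, Hl, Hk. auto. }
 clear. revert k. induction l as [|c l IH]; intros k.
 - exists k. intros z. simpl. ring.
 - destruct k as [|d k].
  + exists (c :: l). intros z. simpl. ring.
  + destruct (IH k) as [n Hn]. exists ((c+d)%C :: n). intros z. simpl. rewrite Hn. ring.
Qed.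

Lemma polyfun_mult (f g : C -> C) : polyfun f -> polyfun g -> polyfun (fun z => f z*g z)%C.
Proof.
 intros [l Hl] [k Hk]. apply (polyfun_ext (fun z => peval l z*peval k z)%C).
 { intros z. rewrite Hl, Hk. auto. }
 clear. induction l as [|c l IH].
 - apply (polyfun_ext (fun _ => 0%C)); [intros; simpl; ring|apply polyfun_const].
 - have P : polyfun (peval k) by (exists k; auto).
  have S : forall h, polyfun h -> polyfun (fun z => z*h z)%C.
  { intros h [n Hn]. exists (RtoC 0 :: n). intros z. simpl. rewrite Hn. ring. }
  have T : forall h, polyfun h -> polyfun (fun z => c*h z)%C.
  { intros h [n Hn]. exists (map (Cmult c) n). intros z. rewrite Hn. clear. induction n as [|d n IH]; simpl; [ring|].
   rewrite <- IH. ring. }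
  apply (polyfun_ext (fun z => c*peval k z+z*(peval l z*peval k z))%C); [intros; simpl; ring|].
  apply polyfun_plus; auto.
Qed.

Lemma polyfun_minus (f g : C -> C) : polyfun f -> polyfun g -> polyfun (fun z => f z-g z)%C.
Proof.
 intros Hf Hg. apply (polyfun_ext (fun z => f z+(- (1))*g z)%C); [intros; ring|]. apply polyfun_plus, polyfun_mult; auto using polyfun_const.
Qed.

Lemma polyfun_pow (f : C -> C) (n : nat) : polyfun f -> polyfun (fun z => f z^n)%C.
Proof.
 intros Hf. induction n as [|n IH].
 - apply (polyfun_ext (fun _ => 1%C)); [reflexivity|apply polyfun_const].
 - apply (polyfun_ext (fun z => f z*f z^n)%C); [intros; simpl; auto|]. apply polyfun_mult; auto.
Qed.

Lemma peval_root (l : list C) (z0 : C) : exists k, length k = pred (length l) /\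
 forall z, (peval l z-peval l z0 = (z-z0)*peval k z)%C.
Proof.
 induction l as [|c [|d l] IH].
 - exists nil. split; auto. intros z. simpl. ring.
 - exists nil. split; auto. intros z. simpl. ring.
 - destruct IH as [k [Hk E]]. exists (peval (d :: l) z0 :: k). split; [simpl in *; lia|].
  intros z. simpl peval in *.
  transitivity (z0*0+(z-z0)*(d+z0*peval l z0)+z*((d+z*peval l z)-(d+z0*peval l z0)))%C; [ring|].
  rewrite E. ring.
Qed.

(** Roots are split off one at a time, which shortens the coefficient list until it is empty. *)
Lemma polyfun_zero (f : C -> C) (zs : nat -> C) :
 polyfun f -> (forall i j, zs i = zs j -> i = j) -> (forall n, f (zs n) = 0%C) -> forall z, f z = 0%C.
Proof.
 intros [l Hl] Hinj Hz z. rewrite Hl.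
 have Hz' : forall n, peval l (zs n) = 0%C by (intros; rewrite <- Hl; auto). clear f Hl Hz. revert z.
 remember (length l) as n eqn:Hn. revert l zs Hn Hinj Hz'. induction n as [|n IH]; intros l zs Hn Hinj Hz z.
 - destruct l; [reflexivity|discriminate].
 - destruct (peval_root l (zs 0%nat)) as [k [Hk E]].
  have K : forall w, peval k w = 0%C.
  { apply (IH k (fun i => zs (S i))); [lia| |].
   - intros i j H. apply Hinj in H. lia.
   - intros i. specialize (E (zs (S i))). rewrite !Hz in E.
    have N : (zs (S i)-zs 0%nat)%C <> 0%C.
    { intros H. have H' : zs (S i) = zs 0%nat by (rewrite <- (Cplus_0_r (zs 0%nat)), <- H; ring).
     apply Hinj in H'. discriminate. }
    apply (f_equal (fun x => (/ (zs (S i)-zs 0%nat)*x)%C)) in E.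
    transitivity (/ (zs (S i)-zs 0%nat)*((zs (S i)-zs 0%nat)*peval k (zs (S i))))%C; [field; auto|].
    rewrite <- E. field. auto. }
  transitivity (peval l z-peval l (zs 0%nat))%C; [rewrite Hz; ring|]. rewrite E, K. ring.
Qed.

(** The quartic [a1^4 + a2^4 + a3^4] on the null cone carries the cubic harmonic
    [n1^4 + n2^4 + n3^4 - 3 / 5]; no similarity turns it into a negative multiple of itself. *)
Definition anti_invariant (k p1 p2 p3 q1 q2 q3 m1 m2 m3 : R) : Prop :=
 forall a1 a2 a3 : C, (a1^2+a2^2+a3^2 = 0)%C ->
  ((p1*a1+q1*a2+m1*a3)^4+(p2*a1+q2*a2+m2*a3)^4+(p3*a1+q3*a2+m3*a3)^4
  = - k*(a1^4+a2^4+a3^4))%C.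

(** The rows are [(p1, q1, m1)], [(p2, q2, m2)], [(p3, q3, m3)]; the same predicate with transposed
    arguments speaks about the columns. *)
Definition conformal (rho p1 p2 p3 q1 q2 q3 m1 m2 m3 : R) : Prop :=
 (p1^2+q1^2+m1^2 = rho /\ p2^2+q2^2+m2^2 = rho /\ p3^2+q3^2+m3^2 = rho) /\
 p1*p2+q1*q2+m1*m2 = 0 /\ p2*p3+q2*q3+m2*m3 = 0 /\ p3*p1+q3*q1+m3*m1 = 0.

Lemma conformal_dual (rho p1 p2 p3 q1 q2 q3 m1 m2 m3 : R) (a1 a2 a3 : C) : conformal rho p1 p2 p3 q1 q2 q3 m1 m2 m3 ->
 let x1 := (p1*a1+p2*a2+p3*a3)%C in let x2 := (q1*a1+q2*a2+q3*a3)%C in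
 let x3 := (m1*a1+m2*a2+m3*a3)%C in
 (x1^2+x2^2+x3^2 = rho*(a1^2+a2^2+a3^2) /\ p1*x1+q1*x2+m1*x3 = rho*a1 /\
 p2*x1+q2*x2+m2*x3 = rho*a2 /\ p3*x1+q3*x2+m3*x3 = rho*a3)%C.
Proof.
 intros ((R1 & R2 & R3) & R12 & R23 & R31) x1 x2 x3.
 have E1 : (p1*x1+q1*x2+m1*x3 = rho*a1)%C.
 { transitivity (RtoC (p1^2+q1^2+m1^2)*a1+RtoC (p1*p2+q1*q2+m1*m2)*a2+RtoC (p3*p1+q3*q1+m3*m1)*a3)%C;
   [unfold x1, x2, x3; RtoC_push; ring|rewrite R1, R12, R31; ring]. }
 have E2 : (p2*x1+q2*x2+m2*x3 = rho*a2)%C.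
 { transitivity (RtoC (p1*p2+q1*q2+m1*m2)*a1+RtoC (p2^2+q2^2+m2^2)*a2+RtoC (p2*p3+q2*q3+m2*m3)*a3)%C;
   [unfold x1, x2, x3; RtoC_push; ring|rewrite R2, R12, R23; ring]. }
 have E3 : (p3*x1+q3*x2+m3*x3 = rho*a3)%C.
 { transitivity (RtoC (p3*p1+q3*q1+m3*m1)*a1+RtoC (p2*p3+q2*q3+m2*m3)*a2+RtoC (p3^2+q3^2+m3^2)*a3)%C;
   [unfold x1, x2, x3; RtoC_push; ring|rewrite R3, R31, R23; ring]. }
 split; [|auto]. transitivity (a1*(p1*x1+q1*x2+m1*x3)+a2*(p2*x1+q2*x2+m2*x3)+a3*(p3*x1+q3*x2+m3*x3))%C;
  [unfold x1, x2, x3; ring|rewrite E1, E2, E3; ring].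
Qed.

(** The identity is evaluated at the null vectors [(1, i, 0)], [(0, 1, i)], [(i, 0, 1)]. The real
    parts add up to [- 6 k] on the right, while each row contributes at least [- 4/3 rho^2] on the
    left. *)
Lemma anti_invariant_bound (k rho p1 p2 p3 q1 q2 q3 m1 m2 m3 : R) :
 conformal rho p1 p2 p3 q1 q2 q3 m1 m2 m3 -> anti_invariant k p1 p2 p3 q1 q2 q3 m1 m2 m3 -> k <= 2/3*rho^2.
Proof.
 intros ((R1 & R2 & R3) & _) H.
 have H12 := f_equal fst (H 1%C Ci 0%C ltac:(apply injective_projections; simpl; ring)).
 have H23 := f_equal fst (H 0%C 1%C Ci ltac:(apply injective_projections; simpl; ring)).
 have H31 := f_equal fst (H Ci 0%C 1%C ltac:(apply injective_projections; simpl; ring)).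
 simpl in H12, H23, H31.
 have E : forall p q m, p^2+q^2+m^2 = rho ->
  2*(p^4+q^4+m^4)-6*(p^2*q^2+q^2*m^2+m^2*p^2) >= - (4/3*rho^2).
 { intros p q m <-. have A1 := pow2_ge_0 (p^2-q^2). have A2 := pow2_ge_0 (q^2-m^2). have A3 := pow2_ge_0 (m^2-p^2). lra. }
 have E1 := E p1 q1 m1 R1. have E2 := E p2 q2 m2 R2. have E3 := E p3 q3 m3 R3. lra.
Qed.

(** The transpose is [rho] times the inverse and is anti-invariant with constant [rho^4 / k]. The
    bound for both matrices gives [rho^4 <= 4/9 rho^4]. *)
Lemma anti_invariant_absurd (k rho p1 p2 p3 q1 q2 q3 m1 m2 m3 : R) : 0 < k -> 0 < rho ->
 conformal rho p1 p2 p3 q1 q2 q3 m1 m2 m3 -> conformal rho p1 q1 m1 p2 q2 m2 p3 q3 m3 ->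
 ~ anti_invariant k p1 p2 p3 q1 q2 q3 m1 m2 m3.
Proof.
 intros Hk Hr HR HK H. have B1 := anti_invariant_bound _ _ _ _ _ _ _ _ _ _ _ HR H.
 have B2 : rho^4/k <= 2/3*rho^2.
 { apply (anti_invariant_bound _ _ _ _ _ _ _ _ _ _ _ HK). intros b1 b2 b3 Hb.
  destruct (conformal_dual _ _ _ _ _ _ _ _ _ _ b1 b2 b3 HR) as (E0 & E1 & E2 & E3).
  rewrite Hb, Cmult_0_r in E0. specialize (H _ _ _ E0). rewrite E1, E2, E3 in H.
  have K0 : RtoC k <> 0%C by (intros E; apply RtoC_inj in E; lra). unfold Rdiv. rewrite RtoC_mult, RtoC_inv, RtoC_pow by lra.
  match goal with |- ?L = _ => transitivity (- / k*(- k*L))%C; [field; auto|] end. rewrite <- H. ring. }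
 have P : 0 < rho^2 by (apply pow_lt; auto).
 have B3 : rho^4 <= 2/3*rho^2*k.
 { replace (rho^4) with (rho^4/k*k) by (field; lra). apply Rmult_le_compat_r; lra. }
 have B4 : rho^2*k <= rho^2*(2/3*rho^2) by (apply Rmult_le_compat_l; lra).
 assert (0 < rho^4) by (apply pow_lt; auto). lra.
Qed.

(** * No piece of D is similar to a piece of P *)

Definition etaD_branch (psi : R -> R) : Prop :=
 forall u, sD (psi u) <> 0 /\ etaD (psi u) = u /\ is_derive psi u (/ etaD1 (psi u)).

Lemma etaD1_neq0 (t : R) : sD t <> 0 -> etaD1 t <> 0.
Proof.
 intros H E. have Q := etaD1_sq t H. rewrite E in Q. have C := cosh_ge1 (2*etaD t). simpl in Q. lra.
Qed.

(** First and second derivative at 0. Two-jets of composite expressions are assembled by the rules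
    below instead of differentiating the whole expression twice. *)
Definition jet (f : R -> R) (d1 d2 : R) : Prop :=
 exists f1, (forall s, is_derive f s (f1 s)) /\ f1 0 = d1 /\ is_derive f1 0 d2.

Lemma jet_plus (f g : R -> R) (d1 d2 e1 e2 : R) : jet f d1 d2 -> jet g e1 e2 -> jet (fun s => f s+g s) (d1+e1) (d2+e2).
Proof.
 intros (f1 & F & <- & F2) (g1 & G & <- & G2). exists (fun s => f1 s+g1 s).
 split; [intros s; apply (is_derive_plus f g)|split; [reflexivity|apply (is_derive_plus f1 g1)]]; auto.
Qed.

Lemma jet_scal (f : R -> R) (c d1 d2 : R) : jet f d1 d2 -> jet (fun s => c*f s) (c*d1) (c*d2).
Proof.
 intros (f1 & F & <- & F2). exists (fun s => c*f1 s). split; [intros s; apply (is_derive_scal f)|split; [reflexivity|apply (is_derive_scal f1)]]; auto.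
Qed.

Lemma jet_shift (f : R -> R) (b d1 d2 : R) : jet f d1 d2 -> jet (fun s => b+f s) d1 d2.
Proof.
 intros (f1 & F & <- & F2). exists f1. split; [|auto]. intros s. have B := F s. derive_auto. ring.
Qed.

Lemma jet_phiP (f : R -> R) (d1 d2 : R) : jet f d1 d2 ->
 jet (fun s => phiP (f s)) (phiP1 (f 0)*d1) (-2*sin (2*phiP (f 0))*d1^2+phiP1 (f 0)*d2).
Proof.
 intros (f1 & F & <- & F2). exists (fun s => phiP1 (f s)*f1 s). split; [|split; [reflexivity|]].
 - intros s. have B := F s. have B' := is_derive_phiP (f s). derive_auto. ring.
 - have B := F 0. have B' := is_derive_phiP1 (f 0). derive_auto. ring.
Qed.

Lemma jet_branch (psi : R -> R) (u al : R) : etaD_branch psi -> let k := / etaD1 (psi u) in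
 jet (fun s => psi (u+s*al)) (k*al) (-2*sinh (2*u)*k*(k*al)^2).
Proof.
 intros H. pose (k := fun u => / etaD1 (psi u)).
 have D : forall u, is_derive psi u (k u) by (intros; apply H).
 have D2 : forall u, is_derive k u (- (2*sinh (2*u))*k u^3).
 { intros v. destruct (H v) as (Hs & He & Hd). have N := etaD1_neq0 _ Hs. have B := is_derive_etaD1 _ Hs. rewrite He in B.
  unfold k. derive_auto. field. auto. }
 have V : u+0*al = u by ring. exists (fun s => k (u+s*al)*al). split; [|split; [rewrite V; reflexivity|]].
 - intros s. have B := D (u+s*al). derive_auto. ring.
 - have B := D2 (u+0*al). derive_auto. rewrite V. fold (k u). ring.
Qed.

Lemma jet_zero (f : R -> R) (d1 d2 : R) : locally 0 (fun s => f s = 0) -> jet f d1 d2 -> d1 = 0 /\ d2 = 0.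
Proof.
 intros H (f1 & F & <- & F2).
 have H1 : locally 0 (fun s => f1 s = 0).
 { apply locally_locally in H. generalize H. apply filter_imp. intros s Hs. rewrite <- (is_derive_unique _ _ _ (F s)).
  transitivity (Derive (fun _ : R => 0) s); [apply Derive_ext_loc; exact Hs|apply Derive_const]. }
 split; [apply (locally_singleton _ _ H1)|]. rewrite <- (is_derive_unique _ _ _ F2).
 transitivity (Derive (fun _ : R => 0) 0); [apply Derive_ext_loc; exact H1|apply Derive_const].
Qed.

(** Polarization: the real vectors [x], [y] and [x + y] account for the real and imaginary parts at
    [x + i y]. *)
Lemma real_quadratic_complexify (c1 c2 c3 A11 A22 A33 A12 A23 A31 : R) :
 (forall t1 t2 t3 : R, c1*t1+c2*t2+c3*t3 = 0 ->
  A11*t1^2+A22*t2^2+A33*t3^2+A12*t1*t2+A23*t2*t3+A31*t3*t1 = 0) ->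
 forall a1 a2 a3 : C, (c1*a1+c2*a2+c3*a3 = 0)%C ->
  (A11*a1^2+A22*a2^2+A33*a3^2+A12*a1*a2+A23*a2*a3+A31*a3*a1 = 0)%C.
Proof.
 intros H [x1 y1] [x2 y2] [x3 y3] E.
 have Ex := f_equal fst E. have Ey := f_equal snd E. simpl in Ex, Ey.
 have Hx := H x1 x2 x3 ltac:(lra). have Hy := H y1 y2 y3 ltac:(lra).
 have Hxy := H (x1+y1) (x2+y2) (x3+y3) ltac:(lra).
 apply injective_projections; simpl; lra.
Qed.

Lemma sin_cos_sum_zero (x y z : R) : x+y+z = 0 ->
 sin (2*x)*sin (2*y) = cos (2*x)*cos (2*y)-cos (2*z).
Proof. intros H. replace (2*z) with (- (2*x+2*y)) by lra. rewrite cos_neg, cos_plus. ring. Qed.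

Lemma sinh_cosh_sum_zero (x y z : R) : x+y+z = 0 ->
 sinh (2*x)*sinh (2*y) = -1*(cosh (2*x)*cosh (2*y)-cosh (2*z)).
Proof. intros H. replace (2*z) with (- (2*x+2*y)) by lra. rewrite cosh_neg, cosh_plus. ring. Qed.

Lemma sin_sq_cos (x : R) : sin x^2 = 1*(1-cos x^2).
Proof. have H := sin2_cos2 x. unfold Rsqr in H. lra. Qed.

Lemma sinh_sq_cosh (x : R) : sinh x^2 = -1*(1-cosh x^2).
Proof. have H := cosh_sq x. lra. Qed.

(** [hopf_quartic] with real data, for P ([e = 1]) and D ([e = - 1]). *)
Lemma hopf_quartic_real (a1 a2 a3 : C) (c1 c2 c3 s1 s2 s3 C1 C2 C3 e : R) :
 (a1^2+a2^2+a3^2 = 0)%C -> (c1*a1+c2*a2+c3*a3 = 0)%C ->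
 c1^2 = 1+2*C1 -> c2^2 = 1+2*C2 -> c3^2 = 1+2*C3 ->
 s1^2 = e*(1-C1^2) -> s2^2 = e*(1-C2^2) -> s3^2 = e*(1-C3^2) ->
 s1*s2 = e*(C1*C2-C3) -> s2*s3 = e*(C2*C3-C1) -> s3*s1 = e*(C3*C1-C2) ->
 (2*(s1*a1^2+s2*a2^2+s3*a3^2)^2 =
 (e*(c1^2+c2^2+c3^2))%R*(a1^4+a2^4+a3^4))%C.
Proof.
 intros Hn Ht X1 X2 X3 S1 S2 S3 S12 S23 S31.
 rewrite (hopf_quartic a1 a2 a3 c1 c2 c3 s1 s2 s3 C1 C2 C3 e); auto;
  rewrite ?RtoC_mult, ?RtoC_plus, ?RtoC_pow; auto;
  rewrite <- ?RtoC_pow, <- ?RtoC_mult, ?X1, ?X2, ?X3, ?S1, ?S2, ?S3, ?S12, ?S23, ?S31;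
  rewrite ?RtoC_mult, ?RtoC_minus, ?RtoC_plus, ?RtoC_mult, ?RtoC_pow; auto.
Qed.

(** At a point of D that is mapped into P, the equation of P is differentiated twice along curves in
    D. First order: the pulled-back normal of P is proportional to that of D. Second order: so are
    the second fundamental forms. Comparing their squares on null tangent vectors through
    [hopf_quartic_real], with [e = 1] on one side and [e = -1] on the other, leaves the quartics
    with opposite signs. *)
Lemma pointwise_anti_invariant (psi1 psi2 psi3 : R -> R) (u1 u2 u3 b1 b2 b3 rho p1 p2 p3 q1 q2 q3 m1 m2 m3 : R) :
 etaD_branch psi1 -> etaD_branch psi2 -> etaD_branch psi3 -> 0 < rho ->
 conformal rho p1 p2 p3 q1 q2 q3 m1 m2 m3 -> conformal rho p1 q1 m1 p2 q2 m2 p3 q3 m3 -> u1+u2+u3 = 0 ->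
 let xi b p q m x y z := b+(p*x+q*y+m*z) in
 (forall al1 al2 al3, al1+al2+al3 = 0 -> locally 0 (fun s =>
   let x := psi1 (u1+s*al1) in let y := psi2 (u2+s*al2) in let z := psi3 (u3+s*al3) in
   phiP (xi b1 p1 q1 m1 x y z)+phiP (xi b2 p2 q2 m2 x y z)+phiP (xi b3 p3 q3 m3 x y z) = 0)) ->
 forall a1 a2 a3 : C, (a1^2+a2^2+a3^2 = 0)%C ->
  (etaD1 (psi1 u1)*a1+etaD1 (psi2 u2)*a2+etaD1 (psi3 u3)*a3 = 0)%C ->
  ((p1*a1+q1*a2+m1*a3)^4+(p2*a1+q2*a2+m2*a3)^4+(p3*a1+q3*a2+m3*a3)^4
  = - rho*(a1^4+a2^4+a3^4))%C.
Proof.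
 intros H1 H2 H3 Hr HR HK Hu xi Hloc a1 a2 a3 Hnull Htan.
 destruct (H1 u1) as (S1 & E1 & _), (H2 u2) as (S2 & E2 & _), (H3 u3) as (S3 & E3 & _).
 have N1 := etaD1_neq0 _ S1. have N2 := etaD1_neq0 _ S2. have N3 := etaD1_neq0 _ S3.
 have X1 := etaD1_sq _ S1. have X2 := etaD1_sq _ S2. have X3 := etaD1_sq _ S3.
 rewrite E1 in X1. rewrite E2 in X2. rewrite E3 in X3.
 have HC := fun al1 al2 al3 Hal => jet_zero _ _ _ (Hloc al1 al2 al3 Hal)
  (let X b p q m := jet_phiP _ _ _ (jet_shift _ b _ _ (jet_plus _ _ _ _ _ _ (jet_plus _ _ _ _ _ _
    (jet_scal _ p _ _ (jet_branch psi1 u1 al1 H1)) (jet_scal _ q _ _ (jet_branch psi2 u2 al2 H2)))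
    (jet_scal _ m _ _ (jet_branch psi3 u3 al3 H3)))) in
  jet_plus _ _ _ _ _ _ (jet_plus _ _ _ _ _ _ (X b1 p1 q1 m1) (X b2 p2 q2 m2)) (X b3 p3 q3 m3)).
 set (c1 := etaD1 (psi1 u1)) in *. set (c2 := etaD1 (psi2 u2)) in *. set (c3 := etaD1 (psi3 u3)) in *.
 set (z1 := xi b1 p1 q1 m1 (psi1 u1) (psi2 u2) (psi3 u3)). set (z2 := xi b2 p2 q2 m2 (psi1 u1) (psi2 u2) (psi3 u3)).
 set (z3 := xi b3 p3 q3 m3 (psi1 u1) (psi2 u2) (psi3 u3)).
 have Hz : phiP z1+phiP z2+phiP z3 = 0.
 { have L := locally_singleton _ _ (Hloc 0 0 0 ltac:(ring)). cbv beta zeta in L. rewrite !Rmult_0_l, !Rplus_0_r in L. exact L. }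
 set (n1 := phiP1 z1) in *. set (n2 := phiP1 z2) in *. set (n3 := phiP1 z3) in *.
 set (s1 := sin (2*phiP z1)) in *. set (s2 := sin (2*phiP z2)) in *. set (s3 := sin (2*phiP z3)) in *.
 set (h1 := sinh (2*u1)) in *. set (h2 := sinh (2*u2)) in *. set (h3 := sinh (2*u3)) in *.
 have HT : forall t1 t2 t3, c1*t1+c2*t2+c3*t3 = 0 ->
  n1*(p1*t1+q1*t2+m1*t3)+n2*(p2*t1+q2*t2+m2*t3)+n3*(p3*t1+q3*t2+m3*t3) = 0 /\
  s1*(p1*t1+q1*t2+m1*t3)^2+s2*(p2*t1+q2*t2+m2*t3)^2+s3*(p3*t1+q3*t2+m3*t3)^2
  + (n1*p1+n2*p2+n3*p3)/c1*h1*t1^2+(n1*q1+n2*q2+n3*q3)/c2*h2*t2^2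
  + (n1*m1+n2*m2+n3*m3)/c3*h3*t3^2 = 0.
 { intros t1 t2 t3 Ht. specialize (HC _ _ _ Ht). cbv beta zeta in HC. rewrite !Rmult_0_l, !Rplus_0_r in HC.
  replace (/ c1*(c1*t1)) with t1 in HC by (field; auto). replace (/ c2*(c2*t2)) with t2 in HC by (field; auto).
  replace (/ c3*(c3*t3)) with t3 in HC by (field; auto). destruct HC as [A1 A2]. unfold n1, n2, n3, s1, s2, s3, z1, z2, z3, xi.
  split; [exact A1|]. unfold Rdiv. lra. }
 (* [mu] is the factor between the pulled-back normal of P and the normal of D. *)
 clear HC Hloc. set (mu := (n1*p1+n2*p2+n3*p3)/c1) in *.
 have G1 : n1*p1+n2*p2+n3*p3 = mu*c1 by (unfold mu; field; auto).
 have G2 : n1*q1+n2*q2+n3*q3 = mu*c2.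
 { destruct (HT c2 (- c1) 0 ltac:(ring)) as [L _]. apply (Rmult_eq_reg_r c1); auto.
  transitivity ((n1*p1+n2*p2+n3*p3)*c2); [lra|rewrite G1; ring]. }
 have G3 : n1*m1+n2*m2+n3*m3 = mu*c3.
 { destruct (HT c3 0 (- c1) ltac:(ring)) as [L _]. apply (Rmult_eq_reg_r c1); auto.
  transitivity ((n1*p1+n2*p2+n3*p3)*c3); [lra|rewrite G1; ring]. }
 set (B1 := (p1*a1+q1*a2+m1*a3)%C). set (B2 := (p2*a1+q2*a2+m2*a3)%C).
 set (B3 := (p3*a1+q3*a2+m3*a3)%C).
  (* the second fundamental forms agree up to scale *)
 have Hform : (s1*B1^2+s2*B2^2+s3*B3^2+mu*(h1*a1^2+h2*a2^2+h3*a3^2) = 0)%C.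
 { rewrite <- (real_quadratic_complexify c1 c2 c3
   (s1*p1^2+s2*p2^2+s3*p3^2+mu*h1) (s1*q1^2+s2*q2^2+s3*q3^2+mu*h2)
   (s1*m1^2+s2*m2^2+s3*m3^2+mu*h3) (2*(s1*p1*q1+s2*p2*q2+s3*p3*q3))
   (2*(s1*q1*m1+s2*q2*m2+s3*q3*m3)) (2*(s1*m1*p1+s2*m2*p2+s3*m3*p3)))
   with (a1 := a1) (a2 := a2) (a3 := a3); auto.
  - unfold B1, B2, B3. RtoC_push. ring.
  - intros t1 t2 t3 Ht. destruct (HT t1 t2 t3 Ht) as [_ L]. rewrite <- L, G2, G3. field. auto. }
 destruct (conformal_dual _ _ _ _ _ _ _ _ _ _ a1 a2 a3 HK) as (HB & _). fold B1 B2 B3 in HB. rewrite Hnull, Cmult_0_r in HB.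
 destruct (conformal_dual _ _ _ _ _ _ _ _ _ _ n1 n2 n3 HR) as (HN & _).
 rewrite <- !RtoC_mult, <- !RtoC_plus in HN.
 replace (p1*n1+p2*n2+p3*n3) with (mu*c1) in HN by lra. replace (q1*n1+q2*n2+q3*n3) with (mu*c2) in HN by lra.
 replace (m1*n1+m2*n2+m3*n3) with (mu*c3) in HN by lra.
 have HnB : (n1*B1+n2*B2+n3*B3 = 0)%C.
 { transitivity (RtoC (n1*p1+n2*p2+n3*p3)*a1+RtoC (n1*q1+n2*q2+n3*q3)*a2+RtoC (n1*m1+n2*m2+n3*m3)*a3)%C.
  - unfold B1, B2, B3. RtoC_push. ring.
  - rewrite G1, G2, G3. transitivity (mu*(c1*a1+c2*a2+c3*a3))%C; [RtoC_push; ring|rewrite Htan; ring]. }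
 have HP := hopf_quartic_real B1 B2 B3 n1 n2 n3 s1 s2 s3 (cos (2*phiP z1)) (cos (2*phiP z2)) (cos (2*phiP z3)) 1
  HB HnB (phiP1_sq z1) (phiP1_sq z2) (phiP1_sq z3) (sin_sq_cos _) (sin_sq_cos _) (sin_sq_cos _)
  ltac:(rewrite Rmult_1_l; apply sin_cos_sum_zero; lra) ltac:(rewrite Rmult_1_l; apply sin_cos_sum_zero; lra)
  ltac:(rewrite Rmult_1_l; apply sin_cos_sum_zero; lra).
 have HD := hopf_quartic_real a1 a2 a3 c1 c2 c3 h1 h2 h3 (cosh (2*u1)) (cosh (2*u2)) (cosh (2*u3)) (-1)
  Hnull Htan X1 X2 X3 (sinh_sq_cosh _) (sinh_sq_cosh _) (sinh_sq_cosh _)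
  ltac:(apply sinh_cosh_sum_zero; lra) ltac:(apply sinh_cosh_sum_zero; lra) ltac:(apply sinh_cosh_sum_zero; lra).
 have Hn : n1^2+n2^2+n3^2 <> 0.
 { have Q := pow2_ge_0 n1. have Q' := pow2_ge_0 n2. have Q'' := pow2_ge_0 n3. intros E.
  destruct separable_minimal_P as (_ & _ & _ & _ & _ & _ & Hm).
  destruct (Hm (z1, z2, z3)) as [Hg _]; [repeat split; exact Hz|]. apply Hg. rewrite grad_sep.
  rewrite (is_derive_unique _ _ _ (is_derive_phiP z1)), (is_derive_unique _ _ _ (is_derive_phiP z2)),
   (is_derive_unique _ _ _ (is_derive_phiP z3)). fold n1 n2 n3.
  have Z : forall t : R, t^2 = 0 -> t = 0 by (intros t Ht; apply (sum_sq_eq_0 t 0); lra).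
  rewrite (Z n1), (Z n2), (Z n3) by lra. reflexivity. }
 rewrite Rmult_1_l in HP. set (Sn := (s1*B1^2+s2*B2^2+s3*B3^2)%C) in *.
 set (Sd := (h1*a1^2+h2*a2^2+h3*a3^2)%C) in *.
 set (QB := (B1^4+B2^4+B3^4)%C) in *. set (QA := (a1^4+a2^4+a3^4)%C) in *.
 rewrite <- !RtoC_pow, <- !RtoC_plus, <- RtoC_mult in HN.
 have HN' : rho*(n1^2+n2^2+n3^2) = mu^2*(c1^2+c2^2+c3^2) by (apply RtoC_inj in HN; rewrite <- HN; ring).
 set (N := n1^2+n2^2+n3^2) in *. have N0 : RtoC N <> 0%C by (intros E'; apply RtoC_inj in E'; auto).
 transitivity (/ N*(N*QB))%C; [field; auto|]. rewrite <- HP.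
 replace Sn with (- mu*Sd)%C by (rewrite <- (Cplus_0_l (- mu*Sd)%C), <- Hform; ring).
 transitivity (/ N*(mu^2*(2*Sd^2)))%C; [ring|]. rewrite HD.
 transitivity (- (/ N*(RtoC (mu^2*(c1^2+c2^2+c3^2))*QA)))%C; [RtoC_push; ring|].
 rewrite <- HN', RtoC_mult. field. auto.
Qed.

(** The stereographic coordinate of a normal [c] of length [nu]. *)
Definition gauss (c1 c2 c3 nu : R) : C := (c1/(nu-c3), c2/(nu-c3)).

(** The null vector at the stereographic coordinate of a normal spans a null direction of the
    complexified tangent plane. *)
Lemma null_vector_tangent (c1 c2 c3 nu : R) : nu^2 = c1^2+c2^2+c3^2 -> nu-c3 <> 0 ->
 let z := gauss c1 c2 c3 nu in
 (c1*(1-z^2)+c2*(Ci*(1+z^2))+c3*(2*z) = 0)%C.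
Proof.
 intros Hnu Hd z. unfold z, gauss. set (d := nu-c3) in *.
 have E : c1^2+c2^2 = 2*nu*d-d^2 by (unfold d; lra).
 have E3 : c3 = nu-d by (unfold d; ring).
 have E' : (c1/d)^2+(c2/d)^2 = 2*nu/d-1.
 { replace ((c1/d)^2+(c2/d)^2) with ((c1^2+c2^2)/d^2) by (field; auto). rewrite E. field. auto. }
 apply injective_projections; simpl.
 - transitivity (c1*(1-((c1/d)^2+(c2/d)^2)+2*c3/d)); [field; auto|]. rewrite E', E3. field. auto.
 - transitivity (c2*(1-((c1/d)^2+(c2/d)^2)+2*c3/d)); [field; auto|]. rewrite E', E3. field. auto.
Qed.

Lemma null_vector_null (z : C) : ((1-z^2)^2+(Ci*(1+z^2))^2+(2*z)^2 = 0)%C.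
Proof.
 have E : (Ci^2 = -1)%C by (apply injective_projections; simpl; ring).
 transitivity ((1-z^2)^2+Ci^2*(1+z^2)^2+(2*z)^2)%C; [ring|]. rewrite E. ring.
Qed.

(** Every null vector is a multiple of [(1 - z^2, i (1 + z^2), 2 z)], with [z = a3 / (a1 - i a2)],
    except on the line [a1 = i a2], [a3 = 0]. *)
Lemma anti_invariant_of_null_vectors (k p1 p2 p3 q1 q2 q3 m1 m2 m3 : R) :
 (forall z : C, let a1 := (1-z^2)%C in let a2 := (Ci*(1+z^2))%C in let a3 := (2*z)%C in
  ((p1*a1+q1*a2+m1*a3)^4+(p2*a1+q2*a2+m2*a3)^4+(p3*a1+q3*a2+m3*a3)^4
  + k*(a1^4+a2^4+a3^4) = 0)%C) ->
 anti_invariant k p1 p2 p3 q1 q2 q3 m1 m2 m3.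
Proof.
 intros H a1 a2 a3 Hn.
 have I2 : (Ci*Ci = -1)%C by (apply injective_projections; simpl; ring).
 have N2 : RtoC 2 <> 0%C by (intros E; apply RtoC_inj in E; lra).
 destruct (classic ((a1-Ci*a2)%C = 0%C)) as [E|E].
 - have A3 : a3 = 0%C.
  { destruct (classic (a3 = 0%C)) as [|N]; auto. exfalso.
   have Q : (a3*a3 = 0)%C.
   { transitivity ((a1^2+a2^2+a3^2)-(a1-Ci*a2)*(a1+Ci*a2)-(1+Ci*Ci)*(a2*a2))%C; [ring|].
    rewrite Hn, E, I2. ring. }
   apply (Cmult_neq_0 a3 a3); auto. }
  have A1 : a1 = (Ci*a2)%C by (rewrite <- (Cplus_0_r (Ci*a2)%C), <- E; ring).
  have H0 := H 0%C. cbv zeta in H0.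
  (* This line belongs to [z] at infinity. It is conjugate to the one at [z = 0], and the
     coefficients are real. *)
  have Hc : ((p1*Ci+q1)^4+(p2*Ci+q2)^4+(p3*Ci+q3)^4+k*(Ci^4+1) = 0)%C.
  { have Hr := f_equal fst H0. have Hi := f_equal snd H0. simpl in Hr, Hi.
   apply injective_projections; simpl; lra. }
  rewrite A1, A3.
  transitivity (a2^4*((p1*Ci+q1)^4+(p2*Ci+q2)^4+(p3*Ci+q3)^4+k*(Ci^4+1))
   - k*((Ci*a2)^4+a2^4+0^4))%C; [ring|]. rewrite Hc. ring.
 - set (L := ((a1-Ci*a2)/2)%C).
  have HL : L <> 0%C.
  { unfold L. intros Z. apply E. transitivity (2*((a1-Ci*a2)/2))%C; [field; auto|]. rewrite Z. ring. }
  have A3 : (a3^2 = - ((a1-Ci*a2)*(a1+Ci*a2)))%C.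
  { transitivity ((a1^2+a2^2+a3^2)-(a1-Ci*a2)*(a1+Ci*a2)-(1+Ci*Ci)*(a2*a2))%C; [ring|].
   rewrite Hn, I2. ring. }
  set (z := (a3/(2*L))%C).
  have Z2 : (z^2 = - ((a1+Ci*a2)/(2*L)))%C.
  { unfold z. transitivity (a3^2/(4*L^2))%C; [field; auto|]. rewrite A3.
   transitivity (- ((2*L)*(a1+Ci*a2))/(4*L^2))%C.
   - f_equal. f_equal. unfold L. field. auto.
   - field. auto. }
  have E1 : a1 = (L*(1-z^2))%C.
  { rewrite Z2. transitivity (L+(a1+Ci*a2)/2)%C; [unfold L; field; auto|field; auto]. }
  have E2 : a2 = (L*(Ci*(1+z^2)))%C.
  { rewrite Z2. transitivity (Ci*(L-(a1+Ci*a2)/2))%C; [|field; auto].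
   transitivity (- (Ci*Ci)*a2)%C; [rewrite I2; ring|unfold L; field; auto]. }
  have E3 : a3 = (L*(2*z))%C by (unfold z; field; auto).
  specialize (H z). cbv zeta in H. rewrite E1, E2, E3.
  match type of H with ?X = _ =>
   transitivity (L^4*X-k*((L*(1-z^2))^4+(L*(Ci*(1+z^2)))^4+(L*(2*z))^4))%C end;
   [ring|rewrite H; ring].
Qed.

Lemma etaD_branch_of_inverse (j : Z) (psi : R -> R) :
 (forall u, cell j (psi u) /\ etaD (psi u) = u /\ is_derive psi u (/ etaD1 (psi u))) -> etaD_branch psi.
Proof. intros H u. destruct (H u) as (Hc & ?). split; [apply (cell_sD j); auto|auto]. Qed.

Lemma etaD1_pos (t : R) : domD t -> 0 < etaD1 t.
Proof.
 intros H. apply domD_iff in H. unfold etaD1. apply Rdiv_lt_0_compat; auto. have V := vD_pos t. lra.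
Qed.

Lemma similarity_conformal (T : R3 -> R3) : similarity T -> exists rho b1 b2 b3 p1 p2 p3 q1 q2 q3 m1 m2 m3, 0 < rho /\
 conformal rho p1 p2 p3 q1 q2 q3 m1 m2 m3 /\ conformal rho p1 q1 m1 p2 q2 m2 p3 q3 m3 /\
 forall x y z, T (x, y, z) = (b1+(p1*x+q1*y+m1*z), b2+(p2*x+q2*y+m2*z), b3+(p3*x+q3*y+m3*z)).
Proof.
 intros (r & [[b1 b2] b3] & [[p1 p2] p3] & [[q1 q2] q3] & [[m1 m2] m3] & Hr & Hpp & Hqq & Hpq & Hm & HT).
 unfold dot in Hpp, Hqq, Hpq. injection Hm as -> -> ->.
 exists (r*r), b1, b2, b3, (r*p1), (r*p2), (r*p3), (r*q1), (r*q2), (r*q3),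
  (r*(p2*q3-p3*q2)), (r*(p3*q1-p1*q3)), (r*(p1*q2-p2*q1)).
 split; [apply Rmult_lt_0_compat; auto|]. unfold conformal. simpl pow. rewrite !Rmult_1_r.
 split; [|split].
 - split; [split; [|split]|split; [|split]]; nsatz.
 - split; [split; [|split]|split; [|split]]; nsatz.
 - intros x y z. rewrite HT, !scal_R3, !plus_R3, scal_R3, plus_R3. f_equal; [f_equal|]; ring.
Qed.

(** On a curve in the piece of D the tangent plane changes, so the pointwise identity holds for
    infinitely many Gauss coordinates. It is polynomial in the coordinate, hence holds for all null
    vectors, against [anti_invariant_absurd] with [k = rho]. *)
Lemma no_similar_piece : ~ exists (T : R3 -> R3) (O : R3 -> Prop),
 similarity T /\ open O /\ (exists p, O p /\ surfaceD p) /\ forall p, O p -> surfaceD p -> surfaceP (T p).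
Proof.
 intros (T & O & HT & HO & ([[x y] z] & Op & (Dx & Dy & Dz & Hs)) & Hmap). unfold sep_fun in Hs.
 destruct (similarity_conformal T HT) as (rho & b1 & b2 & b3 & p1 & p2 & p3 & q1 & q2 & q3 & m1 & m2 & m3 & Hrho & HR & HK & HT').
 have Hf : forall x, domD x -> exists f, f (etaD x) = x /\ etaD_branch f /\ forall u, domD (f u).
 { intros t Dt. destruct (domD_cell t Dt) as (i & Ei & Ct). destruct (etaD_inverse i) as (f & F & F'). exists f. split; [auto|].
  split; [apply (etaD_branch_of_inverse i), F|]. intros u. apply (cell_even_domD i); auto. apply F. }
 destruct (Hf x Dx) as (f1 & E1 & F1 & G1), (Hf y Dy) as (f2 & E2 & F2 & G2), (Hf z Dz) as (f3 & E3 & F3 & G3). clear Hf.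
 rewrite !phiD_eta in Hs by auto. set (u1 := etaD x) in *. set (u2 := etaD y) in *. set (u3 := etaD z) in *.
 have HD : forall v1 v2 v3, v1+v2+v3 = 0 -> surfaceD (f1 v1, f2 v2, f3 v3).
 { intros v1 v2 v3 Hv. split; [auto|]. split; [auto|]. split; [auto|]. unfold sep_fun. rewrite !phiD_eta by auto.
  destruct (F1 v1) as (_ & -> & _), (F2 v2) as (_ & -> & _), (F3 v3) as (_ & -> & _). auto. }
 have Hnear : exists eps, 0 < eps /\ forall v1 v2 v3, Rabs (v1-u1) < eps -> Rabs (v2-u2) < eps -> Rabs (v3-u3) < eps ->
  O (f1 v1, f2 v2, f3 v3).
 { destruct (HO _ Op) as [d Hd].
  have L : forall f u t, etaD_branch f -> f u = t -> exists e : posreal, forall v, Rabs (v-u) < e -> ball t d (f v).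
  { intros f u t F <-. destruct (is_derive_continuous _ _ _ (proj2 (proj2 (F u))) (ball (f u) d)) as [e He]; [exists d; auto|].
   exists e. intros v Hv. apply He, Hv. }
  destruct (L f1 u1 x F1 E1) as [ex Hx], (L f2 u2 y F2 E2) as [ey Hy], (L f3 u3 z F3 E3) as [ez Hz].
  exists (Rmin ex (Rmin ey ez)). split; [repeat apply Rmin_pos; apply cond_pos|]. have A1 := Rmin_l ex (Rmin ey ez).
  have A2 := Rmin_r ex (Rmin ey ez). have A3 := Rmin_l ey ez. have A4 := Rmin_r ey ez.
  intros v1 v2 v3 V1 V2 V3. apply Hd. split; [split|]; [apply Hx|apply Hy|apply Hz]; lra. }
 destruct Hnear as (eps & Heps & Hnear).
 have Hpt : forall v1 v2 v3, v1+v2+v3 = 0 -> Rabs (v1-u1) < eps/2 -> Rabs (v2-u2) < eps/2 -> Rabs (v3-u3) < eps/2 ->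
  forall a1 a2 a3 : C, (a1^2+a2^2+a3^2 = 0)%C ->
  (etaD1 (f1 v1)*a1+etaD1 (f2 v2)*a2+etaD1 (f3 v3)*a3 = 0)%C ->
  ((p1*a1+q1*a2+m1*a3)^4+(p2*a1+q2*a2+m2*a3)^4+(p3*a1+q3*a2+m3*a3)^4
  = - rho*(a1^4+a2^4+a3^4))%C.
 { intros v1 v2 v3 Hv V1 V2 V3. apply (pointwise_anti_invariant f1 f2 f3 v1 v2 v3 b1 b2 b3); auto.
  intros al1 al2 al3 Hal. set (M := 1+Rabs al1+Rabs al2+Rabs al3).
  have A1 := Rabs_pos al1. have A2 := Rabs_pos al2. have A3 := Rabs_pos al3.
  have HM : 0 < eps/2/M by (apply Rdiv_lt_0_compat; unfold M; lra).
  exists (mkposreal _ HM). intros s Hsm. change (Rabs (s-0) < eps/2/M) in Hsm. rewrite Rminus_0_r in Hsm.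
  have Hb : forall v u al, Rabs (v-u) < eps/2 -> Rabs al <= M -> Rabs (v+s*al-u) < eps.
  { intros v u al Hvu Hal'. replace (v+s*al-u) with ((v-u)+s*al) by ring.
   eapply Rle_lt_trans; [apply Rabs_triang|]. rewrite Rabs_mult.
   assert (Rabs s*Rabs al <= eps/2/M*M) by (apply Rmult_le_compat; try apply Rabs_pos; lra).
   replace (eps/2/M*M) with (eps/2) in H by (field; unfold M; lra). lra. }
  have Hon := Hmap (f1 (v1+s*al1), f2 (v2+s*al2), f3 (v3+s*al3))
   (Hnear _ _ _ (Hb v1 u1 al1 V1 ltac:(unfold M; lra)) (Hb v2 u2 al2 V2 ltac:(unfold M; lra)) (Hb v3 u3 al3 V3 ltac:(unfold M; lra))).
  rewrite HT' in Hon. apply Hon, HD. transitivity ((v1+v2+v3)+s*(al1+al2+al3)); [ring|rewrite Hv, Hal; ring]. }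
  (* moving [u2] away from [0] changes the tangent plane, which gives infinitely many null directions *)
 set (sg := if Rle_dec 0 u2 then 1 else -1). have Hsg : 0 <= sg*u2 /\ sg*sg = 1 by (unfold sg; destruct (Rle_dec 0 u2); lra).
 set (sn := fun n : nat => eps/4/(INR n+1)).
 have Hsn : forall n, 0 < sn n <= eps/4.
 { intros n. unfold sn. have P := pos_INR n. split; [apply Rdiv_lt_0_compat; lra|].
  apply (Rmult_le_reg_r (INR n+1)); [lra|]. unfold Rdiv at 1. rewrite Rmult_assoc, Rinv_l by lra. nra. }
 set (c1 := etaD1 (f1 u1)). set (c2 := fun n => etaD1 (f2 (u2+sg*sn n))). set (c3 := fun n => etaD1 (f3 (u3-sg*sn n))).
 have P1 : 0 < c1 by (apply etaD1_pos; auto). have P2 : forall n, 0 < c2 n by (intros; apply etaD1_pos; auto).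
 set (nu := fun n => sqrt (c1^2+c2 n^2+c3 n^2)).
 have Hnu : forall n, nu n^2 = c1^2+c2 n^2+c3 n^2.
 { intros n. apply pow2_sqrt. have A1 := pow2_ge_0 c1. have A2 := pow2_ge_0 (c2 n). have A3 := pow2_ge_0 (c3 n). lra. }
 have Hd : forall n, 0 < nu n-c3 n.
 { intros n. have Q1 := Hnu n. have Q2 : 0 < c1^2 by (apply pow_lt; auto). have Q3 := pow2_ge_0 (c2 n).
  have Q4 : 0 <= nu n by apply sqrt_pos. nra. }
 apply (anti_invariant_absurd rho rho p1 p2 p3 q1 q2 q3 m1 m2 m3); auto. apply anti_invariant_of_null_vectors. cbv zeta.
 match goal with |- forall z, ?f = _ => apply (polyfun_zero (fun z => f) (fun n => gauss c1 (c2 n) (c3 n) (nu n))) end.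
 - repeat first [apply polyfun_const|apply polyfun_id|apply polyfun_minus|apply polyfun_plus|apply polyfun_mult|apply polyfun_pow].
 - intros n l E. injection E as A1 A2. have Dn := Hd n. have Dl := Hd l. have Q := P2 n. have Q' := P2 l.
  have Ed : nu n-c3 n = nu l-c3 l.
  { apply (Rmult_eq_reg_l (c1/(nu n-c3 n)/(nu l-c3 l))).
   - rewrite A1 at 2. field. lra.
   - apply Rgt_not_eq, Rdiv_lt_0_compat; [apply Rdiv_lt_0_compat|]; lra. }
  have Ec : c2 n = c2 l by (rewrite Ed in A2; apply (Rmult_eq_reg_r (/ (nu l-c3 l))); [exact A2|apply Rinv_neq_0_compat; lra]).
  have X : forall n, cosh (2*(sg*u2+sn n)) = (c2 n^2-1)/2.
  { intros n'. unfold c2. destruct (F2 (u2+sg*sn n')) as (Hc & Hv & _). rewrite etaD1_sq, Hv by auto.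
   destruct (Rle_dec 0 u2) as [L|L]; unfold sg; destruct (Rle_dec 0 u2); try contradiction.
   - replace (u2+1*sn n') with (1*u2+sn n') by ring. field.
   - rewrite <- cosh_neg. replace (- (2*(-1*u2+sn n'))) with (2*(u2 + -1*sn n')) by ring. field. }
  have Es : sn n = sn l.
  { have Hn := Hsn n. have Hl := Hsn l. have Ex : cosh (2*(sg*u2+sn n)) = cosh (2*(sg*u2+sn l)) by (rewrite !X, Ec; auto).
   have Inj : forall a b, 0 < a -> a < b -> cosh a <> cosh b.
   { intros a b Ha Hb Eab. have A3 := cosh_sq a. have A4 := cosh_sq b. rewrite Eab in A3.
    apply sinh_lt in Ha, Hb. rewrite sinh_0 in Ha. nra. }
   destruct (Rtotal_order (sn n) (sn l)) as [L|[L|L]]; auto; exfalso; [apply Inj in Ex|symmetry in Ex; apply Inj in Ex]; auto; lra. }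
  apply INR_eq. have B1 := pos_INR n. have B2 := pos_INR l. unfold sn in Es.
  apply (f_equal (fun t => / t)) in Es. replace (/ (eps/4/(INR n+1))) with (4/eps*(INR n+1)) in Es by (field; lra).
  replace (/ (eps/4/(INR l+1))) with (4/eps*(INR l+1)) in Es by (field; lra).
  apply Rmult_eq_reg_l in Es; [lra|]. apply Rgt_not_eq, Rdiv_lt_0_compat; lra.
 - intros n. have Sn := Hsn n. have Ab : Rabs (sg*sn n) < eps/2.
  { unfold sg. destruct (Rle_dec 0 u2); apply Rabs_def1; lra. }
  rewrite (Hpt u1 (u2+sg*sn n) (u3-sg*sn n)).
  + ring.
  + lra.
  + replace (u1-u1) with 0 by ring. rewrite Rabs_R0. lra.
  + replace (u2+sg*sn n-u2) with (sg*sn n) by ring. auto.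
  + replace (u3-sg*sn n-u3) with (- (sg*sn n)) by ring. rewrite Rabs_Ropp. auto.
  + apply null_vector_null.
  + apply null_vector_tangent; [apply Hnu|apply Rgt_not_eq, Hd].
Qed.

Lemma Ci_sq : (Ci*Ci = - (1))%C.
Proof. apply injective_projections; simpl; ring. Qed.

Lemma sqrt2_pos : 0 < sqrt 2.
Proof. apply sqrt_lt_R0. lra. Qed.

(** * Complex-valued functions of a real variable *)

Definition cderive (f : R -> C) (t : R) (l : C) : Prop :=
 is_derive (fun s => Re (f s)) t (Re l) /\ is_derive (fun s => Im (f s)) t (Im l).

Definition ccont {T : UniformSpace} (f : T -> C) (t : T) : Prop :=
 continuous (fun s => Re (f s)) t /\ continuous (fun s => Im (f s)) t.

Lemma is_derive_C (f : R -> C) (t : R) (l : C) :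
 is_derive (K := R_AbsRing) (V := C_R_NormedModule) f t l <-> cderive f t l.
Proof.
 split.
 - intros H. split.
  + eapply filterdiff_ext_lin; [apply (filterdiff_comp' f (fun z : R*R => fst z) t _ _ H (filterdiff_linear _ is_linear_fst))|].
   intros y. reflexivity.
  + eapply filterdiff_ext_lin; [apply (filterdiff_comp' f (fun z : R*R => snd z) t _ _ H (filterdiff_linear _ is_linear_snd))|].
   intros y. reflexivity.
 - intros [H1 H2].
  have L : is_linear (K := R_AbsRing) (U := prod_NormedModule R_AbsRing R_NormedModule R_NormedModule)
   (V := C_R_NormedModule) (fun t : R*R => (fst t, snd t)).
  { split; [intros [] []; reflexivity|intros k []; reflexivity|].
   exists 1. split; [lra|]. intros [x y]. rewrite Rmult_1_l. apply Rle_refl. }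
  apply (filterdiff_ext (fun s => (Re (f s), Im (f s)))); [intros s; symmetry; apply surjective_pairing|].
  eapply filterdiff_ext_lin.
  + apply (filterdiff_comp'_2 (fun s => Re (f s)) (fun s => Im (f s)) (fun x y : R => ((x, y) : C_R_NormedModule))
    t _ _ (fun x y : R => ((x, y) : C_R_NormedModule)) H1 H2).
   apply (filterdiff_linear _ L).
  + intros y. reflexivity.
Qed.

Lemma continuous_C (f : R -> C) (t : R) : continuous f t <-> ccont f t.
Proof.
 split.
 - intros H. split; [apply (continuous_comp f (fun z : R*R => fst z))|apply (continuous_comp f (fun z : R*R => snd z))]; auto;
   [apply continuous_fst|apply continuous_snd].
 - intros [H1 H2]. apply (continuous_ext (fun s => (Re (f s), Im (f s)))); [intros s; symmetry; apply surjective_pairing|].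
  apply (continuous_comp_2 (fun s => Re (f s)) (fun s => Im (f s)) (fun x y => (x, y))); auto.
  apply (continuous_ext (fun z : R*R => z)); [intros []; reflexivity|apply continuous_id].
Qed.

Lemma cderive_ccont (f : R -> C) (t : R) (l : C) : cderive f t l -> ccont f t.
Proof. intros [H1 H2]. split; [apply (is_derive_continuous _ _ _ H1)|apply (is_derive_continuous _ _ _ H2)]. Qed.

Lemma cderive_eq (f : R -> C) (t : R) (l l' : C) : cderive f t l -> l = l' -> cderive f t l'.
Proof. intros H <-. exact H. Qed.

Lemma cderive_ext (f g : R -> C) (t : R) (l : C) : (forall s, f s = g s) -> cderive f t l -> cderive g t l.
Proof. intros E [H1 H2]. split; [eapply is_derive_ext; [|exact H1]|eapply is_derive_ext; [|exact H2]]; intros s; simpl; rewrite E; auto. Qed.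

Lemma cderive_const (c : C) (t : R) : cderive (fun _ => c) t 0%C.
Proof. split; [apply (is_derive_const (Re c))|apply (is_derive_const (Im c))]. Qed.

Lemma cderive_plus (f g : R -> C) (t : R) (l m : C) :
 cderive f t l -> cderive g t m -> cderive (fun s => f s+g s)%C t (l+m)%C.
Proof. intros [F1 F2] [G1 G2]. split; apply (is_derive_plus (K := R_AbsRing) (V := R_NormedModule)); auto. Qed.

Lemma cderive_mult (f g : R -> C) (t : R) (l m : C) :
 cderive f t l -> cderive g t m -> cderive (fun s => f s*g s)%C t (l*g t+f t*m)%C.
Proof.
 intros [F1 F2] [G1 G2].
 pose (f1 := fun s => Re (f s)). pose (f2 := fun s => Im (f s)). pose (g1 := fun s => Re (g s)). pose (g2 := fun s => Im (g s)).
 change (is_derive f1 t (Re l)) in F1. change (is_derive f2 t (Im l)) in F2.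
 change (is_derive g1 t (Re m)) in G1. change (is_derive g2 t (Im m)) in G2.
 split.
 - apply (is_derive_ext (fun s => f1 s*g1 s-f2 s*g2 s)); [reflexivity|].
  derive_auto. unfold f1, f2, g1, g2, Re, Im. simpl. ring.
 - apply (is_derive_ext (fun s => f1 s*g2 s+f2 s*g1 s)); [reflexivity|].
  derive_auto. unfold f1, f2, g1, g2, Re, Im. simpl. ring.
Qed.

Lemma cderive_conj (f : R -> C) (t : R) (l : C) : cderive f t l -> cderive (fun s => Cconj (f s)) t (Cconj l).
Proof. intros [F1 F2]. split; [exact F1|]. apply (is_derive_opp (K := R_AbsRing) (V := R_NormedModule)). exact F2. Qed.

Lemma cderive_unique (f : R -> C) (t : R) (l m : C) : cderive f t l -> cderive f t m -> l = m.
Proof.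
 intros [F1 F2] [G1 G2]. apply is_derive_unique in F1, F2, G1, G2.
 apply injective_projections; [rewrite F1 in G1; exact G1|rewrite F2 in G2; exact G2].
Qed.

Lemma ccont_const {T : UniformSpace} (c : C) (t : T) : ccont (fun _ => c) t.
Proof. split; apply continuous_const. Qed.

Lemma ccont_plus {T : UniformSpace} (f g : T -> C) (t : T) : ccont f t -> ccont g t -> ccont (fun s => f s+g s)%C t.
Proof. intros [F1 F2] [G1 G2]. split; apply (continuous_plus (V := R_NormedModule)); auto. Qed.

Lemma ccont_mult {T : UniformSpace} (f g : T -> C) (t : T) : ccont f t -> ccont g t -> ccont (fun s => f s*g s)%C t.
Proof.
 intros [F1 F2] [G1 G2]. split.
 - apply (continuous_minus (V := R_NormedModule) (fun s => Re (f s)*Re (g s)) (fun s => Im (f s)*Im (g s)));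
   apply (continuous_mult (K := R_AbsRing)); auto.
 - apply (continuous_plus (V := R_NormedModule) (fun s => Re (f s)*Im (g s)) (fun s => Im (f s)*Re (g s)));
   apply (continuous_mult (K := R_AbsRing)); auto.
Qed.

Lemma norm2_pos (z : C) : z <> 0%C -> 0 < Re z^2+Im z^2.
Proof.
 intros H. assert (0 <= Re z^2) by apply pow2_ge_0. assert (0 <= Im z^2) by apply pow2_ge_0.
 destruct (Req_dec (Re z^2+Im z^2) 0) as [E|]; [|lra]. apply sum_sq_eq_0 in E. destruct E.
 exfalso. apply H. apply injective_projections; auto.
Qed.

Lemma ccont_inv {T : UniformSpace} (f : T -> C) (t : T) : ccont f t -> f t <> 0%C -> ccont (fun s => / f s)%C t.
Proof.
 intros [F1 F2] Hn. have Hp := norm2_pos _ Hn.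
 have Hd : continuous (fun s => / (Re (f s)^2+Im (f s)^2)) t.
 { simpl. unfold Re, Im in *. cont. apply Rgt_not_eq. exact Hp. }
 split.
 - apply (continuous_mult (K := R_AbsRing) (fun s => Re (f s))); auto.
 - apply (continuous_mult (K := R_AbsRing) (fun s => - Im (f s))); auto. cont.
Qed.

Lemma ccont_div {T : UniformSpace} (f g : T -> C) (t : T) : ccont f t -> ccont g t -> g t <> 0%C -> ccont (fun s => f s/g s)%C t.
Proof. intros. apply ccont_mult; auto. apply ccont_inv; auto. Qed.

Lemma ccont_pow {T : UniformSpace} (f : T -> C) (n : nat) (t : T) : ccont f t -> ccont (fun s => f s^n)%C t.
Proof. intros H. induction n as [|n IH]; [apply ccont_const|]. apply (ccont_mult f (fun s => f s^n)%C); auto. Qed.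

(** The principal square root, on the right half-plane. *)
Ltac ccon := first [assumption|lazymatch goal with
 | |- ccont (fun _ => ?c) _ => apply ccont_const
 | |- ccont (fun s => @?f s + @?g s)%C _ => apply (ccont_plus f g); ccon
 | |- ccont (fun s => @?f s * @?g s)%C _ => apply (ccont_mult f g); ccon
 | |- ccont (fun s => @?f s / @?g s)%C _ => apply (ccont_div f g); ccon
 | |- ccont (fun s => @?f s^?n)%C _ => apply (ccont_pow f n); ccon
 | _ => auto
 end].

(** The half-angle formula: the real part is the root of [(|s| + Re s) / 2], the imaginary part
    follows from it. *)
Definition csqrt (s : C) : C :=
 let x := sqrt ((sqrt (Re s^2+Im s^2)+Re s)/2) in (x, Im s/(2*x)).

Lemma csqrt_arg_pos (x y : R) : 0 < x -> 0 < (sqrt (x^2+y^2)+x)/2.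
Proof. intros H. assert (0 <= sqrt (x^2+y^2)) by apply sqrt_pos. lra. Qed.

Lemma csqrt_sq (s : C) : 0 < Re s -> (csqrt s*csqrt s)%C = s.
Proof.
 destruct s as [x y]. simpl. intros H. unfold csqrt. simpl Re. simpl Im.
 have Hp := csqrt_arg_pos x y H. have Hs := sqrt_lt_R0 _ Hp.
 have E := pow2_sqrt _ (Rlt_le _ _ Hp). set (u := sqrt ((sqrt (x^2+y^2)+x)/2)) in *.
 have Q : sqrt (x^2+y^2)^2 = x^2+y^2.
 { apply pow2_sqrt. assert (0 <= x^2) by apply pow2_ge_0. assert (0 <= y^2) by apply pow2_ge_0. lra. }
 have Ey : y^2 = 4*u^2*(u^2-x) by (rewrite E; transitivity (sqrt (x^2+y^2)^2-x^2); [lra|field]).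
 apply injective_projections; simpl.
 - replace (u*u-y/(2*u)*(y/(2*u))) with (u^2-y^2/(4*u^2)) by (field; lra). rewrite Ey. field. lra.
 - field. lra.
Qed.

Lemma csqrt_unique (u s : C) : (u*u)%C = s -> 0 < Re u -> u = csqrt s.
Proof.
 destruct u as [x y]. intros <-. simpl. intros H. unfold csqrt. simpl Re. simpl Im.
 replace ((x*x-y*y)^2+(x*y+y*x)^2) with ((x^2+y^2)^2) by ring.
 rewrite sqrt_pow2 by (apply Rplus_le_le_0_compat; apply pow2_ge_0). replace ((x^2+y^2+(x*x-y*y))/2) with (x^2) by field.
 rewrite sqrt_pow2 by lra. apply injective_projections; simpl; [auto|field; lra].
Qed.

Lemma csqrt_derivable (S : R -> C) (t : R) (l : C) : cderive S t l -> 0 < Re (S t) -> exists m, cderive (fun s => csqrt (S s)) t m.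
Proof.
 intros [H1 H2] Hp. pose (x := fun s => Re (S s)). pose (y := fun s => Im (S s)).
 change (is_derive x t (Re l)) in H1. change (is_derive y t (Im l)) in H2. change (0 < x t) in Hp.
 have P1 := csqrt_arg_pos (x t) (y t) Hp. have P2 := sqrt_lt_R0 _ P1.
 have P3 : 0 < x t^2+y t^2.
 { assert (0 < x t^2) by (apply pow2_gt_0; lra). assert (0 <= y t^2) by apply pow2_ge_0. lra. }
 have E1 : ex_derive (fun s => sqrt ((sqrt (x s^2+y s^2)+x s)/2)) t.
 { auto_derive. simpl pow in *. unfold Rdiv in P1. repeat split; auto; eexists; eassumption. }
 have E2 : ex_derive (fun s => y s/(2*sqrt ((sqrt (x s^2+y s^2)+x s)/2))) t.
 { apply ex_derive_div; [eexists; eassumption|apply ex_derive_scal; exact E1|lra]. }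
 destruct E1 as [l1 E1], E2 as [l2 E2]. exists (l1, l2). split; [exact E1|exact E2].
Qed.

(** Continuous square roots of differentiable functions are differentiable away from zero. *)
Lemma cderive_sqrt (w S : R -> C) (t : R) (l : C) :
 cderive S t l -> ccont w t -> w t <> 0%C -> locally t (fun s => (w s*w s)%C = S s) ->
 cderive w t (l/(2*w t))%C.
Proof.
 intros HS Hw Hn Hsq.
 have H2 : RtoC 2 <> 0%C by (intros E; apply RtoC_inj in E; lra).
 set (c := (/ w t)%C).
 have Hu : locally t (fun s => w s = (w t*csqrt ((c*c)*S s))%C).
 { have Hc : ccont (fun s => c*w s)%C t by (apply ccont_mult; auto using ccont_const).
  have H0 : Re (c*w t)%C = 1 by (unfold c; rewrite Cinv_l by auto; reflexivity).
  have Hpos : locally t (fun s => 0 < Re (c*w s)%C).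
  { destruct Hc as [Hc _]. apply (Hc (fun y => 0 < y)). rewrite H0. apply open_gt. lra. }
  generalize (filter_and _ _ Hpos Hsq). apply filter_imp. intros s [Hs Es].
  rewrite <- (csqrt_unique (c*w s)%C); [unfold c; field; auto| |auto]. rewrite <- Es. ring. }
 have Hd : cderive (fun s => (c*c)*S s)%C t ((c*c)*l)%C.
 { eapply cderive_eq; [apply (cderive_mult (fun _ => c*c)%C S); [apply cderive_const|exact HS]|]. ring. }
 destruct (csqrt_derivable _ _ _ Hd) as [m Hm].
 { have E : (c*c*S t)%C = RtoC 1.
  { have E' := locally_singleton _ _ Hsq. cbv beta in E'. rewrite <- E'. unfold c. field. auto. }
  rewrite E. simpl. lra. }
 have Hwd : cderive w t (w t*m)%C.
 { have Hm' := cderive_mult (fun _ => w t) _ t _ _ (cderive_const (w t) t) Hm. cbv beta in Hm'.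
  destruct Hm' as [D1 D2]. split.
  - apply (is_derive_ext_loc (fun s => Re (w t*csqrt ((c*c)*S s))%C)).
   + generalize Hu. apply filter_imp. intros s ->. reflexivity.
   + eapply is_derive_eq; [exact D1|]. f_equal. ring.
  - apply (is_derive_ext_loc (fun s => Im (w t*csqrt ((c*c)*S s))%C)).
   + generalize Hu. apply filter_imp. intros s ->. reflexivity.
   + eapply is_derive_eq; [exact D2|]. f_equal. ring. }
 have E : (2*w t*(w t*m))%C = l.
 { apply (cderive_unique S t); [|exact HS]. destruct (cderive_mult _ _ _ _ _ Hwd Hwd) as [D1 D2]. split.
  - apply (is_derive_ext_loc (fun s => Re (w s*w s)%C)).
   + generalize Hsq. apply filter_imp. intros s ->. reflexivity.
   + eapply is_derive_eq; [exact D1|]. f_equal. ring.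
  - apply (is_derive_ext_loc (fun s => Im (w s*w s)%C)).
   + generalize Hsq. apply filter_imp. intros s ->. reflexivity.
   + eapply is_derive_eq; [exact D2|]. f_equal. ring. }
 eapply cderive_eq; [exact Hwd|]. rewrite <- E. field. auto.
Qed.

(** * Paths of the Weierstrass representation *)

Definition P8 (z : C) : C := (1+14*z^4+z^8)%C.
Definition n1 (z : C) : C := (1-z^2)%C.
Definition n2 (z : C) : C := (Ci*(1+z^2))%C.
Definition n3 (z : C) : C := (2*z)%C.

Definition speed (k : C) (n : C -> C) (z dz w : R -> C) (t : R) : R := Re (k*n (z t)*dz t/w t)%C.

Definition lift_at (k : C) (z dz w : R -> C) (X Y Z : R -> R) (t : R) : Prop :=
 cderive z t (dz t) /\ ccont dz t /\ ccont w t /\ w t <> 0%C /\ (w t*w t)%C = P8 (z t) /\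
 is_derive X t (speed k n1 z dz w t) /\ is_derive Y t (speed k n2 z dz w t) /\ is_derive Z t (speed k n3 z dz w t).

Definition state (z w : R -> C) (X Y Z : R -> R) (t : R) : C*C*R3 := (z t, w t, (X t, Y t, Z t)).

(** The state contains the branch [w] besides the position, so that paths can be concatenated and
    reachability is transitive. *)
Definition reach (k : C) (s0 s1 : C*C*R3) : Prop :=
 exists z dz w X Y Z, (forall t, 0 <= t <= 1 -> lift_at k z dz w X Y Z t) /\
  state z w X Y Z 0 = s0 /\ state z w X Y Z 1 = s1.

Lemma ccont_n {T : UniformSpace} (z : T -> C) (t : T) : ccont z t ->
 ccont (fun t => n1 (z t)) t /\ ccont (fun t => n2 (z t)) t /\ ccont (fun t => n3 (z t)) t.
Proof.
 intros H. unfold n1, n2, n3. have H2 := ccont_pow z 2 t H. split; [|split].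
 - apply (ccont_plus (fun _ => 1%C) (fun t => - z t^2)%C); [apply ccont_const|].
  destruct (ccont_mult (fun _ => (-1)%C) _ t (ccont_const _ t) H2) as [E1 E2].
  split; [eapply continuous_ext; [|exact E1]|eapply continuous_ext; [|exact E2]]; intros s; simpl; ring.
 - ccon.
 - ccon.
Qed.

Lemma speed_continuous (k : C) (n : C -> C) (z dz w : R -> C) (t : R) :
 ccont (fun t => n (z t)) t -> ccont dz t -> ccont w t -> w t <> 0%C -> continuous (speed k n z dz w) t.
Proof.
 intros Hn Hd Hw Hw0. have H : ccont (fun t => k*n (z t)*dz t/w t)%C t by ccon. apply H.
Qed.

Lemma lift_speed_continuous (k : C) (z dz w : R -> C) (X Y Z : R -> R) (t : R) : lift_at k z dz w X Y Z t ->
 continuous (speed k n1 z dz w) t /\ continuous (speed k n2 z dz w) t /\ continuous (speed k n3 z dz w) t.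
Proof.
 intros (Hz & Hd & Hw & Hw0 & _). destruct (ccont_n z t (cderive_ccont _ _ _ Hz)) as (N1 & N2 & N3).
 split; [|split]; apply speed_continuous; auto.
Qed.

Lemma cderive_comp (f : R -> C) (g : R -> R) (t : R) (l : C) (m : R) :
 cderive f (g t) l -> is_derive g t m -> cderive (fun s => f (g s)) t (m*l)%C.
Proof.
 intros [H1 H2] Hg. split.
 - eapply is_derive_eq; [apply (is_derive_comp (fun s => Re (f s)) g); [exact H1|exact Hg]|].
  change (m*Re l = Re (m*l)%C). unfold Re. simpl. ring.
 - eapply is_derive_eq; [apply (is_derive_comp (fun s => Im (f s)) g); [exact H2|exact Hg]|].
  change (m*Im l = Im (m*l)%C). unfold Im. simpl. ring.
Qed.

Lemma ccont_comp (f : R -> C) (g : R -> R) (t : R) : ccont f (g t) -> continuous g t -> ccont (fun s => f (g s)) t.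
Proof. intros [H1 H2] Hg. split; [apply (continuous_comp g (fun s => Re (f s)))|apply (continuous_comp g (fun s => Im (f s)))]; auto. Qed.

Lemma ccont_RtoC (f : R -> R) (t : R) : continuous f t -> ccont (fun s => RtoC (f s)) t.
Proof. intros H. split; [exact H|apply continuous_const]. Qed.

Lemma primitive (g : R -> R) (p : R) : (forall t, 0 <= t <= 1 -> continuous g t) ->
 exists X, X 0 = p /\ X 1 = p+RInt g 0 1 /\ forall t, 0 <= t <= 1 -> is_derive X t (g t).
Proof.
 intros Hg.
 have Hc : forall t, continuous (fun s => g (clamp s)) t.
 { intros t. apply (continuous_comp clamp g); [apply clamp_continuous|]. apply Hg, clamp_bound. }
 exists (fun t => p+RInt (fun s => g (clamp s)) 0 t). split; [|split].
 - rewrite RInt_point. change (p+0 = p). ring.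
 - f_equal. apply RInt_ext. intros x. rewrite Rmin_left, Rmax_right by lra. intros Hx. rewrite clamp_id; auto. lra.
 - intros t Ht. eapply is_derive_eq.
  + apply (is_derive_plus (K := R_AbsRing) (V := R_NormedModule) (fun _ => p)); [apply (is_derive_const p)|].
   apply (is_derive_RInt (fun s => g (clamp s)) _ 0); [|apply Hc].
   apply filter_forall. intros x. apply (RInt_correct (V := R_CompleteNormedModule)).
   apply (ex_RInt_continuous (V := R_CompleteNormedModule)). intros; apply Hc.
  + rewrite (clamp_id t Ht). apply Rplus_0_l.
Qed.

(** On [[0, 1]] this is [3 t^2 - 2 t^3]; its derivative vanishes at both ends, so the constant
    extensions fit to order one. *)
Lemma smoothstep : exists sigma : R -> R,
 (forall t, is_derive sigma t (6*clamp t*(1-clamp t))) /\ (forall t, 0 <= sigma t <= 1) /\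
 (forall t, t <= 0 -> sigma t = 0) /\ (forall t, 1 <= t -> sigma t = 1).
Proof.
 set (g := fun t => 6*clamp t*(1-clamp t)).
 have Hc : forall t, continuous g t.
 { intros t. apply (continuous_comp clamp (fun c => 6*c*(1-c))); [apply clamp_continuous|].
  by_derivative. auto. }
 set (sigma := fun t : R => RInt g 0 t : R).
 have D : forall t, is_derive sigma t (g t).
 { intros t. apply (is_derive_RInt g _ 0); [|apply Hc]. apply filter_forall. intros x.
  apply (RInt_correct (V := R_CompleteNormedModule)). apply (ex_RInt_continuous (V := R_CompleteNormedModule)). intros; apply Hc. }
 have S0 : sigma 0 = 0 by apply (RInt_point (V := R_CompleteNormedModule)).
 have L : forall t, t <= 0 -> clamp t = 0 by (intros t Ht; unfold clamp, Rmax, Rmin; destruct (Rle_dec 1 t), (Rle_dec 0 _); lra).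
 have U : forall t, 1 <= t -> clamp t = 1 by (intros t Ht; unfold clamp, Rmax, Rmin; destruct (Rle_dec 1 t), (Rle_dec 0 _); lra).
 have SL : forall t, t <= 0 -> sigma t = 0.
 { intros t Ht. rewrite <- S0. apply (constant_of_derive sigma t 0 Ht). intros s Hs.
  eapply is_derive_eq; [apply D|]. unfold g. rewrite L by lra. ring. }
 have SM : forall t, 0 <= t <= 1 -> sigma t = 3*t^2-2*t^3.
 { intros t Ht. have E := constant_of_derive (fun t => sigma t-(3*t^2-2*t^3)) 0 t (proj1 Ht).
  cbv beta in E. rewrite S0 in E. enough (sigma t-(3*t^2-2*t^3) = 0) by lra. rewrite <- E; [ring|].
  intros s Hs. have B := D s. derive_auto. unfold g. rewrite clamp_id by lra. ring. }
 have SU : forall t, 1 <= t -> sigma t = 1.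
 { intros t Ht. transitivity (sigma 1); [|rewrite SM by lra; ring]. symmetry. apply (constant_of_derive sigma 1 t Ht). intros s Hs.
  eapply is_derive_eq; [apply D|]. unfold g. rewrite U by lra. ring. }
 exists sigma. split; [exact D|]. split; [|split; auto].
 intros t. destruct (Rle_dec t 0); [rewrite SL by auto; lra|]. destruct (Rle_dec 1 t); [rewrite SU by auto; lra|].
 rewrite SM by lra. have H : 0 < t < 1 by lra. split.
 - assert (0 <= t^2*(3-2*t)) by (apply Rmult_le_pos; [apply pow2_ge_0|lra]). lra.
 - assert (0 <= (1-t)^2*(1+2*t)) by (apply Rmult_le_pos; [apply pow2_ge_0|lra]). lra.
Qed.

(** Arcs can be parametrized to rest before time 0 and after time 1, which makes their concatenation C^1. *)
Lemma reach_rest (k : C) (s0 s1 : C*C*R3) : reach k s0 s1 ->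
 exists z dz w X Y Z, (forall t, lift_at k z dz w X Y Z t) /\
  (forall t, t <= 0 -> state z w X Y Z t = s0 /\ dz t = 0%C) /\
  (forall t, 1 <= t -> state z w X Y Z t = s1 /\ dz t = 0%C).
Proof.
 intros (z & dz & w & X & Y & Z & H & H0 & H1). destruct smoothstep as (sg & D & B & L & U).
 set (v := fun t => 6*clamp t*(1-clamp t)).
 have Hv : forall t, continuous v t.
 { intros t. apply (continuous_comp clamp (fun c => 6*c*(1-c))); [apply clamp_continuous|].
  by_derivative. auto. }
 have Hs : forall t, continuous sg t by (intros; apply (is_derive_continuous _ _ _ (D t))).
 exists (fun t => z (sg t)), (fun t => (v t*dz (sg t))%C), (fun t => w (sg t)), (fun t => X (sg t)), (fun t => Y (sg t)), (fun t => Z (sg t)).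
 split; [|split].
 - intros t. destruct (H (sg t) (B t)) as (Hz & Hd & Hw & Hw0 & Hsq & HX & HY & HZ).
  have Sp : forall n, v t*speed k n z dz w (sg t)
   = speed k n (fun t => z (sg t)) (fun t => (v t*dz (sg t))%C) (fun t => w (sg t)) t.
  { intros n. unfold speed. transitivity (Re (v t*(k*n (z (sg t))*dz (sg t)/w (sg t)))%C); [simpl; ring|].
   f_equal. field. auto. }
  split; [apply cderive_comp; [exact Hz|apply D]|]. split; [|split; [|split; [auto|split; [auto|]]]].
  + apply (ccont_mult (fun t => RtoC (v t)) (fun t => dz (sg t))); [apply ccont_RtoC; auto|apply ccont_comp; auto].
  + apply ccont_comp; auto.
  + split; [|split]; (eapply is_derive_eq; [|apply Sp]);
    [apply (is_derive_comp X sg)|apply (is_derive_comp Y sg)|apply (is_derive_comp Z sg)]; auto; apply D.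
 - intros t Ht. unfold state. rewrite (L t Ht). split; [exact H0|]. unfold v, clamp.
  rewrite Rmin_right, Rmax_left by lra. apply injective_projections; simpl; ring.
 - intros t Ht. unfold state. rewrite (U t Ht). split; [exact H1|]. unfold v, clamp.
  rewrite Rmin_left, Rmax_right by lra. apply injective_projections; simpl; ring.
Qed.

Lemma is_derive_affine (f : R -> R) (a b t l : R) : is_derive f (a*t+b) l -> is_derive (fun s => f (a*s+b)) t (a*l).
Proof.
 intros H. apply (is_derive_comp f (fun s => a*s+b)); [exact H|]. auto_derive; auto. ring.
Qed.

Lemma reach_trans (k : C) (s0 s1 s2 : C*C*R3) : reach k s0 s1 -> reach k s1 s2 -> reach k s0 s2.
Proof.
 intros H1 H2. destruct (reach_rest k s0 s1 H1) as (z & dz & w & X & Y & Z & Hl & H0 & H1').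
 destruct (reach_rest k s1 s2 H2) as (z' & dz' & w' & X' & Y' & Z' & Hl' & H1'' & H2'). clear H1 H2.
 destruct s1 as [[zm wm] [[xm ym] zzm]].
 assert (L : forall t, t <= / 2 -> state z' w' X' Y' Z' (2*t + -1) = (zm, wm, (xm, ym, zzm)) /\ dz' (2*t + -1) = 0%C)
  by (intros; apply H1''; lra).
 assert (U : forall t, / 2 <= t -> state z w X Y Z (2*t+0) = (zm, wm, (xm, ym, zzm)) /\ dz (2*t+0) = 0%C)
  by (intros; apply H1'; lra).
 have Af : forall (c t : R), is_derive (fun s => 2*s+c) t 2 by (intros; auto_derive; auto; ring).
 have Ac : forall (c t : R), continuous (fun s => 2*s+c) t by (intros c t; apply (is_derive_continuous _ _ _ (Af c t))).
 (* At every time one of the two reparametrized paths rests in the middle state, so their sum minus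
    that state is the concatenation. *)
 exists (fun t => (z (2*t+0)%R+z' (2*t + -1)%R + - zm)%C), (fun t => (2*dz (2*t+0)%R+2*dz' (2*t + -1)%R)%C),
  (fun t => (w (2*t+0)%R+w' (2*t + -1)%R + - wm)%C),
  (fun t => X (2*t+0)+X' (2*t + -1)-xm), (fun t => Y (2*t+0)+Y' (2*t + -1)-ym),
  (fun t => Z (2*t+0)+Z' (2*t + -1)-zzm).
 split; [|split].
 - intros t _. destruct (Hl (2*t+0)) as (A1 & A2 & A3 & A4 & A5 & A6 & A7 & A8).
  destruct (Hl' (2*t + -1)) as (B1 & B2 & B3 & B4 & B5 & B6 & B7 & B8).
  split.
  { eapply cderive_eq; [apply (cderive_plus (fun t => z (2*t+0)%R+z' (2*t + -1)%R)%C (fun _ => - zm)%C); [|apply cderive_const]|].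
   - apply cderive_plus; [apply (cderive_comp z (fun t => 2*t+0))|apply (cderive_comp z' (fun t => 2*t + -1))]; eauto.
   - ring. }
  split.
  { apply ccont_plus; apply (ccont_mult (fun _ => 2%C)); try apply ccont_const;
    [apply (ccont_comp dz (fun t => 2*t+0))|apply (ccont_comp dz' (fun t => 2*t + -1))]; auto. }
  split.
  { apply (ccont_plus (fun t => w (2*t+0)%R+w' (2*t + -1)%R)%C); [|apply ccont_const].
   apply ccont_plus; [apply (ccont_comp w (fun t => 2*t+0))|apply (ccont_comp w' (fun t => 2*t + -1))]; auto. }
  have Sp : forall n f f' c,
   is_derive f (2*t+0) (speed k n z dz w (2*t+0)) -> is_derive f' (2*t + -1) (speed k n z' dz' w' (2*t + -1)) ->
   is_derive (fun t => f (2*t+0)+f' (2*t + -1)-c) t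
    (2*speed k n z dz w (2*t+0)+2*speed k n z' dz' w' (2*t + -1)).
  { intros n f f' c Hf Hf'. eapply is_derive_eq; [apply (is_derive_plus (K := R_AbsRing) (V := R_NormedModule)
    (fun t => f (2*t+0)+f' (2*t + -1)) (fun _ => - c)); [|apply (is_derive_const (- c))]|].
   - apply (is_derive_plus (K := R_AbsRing) (V := R_NormedModule)); apply is_derive_affine; eassumption.
   - apply Rplus_0_r. }
  have Re2 : forall x : C, Re (2*x)%C = 2*Re x by (intros; unfold Re; simpl; ring).
  destruct (Rle_dec t (/ 2)) as [Ht|Ht].
  + destruct (L t Ht) as [E E']. unfold state in E. injection E as E1 E2 E3 E4 E5.
   rewrite E1, E2. replace (w (2*t+0)%R+wm + - wm)%C with (w (2*t+0)) by ring.
   replace (z (2*t+0)%R+zm + - zm)%C with (z (2*t+0)) by ring. split; [auto|]. split; [auto|].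
   split; [|split]; (eapply is_derive_eq; [eapply Sp; eassumption|]);
    unfold speed; cbv beta; rewrite E1, E2, E'; replace (w (2*t+0)%R+wm + - wm)%C with (w (2*t+0)) by ring;
    replace (z (2*t+0)%R+zm + - zm)%C with (z (2*t+0)) by ring;
    rewrite <- !Re2; rewrite <- re_plus; f_equal; field; split; auto; rewrite <- E2; auto.
  + destruct (U t) as [E E']; [lra|]. unfold state in E. injection E as E1 E2 E3 E4 E5.
   rewrite E1, E2. replace (wm+w' (2*t + -1)%R + - wm)%C with (w' (2*t + -1)) by ring.
   replace (zm+z' (2*t + -1)%R + - zm)%C with (z' (2*t + -1)) by ring. split; [auto|]. split; [auto|].
   split; [|split]; (eapply is_derive_eq; [eapply Sp; eassumption|]);
    unfold speed; cbv beta; rewrite E1, E2, E'; replace (wm+w' (2*t + -1)%R + - wm)%C with (w' (2*t + -1)) by ring;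
    replace (zm+z' (2*t + -1)%R + - zm)%C with (z' (2*t + -1)) by ring;
    rewrite <- !Re2; rewrite <- re_plus; f_equal; field; split; auto; rewrite <- E2; auto.
 - destruct (L 0) as [E _]; [lra|]. destruct (H0 (2*0+0)) as [E' _]; [lra|]. unfold state in *.
  injection E as E1 E2 E3 E4 E5. rewrite E1, E2, E3, E4, E5, <- E'. f_equal; [f_equal; ring|]. f_equal; [f_equal|]; ring.
 - destruct (U 1) as [E _]; [lra|]. destruct (H2' (2*1 + -1)) as [E' _]; [lra|]. unfold state in *.
  injection E as E1 E2 E3 E4 E5. rewrite E1, E2, E3, E4, E5, <- E'. f_equal; [f_equal; ring|]. f_equal; [f_equal|]; ring.
Qed.

(** Endpoints given by integrals are restated as end states of a differential system, which is what
    gets propagated and concatenated below. *)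
Lemma continuation_reach (k z0 w0 : C) (p0 p : R3) :
 continuation P8 (fun z => k*n1 z)%C (fun z => k*n2 z)%C (fun z => k*n3 z)%C z0 w0 p0 p <->
 exists z1 w1, reach k (z0, w0, p0) (z1, w1, p).
Proof.
 destruct p0 as [[x0 y0] u0]. split.
 - intros (z & dz & w & E0 & E0' & H & Hp). cbv zeta in Hp.
  have Hc : forall t, 0 <= t <= 1 -> cderive z t (dz t) /\ ccont dz t /\ ccont w t /\ w t <> 0%C /\ (w t*w t)%C = P8 (z t).
  { intros t Ht. destruct (H t Ht) as (H1 & H2 & H3 & H4 & H5). apply is_derive_C in H1. apply continuous_C in H2, H3. auto. }
  have Hs : forall t, 0 <= t <= 1 -> continuous (speed k n1 z dz w) t /\ continuous (speed k n2 z dz w) t /\ continuous (speed k n3 z dz w) t.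
  { intros t Ht. destruct (Hc t Ht) as (H1 & H2 & H3 & H4 & H5). destruct (ccont_n z t (cderive_ccont _ _ _ H1)) as (N1 & N2 & N3).
   split; [|split]; apply speed_continuous; auto. }
  destruct (primitive (speed k n1 z dz w) x0) as (X & X0 & X1 & DX); [apply Hs|].
  destruct (primitive (speed k n2 z dz w) y0) as (Y & Y0 & Y1 & DY); [apply Hs|].
  destruct (primitive (speed k n3 z dz w) u0) as (Z & Z0 & Z1 & DZ); [apply Hs|].
  exists (z 1), (w 1), z, dz, w, X, Y, Z. split; [|split].
  + intros t Ht. destruct (Hc t Ht) as (H1 & H2 & H3 & H4 & H5). unfold lift_at. auto 10.
  + unfold state. rewrite E0, E0', X0, Y0, Z0. auto.
  + unfold state. rewrite X1, Y1, Z1, Hp. reflexivity.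
 - intros (z1 & w1 & H). destruct (reach_rest _ _ _ H) as (z & dz & w & X & Y & Z & Hl & H0 & H1).
  destruct (H0 0) as [E0 _]; [lra|]. destruct (H1 1) as [E1 _]; [lra|]. unfold state in *.
  injection E0 as E01 E02 E03 E04 E05.
  exists z, dz, w. split; [auto|]. split; [auto|]. split.
  + intros t _. destruct (Hl t) as (A1 & A2 & A3 & A4 & A5 & _). split; [apply is_derive_C; auto|].
   split; [apply continuous_C; auto|]. split; [apply continuous_C; auto|auto].
  + cbv zeta.
   have I : forall n f, (forall t, continuous (speed k n z dz w) t) -> (forall t, is_derive f t (speed k n z dz w t)) ->
    f 1 = f 0+RInt (speed k n z dz w) 0 1.
   { intros n f Hc Hf. have E : is_RInt (speed k n z dz w) 0 1 (minus (f 1) (f 0)).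
    { apply (is_RInt_derive (V := R_CompleteNormedModule)); intros; auto. }
    apply (is_RInt_unique (V := R_CompleteNormedModule)) in E. rewrite E. symmetry. apply Rplus_minus. }
   have Hs := fun t => lift_speed_continuous _ _ _ _ _ _ _ _ (Hl t).
   injection E1 as E11 E12 E13. rewrite <- E13, plus_R3, <- E03, <- E04, <- E05.
   rewrite (I n1 X), (I n2 Y), (I n3 Z); [reflexivity|intros t; apply (Hs t)|intros t; apply (Hl t)|
    intros t; apply (Hs t)|intros t; apply (Hl t)|intros t; apply (Hs t)|intros t; apply (Hl t)].
Qed.

Lemma Cinv_neq0 (z : C) : z <> 0%C -> (/ z)%C <> 0%C.
Proof.
 intros H E. have E1 := Cinv_r z H. rewrite E, Cmult_0_r in E1. apply (f_equal fst) in E1. simpl in E1. lra.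
Qed.

Lemma ccont_P8 {T : UniformSpace} (z : T -> C) (t : T) : ccont z t -> ccont (fun t => P8 (z t)) t.
Proof.
 intros H. unfold P8. ccon.
Qed.

Lemma cderive_P8 (z : R -> C) (t : R) (d : C) : cderive z t d -> exists l, cderive (fun t => P8 (z t)) t l.
Proof.
 intros H. have H2 := cderive_mult _ _ _ _ _ H H. have H4 := cderive_mult _ _ _ _ _ H2 H2.
 have H8 := cderive_mult _ _ _ _ _ H4 H4. cbv beta in *.
 have H5 := cderive_mult _ _ _ _ _ (cderive_const 14%C t) H4.
 have E := cderive_plus _ _ _ _ _ (cderive_const 1%C t) (cderive_plus _ _ _ _ _ H5 H8).
 eexists. eapply cderive_ext; [|exact E]. intros s. unfold P8. ring.
Qed.

Lemma ccont_Cmod {T : UniformSpace} (f : T -> C) (t : T) : ccont f t -> continuous (fun t => Cmod (f t)) t.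
Proof.
 intros [H1 H2]. apply (continuous_comp (fun t => Re (f t)^2+Im (f t)^2) sqrt); [|apply continuous_sqrt].
 simpl. cont.
Qed.

Definition within (d : R) (z z' : C) : Prop := Rabs (Re z-Re z') < d /\ Rabs (Im z-Im z') < d.

Lemma within_Cmod (d : R) (a b : C) : within d a b -> Cmod (a-b)%C <= 2*d.
Proof.
 intros [H1 H2]. eapply Rle_trans; [apply Cmod_2Rmax|].
 have Hs : 0 <= sqrt 2 <= 2.
 { split; [apply sqrt_pos|]. rewrite <- (sqrt_pow2 2) at 2 by lra. apply sqrt_le_1_alt. lra. }
 assert (Rmax (Rabs (fst (a-b)%C)) (Rabs (snd (a-b)%C)) <= d) by (apply Rmax_lub; left; [exact H1|exact H2]).
 assert (0 <= Rmax (Rabs (fst (a-b)%C)) (Rabs (snd (a-b)%C))) by (eapply Rle_trans; [apply Rabs_pos|apply Rmax_l]).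
 apply Rmult_le_compat; lra.
Qed.

Lemma displacement_bound (X X' : R -> R) (B : R) : (forall t, 0 <= t <= 1 -> is_derive X t (X' t)) ->
 (forall t, 0 <= t <= 1 -> Rabs (X' t) <= B) -> Rabs (X 1-X 0) <= B.
Proof.
 intros D H. destruct (MVT_abs X X' 0 1) as (c & E & Hc).
 - intros c. rewrite Rmin_left, Rmax_right by lra. intros Hc. apply is_derive_Reals, D, Hc.
 - rewrite Rmin_left, Rmax_right in Hc by lra. rewrite E, Rminus_0_r, Rabs_R1, Rmult_1_r. apply H, Hc.
Qed.

(** Straight arcs near a point where the radicand does not vanish. *)
Lemma short_arc (k zc : C) (eps : R) : P8 zc <> 0%C -> 0 < eps -> exists d, 0 < d /\
 forall za zb w x y u, within d za zc -> within d zb zc -> (w*w)%C = P8 za ->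
 exists w' x' y' u', reach k (za, w, (x, y, u)) (zb, w', (x', y', u')) /\
  Rabs (x'-x) < eps /\ Rabs (y'-y) < eps /\ Rabs (u'-u) < eps.
Proof.
 intros Hc Heps. pose (T := prod_UniformSpace R_UniformSpace R_UniformSpace).
 have Hid : ccont (T := T) (fun z : T => z : C) (zc : T) by (split; [apply continuous_fst|apply continuous_snd]).
 destruct (ccont_n _ _ Hid) as (N1 & N2 & N3). have HP := ccont_P8 _ _ Hid. cbv beta in N1, N2, N3, HP.
 pose (Q := fun z : C => (/ P8 zc*P8 z)%C).
 have Hmu : 0 < Cmod (P8 zc) by (apply Cmod_gt_0; auto). set (mu := Cmod (P8 zc)/2).
 set (M := Cmod (k*n1 zc)+Cmod (k*n2 zc)+Cmod (k*n3 zc)+1).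
 have HM : 0 < M by (unfold M; have A1 := Cmod_ge_0 (k*n1 zc); have A2 := Cmod_ge_0 (k*n2 zc); have A3 := Cmod_ge_0 (k*n3 zc); lra).
 have L1 : locally (T := T) (zc : T) (fun z : T => 0 < Re (Q z)).
 { have HQ := ccont_mult (T := T) (fun _ => / P8 zc)%C _ _ (ccont_const _ _) HP.
  destruct HQ as [HQ _]. apply (HQ (fun y => 0 < y)). cbv beta. rewrite Cinv_l by auto. apply open_gt. simpl. lra. }
 have L2 : locally (T := T) (zc : T) (fun z : T => mu < Cmod (P8 z)).
 { apply (ccont_Cmod _ _ HP (fun y => mu < y)). apply open_gt. unfold mu. lra. }
 have L3 : forall n : C -> C, ccont (T := T) n (zc : T) -> Cmod (k*n zc) < M -> locally (T := T) (zc : T) (fun z : T => Cmod (k*n z) < M).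
 { intros n Hn Hl. apply (ccont_Cmod (T := T) (fun z : T => k*n z)%C zc (ccont_mult (fun _ => k) _ _ (ccont_const _ _) Hn) (fun y => y < M)).
  apply open_lt. exact Hl. }
 have A1 := Cmod_ge_0 (k*n1 zc). have A2 := Cmod_ge_0 (k*n2 zc). have A3 := Cmod_ge_0 (k*n3 zc).
 have L31 := L3 n1 N1 ltac:(unfold M; lra). have L32 := L3 n2 N2 ltac:(unfold M; lra). have L33 := L3 n3 N3 ltac:(unfold M; lra).
 destruct (filter_and _ _ (filter_and _ _ L1 L2) (filter_and _ _ L31 (filter_and _ _ L32 L33))) as [d0 Hd0]. clear L1 L2 L3 L31 L32 L33.
 have Hsm : 0 < sqrt mu by (apply sqrt_lt_R0; unfold mu; lra).
 (* On the arc the speed is at most [M (4 d) / sqrt mu], which this radius makes no larger than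
    [eps / 2]. *)
 have Hd1 : 0 < eps*sqrt mu/(8*M) by (apply Rdiv_lt_0_compat; [apply Rmult_lt_0_compat; auto|lra]).
 exists (Rmin d0 (eps*sqrt mu/(8*M))). split; [apply Rmin_pos; [apply cond_pos|auto]|].
 set (d := Rmin d0 (eps*sqrt mu/(8*M))).
 have Dd0 : d <= d0 by apply Rmin_l. have Dd1 : d <= eps*sqrt mu/(8*M) by apply Rmin_r.
 have Hnear : forall z, within d z zc -> 0 < Re (Q z) /\ mu < Cmod (P8 z) /\ Cmod (k*n1 z) < M /\ Cmod (k*n2 z) < M /\ Cmod (k*n3 z) < M.
 { intros z [H1 H2]. destruct (Hd0 z) as [[B1 B2] [B3 [B4 B5]]]; [|auto].
  split; [change (Rabs (Re z-Re zc) < d0)|change (Rabs (Im z-Im zc) < d0)]; lra. }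
 intros za zb w x y u Ha Hb Hw. clearbody d.
 set (z := fun t : R => (za+t*(zb-za))%C).
 have Hz : forall t, 0 <= t <= 1 -> within d (z t) zc.
 { intros t Ht. destruct Ha as [Ha1 Ha2], Hb as [Hb1 Hb2].
  have Cv : forall a b c : R, Rabs (a-c) < d -> Rabs (b-c) < d -> Rabs (a+t*(b-a)-c) < d.
  { intros a b c H1 H2. apply Rabs_def2 in H1, H2.
   have Cp : forall X Y, 0 < X -> 0 < Y -> 0 < (1-t)*X+t*Y.
   { intros X Y HX HY. destruct (Rle_dec t (/ 2)).
    - assert (0 < (1-t)*X) by (apply Rmult_lt_0_compat; lra). assert (0 <= t*Y) by (apply Rmult_le_pos; lra). lra.
    - assert (0 <= (1-t)*X) by (apply Rmult_le_pos; lra). assert (0 < t*Y) by (apply Rmult_lt_0_compat; lra). lra. }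
   have P1 := Cp (d-(a-c)) (d-(b-c)). have P2 := Cp (d+(a-c)) (d+(b-c)). apply Rabs_def1; lra. }
  split.
  - replace (Re (z t)) with (Re za+t*(Re zb-Re za)) by (unfold z, Re; simpl; ring). apply Cv; auto.
  - replace (Im (z t)) with (Im za+t*(Im zb-Im za)) by (unfold z, Im; simpl; ring). apply Cv; auto. }
 have Dz : forall t, cderive z t (zb-za)%C.
 { intros t. split; unfold z, Re, Im; simpl; auto_derive; auto; ring. }
 have Hw0 : w <> 0%C.
 { intros E. destruct (Hnear za Ha) as (_ & B & _). rewrite <- Hw, E, Cmult_0_l, Cmod_0 in B. unfold mu in B. lra. }
 have Q0 : forall c, within d c zc -> csqrt (Q c) <> 0%C.
 { intros c Hcc E. destruct (Hnear c Hcc) as (B & _). have E' := csqrt_sq _ B. rewrite E, Cmult_0_l in E'.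
  rewrite <- E' in B. simpl in B. lra. }
 (* The quotient [Q] of radicands stays in the right half-plane, so its principal root continues the
    given branch [w]. *)
 set (W := fun t : R => (w/csqrt (Q za)*csqrt (Q (z t)))%C).
 have W0 : forall t, 0 <= t <= 1 -> W t <> 0%C.
 { intros t Ht. unfold W. repeat apply Cmult_neq_0; auto. apply Cinv_neq0. auto. }
 have Wsq : forall t, 0 <= t <= 1 -> (W t*W t)%C = P8 (z t).
 { intros t Ht. unfold W. transitivity (w*w*(csqrt (Q (z t))*csqrt (Q (z t)))/(csqrt (Q za)*csqrt (Q za)))%C; [field; auto|].
  destruct (Hnear _ (Hz t Ht)) as (B1 & _). destruct (Hnear _ Ha) as (B2 & B3 & _). rewrite !csqrt_sq by auto. rewrite Hw. unfold Q.
  assert (P8 za <> 0%C) by (intros E; rewrite E, Cmod_0 in B3; unfold mu in B3; lra). field. auto. }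
 have Wc : forall t, 0 <= t <= 1 -> ccont W t.
 { intros t Ht. apply (ccont_mult (fun _ => w/csqrt (Q za))%C); [apply ccont_const|].
  destruct (cderive_P8 z t _ (Dz t)) as [l Dl]. have Dq := cderive_mult _ _ _ _ _ (cderive_const (/ P8 zc)%C t) Dl.
  destruct (csqrt_derivable (fun t => Q (z t)) t _ Dq) as [m Dm]; [apply (Hnear _ (Hz t Ht))|]. apply (cderive_ccont _ _ _ Dm). }
 set (dz := fun _ : R => (zb-za)%C).
 have Hsp : forall n, (forall t, 0 <= t <= 1 -> ccont (fun t => n (z t)) t) -> (forall c, within d c zc -> Cmod (k*n c) < M) -> forall p,
  exists X, X 0 = p /\ (forall t, 0 <= t <= 1 -> is_derive X t (speed k n z dz W t)) /\ Rabs (X 1-p) < eps.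
 { intros n Hn Hb' p. destruct (primitive (speed k n z dz W) p) as (X & X0 & _ & DX).
  { intros t Ht. apply speed_continuous; auto. apply ccont_const. }
  exists X. split; [auto|]. split; [auto|]. rewrite <- X0.
  eapply Rle_lt_trans; [apply (displacement_bound X _ (M*(4*d)/sqrt mu) DX)|].
  - intros t Ht. unfold speed. eapply Rle_trans; [apply re_le_Cmod|]. rewrite Cmod_div by auto. rewrite Cmod_mult.
   have B1 := Hb' _ (Hz t Ht). destruct (Hnear _ (Hz t Ht)) as (_ & B2 & _).
   have B3 : Cmod (dz t) <= 4*d.
   { unfold dz. replace (zb-za)%C with ((zb-zc)-(za-zc))%C by ring.
    eapply Rle_trans; [apply Cmod_triangle|]. rewrite Cmod_opp. have C1 := within_Cmod _ _ _ Ha. have C2 := within_Cmod _ _ _ Hb. lra. }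
   have B4 : sqrt mu <= Cmod (W t).
   { rewrite <- (sqrt_pow2 (Cmod (W t))) by apply Cmod_ge_0. apply sqrt_le_1_alt. left.
    replace (Cmod (W t)^2) with (Cmod (W t*W t)) by (rewrite Cmod_mult; ring). rewrite Wsq by auto. auto. }
   have B5 := Cmod_ge_0 (dz t). have B6 := Cmod_ge_0 (k*n (z t)).
   apply Rmult_le_compat; [apply Rmult_le_pos; auto|left; apply Rinv_0_lt_compat; lra|apply Rmult_le_compat; lra|].
   apply Rinv_le_contravar; auto.
  - apply Rle_lt_trans with (M*(4*(eps*sqrt mu/(8*M)))/sqrt mu).
   + apply Rmult_le_compat_r; [left; apply Rinv_0_lt_compat; auto|]. apply Rmult_le_compat_l; lra.
   + replace (M*(4*(eps*sqrt mu/(8*M)))/sqrt mu) with (eps/2) by (field; lra). lra. }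
 have Cz : forall t, ccont z t by (intros t; apply (cderive_ccont _ _ _ (Dz t))).
 destruct (Hsp n1) with (p := x) as (X & X0 & DX & BX); [intros; apply (ccont_n z t); auto|intros c Hcc; apply (Hnear c Hcc)|].
 destruct (Hsp n2) with (p := y) as (Y & Y0 & DY & BY); [intros; apply (ccont_n z t); auto|intros c Hcc; apply (Hnear c Hcc)|].
 destruct (Hsp n3) with (p := u) as (U & U0 & DU & BU); [intros; apply (ccont_n z t); auto|intros c Hcc; apply (Hnear c Hcc)|].
 exists (W 1), (X 1), (Y 1), (U 1). split; [|auto].
 exists z, dz, W, X, Y, U. split; [|split].
 - intros t Ht. unfold lift_at. split; [apply Dz|]. split; [apply ccont_const|]. auto 10.
 - unfold state. rewrite X0, Y0, U0. f_equal. f_equal; [unfold z; ring|]. unfold W. unfold z.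
  replace (za+0%R*(zb-za))%C with za by ring. field. auto.
 - unfold state. f_equal. f_equal. unfold z. ring.
Qed.

(** * Rescaling the coordinates of a Weierstrass representation *)

Definition rescale (mu : R) (p0 q0 p : R3) : R3 := plus q0 (scal mu (minus p p0)).

Lemma rescale_E (mu x0 y0 u0 x1 y1 u1 x y u : R) :
 rescale mu (x0, y0, u0) (x1, y1, u1) (x, y, u) = (x1+mu*(x-x0), y1+mu*(y-y0), u1+mu*(u-u0)).
Proof. reflexivity. Qed.

Lemma closure_image (S S' : R3 -> Prop) (T : R3 -> R3) (p : R3) :
 (forall q, S q -> S' (T q)) -> continuous T p -> closure S p -> closure S' (T p).
Proof.
 intros H HT Hp O HO. destruct (Hp (fun q => O (T q)) (HT O HO)) as (q & Hq & Sq). exists (T q). auto.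
Qed.

Lemma rescale_continuous (mu : R) (p0 q0 p : R3) : continuous (rescale mu p0 q0) p.
Proof.
 unfold rescale. apply (continuous_plus (V := prod_NormedModule R_AbsRing (prod_NormedModule R_AbsRing R_NormedModule R_NormedModule) R_NormedModule)
  (fun _ => q0)); [apply continuous_const|].
 apply (continuous_scal_r (V := prod_NormedModule R_AbsRing (prod_NormedModule R_AbsRing R_NormedModule R_NormedModule) R_NormedModule) mu).
 apply (continuous_minus (V := prod_NormedModule R_AbsRing (prod_NormedModule R_AbsRing R_NormedModule R_NormedModule) R_NormedModule)
  (fun p => p) (fun _ => p0)); [apply continuous_id|apply continuous_const].
Qed.

Lemma weierstrass_rescale (mu : R) (c : C) (a1 a2 a3 b1 b2 b3 : C -> C) (z0 w0 : C) (p0 q0 p : R3) :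
 (forall z, a1 z = c*n1 z /\ a2 z = c*n2 z /\ a3 z = c*n3 z)%C ->
 (forall z, b1 z = mu*(c*n1 z) /\ b2 z = mu*(c*n2 z) /\ b3 z = mu*(c*n3 z))%C ->
 weierstrass P8 a1 a2 a3 z0 w0 p0 p -> weierstrass P8 b1 b2 b3 z0 w0 q0 (rescale mu p0 q0 p).
Proof.
 intros Ha Hb. apply closure_image; [|apply rescale_continuous].
 clear p. intros p (z & dz & w & H0 & Hw & H & Hp). exists z, dz, w. split; [auto|]. split; [auto|]. split; [auto|].
 cbv beta zeta in *.
 have L : forall a b n : C -> C, (forall z, a z = c*n z)%C -> (forall z, b z = mu*(c*n z))%C ->
  (forall t, 0 <= t <= 1 -> ccont (fun t => n (z t)) t) ->
  RInt (fun t => Re (b (z t)*dz t/w t)%C) 0 1 = mu*RInt (fun t => Re (a (z t)*dz t/w t)%C) 0 1.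
 { intros a b n Han Hbn Hn. transitivity (RInt (fun t => mu*speed c n z dz w t) 0 1).
  - apply RInt_ext. intros t _. rewrite Hbn. unfold speed, Cdiv. unfold Re. simpl. ring.
  - transitivity (mu*RInt (speed c n z dz w) 0 1).
   + apply (RInt_scal (V := R_CompleteNormedModule) (speed c n z dz w) 0 1 mu).
    apply (ex_RInt_continuous (V := R_CompleteNormedModule)). intros t. rewrite Rmin_left, Rmax_right by lra. intros Ht.
    destruct (H t Ht) as (D & C1 & C2 & C3 & _). apply continuous_C in C1, C2. apply speed_continuous; auto.
   + f_equal. apply RInt_ext. intros t _. rewrite Han. reflexivity. }
 have N : forall t, 0 <= t <= 1 -> ccont z t.
 { intros t Ht. destruct (H t Ht) as (D & _). apply is_derive_C in D. apply (cderive_ccont _ _ _ D). }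
 rewrite (L a1 b1 n1 (fun z => proj1 (Ha z)) (fun z => proj1 (Hb z)) (fun t Ht => proj1 (ccont_n z t (N t Ht)))).
 rewrite (L a2 b2 n2 (fun z => proj1 (proj2 (Ha z))) (fun z => proj1 (proj2 (Hb z))) (fun t Ht => proj1 (proj2 (ccont_n z t (N t Ht))))).
 rewrite (L a3 b3 n3 (fun z => proj2 (proj2 (Ha z))) (fun z => proj2 (proj2 (Hb z))) (fun t Ht => proj2 (proj2 (ccont_n z t (N t Ht))))).
 rewrite Hp. destruct p0 as [[x0 y0] u0], q0 as [[x1 y1] u1]. rewrite !plus_R3, rescale_E.
 f_equal; [f_equal|]; ring.
Qed.

(** * The coordinates of P and D along a path *)

(** All three coordinates arise in the same way from a pair [(A, B)] of quadratic polynomials in [zeta]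
    with [A B' - B A'] the component of the null vector and [A^4 + 14 A^2 B^2 + B^4] the radicand. *)
Definition sqn (z : C) : R := Re z^2+Im z^2.
Definition DP (A B w : C) : R :=
 sqn A^2+12*sqn A*sqn B+sqn B^2+2*Re ((B*Cconj A)^2)%C+sqn w.
Definition hP (A B w : C) : R := 2*Re (B*A*Cconj w)%C.
(** The slope of [phiP] as a function of the Weierstrass data; [tP] is the tangent of [phiP]. *)
Definition cP (A B w : C) : R := sqrt 6*(sqn B-sqn A)/sqrt (DP A B w).
Definition tP (A B w : C) : R := - (sqrt 6*hP A B w)/((sqn A+sqn B)*sqrt (DP A B w)).

Definition eD (A B : C) : R := Im (B*Cconj A)%C.
Definition DD (A B w : C) : R :=
 sqn A^2+16*sqn A*sqn B+sqn B^2-2*Re ((B*Cconj A)^2)%C+sqn w.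
Definition GD (A B : C) : C :=
 (A*Cconj A^3+7*(B*Cconj B*Cconj A^2)+7*(A*Cconj B^2*Cconj A)+B*Cconj B^3)%C.
Definition gD (A B w : C) : R := 2*Re (w*GD A B)%C.

Definition rad2 (A B : C) : C := (A^4+14*A^2*B^2+B^4)%C.

Lemma RtoC_sqn (z : C) : RtoC (sqn z) = (z*Cconj z)%C.
Proof. apply injective_projections; unfold sqn, Re, Im; simpl; ring. Qed.

Lemma RtoC_2Re (z : C) : RtoC (2*Re z) = (z+Cconj z)%C.
Proof. apply injective_projections; unfold Re; simpl; ring. Qed.

Lemma RtoC_2Im (z : C) : RtoC (2*Im z) = (- Ci*(z-Cconj z))%C.
Proof. apply injective_projections; unfold Im; simpl; ring. Qed.

Lemma Cconj_RtoC (x : R) : Cconj x = x.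
Proof. apply injective_projections; simpl; ring. Qed.

Lemma Cconj_Ci : Cconj Ci = (- Ci)%C.
Proof. apply injective_projections; simpl; ring. Qed.

Lemma Cconj_pow (z : C) (n : nat) : Cconj (z^n)%C = (Cconj z^n)%C.
Proof. induction n as [|n IH]; simpl; [apply Cconj_RtoC|]. rewrite Cmult_conj, IH. auto. Qed.

Lemma sqn_nonneg (z : C) : 0 <= sqn z.
Proof. unfold sqn. assert (0 <= Re z^2) by apply pow2_ge_0. assert (0 <= Im z^2) by apply pow2_ge_0. lra. Qed.

Lemma DP_DD (A B w : C) : DD A B w = DP A B w+8*eD A B^2.
Proof.
 unfold DD, DP, eD, sqn. destruct A as [a1 a2], B as [b1 b2]. unfold Re, Im. simpl. ring.
Qed.

Lemma DP_pos (A B w : C) : w <> 0%C -> 0 < DP A B w.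
Proof.
 intros Hw. have Pw : 0 < sqn w by (apply norm2_pos; auto).
 have E : DP A B w = sqn A^2+10*(sqn A*sqn B)+sqn B^2+4*Re (B*Cconj A)%C^2+sqn w.
 { unfold DP, sqn. destruct A as [a1 a2], B as [b1 b2]. unfold Re, Im. simpl. ring. }
 assert (0 <= sqn A^2) by apply pow2_ge_0. assert (0 <= sqn B^2) by apply pow2_ge_0.
 assert (0 <= Re (B*Cconj A)%C^2) by apply pow2_ge_0.
 assert (0 <= sqn A*sqn B) by (apply Rmult_le_pos; apply sqn_nonneg). lra.
Qed.

Ltac conj_push := repeat (rewrite Cplus_conj || rewrite Cmult_conj || rewrite Cminus_conj || rewrite Copp_conj || rewrite Cconj_pow || rewrite Cconj_conj || rewrite Cconj_RtoC || rewrite Cconj_Ci).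

(** Polarized forms: conjugates become independent variables, so that the real identities turn into
    polynomial identities modulo the equations for [w^2] and for its conjugate. *)
Definition DPc (A B w A' B' w' : C) : C :=
 ((A*A')^2+12*(A*A')*(B*B')+(B*B')^2+((B*A')^2+(B'*A)^2)+w*w')%C.
Definition DDc (A B w A' B' w' : C) : C :=
 ((A*A')^2+16*(A*A')*(B*B')+(B*B')^2-((B*A')^2+(B'*A)^2)+w*w')%C.
Definition gDc (A B w A' B' w' : C) : C :=
 (w*(A*A'^3+7*(B*B'*A'^2)+7*(A*B'^2*A')+B*B'^3)
 + w'*(A'*A^3+7*(B'*B*A^2)+7*(A'*B^2*A)+B'*B^3))%C.

Lemma RtoC_DP (A B w : C) : RtoC (DP A B w) = DPc A B w (Cconj A) (Cconj B) (Cconj w).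
Proof. unfold DP, DPc. rewrite !RtoC_plus, RtoC_2Re, !RtoC_mult, !RtoC_pow, !RtoC_sqn. conj_push. ring. Qed.

Lemma RtoC_DD (A B w : C) : RtoC (DD A B w) = DDc A B w (Cconj A) (Cconj B) (Cconj w).
Proof. unfold DD, DDc. rewrite !RtoC_plus, RtoC_minus, RtoC_2Re, !RtoC_plus, !RtoC_mult, !RtoC_pow, !RtoC_sqn. conj_push. ring. Qed.

Lemma RtoC_gD (A B w : C) : RtoC (gD A B w) = gDc A B w (Cconj A) (Cconj B) (Cconj w).
Proof. unfold gD. rewrite RtoC_2Re. unfold GD, gDc. conj_push. auto. Qed.

Lemma RtoC_hP (A B w : C) : RtoC (hP A B w) = (B*A*Cconj w+Cconj B*Cconj A*w)%C.
Proof. unfold hP. rewrite RtoC_2Re. conj_push. auto. Qed.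

Lemma RtoC_2eD (A B : C) : RtoC (2*eD A B) = (- Ci*(B*Cconj A-Cconj B*A))%C.
Proof. unfold eD. rewrite RtoC_2Im. conj_push. auto. Qed.

(** The derivative of a real function can be computed from a formula with complex conjugates. *)
Lemma cderive_real (f : R -> R) (F : R -> C) (t : R) (l : C) :
 (forall s, RtoC (f s) = F s) -> cderive F t l -> exists d : R, is_derive f t d /\ RtoC d = l.
Proof.
 intros E [H1 H2]. exists (Re l). split.
 - apply (is_derive_ext (fun s => Re (F s))); [intros s; rewrite <- E; auto|exact H1].
 - have E2 : Im l = 0.
  { apply is_derive_unique in H2. rewrite <- H2, (Derive_ext _ (fun _ => 0)); [apply Derive_const|intros s; rewrite <- E; auto]. }
  apply injective_projections; auto.
Qed.

Lemma cderive_opp (f : R -> C) (t : R) (l : C) : cderive f t l -> cderive (fun s => - f s)%C t (- l)%C.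
Proof. intros [H1 H2]. split; [exact (is_derive_opp _ _ _ H1)|exact (is_derive_opp _ _ _ H2)]. Qed.

Lemma cderive_pow (f : R -> C) (n : nat) (t : R) (l : C) : cderive f t l ->
 cderive (fun s => f s^n)%C t (match n with O => 0 | S k => IZR (Z.of_nat n)*f t^k*l end)%C.
Proof.
 intros H. induction n as [|n IH]; [apply (cderive_const 1%C)|].
 eapply cderive_eq; [exact (cderive_mult _ _ _ _ _ H IH)|]. destruct n as [|n]; [simpl; ring|].
 rewrite <- !INR_IZR_INZ, (S_INR (S n)), RtoC_plus. simpl Cpow. ring.
Qed.

Ltac cder := lazymatch goal with
 | |- cderive (fun s => (@?f s + @?g s)%C) _ _ => apply (cderive_plus f g); cder
 | |- cderive (fun s => (@?f s - @?g s)%C) _ _ => apply (cderive_plus f (fun s => - g s)%C); cder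
 | |- cderive (fun s => (- @?f s)%C) _ _ => apply (cderive_opp f); cder
 | |- cderive (fun s => (@?f s * @?g s)%C) _ _ => apply (cderive_mult f g); cder
 | |- cderive (fun s => (@?f s^?n)%C) _ _ => apply (cderive_pow f n); cder
 | |- cderive (fun _ => ?c) _ _ => apply (cderive_const c)
 | _ => eassumption
 end.

(** Writing the derivatives of [A] and [B] as multiples of [w] cancels the division by [w], and the
    derivative of [w] becomes a polynomial. *)
Lemma cderive_rad2_sqrt (A B w : R -> C) (t : R) (al be : C) :
 cderive A t (w t*al)%C -> cderive B t (w t*be)%C -> ccont w t -> w t <> 0%C ->
 locally t (fun s => (w s*w s)%C = rad2 (A s) (B s)) ->
 cderive w t (2*A t^3*al+14*A t*B t^2*al+14*A t^2*B t*be+2*B t^3*be)%C.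
Proof.
 intros HA HB Hw Hw0 Hsq. have H2 : RtoC 2 <> 0%C by (intros E; apply RtoC_inj in E; lra).
 have A2 := cderive_mult _ _ _ _ _ HA HA. have B2 := cderive_mult _ _ _ _ _ HB HB.
 have A4 := cderive_mult _ _ _ _ _ A2 A2. have B4 := cderive_mult _ _ _ _ _ B2 B2.
 have AB := cderive_mult _ _ _ _ _ (cderive_const 14%C t) (cderive_mult _ _ _ _ _ A2 B2). cbv beta in *.
 have S := cderive_plus _ _ _ _ _ A4 (cderive_plus _ _ _ _ _ AB B4).
 eapply cderive_eq.
 - eapply cderive_sqrt; [eapply (cderive_ext _ (fun s => rad2 (A s) (B s)) t _ _ S)|auto|auto|auto].
 - field. auto.
  Unshelve. intros s. unfold rad2. ring.
Qed.

Lemma sin_2atan_neg (y : R) : -2*sin (2*atan y) = - 4*y/(1+y^2).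
Proof. rewrite sin_2atan. assert (0 <= y^2) by apply pow2_ge_0. field. lra. Qed.

(** The polynomial identity behind the equation of D, with [z'] and [w'] in the role of the
    conjugates. The arguments [4 w] clear the factors 1/2 of the first two pairs of quadratics. *)
Lemma sum_product_poly (z w z' w' : C) :
 (w*w = 1+14*z^4+z^8)%C -> (w'*w' = 1+14*z'^4+z'^8)%C ->
 let A1 := ((1-z)^2)%C in let B1 := ((1+z)^2)%C in let A1' := ((1-z')^2)%C in let B1' := ((1+z')^2)%C in
 let A2 := ((1+Ci*z)^2)%C in let B2 := (- (1-Ci*z)^2)%C in let A2' := ((1-Ci*z')^2)%C in let B2' := (- (1+Ci*z')^2)%C in
 let A3 := Ci in let B3 := (- Ci*z^2)%C in let A3' := (- Ci)%C in let B3' := (Ci*z'^2)%C in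
 let d1 := (DDc A1 B1 (4*w) A1' B1' (4*w'))%C in let d2 := (DDc A2 B2 (4*w) A2' B2' (4*w'))%C in let d3 := DDc A3 B3 w A3' B3' w' in
 let g1 := (gDc A1 B1 (4*w) A1' B1' (4*w'))%C in let g2 := (gDc A2 B2 (4*w) A2' B2' (4*w'))%C in let g3 := gDc A3 B3 w A3' B3' w' in
 let D := (1+12*z^2*z'^2+(z*z')^4+(z^4+z'^4)+w*w')%C in
 (D*(4*g1*d2*d3+4*g2*d1*d3+16*g3*d1*d2)+2*g1*g2*g3 = 0)%C.
Proof.
 intros H H' A1 B1 A1' B1' A2 B2 A2' B2' A3 B3 A3' B3' d1 d2 d3 g1 g2 g3 D.
 have I2 := Ci_sq.
 have E2 : d2 = (16+16*w*w'+32*z'^2+16*z'^4+64*z*z'-64*z*z'^3+32*z^2+64*z^2*z'^2+32*z^2*z'^4-64*z^3*z'+64*z^3*z'^3+16*z^4+32*z^4*z'^2+16*z^4*z'^4)%C by (unfold d2, DDc, A2, B2, A2', B2'; ring [I2]).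
 have F2 : g2 = (64*w'+64*w-64*z'^2*w'-64*z'^2*w+64*z'^4*w-64*z'^6*w-128*z*z'*w'-128*z*z'*w-768*z*z'^3*w-128*z*z'^5*w-64*z^2*w'-64*z^2*w+64*z^2*z'^2*w'+64*z^2*z'^2*w-64*z^2*z'^4*w+64*z^2*z'^6*w-768*z^3*z'*w'+64*z^4*w'-64*z^4*z'^2*w'-128*z^5*z'*w'-64*z^6*w'+64*z^6*z'^2*w')%C by (unfold g2, gDc, A2, B2, A2', B2'; ring [I2]).
 have E3 : d3 = (1+w*w'-z'^4+16*z^2*z'^2-z^4+z^4*z'^4)%C by (unfold d3, DDc, A3, B3, A3', B3'; ring [I2]).
 have F3 : g3 = (- (w)-w'-7*z'^4*w-7*z^2*z'^2*w'-7*z^2*z'^2*w-z^2*z'^6*w-7*z^4*w'-z^6*z'^2*w')%C by (unfold g3, gDc, A3, B3, A3', B3'; ring [I2]).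
 rewrite E2, F2, E3, F3. unfold d1, g1, D, DDc, gDc, A1, B1, A1', B1'.
 ring [H H'].
Qed.

(** The calculus part for P: two polynomial identities are all that the pendulum equation requires
    of the data. *)
Lemma hat_P_real (a b h D : R -> R) (t da db dh dD X : R) :
 is_derive a t da -> is_derive b t db -> is_derive h t dh -> is_derive D t dD ->
 0 < D t -> 0 < a t+b t ->
 2*(dh*(a t+b t)*D t-h t*(da+db)*D t)-h t*(a t+b t)*dD =
  2*(a t-b t)*X*((a t+b t)^2*D t+6*h t^2) ->
 (2*(da-db)*D t-(a t-b t)*dD)*((a t+b t)^2*D t+6*h t^2) = - 8*h t*(a t+b t)*D t^2*X ->
 is_derive (fun t => atan (- (sqrt 6*h t)/((a t+b t)*sqrt (D t)))) t (sqrt 6*(b t-a t)/sqrt (D t)*X) /\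
 is_derive (fun t => sqrt 6*(b t-a t)/sqrt (D t)) t (-2*sin (2*atan (- (sqrt 6*h t)/((a t+b t)*sqrt (D t))))*X).
Proof.
 intros Ha Hb Hh HD P M I1 I2. have S6 : sqrt 6^2 = 6 by (apply pow2_sqrt; lra).
 have Hr := sqrt_lt_R0 _ P. have R2 : sqrt (D t)^2 = D t by (apply pow2_sqrt; lra).
 set (m := a t+b t) in *. set (r := sqrt (D t)) in *. set (s6 := sqrt 6) in *.
 have Hden : 0 < m^2*D t+6*h t^2.
 { assert (0 < m^2*D t) by (apply Rmult_lt_0_compat; auto; apply pow2_gt_0; lra). assert (0 <= h t^2) by apply pow2_ge_0. lra. }
 have Hy : 1+(- (s6*h t)/(m*r))^2 = (m^2*D t+6*h t^2)/(m^2*D t).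
 { rewrite <- S6, <- R2. field. lra. }
 have Hmr : m*r <> 0 by (apply Rgt_not_eq, Rmult_lt_0_compat; auto).
 split.
 - auto_derive; [fold m r; repeat split; auto; eexists; eassumption|].
  derive_value Ha. derive_value Hb. derive_value Hh. derive_value HD. fold m r.
  apply (Rmult_eq_reg_r (2*r*(m^2*D t+6*h t^2))); [|apply Rgt_not_eq; repeat apply Rmult_lt_0_compat; lra].
  transitivity (- s6*(2*(dh*m*D t-h t*(da+db)*D t)-h t*m*dD)).
  + unfold Rdiv in Hy. replace (- (s6*h t) * / (m*r)*(- (s6*h t) * / (m*r)*1)) with ((- (s6*h t) * / (m*r))^2) by ring.
   rewrite Hy. rewrite <- R2. field. split; [lra|]. split; [lra|]. rewrite Rpow_mult_distr, R2. lra.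
  + rewrite I1. field. lra.
 - rewrite sin_2atan_neg. rewrite Hy. auto_derive; [fold r; repeat split; auto; try (eexists; eassumption); lra|].
  derive_value Ha. derive_value Hb. derive_value HD. fold r.
  apply (Rmult_eq_reg_r (2*r*D t*(m^2*D t+6*h t^2))); [|apply Rgt_not_eq; repeat apply Rmult_lt_0_compat; lra].
  transitivity (- s6*((2*(da-db)*D t-(a t-b t)*dD)*(m^2*D t+6*h t^2))).
  + rewrite <- R2. field. lra.
  + rewrite I2. rewrite <- R2. field. split; [lra|]. split; [lra|]. rewrite Rpow_mult_distr, R2. lra.
Qed.

Lemma Ceq_of (x y u v : C) : u = v -> (x-y = u-v)%C -> x = y.
Proof. intros -> H. transitivity (x-y+y)%C; [ring|]. rewrite H. ring. Qed.

Lemma rad2_sum_pos (A B w : C) : w <> 0%C -> (w*w)%C = rad2 A B -> 0 < sqn A+sqn B.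
Proof.
 intros Hw E. have PA := sqn_nonneg A. have PB := sqn_nonneg B.
 destruct (Req_dec (sqn A+sqn B) 0) as [E0|]; [|lra]. exfalso.
 have EA : sqn A = 0 by lra. have EB : sqn B = 0 by lra. apply sum_sq_eq_0 in EA, EB. destruct EA, EB.
 assert (A = 0%C) by (apply injective_projections; auto). assert (B = 0%C) by (apply injective_projections; auto). subst.
 apply (Cmult_neq_0 w w Hw Hw). rewrite E. unfold rad2. ring.
Qed.

Lemma rad2_conj (A B w : C) : (w*w)%C = rad2 A B -> (Cconj w*Cconj w)%C = rad2 (Cconj A) (Cconj B).
Proof. intros H. rewrite <- Cmult_conj, H. unfold rad2. conj_push. auto. Qed.

(** With the coordinate as time, the expressions in the Weierstrass data satisfy the same system as
    [phiP] and [phiP1]. The two identities of [hat_P_real] are checked in polarized form. *)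
Lemma hat_P (A B w : R -> C) (t : R) (al be : C) :
 cderive A t (w t*al)%C -> cderive B t (w t*be)%C -> ccont w t -> w t <> 0%C ->
 locally t (fun s => (w s*w s)%C = rad2 (A s) (B s)) ->
 let X := 2*Re (be*A t-B t*al)%C in
 is_derive (fun t => atan (tP (A t) (B t) (w t))) t (cP (A t) (B t) (w t)*X) /\
 is_derive (fun t => cP (A t) (B t) (w t)) t (-2*sin (2*atan (tP (A t) (B t) (w t)))*X).
Proof.
 intros HA HB Hw Hw0 Hsq X. have Dw := cderive_rad2_sqrt A B w t al be HA HB Hw Hw0 Hsq.
 have Hs := locally_singleton _ _ Hsq. have Hs' := rad2_conj _ _ _ Hs.
 have HA' := cderive_conj _ _ _ HA. have HB' := cderive_conj _ _ _ HB. have Dw' := cderive_conj _ _ _ Dw.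
 destruct (cderive_real (fun s => sqn (A s)) (fun s => A s*Cconj (A s))%C t _ (fun s => RtoC_sqn (A s)) ltac:(cder)) as (da & Da & Ea).
 destruct (cderive_real (fun s => sqn (B s)) (fun s => B s*Cconj (B s))%C t _ (fun s => RtoC_sqn (B s)) ltac:(cder)) as (db & Db & Eb).
 destruct (cderive_real (fun s => hP (A s) (B s) (w s)) _ t _ (fun s => RtoC_hP (A s) (B s) (w s)) ltac:(cder)) as (dh & Dh & Eh).
 destruct (cderive_real (fun s => DP (A s) (B s) (w s)) _ t _ (fun s => RtoC_DP (A s) (B s) (w s)) ltac:(unfold DPc; cder)) as (dD & DDv & ED).
 have EX : RtoC X = (be*A t-B t*al+(Cconj be*Cconj (A t)-Cconj (B t)*Cconj al))%C.
 { unfold X. rewrite RtoC_2Re. conj_push. auto. }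
 apply (hat_P_real (fun s => sqn (A s)) (fun s => sqn (B s)) _ _ t da db dh dD X Da Db Dh DDv);
  [apply DP_pos; auto|apply (rad2_sum_pos _ _ (w t)); auto| |]; apply RtoC_inj; RtoC_push;
  rewrite Ea, Eb, ED, ?Eh, EX, !RtoC_sqn, RtoC_hP, RtoC_DP; unfold DPc; simpl Z.of_nat; conj_push; unfold rad2 in Hs, Hs'; ring [Hs Hs'].
Qed.

(** [sD] as a function of the Weierstrass data; [gH] is its derivative [2 cD vD] with respect to the
    coordinate. *)
Definition sH (A B w : C) : R := - (4*sqrt 2*eD A B)/sqrt (DD A B w).
Definition gH (A B w : C) : R := 2*sqrt 2*gD A B w/(DD A B w*sqrt (DD A B w)).

Lemma hat_D_real (e D g : R -> R) (t de dD dg X : R) :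
 is_derive e t de -> is_derive D t dD -> is_derive g t dg -> 0 < D t ->
 2*(2*de)*D t-2*e t*dD = -2*g t*X ->
 2*dg*D t-3*g t*dD = (10*(2*e t)*D t^2-32*(2*e t)^3*D t)*X ->
 is_derive (fun t => - (4*sqrt 2*e t)/sqrt (D t)) t (2*sqrt 2*g t/(D t*sqrt (D t))*X) /\
 is_derive (fun t => 2*sqrt 2*g t/(D t*sqrt (D t))) t
  ((-5*(- (4*sqrt 2*e t)/sqrt (D t))+2*(- (4*sqrt 2*e t)/sqrt (D t))^3)*X).
Proof.
 intros He HD Hg P I1 I2. have S2 : sqrt 2^2 = 2 by (apply pow2_sqrt; lra).
 have Hr := sqrt_lt_R0 _ P. have R2 : sqrt (D t)^2 = D t by (apply pow2_sqrt; lra).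
 set (r := sqrt (D t)) in *. set (s2 := sqrt 2) in *.
 have Hn : D t*r <> 0 by (apply Rgt_not_eq, Rmult_lt_0_compat; auto).
 split.
 - auto_derive; [fold r; repeat split; auto; try (eexists; eassumption); lra|].
  derive_value He. derive_value HD. fold r.
  apply (Rmult_eq_reg_r (D t*r)); [|auto].
  transitivity (- s2*(2*(2*de)*D t-2*e t*dD)).
  + rewrite <- R2. field. lra.
  + rewrite I1. field. lra.
 - auto_derive; [fold r; repeat split; auto; try (eexists; eassumption); lra|].
  derive_value Hg. derive_value HD. fold r.
  apply (Rmult_eq_reg_r (D t*D t*r)); [|apply Rgt_not_eq; repeat apply Rmult_lt_0_compat; auto].
  transitivity (s2*(2*dg*D t-3*g t*dD)).
  + rewrite <- R2. field. lra.
  + rewrite I2. rewrite <- R2.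
   replace ((-5*(- (4*s2*e t)/r)+2*(- (4*s2*e t)/r)^3)) with
    (20*s2*e t/r-128*s2^2*s2*e t^3/r^3) by (field; lra).
   rewrite S2. field. lra.
Qed.

Lemma DD_pos (A B w : C) : w <> 0%C -> 0 < DD A B w.
Proof.
 intros H. rewrite DP_DD. have P := DP_pos A B w H. assert (0 <= eD A B^2) by apply pow2_ge_0. lra.
Qed.

(** Both [sD] and this expression solve [s'' = - 5 s + 2 s^3], the equation of [sn (2 t)] at
    parameter 1/4, with the coordinate as time. *)
Lemma hat_D (A B w : R -> C) (t : R) (al be : C) :
 cderive A t (w t*al)%C -> cderive B t (w t*be)%C -> ccont w t -> w t <> 0%C ->
 locally t (fun s => (w s*w s)%C = rad2 (A s) (B s)) ->
 let X := 2*Re (Ci*(be*A t-B t*al))%C in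
 is_derive (fun t => sH (A t) (B t) (w t)) t (gH (A t) (B t) (w t)*X) /\
 is_derive (fun t => gH (A t) (B t) (w t)) t
  ((-5*sH (A t) (B t) (w t)+2*sH (A t) (B t) (w t)^3)*X).
Proof.
 intros HA HB Hw Hw0 Hsq X. have Dw := cderive_rad2_sqrt A B w t al be HA HB Hw Hw0 Hsq.
 have Hs := locally_singleton _ _ Hsq. have Hs' := rad2_conj _ _ _ Hs. have I2 := Ci_sq.
 have HA' := cderive_conj _ _ _ HA. have HB' := cderive_conj _ _ _ HB. have Dw' := cderive_conj _ _ _ Dw.
 destruct (cderive_real (fun s => 2*eD (A s) (B s)) _ t _ (fun s => RtoC_2eD (A s) (B s)) ltac:(cder)) as (de & De & Ee).
 destruct (cderive_real (fun s => DD (A s) (B s) (w s)) _ t _ (fun s => RtoC_DD (A s) (B s) (w s)) ltac:(unfold DDc; cder)) as (dD & Dd & ED).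
 destruct (cderive_real (fun s => gD (A s) (B s) (w s)) _ t _ (fun s => RtoC_gD (A s) (B s) (w s)) ltac:(unfold gDc; cder)) as (dg & Dg & Eg).
 have EX : RtoC X = (Ci*(be*A t-B t*al) + - Ci*(Cconj be*Cconj (A t)-Cconj (B t)*Cconj al))%C.
 { unfold X. rewrite RtoC_2Re. conj_push. auto. }
 have De' : is_derive (fun s => eD (A s) (B s)) t (de/2).
 { apply (is_derive_ext (fun s => / 2*(2*eD (A s) (B s)))); [intros s; simpl; field|].
  eapply is_derive_eq; [exact (is_derive_scal _ t (/ 2) _ De)|apply Rmult_comm]. }
 have E2 := RtoC_2eD (A t) (B t).
 apply (hat_D_real _ _ _ t _ dD dg X De' Dd Dg); [apply DD_pos; auto| |]; replace (2*(de/2)) with de by field;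
  set (e := 2*eD (A t) (B t)) in *; clearbody e; apply RtoC_inj; RtoC_push;
  rewrite ED, ?Ee, ?Eg, EX, E2, RtoC_DD, RtoC_gD; unfold DDc, gDc; simpl Z.of_nat; conj_push; unfold rad2 in Hs, Hs'; ring [Hs Hs' I2].
Qed.

(** Each pair is made so that [4 qA qB] is the square of a null component, its Wronskian is that
    component, and [rad2] gives the common radicand ([quad_prod], [quad_derive], [quad_rad]). *)
Definition qA1 (z : C) : C := ((/ 2)%R*(1-z)^2)%C.
Definition qB1 (z : C) : C := ((/ 2)%R*(1+z)^2)%C.
Definition qA2 (z : C) : C := ((/ 2)%R*(1+Ci*z)^2)%C.
Definition qB2 (z : C) : C := (- ((/ 2)%R*(1-Ci*z)^2))%C.
Definition qA3 (z : C) : C := Ci.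
Definition qB3 (z : C) : C := (- Ci*z^2)%C.

(** [(v1, v2, v3) / v0] is the Gauss map. *)
Definition v0 (z : C) : R := 1+sqn z.
Definition v1 (z : C) : R := 2*Re z.
Definition v2 (z : C) : R := 2*Im z.
Definition v3 (z : C) : R := sqn z-1.

Lemma v0_pos (z : C) : 0 < v0 z.
Proof. unfold v0. have H := sqn_nonneg z. lra. Qed.

Lemma v_sphere (z : C) : v1 z^2+v2 z^2+v3 z^2 = v0 z^2.
Proof. unfold v0, v1, v2, v3, sqn. ring. Qed.

Ltac in_coordinates z := unfold v0, v1, v2, v3, n1, n2, n3, qA1, qB1, qA2, qB2, qA3, qB3, eD, DP, hP, sqn; destruct z as [x y]; unfold Re, Im; simpl.

Lemma quad_diff (z : C) : sqn (qB1 z)-sqn (qA1 z) = v0 z*v1 z /\ sqn (qB2 z)-sqn (qA2 z) = v0 z*v2 z /\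
 sqn (qB3 z)-sqn (qA3 z) = v0 z*v3 z.
Proof. in_coordinates z. split; [|split]; field. Qed.

Lemma quad_sum (z : C) : 2*(sqn (qA1 z)+sqn (qB1 z)) = v0 z^2+v1 z^2 /\
 2*(sqn (qA2 z)+sqn (qB2 z)) = v0 z^2+v2 z^2 /\ 2*(sqn (qA3 z)+sqn (qB3 z)) = v0 z^2+v3 z^2.
Proof. in_coordinates z. split; [|split]; field. Qed.

Lemma quad_eD (z : C) : 2*eD (qA1 z) (qB1 z) = - (v2 z*v3 z) /\ 2*eD (qA2 z) (qB2 z) = - (v3 z*v1 z) /\
 2*eD (qA3 z) (qB3 z) = - (v1 z*v2 z).
Proof. in_coordinates z. split; [|split]; field. Qed.

(** The three coordinates share one denominator. With [quad_diff] this makes the three slopes of P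
    proportional to the Gauss map. *)
Lemma quad_DP (z w : C) : let d := (v0 z^4+v1 z^4+v2 z^4+v3 z^4)/2+sqn w in
 DP (qA1 z) (qB1 z) w = d /\ DP (qA2 z) (qB2 z) w = d /\ DP (qA3 z) (qB3 z) w = d.
Proof. in_coordinates z. split; [|split]; field. Qed.

Lemma quad_prod (z : C) : (4*(qB1 z*qA1 z) = n1 z^2 /\ 4*(qB2 z*qA2 z) = n2 z^2 /\ 4*(qB3 z*qA3 z) = n3 z^2)%C.
Proof.
 in_coordinates z; split; [|split]; apply injective_projections; simpl; field.
Qed.

Lemma quad_rad (z : C) : rad2 (qA1 z) (qB1 z) = P8 z /\ rad2 (qA2 z) (qB2 z) = P8 z /\ rad2 (qA3 z) (qB3 z) = P8 z.
Proof.
 have I2 := Ci_sq.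
 have Hh : (2*(/ 2)%R)%C = 1%C by (rewrite <- RtoC_mult; f_equal; field).
 have E : forall s : C, (s = (/ 2)%R*(2*s))%C by (intros s; rewrite <- (Cmult_1_l s) at 1; rewrite <- Hh; ring).
 have H16 : forall x y : C, (16*x = 16*y)%C -> x = y.
 { intros x y H. rewrite (E x), (E y), (E (2*x)%C), (E (2*y)%C), (E (2*(2*x))%C), (E (2*(2*y))%C),
   (E (2*(2*(2*x)))%C), (E (2*(2*(2*y)))%C). do 4 f_equal. transitivity (16*x)%C; [ring|]. rewrite H. ring. }
 unfold rad2, P8, qA1, qB1, qA2, qB2, qA3, qB3. set (h := RtoC (/ 2)) in *. clearbody h.
 split; [|split]; apply H16; ring [I2 Hh].
Qed.

Lemma cderive_sq (z : R -> C) (t : R) (d : C) : cderive z t d -> cderive (fun t => z t^2)%C t (2*z t*d)%C.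
Proof.
 intros H. eapply cderive_ext; [|eapply cderive_eq; [exact (cderive_mult _ _ _ _ _ H H)|]]; [intros s; simpl; ring|ring].
Qed.

Lemma quad_derive (z : R -> C) (t : R) (d : C) : cderive z t d ->
 (exists a b, cderive (fun t => qA1 (z t)) t a /\ cderive (fun t => qB1 (z t)) t b /\ (b*qA1 (z t)-qB1 (z t)*a = n1 (z t)*d)%C) /\
 (exists a b, cderive (fun t => qA2 (z t)) t a /\ cderive (fun t => qB2 (z t)) t b /\ (b*qA2 (z t)-qB2 (z t)*a = n2 (z t)*d)%C) /\
 (exists a b, cderive (fun t => qA3 (z t)) t a /\ cderive (fun t => qB3 (z t)) t b /\ (b*qA3 (z t)-qB3 (z t)*a = n3 (z t)*d)%C).
Proof.
 intros H. have I2 := Ci_sq.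
 have Hh : (2*(/ 2)%R)%C = 1%C by (rewrite <- RtoC_mult; f_equal; field).
 have L : forall c e : C, cderive (fun t => e*(1+c*z t)^2)%C t (e*(2*(1+c*z t)*(c*d)))%C.
 { intros c e. eapply cderive_eq; [apply (cderive_mult (fun _ => e)); [apply cderive_const|]|].
  - apply cderive_sq. apply (cderive_plus (fun _ => 1%C)); [apply cderive_const|].
   apply (cderive_mult (fun _ => c)); [apply cderive_const|exact H].
  - cbv beta. ring. }
 split; [|split].
 - exists ((/ 2)%R*(2*(1 + -1*z t)*(-1*d)))%C, ((/ 2)%R*(2*(1+1*z t)*(1*d)))%C.
  split; [eapply cderive_ext; [|exact (L (-1)%C (RtoC (/ 2)))]; intros s; unfold qA1; ring|].
  split; [eapply cderive_ext; [|exact (L 1%C (RtoC (/ 2)))]; intros s; unfold qB1; ring|].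
  unfold qA1, qB1, n1. set (h := RtoC (/ 2)) in *. clearbody h. ring [Hh].
 - exists ((/ 2)%R*(2*(1+Ci*z t)*(Ci*d)))%C, (- (/ 2)%R*(2*(1 + - Ci*z t)*(- Ci*d)))%C.
  split; [eapply cderive_ext; [|exact (L Ci (RtoC (/ 2)))]; intros s; unfold qA2; ring|].
  split; [eapply cderive_ext; [|exact (L (- Ci)%C (- RtoC (/ 2))%C)]; intros s; unfold qB2; ring|].
  unfold qA2, qB2, n2. set (h := RtoC (/ 2)) in *. clearbody h. ring [Hh I2].
 - exists 0%C, (- Ci*(2*z t*d))%C.
  split; [exact (cderive_const Ci t)|]. split.
  + have Q := cderive_mult _ _ _ _ _ (cderive_const (- Ci)%C t) (cderive_sq z t d H). cbv beta in Q.
   eapply cderive_eq; [exact Q|]. ring.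
  + unfold qA3, qB3, n3. ring [I2].
Qed.

Definition hatP (qA qB : C -> C) (z w : C) (x : R) : Prop :=
 phiP x = atan (tP (qA z) (qB z) w) /\ phiP1 x = cP (qA z) (qB z) w.

Definition stateP (s : C*C*R3) : Prop :=
 let '(z, w, (x, y, u)) := s in w <> 0%C /\ (w*w)%C = P8 z /\
 hatP qA1 qB1 z w x /\ hatP qA2 qB2 z w y /\ hatP qA3 qB3 z w u /\ phiP x+phiP y+phiP u = 0.

Definition hatD (qA qB : C -> C) (z w : C) (x : R) : Prop :=
 sD x = sH (qA z) (qB z) w /\ 2*cD x*vD x = gH (qA z) (qB z) w.

Definition stateD (s : C*C*R3) : Prop :=
 let '(z, w, (x, y, u)) := s in w <> 0%C /\ (w*w)%C = P8 z /\
 hatD qA1 qB1 z w x /\ hatD qA2 qB2 z w y /\ hatD qA3 qB3 z w u.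

(** What a coordinate function needs from its pair of quadratics. *)
Definition quad_pair (qA qB n : C -> C) : Prop :=
 (forall z, rad2 (qA z) (qB z) = P8 z) /\
 forall (z : R -> C) t d, cderive z t d ->
  exists a b, cderive (fun t => qA (z t)) t a /\ cderive (fun t => qB (z t)) t b /\ (b*qA (z t)-qB (z t)*a = n (z t)*d)%C.

Lemma quad_pairs : quad_pair qA1 qB1 n1 /\ quad_pair qA2 qB2 n2 /\ quad_pair qA3 qB3 n3.
Proof.
 split; [|split]; (split; [intros z; apply (quad_rad z)|intros z t d H; apply (quad_derive z t d H)]).
Qed.

Lemma hat_speed_P (qA qB n : C -> C) (z dz w : R -> C) (t : R) : quad_pair qA qB n ->
 cderive z t (dz t) -> ccont w t -> w t <> 0%C -> locally t (fun s => (w s*w s)%C = P8 (z s)) ->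
 is_derive (fun t => atan (tP (qA (z t)) (qB (z t)) (w t))) t (cP (qA (z t)) (qB (z t)) (w t)*speed 2 n z dz w t) /\
 is_derive (fun t => cP (qA (z t)) (qB (z t)) (w t)) t
  (-2*sin (2*atan (tP (qA (z t)) (qB (z t)) (w t)))*speed 2 n z dz w t).
Proof.
 intros [Hr Hd] Hz Hw Hw0 Hsq. destruct (Hd z t _ Hz) as (a & b & Ha & Hb & E).
 have Ea : a = (w t*(a/w t))%C by (field; auto). have Eb : b = (w t*(b/w t))%C by (field; auto).
 have ES : 2*Re (b/w t*qA (z t)-qB (z t)*(a/w t))%C = speed 2 n z dz w t.
 { unfold speed. replace (b/w t*qA (z t)-qB (z t)*(a/w t))%C with ((b*qA (z t)-qB (z t)*a)/w t)%C by (field; auto).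
  rewrite E. replace (2*n (z t)*dz t/w t)%C with (2*(n (z t)*dz t/w t))%C by (field; auto). unfold Re. simpl. ring. }
 rewrite Ea in Ha. rewrite Eb in Hb. rewrite <- ES.
 apply (hat_P (fun t => qA (z t)) (fun t => qB (z t)) w t _ _ Ha Hb); auto.
 generalize Hsq. apply filter_imp. intros s ->. auto.
Qed.

Lemma hat_speed_D (qA qB n : C -> C) (z dz w : R -> C) (t : R) : quad_pair qA qB n ->
 cderive z t (dz t) -> ccont w t -> w t <> 0%C -> locally t (fun s => (w s*w s)%C = P8 (z s)) ->
 is_derive (fun t => sH (qA (z t)) (qB (z t)) (w t)) t (gH (qA (z t)) (qB (z t)) (w t)*speed (2*Ci) n z dz w t) /\
 is_derive (fun t => gH (qA (z t)) (qB (z t)) (w t)) t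
  ((-5*sH (qA (z t)) (qB (z t)) (w t)+2*sH (qA (z t)) (qB (z t)) (w t)^3)*speed (2*Ci) n z dz w t).
Proof.
 intros [Hr Hd] Hz Hw Hw0 Hsq. destruct (Hd z t _ Hz) as (a & b & Ha & Hb & E).
 have Ea : a = (w t*(a/w t))%C by (field; auto). have Eb : b = (w t*(b/w t))%C by (field; auto).
 have ES : 2*Re (Ci*(b/w t*qA (z t)-qB (z t)*(a/w t)))%C = speed (2*Ci) n z dz w t.
 { unfold speed. replace (b/w t*qA (z t)-qB (z t)*(a/w t))%C with ((b*qA (z t)-qB (z t)*a)/w t)%C by (field; auto).
  rewrite E. replace (2*Ci*n (z t)*dz t/w t)%C with (2*(Ci*(n (z t)*dz t/w t)))%C by (field; auto). unfold Re. simpl. ring. }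
 rewrite Ea in Ha. rewrite Eb in Hb. rewrite <- ES.
 apply (hat_D (fun t => qA (z t)) (fun t => qB (z t)) w t _ _ Ha Hb); auto.
 generalize Hsq. apply filter_imp. intros s ->. auto.
Qed.

(** Both sides of the relation solve the same second-order system driven by the speed of the
    coordinate, so agreement at time 0 persists. *)
Lemma hatP_path (qA qB n : C -> C) (z dz w : R -> C) (X : R -> R) : quad_pair qA qB n ->
 (forall t, cderive z t (dz t) /\ ccont w t /\ w t <> 0%C /\ (w t*w t)%C = P8 (z t)) ->
 (forall t, continuous (speed 2 n z dz w) t) -> (forall t, is_derive X t (speed 2 n z dz w t)) ->
 hatP qA qB (z 0) (w 0) (X 0) -> forall t, 0 <= t <= 1 -> hatP qA qB (z t) (w t) (X t).
Proof.
 intros Hq Hl Hc HX [H0 H0'].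
 have Hh := fun t => hat_speed_P qA qB n z dz w t Hq (proj1 (Hl t)) (proj1 (proj2 (Hl t))) (proj1 (proj2 (proj2 (Hl t))))
  (filter_forall _ (fun s => proj2 (proj2 (proj2 (Hl s))))).
 have L : forall f l t, is_derive f (X t) l -> is_derive (fun s => f (X s)) t (l*speed 2 n z dz w t).
 { intros f l t Hf. eapply is_derive_eq; [apply (is_derive_comp f X); [exact Hf|apply HX]|]. apply Rmult_comm. }
 refine (second_order_unique (fun u => -2*sin (2*u)) 4 (speed 2 n z dz w) (fun t => phiP (X t)) (fun t => phiP1 (X t))
  (fun t => atan (tP (qA (z t)) (qB (z t)) (w t))) (fun t => cP (qA (z t)) (qB (z t)) (w t)) 0 1 0 _ _ _ _ _ _ _ _ _); auto; try lra.
 - intros t _. apply L, is_derive_phiP.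
 - intros t _. apply L, is_derive_phiP1.
 - intros t _. apply Hh.
 - intros t _. apply Hh.
 - intros t _. apply sin2_lipschitz.
Qed.

Lemma is_derive_2cv (x : R) : is_derive (fun x => 2*cD x*vD x) x (-5*sD x+2*sD x^3).
Proof.
 destruct (Jacobi_D x) as (D1 & D2 & D3 & E1 & E2). derive_auto. transitivity (-4*sD x*vD x^2-sD x*cD x^2); [field|]. rewrite E2. replace (cD x^2) with (1-sD x^2) by lra. field.
Qed.

Lemma sH_sq (A B w : C) : w <> 0%C -> sH A B w^2 = 32*eD A B^2/DD A B w.
Proof.
 intros Hw. have P := DD_pos A B w Hw. unfold sH. have S2 : sqrt 2^2 = 2 by (apply pow2_sqrt; lra).
 have Hr := sqrt_lt_R0 _ P. have R2 : sqrt (DD A B w)^2 = DD A B w by (apply pow2_sqrt; lra).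
 transitivity (16*sqrt 2^2*eD A B^2/sqrt (DD A B w)^2); [field; lra|]. rewrite S2, R2. field. lra.
Qed.

Lemma hatD_path (qA qB n : C -> C) (z dz w : R -> C) (X : R -> R) : quad_pair qA qB n ->
 (forall t, cderive z t (dz t) /\ ccont w t /\ w t <> 0%C /\ (w t*w t)%C = P8 (z t)) ->
 (forall t, continuous (speed (2*Ci) n z dz w) t) -> (forall t, is_derive X t (speed (2*Ci) n z dz w t)) ->
 hatD qA qB (z 0) (w 0) (X 0) -> forall t, 0 <= t <= 1 -> hatD qA qB (z t) (w t) (X t).
Proof.
 intros Hq Hl Hc HX [H0 H0'].
 have Hh := fun t => hat_speed_D qA qB n z dz w t Hq (proj1 (Hl t)) (proj1 (proj2 (Hl t))) (proj1 (proj2 (proj2 (Hl t))))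
  (filter_forall _ (fun s => proj2 (proj2 (proj2 (Hl s))))).
 have L : forall f l t, is_derive f (X t) l -> is_derive (fun s => f (X s)) t (l*speed (2*Ci) n z dz w t).
 { intros f l t Hf. eapply is_derive_eq; [apply (is_derive_comp f X); [exact Hf|apply HX]|]. apply Rmult_comm. }
 (* The squares of the two solutions are at most 1 and 4, which makes the cubic Lipschitz; 19 is a
    crude constant. *)
 refine (second_order_unique (fun s => -5*s+2*s^3) 19 (speed (2*Ci) n z dz w) (fun t => sD (X t)) (fun t => 2*cD (X t)*vD (X t))
  (fun t => sH (qA (z t)) (qB (z t)) (w t)) (fun t => gH (qA (z t)) (qB (z t)) (w t)) 0 1 0 _ _ _ _ _ _ _ _ _); auto; try lra.
 - intros t _. apply L, Jacobi_D.
 - intros t _. apply (L (fun x => 2*cD x*vD x)), is_derive_2cv.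
 - intros t _. apply Hh.
 - intros t _. apply Hh.
 - intros t _. set (x := sD (X t)). set (y := sH (qA (z t)) (qB (z t)) (w t)).
  have Bx : x^2 <= 1.
  { destruct (Jacobi_D (X t)) as (_ & _ & _ & E & _). fold x in E. assert (0 <= cD (X t)^2) by apply pow2_ge_0. lra. }
  have By : y^2 <= 4.
  { have W := proj1 (proj2 (proj2 (Hl t))). unfold y. rewrite sH_sq by auto. have P := DD_pos (qA (z t)) (qB (z t)) _ W.
   apply (Rmult_le_reg_r (DD (qA (z t)) (qB (z t)) (w t))); auto. unfold Rdiv. rewrite Rmult_assoc, Rinv_l, Rmult_1_r by lra.
   rewrite DP_DD. have Q := DP_pos (qA (z t)) (qB (z t)) _ W. lra. }
  replace (-5*x+2*x^3-(-5*y+2*y^3)) with ((-5+2*(x^2+x*y+y^2))*(x-y)) by ring.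
  rewrite Rabs_mult. apply Rmult_le_compat_r; [apply Rabs_pos|].
  assert (0 <= (x+y)^2) by apply pow2_ge_0. assert (0 <= (x-y)^2) by apply pow2_ge_0. apply Rabs_le. split; lra.
Qed.

(** The sum of the three values is constant because the slopes are proportional to the Gauss map,
    which is orthogonal to the null vector of the integrand. *)
Lemma stateP_lift (z dz w : R -> C) (X Y Z : R -> R) : (forall t, lift_at 2 z dz w X Y Z t) ->
 stateP (state z w X Y Z 0) -> forall t, 0 <= t <= 1 -> stateP (state z w X Y Z t).
Proof.
 intros Hl H0 t1 I1. destruct H0 as (W0 & Wsq & H1 & H2 & H3 & Hs). destruct quad_pairs as (Q1 & Q2 & Q3).
 have Hz : forall t, cderive z t (dz t) /\ ccont w t /\ w t <> 0%C /\ (w t*w t)%C = P8 (z t).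
 { intros t. destruct (Hl t) as (A1 & A2 & A3 & A4 & A5 & _). auto. }
 have Hc := fun t => lift_speed_continuous _ _ _ _ _ _ _ _ (Hl t).
 have K1 := hatP_path qA1 qB1 n1 z dz w X Q1 Hz (fun t => proj1 (Hc t)) ltac:(intros t; apply (Hl t)) H1.
 have K2 := hatP_path qA2 qB2 n2 z dz w Y Q2 Hz (fun t => proj1 (proj2 (Hc t))) ltac:(intros t; apply (Hl t)) H2.
 have K3 := hatP_path qA3 qB3 n3 z dz w Z Q3 Hz (fun t => proj2 (proj2 (Hc t))) ltac:(intros t; apply (Hl t)) H3.
 unfold stateP, state. split; [apply Hz|]. split; [apply Hz|]. split; [auto|]. split; [auto|]. split; [auto|].
 rewrite <- Hs. symmetry. apply (constant_of_derive (fun t => phiP (X t)+phiP (Y t)+phiP (Z t)) 0 t1); [lra|].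
 intros t Ht'. have Ht : 0 <= t <= 1 by lra. destruct (Hl t) as (_ & _ & _ & Wt & _ & DX & DY & DZ).
 have B1 := is_derive_phiP (X t). have B2 := is_derive_phiP (Y t). have B3 := is_derive_phiP (Z t).
 derive_auto. destruct (K1 t Ht) as [_ ->], (K2 t Ht) as [_ ->], (K3 t Ht) as [_ ->].
 unfold cP. destruct (quad_diff (z t)) as (-> & -> & ->). destruct (quad_DP (z t) (w t)) as (P1 & P2 & P3). rewrite P2, P3, <- P1.
 have P := DP_pos (qA1 (z t)) (qB1 (z t)) _ Wt. have Hr := sqrt_lt_R0 _ P. set (r := sqrt _) in *.
 transitivity (sqrt 6*v0 (z t)/r*(v1 (z t)*speed 2 n1 z dz w t+v2 (z t)*speed 2 n2 z dz w t+v3 (z t)*speed 2 n3 z dz w t));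
  [field; lra|].
 enough (E : v1 (z t)*speed 2 n1 z dz w t+v2 (z t)*speed 2 n2 z dz w t+v3 (z t)*speed 2 n3 z dz w t = 0) by (rewrite E; ring).
 unfold speed. set (k := (2*dz t/w t)%C).
 have F : forall n, (2*n (z t)*dz t/w t = n (z t)*k)%C by (intros; unfold k; field; auto).
 rewrite !F. clearbody k. destruct (z t) as [a b], k as [k1 k2]. unfold v1, v2, v3, n1, n2, n3, sqn, Re, Im. simpl. ring.
Qed.

Lemma stateP_reach (s0 s1 : C*C*R3) : stateP s0 -> reach 2 s0 s1 -> stateP s1.
Proof.
 intros H0 H. destruct (reach_rest _ _ _ H) as (z & dz & w & X & Y & Z & Hl & E0 & E1).
 destruct (E0 0) as [E _]; [lra|]. destruct (E1 1) as [<- _]; [lra|]. rewrite <- E in H0. apply (stateP_lift z dz); auto. lra.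
Qed.

Lemma stateD_reach (s0 s1 : C*C*R3) : stateD s0 -> reach (2*Ci) s0 s1 -> stateD s1.
Proof.
 intros H0 H. destruct (reach_rest _ _ _ H) as (z & dz & w & X & Y & Z & Hl & E0 & E1). clear H.
 destruct (E0 0) as [E0' _]; [lra|]. destruct (E1 1) as [E1' _]; [lra|]. clear E0 E1. subst s0 s1.
 destruct H0 as (W0 & Wsq & H1 & H2 & H3). destruct quad_pairs as (Q1 & Q2 & Q3).
 have Hz : forall t, cderive z t (dz t) /\ ccont w t /\ w t <> 0%C /\ (w t*w t)%C = P8 (z t).
 { intros t. destruct (Hl t) as (A1 & A2 & A3 & A4 & A5 & _). auto. }
 have Hc := fun t => lift_speed_continuous _ _ _ _ _ _ _ _ (Hl t).
 have I1 : 0 <= 1 <= 1 by lra.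
 split; [apply Hz|]. split; [apply Hz|]. split; [|split].
 - apply (hatD_path qA1 qB1 n1 z dz w X Q1 Hz (fun t => proj1 (Hc t)) ltac:(intros t; apply (Hl t)) H1 1 I1).
 - apply (hatD_path qA2 qB2 n2 z dz w Y Q2 Hz (fun t => proj1 (proj2 (Hc t))) ltac:(intros t; apply (Hl t)) H2 1 I1).
 - apply (hatD_path qA3 qB3 n3 z dz w Z Q3 Hz (fun t => proj2 (proj2 (Hc t))) ltac:(intros t; apply (Hl t)) H3 1 I1).
Qed.

(** * The equation of the complete surface D *)

(** The relation fixes the product of [cD] and [vD]. Since [vD] is positive with square
    [1 - sD^2 / 4 = DP / DD], it can be divided out. *)
Lemma cD_hat (qA qB : C -> C) (z w : C) (x : R) : w <> 0%C -> hatD qA qB z w x ->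
 cD x = sqrt 2*gD (qA z) (qB z) w/(DD (qA z) (qB z) w*sqrt (DP (qA z) (qB z) w)).
Proof.
 intros Hw [Hs Hg]. set (A := qA z) in *. set (B := qB z) in *.
 have P := DP_pos A B w Hw. have Q := DD_pos A B w Hw.
 have Rp := sqrt_lt_R0 _ P. have Rq := sqrt_lt_R0 _ Q.
 have V : vD x = sqrt (DP A B w)/sqrt (DD A B w).
 { have V0 := vD_pos x. rewrite <- sqrt_div_alt by auto. rewrite <- (sqrt_pow2 (vD x)) by lra. f_equal.
  destruct (Jacobi_D x) as (_ & _ & _ & _ & ->). rewrite Hs, sH_sq by auto. rewrite DP_DD. rewrite DP_DD in Q. field. lra. }
 rewrite V in Hg. unfold gH in Hg.
 apply (Rmult_eq_reg_r (2*(sqrt (DP A B w)/sqrt (DD A B w)))).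
 - replace (cD x*(2*(sqrt (DP A B w)/sqrt (DD A B w)))) with (2*cD x*(sqrt (DP A B w)/sqrt (DD A B w))) by ring.
  rewrite Hg. field. lra.
 - apply Rgt_not_eq. apply Rmult_lt_0_compat; [lra|]. apply Rdiv_lt_0_compat; auto.
Qed.

Lemma sum_product_real (z w : C) : (w*w)%C = P8 z ->
 let d1 := DD (qA1 z) (qB1 z) w in let d2 := DD (qA2 z) (qB2 z) w in let d3 := DD (qA3 z) (qB3 z) w in
 let g1 := gD (qA1 z) (qB1 z) w in let g2 := gD (qA2 z) (qB2 z) w in let g3 := gD (qA3 z) (qB3 z) w in
 DP (qA3 z) (qB3 z) w*(g1*d2*d3+g2*d1*d3+g3*d1*d2)+2*g1*g2*g3 = 0.
Proof.
 intros H d1 d2 d3 g1 g2 g3. have I2 := Ci_sq.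
 have Hh : (2*(/ 2)%R)%C = 1%C by (rewrite <- RtoC_mult; f_equal; field).
 have H' : (Cconj w*Cconj w = 1+14*Cconj z^4+Cconj z^8)%C.
 { rewrite <- Cmult_conj, H. unfold P8. conj_push. auto. }
 have P := sum_product_poly z w (Cconj z) (Cconj w) H H'. cbv beta zeta in P.
 have HD4 : forall A B v, RtoC (DD ((/ 2)%R*A) ((/ 2)%R*B) v*16) = RtoC (DD A B (4*v)%C).
 { intros A B v. rewrite RtoC_mult, !RtoC_DD. unfold DDc. conj_push. set (h := RtoC (/ 2)) in *. clearbody h. ring [Hh]. }
 have HG4 : forall A B v, RtoC (gD ((/ 2)%R*A) ((/ 2)%R*B) v*64) = RtoC (gD A B (4*v)%C).
 { intros A B v. rewrite RtoC_mult, !RtoC_gD. unfold gDc. conj_push. set (h := RtoC (/ 2)) in *. clearbody h. ring [Hh]. }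
 have EB : qB2 z = ((/ 2)%R*(- (1-Ci*z)^2))%C by (unfold qB2; ring).
 have E : DP (qA3 z) (qB3 z) w*(4*(g1*64)*(d2*16)*d3+4*(g2*64)*(d1*16)*d3+16*g3*(d1*16)*(d2*16))
  + 2*(g1*64)*(g2*64)*g3 = 0.
 { apply RtoC_inj. unfold g1, g2, g3, d1, d2, d3. rewrite EB. unfold qA1, qB1, qA2.
  rewrite (RtoC_plus (_ * _)), !RtoC_mult, !RtoC_plus, !RtoC_mult.
  rewrite <- !(RtoC_mult _ 64), <- !(RtoC_mult _ 16), !HD4, !HG4, !RtoC_DD, !RtoC_gD, RtoC_DP. unfold qA3, qB3, DPc, DDc, gDc. unfold DDc, gDc in P. conj_push.
  eapply Ceq_of; [exact P|]. ring [I2]. }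
 lra.
Qed.

(** Inside cells this is the exponential form of [etaD x + etaD y + etaD u = 0]; unlike the
    logarithm it makes sense across the lattice planes. *)
Lemma stateD_equation (z w : C) (x y u : R) : stateD (z, w, (x, y, u)) -> cD x+cD y+cD u+cD x*cD y*cD u = 0.
Proof.
 intros (Hw & Hsq & H1 & H2 & H3). rewrite (cD_hat _ _ _ _ _ Hw H1), (cD_hat _ _ _ _ _ Hw H2), (cD_hat _ _ _ _ _ Hw H3).
 have E := sum_product_real z w Hsq. cbv zeta in E. destruct (quad_DP z w) as (P1 & P2 & P3). rewrite P1, P2. rewrite <- P3.
 have P := DP_pos (qA3 z) (qB3 z) w Hw. have Q1 := DD_pos (qA1 z) (qB1 z) w Hw. have Q2 := DD_pos (qA2 z) (qB2 z) w Hw.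
 have Q3 := DD_pos (qA3 z) (qB3 z) w Hw. have Hr := sqrt_lt_R0 _ P. have R2 : sqrt (DP (qA3 z) (qB3 z) w)^2 = DP (qA3 z) (qB3 z) w by (apply pow2_sqrt; lra).
 have S2 : sqrt 2^2 = 2 by (apply pow2_sqrt; lra).
 set (r := sqrt (DP (qA3 z) (qB3 z) w)) in *. rewrite <- R2 in E. set (s := sqrt 2) in *.
 set (d1 := DD (qA1 z) (qB1 z) w) in *. set (d2 := DD (qA2 z) (qB2 z) w) in *. set (d3 := DD (qA3 z) (qB3 z) w) in *.
 set (g1 := gD (qA1 z) (qB1 z) w) in *. set (g2 := gD (qA2 z) (qB2 z) w) in *. set (g3 := gD (qA3 z) (qB3 z) w) in *.
 transitivity (s*(r^2*(g1*d2*d3+g2*d1*d3+g3*d1*d2)+s^2*g1*g2*g3)/(r^3*d1*d2*d3)); [field; lra|].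
 rewrite S2, E. field. lra.
Qed.

(** * The inverse of the Gauss map *)

(** Up to scale, the real part of the square of a null component times the conjugate Hopf
    differential, for a normal with squared components [X1], [X2], [X3] ([hopf_Re]). *)
Definition Tsum (s1 s2 s3 X1 X2 X3 : R) : R :=
 let S := X1+X2+X3 in s1*(S-X1)^2+s2*(X1*X2-X3*S)+s3*(X1*X3-X2*S).

(** [e = 1] for tangents and [e = - 1] for hyperbolic tangents of numbers with sum zero. *)
Lemma Tsum_tan (e t1 t2 t3 : R) : 1-e*t2*t3 <> 0 -> 1+e*t2^2 <> 0 -> 1+e*t3^2 <> 0 ->
 t1 = - (t2+t3)/(1-e*t2*t3) ->
 let s t := 2*t/(1+e*t^2) in let X t := 1+2*((1-e*t^2)/(1+e*t^2)) in
 Tsum (s t1) (s t2) (s t3) (X t1) (X t2) (X t3) = t1*(X t1+X t2+X t3)*(X t1+X t2+X t3+X t1).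
Proof.
 intros H1 H2 H3 E s X.
 have D1 : 1+e*t1^2 = (1+e*t2^2)*(1+e*t3^2)/(1-e*t2*t3)^2 by (rewrite E; field; auto).
 have S1 : s t1 = - 2*(t2+t3)*(1-e*t2*t3)/((1+e*t2^2)*(1+e*t3^2)).
 { unfold s. rewrite D1. rewrite E. field. auto. }
 have Y1 : X t1 = 1+2*((2*(1-e*t2*t3)^2-(1+e*t2^2)*(1+e*t3^2))/((1+e*t2^2)*(1+e*t3^2))).
 { unfold X. replace (1-e*t1^2) with (2-(1+e*t1^2)) by ring. rewrite D1. field. auto. }
 rewrite S1, Y1, E. unfold s, X, Tsum. field. auto.
Qed.

(** Up to scale, the squared modulus of the Hopf differential ([hopf_sqn]). *)
Definition Qsum (s1 s2 s3 X1 X2 X3 : R) : R :=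
 let S := X1+X2+X3 in
 s1^2*(S-X1)^2+s2^2*(S-X2)^2+s3^2*(S-X3)^2
 + 2*(s1*s2*(X1*X2-X3*S)+s2*s3*(X2*X3-X1*S)+s3*s1*(X3*X1-X2*S)).

Lemma Qsum_P (s1 s2 s3 C1 C2 C3 : R) :
 s1^2 = 1*(1-C1^2) -> s2^2 = 1*(1-C2^2) -> s3^2 = 1*(1-C3^2) ->
 s1*s2 = C1*C2-C3 -> s2*s3 = C2*C3-C1 -> s3*s1 = C3*C1-C2 ->
 let X1 := 1+2*C1 in let X2 := 1+2*C2 in let X3 := 1+2*C3 in let S := X1+X2+X3 in
 S*(S^2+X1^2+X2^2+X3^2)/2+Qsum s1 s2 s3 X1 X2 X3 = 6*S*S.
Proof.
 intros S1 S2 S3 S12 S23 S31 X1 X2 X3 S. unfold Qsum. fold S. rewrite S1, S2, S3, S12, S23, S31.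
 (* The relation between the cosines of three angles with sum zero, from two expressions of the
    square of [s1 s2]. *)
 have R : 1+2*C1*C2*C3-C1^2-C2^2-C3^2 = 0.
 { have E : (s1*s2)^2 = s1^2*s2^2 by ring. rewrite S12, S1, S2 in E. lra. }
 transitivity (6*S*S-8*S*(1+2*C1*C2*C3-C1^2-C2^2-C3^2)); [unfold S, X1, X2, X3; field|].
 rewrite R. ring.
Qed.

Lemma Qsum_D (s1 s2 s3 C1 C2 C3 : R) :
 s1^2 = -1*(1-C1^2) -> s2^2 = -1*(1-C2^2) -> s3^2 = -1*(1-C3^2) ->
 s1*s2 = -1*(C1*C2-C3) -> s2*s3 = -1*(C2*C3-C1) -> s3*s1 = -1*(C3*C1-C2) ->
 let X1 := 1+2*C1 in let X2 := 1+2*C2 in let X3 := 1+2*C3 in let S := X1+X2+X3 in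
 S*(S^2+X1^2+X2^2+X3^2)/2+Qsum s1 s2 s3 X1 X2 X3 = 2*X1*X2*X3*S.
Proof.
 intros S1 S2 S3 S12 S23 S31 X1 X2 X3 S. unfold Qsum. fold S. rewrite S1, S2, S3, S12, S23, S31. unfold S, X1, X2, X3. field.
Qed.

(** The diagonal second fundamental form with coefficients [s1], [s2], [s3], evaluated on the null
    vector. *)
Definition hopf (s1 s2 s3 : R) (z : C) : C := (s1*n1 z^2+s2*n2 z^2+s3*n3 z^2)%C.

Lemma hopf_sqn (s1 s2 s3 : R) (z : C) : sqn (hopf s1 s2 s3 z) =
 s1^2*(v0 z^2-v1 z^2)^2+s2^2*(v0 z^2-v2 z^2)^2+s3^2*(v0 z^2-v3 z^2)^2
 + 2*(s1*s2*(v1 z^2*v2 z^2-v3 z^2*v0 z^2)+s2*s3*(v2 z^2*v3 z^2-v1 z^2*v0 z^2)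
  + s3*s1*(v3 z^2*v1 z^2-v2 z^2*v0 z^2)).
Proof. unfold hopf. in_coordinates z. ring. Qed.

Lemma hopf_Re (s1 s2 s3 : R) (z : C) :
 Re (n1 z^2*Cconj (hopf s1 s2 s3 z))%C = s1*(v0 z^2-v1 z^2)^2+s2*(v1 z^2*v2 z^2-v3 z^2*v0 z^2)
  + s3*(v1 z^2*v3 z^2-v2 z^2*v0 z^2) /\
 Re (n2 z^2*Cconj (hopf s1 s2 s3 z))%C = s2*(v0 z^2-v2 z^2)^2+s3*(v2 z^2*v3 z^2-v1 z^2*v0 z^2)
  + s1*(v2 z^2*v1 z^2-v3 z^2*v0 z^2) /\
 Re (n3 z^2*Cconj (hopf s1 s2 s3 z))%C = s3*(v0 z^2-v3 z^2)^2+s1*(v3 z^2*v1 z^2-v2 z^2*v0 z^2)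
  + s2*(v3 z^2*v2 z^2-v1 z^2*v0 z^2).
Proof. unfold hopf. in_coordinates z. split; [|split]; ring. Qed.

Lemma gauss_v (c1 c2 c3 nu : R) : nu^2 = c1^2+c2^2+c3^2 -> nu-c3 <> 0 ->
 let z := gauss c1 c2 c3 nu in let m := 2/(nu-c3) in
 v0 z = m*nu /\ v1 z = m*c1 /\ v2 z = m*c2 /\ v3 z = m*c3.
Proof.
 intros H Hd z m. have E : c1^2+c2^2 = (nu-c3)*(nu+c3) by lra.
 have Sz : sqn z = (nu+c3)/(nu-c3).
 { unfold sqn, z, gauss, Re, Im. simpl fst. simpl snd. transitivity ((c1^2+c2^2)/(nu-c3)^2); [field; auto|].
  rewrite E. field. auto. }
 unfold v0, v1, v2, v3. rewrite Sz. unfold m, z, gauss, Re, Im. simpl. split; [|split; [|split]]; field; auto.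
Qed.

Lemma gauss_of_v (z : C) (k : R) : k <> 0 -> gauss (k*v1 z) (k*v2 z) (k*v3 z) (k*v0 z) = z.
Proof.
 intros Hk. unfold gauss. replace (k*v0 z-k*v3 z) with (2*k) by (unfold v0, v3; ring).
 unfold v1, v2. destruct z as [x y]. unfold Re, Im. simpl. apply injective_projections; simpl; field; auto.
Qed.

Definition norm3 (c1 c2 c3 : R) : R := sqrt (c1^2+c2^2+c3^2).
Definition gauss_of (c1 c2 c3 : R) : C := gauss c1 c2 c3 (norm3 c1 c2 c3).
(** The square of the Hopf differential is [e nu^2] times the radicand; dividing by [nu] and
    multiplying by a unit [sg] with [sg^2 = e] gives a square root of the radicand. *)
Definition root_of (sg : C) (s1 s2 s3 c1 c2 c3 : R) : C :=
 (sg*(/ norm3 c1 c2 c3)%R*hopf s1 s2 s3 (gauss_of c1 c2 c3))%C.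

Lemma norm3_sq (c1 c2 c3 : R) : norm3 c1 c2 c3^2 = c1^2+c2^2+c3^2.
Proof. apply pow2_sqrt. nra. Qed.

Lemma norm3_pos (c1 c2 c3 : R) : norm3 c1 c2 c3-c3 <> 0 -> 0 < norm3 c1 c2 c3.
Proof.
 intros H. have Q := norm3_sq c1 c2 c3. assert (0 <= norm3 c1 c2 c3) by apply sqrt_pos.
 destruct (Req_dec (norm3 c1 c2 c3) 0) as [E|]; [|lra]. exfalso. rewrite E in *. assert (c3 = 0) by nra. lra.
Qed.

Lemma hopf_lift (sg : C) (e q c1 c2 c3 s1 s2 s3 C1 C2 C3 t1 t2 t3 : R) :
 (sg*sg = e)%C -> e^2 = 1 -> sqn sg = 1 -> norm3 c1 c2 c3-c3 <> 0 ->
 c1^2 = 1+2*C1 -> c2^2 = 1+2*C2 -> c3^2 = 1+2*C3 ->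
 s1^2 = e*(1-C1^2) -> s2^2 = e*(1-C2^2) -> s3^2 = e*(1-C3^2) ->
 s1*s2 = e*(C1*C2-C3) -> s2*s3 = e*(C2*C3-C1) -> s3*s1 = e*(C3*C1-C2) ->
 let S := c1^2+c2^2+c3^2 in
 Tsum s1 s2 s3 (c1^2) (c2^2) (c3^2) = t1*S*(S+c1^2) ->
 Tsum s2 s3 s1 (c2^2) (c3^2) (c1^2) = t2*S*(S+c2^2) ->
 Tsum s3 s1 s2 (c3^2) (c1^2) (c2^2) = t3*S*(S+c3^2) ->
 S*(S^2+(c1^2)^2+(c2^2)^2+(c3^2)^2)/2+Qsum s1 s2 s3 (c1^2) (c2^2) (c3^2) = q*S ->
 let nu := norm3 c1 c2 c3 in let z := gauss_of c1 c2 c3 in let w := root_of sg s1 s2 s3 c1 c2 c3 in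
 let m := 2/(nu-c3) in
 let F A B t c := 2*Re (B*A*Cconj w*sg)%C = m^4*(t*nu*(nu^2+c^2))/2 in
 0 < m /\ (v0 z = m*nu /\ v1 z = m*c1 /\ v2 z = m*c2 /\ v3 z = m*c3) /\ (w*w)%C = P8 z /\ (w = 0%C -> t1 = 0 /\ t2 = 0 /\ t3 = 0) /\
 (v0 z^4+v1 z^4+v2 z^4+v3 z^4)/2+sqn w = m^4*q /\
 F (qA1 z) (qB1 z) t1 c1 /\ F (qA2 z) (qB2 z) t2 c2 /\ F (qA3 z) (qB3 z) t3 c3.
Proof.
 intros Hsg He Hn Hd X1 X2 X3 S1 S2 S3 S12 S23 S31 S T1 T2 T3 HQ nu z w m F.
 have Hnu2 := norm3_sq c1 c2 c3. have Hnu := norm3_pos _ _ _ Hd. fold nu in Hnu2, Hnu, Hd. have HS : S = nu^2 by (unfold S; auto). rewrite HS in T1, T2, T3, HQ.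
 have Hm : 0 < m by (apply Rdiv_lt_0_compat; [lra|]; destruct (Rtotal_order c3 nu) as [H|[H|H]]; [lra|destruct Hd; lra|nra]).
 destruct (gauss_v c1 c2 c3 nu Hnu2 Hd) as (V0 & V1 & V2 & V3). change (gauss c1 c2 c3 nu) with z in *. fold m in V0, V1, V2, V3.
 set (h := hopf s1 s2 s3 z). have Hw : w = (sg*(/ nu)%R*h)%C by reflexivity.
 have HF : forall A B n t c, (4*(B*A) = n^2)%C -> Re (n^2*Cconj h)%C = m^4*(t*nu^2*(nu^2+c^2)) -> F A B t c.
 { intros A B n t c HAB Ht. unfold F. transitivity (sqn sg*Re (4*(B*A)*Cconj h)%C/(2*nu)).
  - rewrite Hw. unfold sqn, Re, Im. destruct (B*A)%C, h, sg. simpl. field. lra.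
  - rewrite Hn, HAB, Ht. field. lra. }
 destruct (quad_prod z) as (B1 & B2 & B3). destruct (hopf_Re s1 s2 s3 z) as (R1 & R2 & R3). fold h in R1, R2, R3.
 have F1 : F (qA1 z) (qB1 z) t1 c1.
 { apply (HF _ _ _ _ _ B1). rewrite R1, V0, V1, V2, V3, <- T1, !Rpow_mult_distr, Hnu2. unfold Tsum. ring. }
 have F2 : F (qA2 z) (qB2 z) t2 c2.
 { apply (HF _ _ _ _ _ B2). rewrite R2, V0, V1, V2, V3, <- T2, !Rpow_mult_distr, Hnu2. unfold Tsum. ring. }
 have F3 : F (qA3 z) (qB3 z) t3 c3.
 { apply (HF _ _ _ _ _ B3). rewrite R3, V0, V1, V2, V3, <- T3, !Rpow_mult_distr, Hnu2. unfold Tsum. ring. }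
 split; [auto|]. split; [auto|]. split; [|split; [|split; [|auto]]].
 (* The quartic at the null vector is twice the radicand. *)
 - have HH := hopf_quartic_real (n1 z) (n2 z) (n3 z) c1 c2 c3 s1 s2 s3 C1 C2 C3 e (null_vector_null z)
   (null_vector_tangent c1 c2 c3 nu Hnu2 Hd) X1 X2 X3 S1 S2 S3 S12 S23 S31. have I2 := Ci_sq.
  have N4 : (n1 z^4+n2 z^4+n3 z^4 = 2*P8 z)%C by (unfold n1, n2, n3, P8; ring [I2]).
  have N2 : RtoC 2 <> 0%C by (intros E; apply RtoC_inj in E; lra).
  have Nn : RtoC nu <> 0%C by (intros E; apply RtoC_inj in E; lra).
  fold S in HH. rewrite N4, HS, RtoC_mult, RtoC_pow in HH. rewrite Hw, RtoC_inv by lra.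
  transitivity (sg*sg*(2*h^2)/(2*nu^2))%C; [field; auto|]. unfold h, hopf. rewrite HH, Hsg.
  transitivity (RtoC (e^2)*P8 z)%C; [rewrite RtoC_pow; field; auto|]. rewrite He. ring.
 - intros E. have Z : forall A B t c, F A B t c -> t = 0.
  { intros A B t c H. unfold F in H. rewrite E in H. replace (2*Re (B*A*Cconj 0*sg)%C) with 0 in H by (unfold Re; simpl; ring).
   assert (0 < m^4) by (apply pow_lt; auto). assert (0 < nu*(nu^2+c^2)) by (apply Rmult_lt_0_compat; nra).
   apply (Rmult_eq_reg_r (m^4*(nu*(nu^2+c^2))/2)); [lra|]. apply Rgt_not_eq. apply Rdiv_lt_0_compat; [apply Rmult_lt_0_compat; auto|lra]. }
  split; [|split]; eapply Z; eassumption.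
 - have Wn : sqn w = sqn h/nu^2.
  { transitivity (sqn sg*sqn h/nu^2); [rewrite Hw; unfold sqn, Re, Im; destruct h, sg; simpl; field; lra|rewrite Hn; field; lra]. }
  rewrite Wn. unfold h. rewrite hopf_sqn, V0, V1, V2, V3. apply (Rmult_eq_reg_r (nu^2)); [|apply pow_nonzero; lra].
  rewrite (Rmult_assoc (m^4) q), <- HQ. unfold Qsum. fold S. rewrite HS. field. lra.
Qed.

Lemma tan_PI3_range (u : R) : - (PI/3) <= u <= PI/3 -> 0 < cos u.
Proof. intros H. have P := PI_RGT_0. apply cos_gt_0; lra. Qed.

Lemma tan_sum_zero (x y z : R) : x+y+z = 0 -> 0 < cos x -> 0 < cos y -> 0 < cos z ->
 1-1*tan y*tan z <> 0 /\ tan x = - (tan y+tan z)/(1-1*tan y*tan z).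
Proof.
 intros H Hx Hy Hz. have E : 1-1*tan y*tan z = cos x/(cos y*cos z).
 { replace (cos x) with (cos (y+z)) by (rewrite <- cos_neg; f_equal; lra). rewrite cos_plus. unfold tan. field. lra. }
 have P : 0 < cos x/(cos y*cos z) by (apply Rdiv_lt_0_compat; auto; apply Rmult_lt_0_compat; auto).
 rewrite E. split; [lra|]. replace (tan x) with (- tan (y+z)) by (rewrite <- tan_neg; f_equal; lra).
 unfold tan at 1. rewrite sin_plus. replace (cos (y+z)) with (cos x) by (rewrite <- (cos_neg x); f_equal; lra).
 unfold tan. field. lra.
Qed.

Lemma sin_cos_tan (u : R) : 0 < cos u -> sin (2*u) = 2*tan u/(1+1*tan u^2) /\
 cos (2*u) = (1-1*tan u^2)/(1+1*tan u^2).
Proof.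
 intros H. have E := sin2_cos2 u. unfold Rsqr in E.
 have F : 1+1*tan u^2 = 1/cos u^2 by (unfold tan; field_simplify_eq; [lra|lra]).
 rewrite F. rewrite sin_2a, cos_2a. unfold tan. split; field; lra.
Qed.

Lemma Tsum_P (x y z S : R) : x+y+z = 0 -> 0 < cos x -> 0 < cos y -> 0 < cos z ->
 let X u := 1+2*cos (2*u) in S = X x+X y+X z ->
 Tsum (sin (2*x)) (sin (2*y)) (sin (2*z)) (X x) (X y) (X z) = tan x*S*(S+X x).
Proof.
 intros H Hx Hy Hz X ->. destruct (tan_sum_zero x y z H Hx Hy Hz) as [N E].
 unfold X. destruct (sin_cos_tan x Hx) as [-> ->], (sin_cos_tan y Hy) as [-> ->], (sin_cos_tan z Hz) as [-> ->].
 apply (Tsum_tan 1 (tan x) (tan y) (tan z) N); auto; nra.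
Qed.

(** * Reconstruction of the lift for P *)

Definition nuP (x y u : R) : R := norm3 (phiP1 x) (phiP1 y) (phiP1 u).
Definition zP (x y u : R) : C := gauss_of (phiP1 x) (phiP1 y) (phiP1 u).
Definition wP (x y u : R) : C :=
 root_of (-1)%R (sin (2*phiP x)) (sin (2*phiP y)) (sin (2*phiP u)) (phiP1 x) (phiP1 y) (phiP1 u).

(** The second condition keeps the Gauss coordinate finite; the third excludes the flat points,
    which lie over the zeros of the radicand. *)
Definition regularP (x y u : R) : Prop :=
 phiP x+phiP y+phiP u = 0 /\ nuP x y u-phiP1 u <> 0 /\ ~ (phiP x = 0 /\ phiP y = 0 /\ phiP u = 0).

Lemma cos_phiP (t : R) : 0 < cos (phiP t).
Proof. apply tan_PI3_range, phiP_bound. Qed.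

Lemma tan_phiP_0 (t : R) : tan (phiP t) = 0 -> phiP t = 0.
Proof.
 intros H. have B := phiP_bound t. have P := PI_RGT_0. rewrite <- tan_0 in H. apply tan_inj in H; lra.
Qed.

Lemma stateP_of (x y u : R) : regularP x y u -> stateP (zP x y u, wP x y u, (x, y, u)).
Proof.
 intros (Hs & Hd & Hf). have Cp := cos_phiP.
 destruct (hopf_lift (-1)%R 1 (6*nuP x y u^2) (phiP1 x) (phiP1 y) (phiP1 u) (sin (2*phiP x)) (sin (2*phiP y)) (sin (2*phiP u))
  (cos (2*phiP x)) (cos (2*phiP y)) (cos (2*phiP u)) (tan (phiP x)) (tan (phiP y)) (tan (phiP u)))
  as (Hm & (V0 & V1 & V2 & V3) & Wsq & W0 & HDP & F1 & F2 & F3); auto using sin_sq_cos, phiP1_sq;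
  try (rewrite Rmult_1_l; apply sin_cos_sum_zero; lra); rewrite ?phiP1_sq; try (apply Tsum_P; auto; lra).
 { apply injective_projections; simpl; ring. }
 { ring. }
 { unfold sqn, Re, Im. simpl. ring. }
 { unfold nuP. rewrite norm3_sq, !phiP1_sq. apply Qsum_P; auto using sin_sq_cos; apply sin_cos_sum_zero; lra. }
 fold (zP x y u) (wP x y u) (nuP x y u) in *. set (z := zP x y u) in *. set (w := wP x y u) in *.
 set (nu := nuP x y u) in *. set (m := 2 / _) in *. have Hnu := norm3_pos _ _ _ Hd. fold (nuP x y u) nu in Hnu.
 destruct (quad_diff z) as (E1 & E2 & E3). destruct (quad_sum z) as (G1 & G2 & G3). destruct (quad_DP z w) as (P1 & P2 & P3).
 have S6 : 0 < sqrt 6 by (apply sqrt_lt_R0; lra).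
 have Hsq : sqrt (m^4*(6*nu^2)) = sqrt 6*(m^2*nu).
 { replace (m^4*(6*nu^2)) with (6*(m^2*nu)^2) by ring. rewrite sqrt_mult_alt, sqrt_pow2 by (try apply Rmult_le_pos; try apply pow2_ge_0; lra). auto. }
 have Ht : forall A B t v, DP A B w = (v0 z^4+v1 z^4+v2 z^4+v3 z^4)/2+sqn w ->
  2*Re (B*A*Cconj w*(-1)%R)%C = m^4*(tan (phiP t)*nu*(nu^2+phiP1 t^2))/2 -> sqn B-sqn A = v0 z*v ->
  v = m*phiP1 t -> 2*(sqn A+sqn B) = v0 z^2+v^2 -> phiP t = atan (tP A B w) /\ phiP1 t = cP A B w.
 { intros A B t v K1 K2 K3 K4 K5. rewrite HDP in K1. split.
  - assert (tP A B w = tan (phiP t)) as ->.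
   { unfold tP, hP. rewrite K1, Hsq. replace (2*Re (B*A*Cconj w)%C) with (- (2*Re (B*A*Cconj w*(-1)%R)%C)) by (unfold Re; destruct (B*A*Cconj w)%C; simpl; ring).
    rewrite K2. replace (sqn A+sqn B) with (m^2*(nu^2+phiP1 t^2)/2) by (rewrite K4, V0 in K5; lra).
    assert (0 < nu^2) by (apply pow_lt; auto). assert (0 <= phiP1 t^2) by apply pow2_ge_0. field. repeat split; lra. }
   symmetry. apply atan_tan. have Bt := phiP_bound t. have Pt := PI_RGT_0. lra.
  - unfold cP. rewrite K1, Hsq, K3, K4, V0. field. lra. }
 split; [|split; [auto|]].
 - intros E. apply Hf. destruct (W0 E) as (T1 & T2 & T3). auto using tan_phiP_0.
 - split; [apply (Ht _ _ _ _ P1 F1 E1 V1 G1)|]. split; [apply (Ht _ _ _ _ P2 F2 E2 V2 G2)|]. split; [apply (Ht _ _ _ _ P3 F3 E3 V3 G3)|auto].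
Qed.

(** The common value of [DP] leaves no room for the term [|w|^2]: flat points force [w = 0]. *)
Lemma quad_flat (z w : C) : w <> 0%C -> DP (qA1 z) (qB1 z) w = 2/3*v0 z^4 ->
 v1 z^2 = v0 z^2/3 -> v2 z^2 = v0 z^2/3 -> v3 z^2 = v0 z^2/3 -> False.
Proof.
 intros Hw HD E1 E2 E3. destruct (quad_DP z w) as (P & _). rewrite P in HD. have Q := norm2_pos w Hw. fold (sqn w) in Q.
 replace (v1 z^4) with ((v1 z^2)^2) in HD by ring. replace (v2 z^4) with ((v2 z^2)^2) in HD by ring.
 replace (v3 z^4) with ((v3 z^2)^2) in HD by ring. rewrite E1, E2, E3 in HD. lra.
Qed.

Lemma Csqrt_unique (w w' : C) : (w*w = w'*w')%C -> w = w' \/ w = (- w')%C.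
Proof.
 intros H. destruct (classic (w = w')) as [|N]; [auto|]. right.
 destruct (classic (w+w' = 0)%C) as [E|E].
 - transitivity (w+w'-w')%C; [ring|]. rewrite E. ring.
 - exfalso. have N' : (w-w')%C <> 0%C.
  { intros E'. apply N. transitivity (w-w'+w')%C; [ring|]. rewrite E'. ring. }
  apply (Cmult_neq_0 _ _ N' E). transitivity (w*w-w'*w')%C; [ring|]. rewrite H. ring.
Qed.

Lemma hP_neg (A B w : C) : hP A B (- w)%C = - hP A B w.
Proof. unfold hP, Re. destruct A, B, w. simpl. ring. Qed.

Lemma DP_neg (A B w : C) : DP A B (- w)%C = DP A B w.
Proof. unfold DP. f_equal. unfold sqn, Re, Im. destruct w. simpl. ring. Qed.

Lemma tP_neg (A B w : C) : tP A B (- w)%C = - tP A B w.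
Proof. unfold tP. rewrite hP_neg, DP_neg. unfold Rdiv. ring. Qed.

(** The slopes are a positive multiple of the Gauss vector, which determines [z]; the equation for
    [w] leaves two roots. *)
Lemma stateP_unique (z w : C) (x y u : R) : stateP (z, w, (x, y, u)) ->
 regularP x y u /\ z = zP x y u /\ w = wP x y u.
Proof.
 intros (Hw & Hsq & [H1 C1] & [H2 C2] & [H3 C3] & Hs).
 destruct (quad_diff z) as (F1 & F2 & F3). destruct (quad_DP z w) as (P1 & P2 & P3).
 have P := DP_pos (qA1 z) (qB1 z) w Hw. have Hr := sqrt_lt_R0 _ P.
 have S6 : 0 < sqrt 6 by (apply sqrt_lt_R0; lra). have V := v0_pos z.
 set (k := sqrt 6*v0 z/sqrt (DP (qA1 z) (qB1 z) w)).
 have Hk : 0 < k by (apply Rdiv_lt_0_compat; auto; apply Rmult_lt_0_compat; auto).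
 have K1 : phiP1 x = k*v1 z by (rewrite C1; unfold cP; rewrite F1; unfold k; field; lra).
 have K2 : phiP1 y = k*v2 z by (rewrite C2; unfold cP; rewrite F2, P2, <- P1; unfold k; field; lra).
 have K3 : phiP1 u = k*v3 z by (rewrite C3; unfold cP; rewrite F3, P3, <- P1; unfold k; field; lra).
 have Knu : nuP x y u = k*v0 z.
 { unfold nuP, norm3. rewrite K1, K2, K3. replace ((k*v1 z)^2+(k*v2 z)^2+(k*v3 z)^2) with ((k*v0 z)^2)
   by (rewrite !Rpow_mult_distr, <- v_sphere; ring).
  apply sqrt_pow2. apply Rmult_le_pos; lra. }
 have Ez : z = zP x y u by (unfold zP, gauss_of; fold (nuP x y u); rewrite K1, K2, K3, Knu; symmetry; apply gauss_of_v; lra).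
 have Hreg : regularP x y u.
 { split; [auto|]. split.
  - rewrite Knu, K3. replace (k*v0 z-k*v3 z) with (2*k) by (unfold v0, v3; ring). lra.
  - intros (Z1 & Z2 & Z3).
   have Y : forall t v, phiP t = 0 -> phiP1 t = k*v -> v^2 = 3/k^2.
   { intros t v Zt Et. have Q := phiP1_sq t. rewrite Zt, Rmult_0_r, cos_0, Et in Q.
    apply (Rmult_eq_reg_r (k^2)); [|apply Rgt_not_eq, pow_lt; auto]. replace (3/k^2*k^2) with 3 by (field; lra). lra. }
   have Y1 := Y _ _ Z1 K1. have Y2 := Y _ _ Z2 K2. have Y3 := Y _ _ Z3 K3.
   have Vs := v_sphere z. rewrite Y1, Y2, Y3 in Vs.
   have Ek : 3/k^2 = v0 z^2/3 by lra.
   have DPk : DP (qA1 z) (qB1 z) w = 2/3*v0 z^4.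
   { have R2 : sqrt (DP (qA1 z) (qB1 z) w)^2 = DP (qA1 z) (qB1 z) w by (apply pow2_sqrt; lra).
    have Q6 : sqrt 6^2 = 6 by (apply pow2_sqrt; lra).
    have K2' : k^2 = 6*v0 z^2/DP (qA1 z) (qB1 z) w.
    { transitivity (sqrt 6^2*v0 z^2/sqrt (DP (qA1 z) (qB1 z) w)^2); [unfold k; field; lra|]. rewrite Q6, R2. auto. }
    rewrite K2' in Ek.
    replace (3/(6*v0 z^2/DP (qA1 z) (qB1 z) w)) with (DP (qA1 z) (qB1 z) w/(2*v0 z^2)) in Ek by (field; lra).
    apply (Rmult_eq_reg_r (/ (2*v0 z^2))); [|apply Rinv_neq_0_compat, Rgt_not_eq, Rmult_lt_0_compat; [lra|apply pow_lt; auto]].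
    change (DP (qA1 z) (qB1 z) w/(2*v0 z^2) = 2/3*v0 z^4 * / (2*v0 z^2)). rewrite Ek. field. lra. }
   apply (quad_flat z w Hw DPk); lra. }
 split; [auto|]. split; [auto|].
 destruct (stateP_of x y u Hreg) as (W0 & W2 & [T1 _] & [T2 _] & [T3 _] & _). rewrite <- Ez in *.
 destruct (Csqrt_unique w (wP x y u)) as [|E]; [rewrite Hsq, W2; auto|auto|].
 (* The opposite root would change the sign of all three tangents, so all values would be zero. *)
 exfalso. apply Hreg. rewrite E, tP_neg, atan_opp in H1, H2, H3. lra.
Qed.

(** * Reconstruction of the lift for D *)

Definition shD (x : R) : R := -2*cD x/sD x^2.
(** [ep] is the orientation of the normal. [sD] depends only on products of two components of the
    Gauss map, so a point of D determines it only up to this sign. *)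
Definition zD (ep x y u : R) : C := gauss_of (ep*etaD1 x) (ep*etaD1 y) (ep*etaD1 u).
Definition wD (ep x y u : R) : C := root_of (Ci*ep) (shD x) (shD y) (shD u) (ep*etaD1 x) (ep*etaD1 y) (ep*etaD1 u).

(** The sign condition also excludes the lattice planes; the last condition excludes the flat
    points. *)
Definition regularD (x y u : R) : Prop :=
 0 < sD x*sD y*sD u /\ etaD x+etaD y+etaD u = 0 /\ ~ (cD x = 0 /\ cD y = 0 /\ cD u = 0).

Lemma eta_sum (x y u : R) : sD x <> 0 -> sD y <> 0 -> sD u <> 0 ->
 (etaD x+etaD y+etaD u = 0 <-> cD x+cD y+cD u+cD x*cD y*cD u = 0).
Proof.
 intros Hx Hy Hu. destruct (cD_lt1 x Hx), (cD_lt1 y Hy), (cD_lt1 u Hu).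
 have E : exp (2*(etaD x+etaD y+etaD u)) = (1-cD x)*(1-cD y)*(1-cD u)/((1+cD x)*(1+cD y)*(1+cD u)).
 { replace (2*(etaD x+etaD y+etaD u)) with (2*etaD x+(2*etaD y+2*etaD u)) by ring.
  rewrite !exp_plus, !exp_2eta by auto. field. lra. }
 split; intros K.
 - rewrite K, Rmult_0_r, exp_0 in E.
  have E' : (1-cD x)*(1-cD y)*(1-cD u) = (1+cD x)*(1+cD y)*(1+cD u).
  { transitivity ((1-cD x)*(1-cD y)*(1-cD u)/((1+cD x)*(1+cD y)*(1+cD u))*((1+cD x)*(1+cD y)*(1+cD u)));
    [field; lra|]. rewrite <- E. ring. }
  lra.
 - have E' : (1-cD x)*(1-cD y)*(1-cD u) = (1+cD x)*(1+cD y)*(1+cD u) by lra.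
  rewrite E' in E. replace ((1+cD x)*(1+cD y)*(1+cD u)/((1+cD x)*(1+cD y)*(1+cD u))) with 1 in E by (field; lra).
  rewrite <- exp_0 in E. apply exp_inv in E. lra.
Qed.

Lemma Tsum_D (x y u S : R) : sD x <> 0 -> sD y <> 0 -> sD u <> 0 -> etaD x+etaD y+etaD u = 0 ->
 S = etaD1 x^2+etaD1 y^2+etaD1 u^2 ->
 Tsum (shD x) (shD y) (shD u) (etaD1 x^2) (etaD1 y^2) (etaD1 u^2) = - cD x*S*(S+etaD1 x^2).
Proof.
 intros Hx Hy Hu Hs ->. destruct (cD_lt1 x Hx), (cD_lt1 y Hy), (cD_lt1 u Hu).
 apply eta_sum in Hs; auto.
 have A : forall t, sD t <> 0 -> -1 < cD t < 1 -> 0 < 1 + -1*(- cD t)^2 /\ shD t = 2*(- cD t)/(1 + -1*(- cD t)^2) /\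
  etaD1 t^2 = 1+2*((1 - -1*(- cD t)^2)/(1 + -1*(- cD t)^2)).
 { intros t Ht Hb. destruct (Jacobi_D t) as (_ & _ & _ & E & _).
  have Eq : 1 + -1*(- cD t)^2 = sD t^2 by lra. have P : 0 < sD t^2 by (apply pow2_gt_0; auto).
  split; [lra|]. rewrite Eq. split; [unfold shD; field; auto|].
  rewrite etaD1_sq by auto. destruct (sinh_cosh_2eta t Ht) as [_ ->]. f_equal. f_equal. f_equal. lra. }
 destruct (A x) as (P1 & -> & ->); auto. destruct (A y) as (P2 & -> & ->); auto. destruct (A u) as (P3 & -> & ->); auto.
 have N : 0 < 1 - -1 * - cD y * - cD u by nra.
 apply (Tsum_tan (-1) (- cD x) (- cD y) (- cD u)); try lra.
 apply (Rmult_eq_reg_r (1 - -1 * - cD y * - cD u)); [|lra].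
 replace (- (- cD y + - cD u)/(1 - -1 * - cD y * - cD u)*(1 - -1 * - cD y * - cD u)) with (cD y+cD u) by (field; lra). lra.
Qed.

(** Recovers [gD], hence [cD], from the product of [A], [B] and the conjugate of [w]; it is a
    polynomial identity modulo the equations for [w^2] and its conjugate. *)
Lemma gD_real (A B w : C) : (w*w)%C = rad2 A B ->
 2*gD A B w*(2*eD A B)*(sqn B^2-sqn A^2) = - (2*Im (B*A*Cconj w)%C)*DP A B w*DD A B w.
Proof.
 intros H. have H' := rad2_conj _ _ _ H. have I2 := Ci_sq. apply RtoC_inj.
 rewrite RtoC_mult, (RtoC_mult (2*gD A B w)), (RtoC_mult _ (DD A B w)), (RtoC_mult _ (DP A B w)), RtoC_opp, RtoC_2Im,
  RtoC_2eD, RtoC_mult, RtoC_gD, RtoC_DP, RtoC_DD, RtoC_minus, !RtoC_pow, !RtoC_sqn.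
 unfold gDc, DDc, DPc, rad2 in *. conj_push. ring [H H'].
Qed.

(** The positivity of [d e sD t] selects the sign in the explicit root of [DD], which yields [sH];
    [gD_real] then yields [gH]. *)
Lemma D_coordinate (A B w : C) (ep m nu t c d e : R) : ep^2 = 1 -> 0 < m -> 0 < nu ->
 w <> 0%C -> (w*w)%C = rad2 A B -> DP A B w = m^4*(2*c^2*d^2*e^2) ->
 2*Re (B*A*Cconj w*(Ci*ep))%C = m^4*(- cD t*nu*(nu^2+c^2))/2 -> sqn B-sqn A = m*nu*(m*c) ->
 2*(sqn A+sqn B) = (m*nu)^2+(m*c)^2 -> 2*eD A B = - (m*d*(m*e)) ->
 sD t <> 0 -> c = ep*etaD1 t -> 0 < d*e*sD t -> sD t = sH A B w /\ 2*cD t*vD t = gH A B w.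
Proof.
 intros Hep Hm Hnu Hw Hsq DPv K4 K5 K6 K7 K8 K9 K10.
 have VV := vD_pos t. have Sq2 : sqrt 2^2 = 2 by (apply pow2_sqrt; lra). have Sq2p := sqrt2_pos.
 have Hm2 : 0 < m^2 by (apply pow_lt; auto). have Hm6 : m^6 <> 0 by (apply pow_nonzero; lra).
 have Nd : d <> 0 by (intros E; rewrite E in K10; lra). have Ne : e <> 0 by (intros E; rewrite E in K10; lra).
 have Hc : ep*c = 2*vD t/sD t by (rewrite K9; unfold etaD1; transitivity (ep^2*(2*vD t/sD t)); [ring|rewrite Hep; ring]).
 have Nc : c <> 0 by (rewrite K9; apply Rmult_integral_contrapositive_currified; [intros E; rewrite E in Hep; lra|apply etaD1_neq0; auto]).
 have HSc : 0 < nu^2+c^2 by (assert (0 < nu^2) by (apply pow_lt; auto); assert (0 <= c^2) by apply pow2_ge_0; lra). have DDp := DD_pos A B w Hw.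
 have De : eD A B = - (m^2*(d*e))/2 by lra.
 have C1 : c^2+1 = 4/sD t^2.
 { transitivity (ep^2*c^2+1); [rewrite Hep; ring|]. rewrite <- Rpow_mult_distr, Hc. destruct (Jacobi_D t) as (_ & _ & _ & J1 & J2).
  replace ((2*vD t/sD t)^2) with (4*vD t^2/sD t^2) by (field; auto). rewrite J2. field. auto. }
 have Pde : 0 < d*e/sD t.
 { replace (d*e/sD t) with (d*e*sD t/sD t^2) by (field; auto). apply Rdiv_lt_0_compat; auto. apply pow2_gt_0; auto. }
 have RD : sqrt (DD A B w) = 2*sqrt 2*m^2*(d*e/sD t).
 { rewrite <- (sqrt_pow2 (2*sqrt 2*m^2*(d*e/sD t))) by (left; apply Rmult_lt_0_compat; auto; apply Rmult_lt_0_compat; lra). f_equal.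
  rewrite DP_DD, DPv, De. transitivity (2*m^4*d^2*e^2*(c^2+1)); [field|]. rewrite C1.
  transitivity (4*sqrt 2^2*m^4*d^2*e^2/sD t^2); [rewrite Sq2|]; field; auto. }
 have Gv : gD A B w = ep*c*(cD t*m^2*(d*e)*DD A B w).
 { have GR := gD_real A B w Hsq. rewrite K7, DPv in GR.
  have EI : 2*Im (B*A*Cconj w)%C = ep*(m^4*(cD t*nu*(nu^2+c^2))/2).
  { transitivity (- (ep*(2*Re (B*A*Cconj w*(Ci*ep))%C))); [|rewrite K4; field].
   transitivity (ep^2*(2*Im (B*A*Cconj w)%C)); [rewrite Hep; ring|]. unfold Re, Im. destruct (B*A*Cconj w)%C. simpl. ring. }
  rewrite EI in GR. replace (sqn B^2-sqn A^2) with ((sqn B-sqn A)*(2*(sqn A+sqn B))/2) in GR by field.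
  rewrite K5, K6 in GR. apply (Rmult_eq_reg_r (- (m^6*c*d*e*nu*(nu^2+c^2)))).
  - lra.
  - apply Ropp_neq_0_compat. repeat (apply Rmult_integral_contrapositive_currified; [|assumption || lra]). assumption. }
 split.
 - unfold sH. rewrite RD, De. field. repeat split; auto; lra.
 - unfold gH. rewrite Gv, RD, Hc. field. repeat split; auto; lra.
Qed.

Lemma regularD_neq0 (x y u : R) : regularD x y u -> sD x <> 0 /\ sD y <> 0 /\ sD u <> 0.
Proof. intros (H & _). repeat split; intros E; rewrite E in H; lra. Qed.

Lemma regularD_norm3 (ep x y u : R) : ep^2 = 1 -> regularD x y u ->
 norm3 (ep*etaD1 x) (ep*etaD1 y) (ep*etaD1 u)-ep*etaD1 u <> 0.
Proof.
 intros Hep H E. destruct (regularD_neq0 _ _ _ H) as (Sx & _). have Q := norm3_sq (ep*etaD1 x) (ep*etaD1 y) (ep*etaD1 u).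
 rewrite (Rminus_diag_uniq _ _ E), !Rpow_mult_distr, Hep in Q.
 assert (0 < etaD1 x^2) by (apply pow2_gt_0, etaD1_neq0; auto). assert (0 <= etaD1 y^2) by apply pow2_ge_0. lra.
Qed.

Lemma stateD_of (ep x y u : R) : ep^2 = 1 -> regularD x y u -> stateD (zD ep x y u, wD ep x y u, (x, y, u)).
Proof.
 intros Hep Hreg. destruct (regularD_neq0 _ _ _ Hreg) as (Sx & Sy & Su). have Hn := regularD_norm3 ep x y u Hep Hreg.
 destruct Hreg as (Hpos & Hs & Hf).
 have E2 : forall t, (ep*etaD1 t)^2 = etaD1 t^2 by (intros; rewrite Rpow_mult_distr, Hep; ring).
 have EX : forall t, sD t <> 0 -> (ep*etaD1 t)^2 = 1+2*cosh (2*etaD t) by (intros; rewrite E2; apply etaD1_sq; auto).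
 have Sh : forall t, sD t <> 0 -> shD t = sinh (2*etaD t) by (intros t Ht; destruct (sinh_cosh_2eta t Ht) as [-> _]; auto).
 have ES : forall t, sD t <> 0 -> shD t^2 = -1*(1-cosh (2*etaD t)^2) by (intros; rewrite Sh by auto; apply sinh_sq_cosh).
 have EP : forall t t' t'', sD t <> 0 -> sD t' <> 0 -> etaD t+etaD t'+etaD t'' = 0 ->
  shD t*shD t' = -1*(cosh (2*etaD t)*cosh (2*etaD t')-cosh (2*etaD t'')) by (intros; rewrite !Sh by auto; apply sinh_cosh_sum_zero; auto).
 destruct (hopf_lift (Ci*ep) (-1) (2*etaD1 x^2*etaD1 y^2*etaD1 u^2) (ep*etaD1 x) (ep*etaD1 y) (ep*etaD1 u)
  (shD x) (shD y) (shD u) (cosh (2*etaD x)) (cosh (2*etaD y)) (cosh (2*etaD u)) (- cD x) (- cD y) (- cD u))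
  as (Hm & (V0 & V1 & V2 & V3) & Wsq & W0 & HDP & F1 & F2 & F3); auto;
  try (apply EP; auto; lra); rewrite ?E2; try (apply Tsum_D; auto; lra).
 { apply injective_projections; simpl; [transitivity (- ep^2); [|rewrite Hep]|]; ring. }
 { ring. }
 { rewrite <- Hep. unfold sqn, Re, Im. simpl. ring. }
 { rewrite <- !E2, !EX by auto. apply Qsum_D; auto; apply EP; auto; lra. }
 fold (zD ep x y u) (wD ep x y u) in *. have Hnu := norm3_pos _ _ _ Hn.
 set (nu := norm3 _ _ _) in *. set (m := 2 / _) in *. set (z := zD ep x y u) in *. set (w := wD ep x y u) in *. clearbody m nu z w.
 have Hw : w <> 0%C by (intros E; apply Hf; destruct (W0 E) as (T1 & T2 & T3); repeat split; lra).
 destruct (quad_diff z) as (B1 & B2 & B3). destruct (quad_sum z) as (G1 & G2 & G3). destruct (quad_DP z w) as (P1 & P2 & P3).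
 destruct (quad_eD z) as (D1 & D2 & D3). destruct (quad_rad z) as (Rd1 & Rd2 & Rd3).
 have Sg : forall a b c, sD a <> 0 -> sD b <> 0 -> 0 < sD a*sD b*sD c -> 0 < ep*etaD1 a*(ep*etaD1 b)*sD c.
 { intros a b c Ha Hb Hc. have Pa := vD_pos a. have Pb := vD_pos b.
  replace (ep*etaD1 a*(ep*etaD1 b)*sD c) with (ep^2*(4*(vD a*vD b)*(sD a*sD b*sD c)/(sD a^2*sD b^2)))
   by (unfold etaD1; field; auto). rewrite Hep, Rmult_1_l. apply Rdiv_lt_0_compat.
  - assert (0 < vD a*vD b) by (apply Rmult_lt_0_compat; auto). apply Rmult_lt_0_compat; lra.
  - apply Rmult_lt_0_compat; apply pow2_gt_0; auto. }
 rewrite V0, V1 in B1, G1. rewrite V0, V2 in B2, G2. rewrite V0, V3 in B3, G3. rewrite V2, V3 in D1. rewrite V3, V1 in D2. rewrite V1, V2 in D3.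
 rewrite HDP in P1, P2, P3.
 split; [auto|]. split; [auto|]. split; [|split].
 - apply (D_coordinate _ _ w ep m nu x (ep*etaD1 x) (ep*etaD1 y) (ep*etaD1 u)); auto; [rewrite Rd1; auto|rewrite P1, !E2; ring|apply Sg; auto; lra].
 - apply (D_coordinate _ _ w ep m nu y (ep*etaD1 y) (ep*etaD1 u) (ep*etaD1 x)); auto; [rewrite Rd2; auto|rewrite P2, !E2; ring|apply Sg; auto; lra].
 - apply (D_coordinate _ _ w ep m nu u (ep*etaD1 u) (ep*etaD1 x) (ep*etaD1 y)); auto; [rewrite Rd3; auto|rewrite P3, !E2; ring].
Qed.

Lemma gD_neg (A B w : C) : gD A B (- w)%C = - gD A B w.
Proof. unfold gD, Re. destruct (GD A B), w. simpl. ring. Qed.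

Lemma gH_neg (A B w : C) : gH A B (- w)%C = - gH A B w.
Proof.
 unfold gH. rewrite gD_neg. replace (DD A B (- w)%C) with (DD A B w) by (rewrite !DP_DD, DP_neg; auto). unfold Rdiv. ring.
Qed.

Lemma hatD_normal (qA qB : C -> C) (z w : C) (x v v' : R) : w <> 0%C -> sD x <> 0 -> hatD qA qB z w x ->
 2*eD (qA z) (qB z) = - (v*v') ->
 sD x = 2*sqrt 2*(v*v')/sqrt (DD (qA z) (qB z) w) /\ v*v' <> 0 /\
 etaD1 x = sqrt (DP (qA z) (qB z) w)/(sqrt 2*(v*v')) /\
 (cD x = 0 -> DP (qA z) (qB z) w = 6*(v*v')^2).
Proof.
 intros Hw Hx H E. have Hc := cD_hat _ _ _ _ _ Hw H. destruct H as [Hs Hg].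
 have P := DP_pos (qA z) (qB z) w Hw. have Q := DD_pos (qA z) (qB z) w Hw.
 have Rp := sqrt_lt_R0 _ P. have Rq := sqrt_lt_R0 _ Q. have S2 := sqrt2_pos.
 have Q2 : sqrt 2^2 = 2 by (apply pow2_sqrt; lra).
 have S' : sD x = 2*sqrt 2*(v*v')/sqrt (DD (qA z) (qB z) w).
 { rewrite Hs. unfold sH. replace (- (4*sqrt 2*eD (qA z) (qB z))) with (- (2*sqrt 2*(2*eD (qA z) (qB z)))) by ring. rewrite E. field. lra. }
 have N : v*v' <> 0 by (intros N; apply Hx; rewrite S', N; field; lra).
 split; [auto|]. split; [auto|]. split.
 - have V : vD x = sqrt (DP (qA z) (qB z) w)/sqrt (DD (qA z) (qB z) w).
  { have V0 := vD_pos x. rewrite <- sqrt_div_alt by auto. rewrite <- (sqrt_pow2 (vD x)) by lra. f_equal.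
   destruct (Jacobi_D x) as (_ & _ & _ & _ & ->). rewrite Hs, sH_sq by auto. rewrite DP_DD. rewrite DP_DD in Q. field. lra. }
  have Nv : v <> 0 by (intros Z; apply N; rewrite Z; ring). have Nv' : v' <> 0 by (intros Z; apply N; rewrite Z; ring).
  unfold etaD1. rewrite V, S'. apply (Rmult_eq_reg_r (sqrt 2)); [|lra]. field. repeat split; auto; lra.
 - intros Z. destruct (Jacobi_D x) as (_ & _ & _ & J & _). rewrite Z, Hs, sH_sq in J by auto.
  have Ee : eD (qA z) (qB z)^2 = (v*v')^2/4 by (replace (eD (qA z) (qB z)) with (- (v*v')/2) by lra; field).
  have D8 := DP_DD (qA z) (qB z) w. rewrite Ee in J, D8.
  apply (f_equal (fun r => r*DD (qA z) (qB z) w)) in J.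
  replace ((32*((v*v')^2/4)/DD (qA z) (qB z) w+0^2)*DD (qA z) (qB z) w) with (8*(v*v')^2) in J by (field; lra). lra.
Qed.

(** The product is a positive multiple of [(p q r)^2]. This is the sign condition of [regularD],
    each [sD] being a multiple of two Gauss components. *)
Lemma cyclic_product_pos (k p q r d1 d2 d3 : R) : 0 < k -> 0 < d1 -> 0 < d2 -> 0 < d3 -> p <> 0 -> q <> 0 -> r <> 0 ->
 0 < k*(q*r)/d1*(k*(r*p)/d2)*(k*(p*q)/d3).
Proof.
 intros Hk H1 H2 H3 Hp Hq Hr.
 replace (k*(q*r)/d1*(k*(r*p)/d2)*(k*(p*q)/d3)) with (k^3*(p*q*r)^2/(d1*d2*d3)) by (field; lra).
 apply Rdiv_lt_0_compat; [|repeat apply Rmult_lt_0_compat; auto]. apply Rmult_lt_0_compat; [apply pow_lt; auto|].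
 apply pow2_gt_0. repeat apply Rmult_integral_contrapositive_currified; auto.
Qed.

Lemma stateD_unique (z w : C) (x y u : R) : stateD (z, w, (x, y, u)) -> sD x <> 0 -> sD y <> 0 -> sD u <> 0 ->
 regularD x y u /\ exists ep, ep^2 = 1 /\ z = zD ep x y u /\ w = wD ep x y u.
Proof.
 intros Hst Sx Sy Su. have Heq := stateD_equation _ _ _ _ _ Hst.
 destruct Hst as (Hw & Hsq & H1 & H2 & H3). destruct (quad_eD z) as (D1 & D2 & D3). destruct (quad_DP z w) as (P1 & P2 & P3).
 have P := DP_pos (qA1 z) (qB1 z) w Hw. have Rp := sqrt_lt_R0 _ P. have S2 := sqrt2_pos.
 destruct (hatD_normal qA1 qB1 z w x _ _ Hw Sx H1 D1) as (A1 & B1 & C1 & Z1).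
 destruct (hatD_normal qA2 qB2 z w y _ _ Hw Sy H2 D2) as (A2 & B2 & C2 & Z2).
 destruct (hatD_normal qA3 qB3 z w u _ _ Hw Su H3 D3) as (A3 & B3 & C3 & Z3).
 have N1 : v1 z <> 0 by (intros E; apply B2; rewrite E; ring). have N2 : v2 z <> 0 by (intros E; apply B1; rewrite E; ring).
 have N3 : v3 z <> 0 by (intros E; apply B2; rewrite E; ring). have V := v0_pos z. have Vs := v_sphere z.
 have L1 : sqrt (DD (qA1 z) (qB1 z) w) > 0 by (apply sqrt_lt_R0, DD_pos; auto).
 have L2 : sqrt (DD (qA2 z) (qB2 z) w) > 0 by (apply sqrt_lt_R0, DD_pos; auto).
 have L3 : sqrt (DD (qA3 z) (qB3 z) w) > 0 by (apply sqrt_lt_R0, DD_pos; auto).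
 set (r := sqrt (DP (qA1 z) (qB1 z) w)) in *. rewrite P2, <- P1 in C2, Z2. rewrite P3, <- P1 in C3, Z3. fold r in C2, C3.
 have Hreg : regularD x y u.
 { split; [|split; [exact (proj2 (eta_sum x y u Sx Sy Su) Heq)|]].
  - rewrite A1, A2, A3. apply cyclic_product_pos; auto. lra.
  - intros (E1 & E2 & E3). specialize (Z1 E1). specialize (Z2 E2). specialize (Z3 E3).
   have Q1 : v1 z^2 = v2 z^2.
   { apply (Rmult_eq_reg_r (v3 z^2)); [|apply pow_nonzero; auto]. lra. }
   have Q2 : v1 z^2 = v3 z^2.
   { apply (Rmult_eq_reg_r (v2 z^2)); [|apply pow_nonzero; auto]. lra. }
   apply (quad_flat z w Hw); try lra. rewrite Z1. replace (v2 z^2) with (v0 z^2/3) by lra || idtac.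
   transitivity (6*v2 z^2*v3 z^2); [ring|]. replace (v2 z^2) with (v0 z^2/3) by lra. replace (v3 z^2) with (v0 z^2/3) by lra. field. }
 split; [auto|].
 set (k := r/(sqrt 2*(v1 z*v2 z*v3 z))).
 have Nk : k <> 0.
 { unfold k. apply Rgt_not_eq in Rp. apply Rgt_not_eq in S2. apply Rmult_integral_contrapositive_currified; [exact Rp|]. apply Rinv_neq_0_compat.
  exact (Rmult_integral_contrapositive_currified _ _ S2
   (Rmult_integral_contrapositive_currified _ _ (Rmult_integral_contrapositive_currified _ _ N1 N2) N3)). }
 have S2n : sqrt 2 <> 0 by (apply Rgt_not_eq, S2). clear Z1 Z2 Z3 A1 A2 A3 B1 B2 B3 D1 D2 D3 L1 L2 L3 P1 P2 P3.
 have K1 : etaD1 x = k*v1 z by (rewrite C1; unfold k; field; auto).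
 have K2 : etaD1 y = k*v2 z by (rewrite C2; unfold k; field; auto).
 have K3 : etaD1 u = k*v3 z by (rewrite C3; unfold k; field; auto).
 have Hep : exists ep, ep^2 = 1 /\ ep*k = Rabs k.
 { unfold Rabs. destruct (Rcase_abs k); [exists (-1)|exists 1]; split; ring. }
 destruct Hep as (ep & Hep & Ek). exists ep. split; [auto|].
 have Ez : z = zD ep x y u.
 { unfold zD, gauss_of, norm3. rewrite K1, K2, K3, <- !Rmult_assoc, Ek.
  replace ((Rabs k*v1 z)^2+(Rabs k*v2 z)^2+(Rabs k*v3 z)^2) with ((Rabs k*v0 z)^2)
   by (rewrite !Rpow_mult_distr, <- Vs; ring).
  rewrite sqrt_pow2 by (apply Rmult_le_pos; [apply Rabs_pos|lra]). symmetry. apply gauss_of_v. apply Rabs_no_R0. auto. }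
 split; [auto|].
 destruct (stateD_of ep x y u Hep Hreg) as (W0 & W2 & G1 & G2 & G3). rewrite <- Ez in *.
 destruct (Csqrt_unique w (wD ep x y u)) as [|E]; [rewrite Hsq, W2; auto|auto|].
 exfalso. apply Hreg.
 have F : forall qA qB t, hatD qA qB z w t -> hatD qA qB z (wD ep x y u) t -> cD t = 0.
 { intros qA qB t [_ T1] [_ T2]. rewrite E, gH_neg, <- T2 in T1. have Vt := vD_pos t.
  have T3 : cD t*vD t = 0 by lra. apply Rmult_integral in T3. lra. }
 split; [|split]; eapply F; eassumption.
Qed.

(** * Lifting curves on the surfaces *)

Definition nu3 (c1 c2 c3 : R -> R) (t : R) : R := norm3 (c1 t) (c2 t) (c3 t).

Lemma gauss_lift (c1 c2 c3 d1 d2 d3 : R -> R) (t : R) :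
 is_derive c1 t (d1 t) -> is_derive c2 t (d2 t) -> is_derive c3 t (d3 t) ->
 continuous d1 t -> continuous d2 t -> continuous d3 t ->
 0 < c1 t^2+c2 t^2+c3 t^2 -> nu3 c1 c2 c3 t-c3 t <> 0 ->
 let nu := nu3 c1 c2 c3 in
 let e := fun t => (c1 t*d1 t+c2 t*d2 t+c3 t*d3 t) * / nu t-d3 t in
 let q := fun t => / (nu t-c3 t) in
 let dz := fun t : R => (d1 t*q t-c1 t*(e t*(q t*q t)), d2 t*q t-c2 t*(e t*(q t*q t))) : C in
 cderive (fun t => gauss (c1 t) (c2 t) (c3 t) (nu t)) t (dz t) /\ ccont dz t /\ continuous nu t.
Proof.
 intros D1 D2 D3 C1 C2 C3 Hp Hn nu e q dz.
 have E1 := is_derive_continuous _ _ _ D1. have E2 := is_derive_continuous _ _ _ D2. have E3 := is_derive_continuous _ _ _ D3.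
 have Hnu : 0 < nu t by (apply sqrt_lt_R0; auto).
 have Dnu : is_derive nu t ((c1 t*d1 t+c2 t*d2 t+c3 t*d3 t) * / nu t).
 { unfold nu, nu3, norm3. derive_auto. change (sqrt (c1 t*(c1 t*1)+c2 t*(c2 t*1)+c3 t*(c3 t*1))) with (nu t); change (sqrt (c1 t^2+c2 t^2+c3 t^2)) with (nu t). field. lra. }
 have Cnu := is_derive_continuous _ _ _ Dnu.
 have Ce : continuous e t by (unfold e; cont; lra). have Cq : continuous q t by (unfold q; cont).
 have Cdz : forall c d : R -> R, continuous c t -> continuous d t -> continuous (fun t => d t*q t-c t*(e t*(q t*q t))) t by (intros; cont).
 have Ddz : forall c d : R -> R, is_derive c t (d t) -> is_derive (fun t => c t/(nu t-c3 t)) t (d t*q t-c t*(e t*(q t*q t))).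
 { intros c d Dc. derive_auto. unfold e, q. change (nu t-c3 t <> 0) in Hn. field. repeat split; auto; lra. }
 split; [|split; [|auto]].
 - split; [apply (Ddz c1 d1 D1)|apply (Ddz c2 d2 D2)].
 - split; [apply (Cdz c1 d1)|apply (Cdz c2 d2)]; auto.
Qed.

Lemma hopf_ccont (s1 s2 s3 : R -> R) (z : R -> C) (t : R) :
 continuous s1 t -> continuous s2 t -> continuous s3 t -> ccont z t -> ccont (fun t => hopf (s1 t) (s2 t) (s3 t) (z t)) t.
Proof.
 intros H1 H2 H3 Hz. destruct (ccont_n z t Hz) as (N1 & N2 & N3).
 unfold hopf. ccon; apply ccont_RtoC; auto.
Qed.

(** Speeds are compared after multiplication by the first or the second derivative of the coordinate
    function; these never vanish together, which covers turning points. *)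
Lemma cancel_either (a b X Y : R) : a*X = a*Y -> b*X = b*Y -> (a <> 0 \/ b <> 0) -> X = Y.
Proof. intros H1 H2 [N|N]; [apply (Rmult_eq_reg_l a)|apply (Rmult_eq_reg_l b)]; auto. Qed.

Lemma is_derive_comp_R (f g : R -> R) (t l m : R) : is_derive f (g t) l -> is_derive g t m -> is_derive (fun s => f (g s)) t (l*m).
Proof. intros Hf Hg. eapply is_derive_eq; [apply (is_derive_comp f g); eassumption|]. apply Rmult_comm. Qed.

Lemma is_derive_unique2 (f g : R -> R) (t l m : R) : locally t (fun s => f s = g s) -> is_derive f t l -> is_derive g t m -> l = m.
Proof.
 intros E Hf Hg. apply (is_derive_ext_loc f g t l E) in Hf. apply is_derive_unique in Hf, Hg. rewrite <- Hf. exact Hg.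
Qed.

Definition smooth_curve (reg : R -> R -> R -> Prop) (x y u x' y' u' : R -> R) (s : R) : Prop :=
 is_derive x s (x' s) /\ is_derive y s (y' s) /\ is_derive u s (u' s) /\
 continuous x' s /\ continuous y' s /\ continuous u' s /\ reg (x s) (y s) (u s).

(** The Gauss coordinate and the root along a surface curve form a path of the Weierstrass
    representation as soon as the coordinate relation identifies the speeds. *)
Lemma lift_reach (k sg : C) (hat : (C -> C) -> (C -> C) -> C -> C -> R -> Prop)
 (c1 c2 c3 d1 d2 d3 s1 s2 s3 x y u x' y' u' : R -> R) :
 let z t := gauss_of (c1 t) (c2 t) (c3 t) in let w t := root_of sg (s1 t) (s2 t) (s3 t) (c1 t) (c2 t) (c3 t) in
 (forall t, 0 <= t <= 1 ->
  (is_derive x t (x' t) /\ is_derive y t (y' t) /\ is_derive u t (u' t)) /\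
  (is_derive c1 t (d1 t) /\ is_derive c2 t (d2 t) /\ is_derive c3 t (d3 t)) /\
  (continuous d1 t /\ continuous d2 t /\ continuous d3 t) /\ (continuous s1 t /\ continuous s2 t /\ continuous s3 t) /\
  norm3 (c1 t) (c2 t) (c3 t)-c3 t <> 0 /\
  locally t (fun s => w s <> 0%C /\ (w s*w s)%C = P8 (z s) /\
   hat qA1 qB1 (z s) (w s) (x s) /\ hat qA2 qB2 (z s) (w s) (y s) /\ hat qA3 qB3 (z s) (w s) (u s))) ->
 (forall qA qB n dz f l t, quad_pair qA qB n -> cderive z t (dz t) -> ccont w t -> w t <> 0%C ->
  locally t (fun s => (w s*w s)%C = P8 (z s)) -> is_derive f t l -> locally t (fun s => hat qA qB (z s) (w s) (f s)) ->
  l = speed k n z dz w t) ->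
 reach k (z 0, w 0, (x 0, y 0, u 0)) (z 1, w 1, (x 1, y 1, u 1)).
Proof.
 intros z w H Hs. pose (nu := nu3 c1 c2 c3).
 pose (e := fun t => (c1 t*d1 t+c2 t*d2 t+c3 t*d3 t) * / nu t-d3 t). pose (q := fun t => / (nu t-c3 t)).
 pose (dz := fun t : R => (d1 t*q t-c1 t*(e t*(q t*q t)), d2 t*q t-c2 t*(e t*(q t*q t))) : C).
 exists z, dz, w, x, y, u. split; [|split; reflexivity].
 intros t Ht. destruct (H t Ht) as ((Dx & Dy & Du) & (Dc1 & Dc2 & Dc3) & (Cd1 & Cd2 & Cd3) & (Cs1 & Cs2 & Cs3) & Hd & Hst).
 have Hnu := norm3_pos _ _ _ Hd.
 have Hpos : 0 < c1 t^2+c2 t^2+c3 t^2 by (rewrite <- norm3_sq; apply pow_lt; auto).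
 destruct (gauss_lift c1 c2 c3 d1 d2 d3 t Dc1 Dc2 Dc3 Cd1 Cd2 Cd3 Hpos Hd) as (Dz & Cdz & Cnu).
 change (cderive z t (dz t)) in Dz. change (ccont dz t) in Cdz.
 have Cw : ccont w t.
 { apply (ccont_mult (fun t => sg*RtoC (/ nu t))%C (fun t => hopf (s1 t) (s2 t) (s3 t) (z t))).
  - apply (ccont_mult (fun _ => sg)); [apply ccont_const|]. apply ccont_RtoC. cont. change (nu t) with (norm3 (c1 t) (c2 t) (c3 t)). lra.
  - apply hopf_ccont; auto. apply (cderive_ccont _ _ _ Dz). }
 destruct (locally_singleton _ _ Hst) as (W0 & Wsq & _). destruct quad_pairs as (Q1 & Q2 & Q3).
 have Wloc : locally t (fun s => (w s*w s)%C = P8 (z s)) by (weaken Hst).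
 unfold lift_at. split; [auto|]. split; [auto|]. split; [auto|]. split; [auto|]. split; [auto|].
 rewrite <- (Hs qA1 qB1 n1 dz x (x' t) t), <- (Hs qA2 qB2 n2 dz y (y' t) t), <- (Hs qA3 qB3 n3 dz u (u' t) t); auto; weaken Hst.
Qed.

Lemma lift_P (x y u x' y' u' : R -> R) :
 (forall t, 0 <= t <= 1 -> locally t (smooth_curve regularP x y u x' y' u')) ->
 reach 2 (zP (x 0) (y 0) (u 0), wP (x 0) (y 0) (u 0), (x 0, y 0, u 0)) (zP (x 1) (y 1) (u 1), wP (x 1) (y 1) (u 1), (x 1, y 1, u 1)).
Proof.
 intros H. pose (sn (f : R -> R) t := sin (2*phiP (f t))). pose (d (f f' : R -> R) t := -2*sn f t*f' t).
 apply (lift_reach 2 (-1)%R hatP (fun t => phiP1 (x t)) (fun t => phiP1 (y t)) (fun t => phiP1 (u t)) (d x x') (d y y') (d u u')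
  (sn x) (sn y) (sn u) x y u x' y' u').
 - intros t Ht. have Hloc := H t Ht. destruct (locally_singleton _ _ Hloc) as (Dx & Dy & Du & Cx & Cy & Cu & _ & Rd & _).
  have Hsin : forall f l, is_derive f t l -> continuous (sn f) t.
  { intros f l Hf. apply (continuous_comp f (fun v => sin (2*phiP v))); [apply (is_derive_continuous _ _ _ Hf)|].
   have B := is_derive_phiP (f t). by_derivative. eexists; eassumption. }
  have Hd : forall f f', is_derive f t (f' t) -> continuous f' t -> is_derive (fun s => phiP1 (f s)) t (d f f' t) /\ continuous (d f f') t.
  { intros f f' Hf Hf'. split; [apply (is_derive_comp_R phiP1); [apply is_derive_phiP1|assumption]|].
   apply Hsin in Hf. unfold d. cont. }
  destruct (Hd x x'), (Hd y y'), (Hd u u'); auto. do 3 (split; [auto|]).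
  split; [split; [|split]; eapply Hsin; eauto|]. split; [exact Rd|].
  generalize Hloc. apply filter_imp. intros s Hs. destruct (stateP_of (x s) (y s) (u s)) as (A1 & A2 & A3 & A4 & A5 & _); [apply Hs|]. auto.
 - intros qA qB n dz f l t Q Dz Cw W0 Wloc Df Hh.
  destruct (hat_speed_P qA qB n _ dz _ t Q Dz Cw W0 Wloc) as [T1 T2].
  destruct (locally_singleton _ _ Hh) as [G1 G2]. rewrite <- G2 in T1. rewrite <- G1 in T2.
  apply (cancel_either (phiP1 (f t)) (-2*sin (2*phiP (f t)))).
  + eapply is_derive_unique2; [|apply (is_derive_comp_R phiP f); [apply is_derive_phiP|exact Df]|exact T1]. weaken Hh.
  + eapply is_derive_unique2; [|apply (is_derive_comp_R phiP1 f); [apply is_derive_phiP1|exact Df]|exact T2]. weaken Hh.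
  + destruct (Req_dec (phiP1 (f t)) 0) as [E|]; [|auto]. right. intros E'.
   have A1 := phiP1_sq (f t). have A2 := sin_sq_cos (2*phiP (f t)). replace (sin (2*phiP (f t))) with 0 in A2 by lra.
   rewrite E in A1. have A3 : cos (2*phiP (f t)) = - (1/2) by lra. rewrite A3 in A2. lra.
Qed.

Lemma lift_D (ep : R) (x y u x' y' u' : R -> R) : ep^2 = 1 ->
 (forall t, 0 <= t <= 1 -> locally t (smooth_curve regularD x y u x' y' u')) ->
 reach (2*Ci) (zD ep (x 0) (y 0) (u 0), wD ep (x 0) (y 0) (u 0), (x 0, y 0, u 0))
  (zD ep (x 1) (y 1) (u 1), wD ep (x 1) (y 1) (u 1), (x 1, y 1, u 1)).
Proof.
 intros Hep H. pose (G v := 2*sinh (2*etaD v)). pose (c (f : R -> R) t := ep*etaD1 (f t)). pose (d (f f' : R -> R) t := ep*(G (f t)*f' t)).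
 apply (lift_reach (2*Ci) (Ci*ep) hatD (c x) (c y) (c u) (d x x') (d y y') (d u u')
  (fun t => shD (x t)) (fun t => shD (y t)) (fun t => shD (u t)) x y u x' y' u').
 - intros t Ht. have Hloc := H t Ht. destruct (locally_singleton _ _ Hloc) as (Dx & Dy & Du & Cx & Cy & Cu & Hreg).
  destruct (regularD_neq0 _ _ _ Hreg) as (Sx & Sy & Su).
  have Hd : forall f f', is_derive f t (f' t) -> continuous f' t -> sD (f t) <> 0 ->
   is_derive (c f) t (d f f' t) /\ continuous (d f f') t /\ continuous (fun s => shD (f s)) t.
  { intros f f' Hf Hf' Hs. have Cf := is_derive_continuous _ _ _ Hf. split; [|split].
   - apply (is_derive_scal (fun s => etaD1 (f s))). apply (is_derive_comp_R etaD1 f); auto. apply is_derive_etaD1. auto.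
   - have CG : continuous (fun s => G (f s)) t; [|unfold d; cont]. apply (continuous_comp f G); auto.
    have B := is_derive_etaD (f t) Hs. unfold G, sinh. by_derivative. repeat split; eexists; eassumption.
   - apply (continuous_comp f shD); auto. destruct (Jacobi_D (f t)) as (J1 & J2 & _). unfold shD. by_derivative.
    repeat split; try (eexists; eassumption). apply Rmult_integral_contrapositive_currified; auto; rewrite Rmult_1_r; auto. }
  destruct (Hd x x') as (? & ? & ?), (Hd y y') as (? & ? & ?), (Hd u u') as (? & ? & ?); auto. do 4 (split; [auto|]).
  split; [apply regularD_norm3; auto|].
  generalize Hloc. apply filter_imp. intros s Hs. destruct (stateD_of ep (x s) (y s) (u s) Hep) as (A1 & A2 & A3 & A4 & A5); [apply Hs|]. auto.
 - intros qA qB n dz f l t Q Dz Cw W0 Wloc Df Hh.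
  destruct (hat_speed_D qA qB n _ dz _ t Q Dz Cw W0 Wloc) as [T1 T2].
  destruct (locally_singleton _ _ Hh) as [G1 G2]. rewrite <- G2 in T1. rewrite <- G1 in T2. destruct (Jacobi_D (f t)) as (J1 & _ & _ & J & _).
  apply (cancel_either (2*cD (f t)*vD (f t)) (-5*sD (f t)+2*sD (f t)^3)).
  + eapply is_derive_unique2; [|apply (is_derive_comp_R sD f); [exact J1|exact Df]|exact T1]. weaken Hh.
  + eapply is_derive_unique2; [|apply (is_derive_comp_R (fun v => 2*cD v*vD v) f); [apply is_derive_2cv|exact Df]|exact T2]. weaken Hh.
  + destruct (Req_dec (cD (f t)) 0) as [E|N].
   * right. rewrite E in J. intros E'. replace (-5*sD (f t)+2*sD (f t)^3) with (sD (f t)*(-5+2*sD (f t)^2)) in E' by ring.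
    apply Rmult_integral in E'. destruct E' as [E'|E']; [rewrite E' in J|]; lra.
   * left. apply Rmult_integral_contrapositive_currified; [apply Rmult_integral_contrapositive_currified; lra|]. have V := vD_pos (f t). lra.
Qed.

(** * The surface P is the closure of the continuations *)

(** At [z = 0] on the branch [w = 1] the formulas give the values [- PI / 3], [PI / 3], 0 with
    slopes 0, 0 and [- sqrt 3]; [KP], 0 and [KP / 2] realize them. *)
Definition baseP : C*C*R3 := (RtoC 0, RtoC 1, (KP, 0, KP/2)).

Lemma base_DP : DP (qA1 0%C) (qB1 0%C) 1%C = 2 /\ DP (qA2 0%C) (qB2 0%C) 1%C = 2 /\ DP (qA3 0%C) (qB3 0%C) 1%C = 2.
Proof.
 destruct (quad_DP 0%C 1%C) as (-> & -> & ->). unfold v0, v1, v2, v3, sqn, Re, Im. simpl. repeat split; field.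
Qed.

Lemma base_rad : (RtoC 1*RtoC 1)%C = P8 0%C.
Proof. unfold P8. apply injective_projections; simpl; ring. Qed.

Lemma sqrt6_sqrt2 : sqrt 6/sqrt 2 = sqrt 3.
Proof. rewrite <- sqrt_div_alt by lra. f_equal. field. Qed.

Lemma stateP_base : stateP baseP.
Proof.
 have S3 := sqrt3_pos. have S2 := sqrt2_pos. have S32 := sqrt6_sqrt2.
 have S6 : sqrt 6 = sqrt 3*sqrt 2 by (rewrite <- S32; field; lra).
 destruct base_DP as (E1 & E2 & E3). destruct (quad_diff 0%C) as (F1 & F2 & F3). destruct (quad_sum 0%C) as (G1 & G2 & G3).
 destruct (Jacobi_K (3/4) m34) as (K1 & K2 & K3). destruct (Jacobi_0 (3/4) m34) as (Z1 & Z2 & Z3).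
 have A2 : am_lt1 (2*KP) (3/4) = PI.
 { unfold KP. rewrite am_IZR_K by apply m34. field. }
 have V0 : v0 0%C = 1 by (unfold v0, sqn, Re, Im; simpl; ring). have V1 : v1 0%C = 0 by (unfold v1, Re; simpl; ring).
 have V2 : v2 0%C = 0 by (unfold v2, Im; simpl; ring). have V3 : v3 0%C = -1 by (unfold v3, sqn, Re, Im; simpl; ring).
 rewrite V0, V1 in F1, G1. rewrite V0, V2 in F2, G2. rewrite V0, V3 in F3, G3.
 have T1 : tP (qA1 0%C) (qB1 0%C) 1%C = - sqrt 3.
 { unfold tP. rewrite E1. replace (sqn (qA1 0%C)+sqn (qB1 0%C)) with (/ 2) by lra.
  replace (hP (qA1 0%C) (qB1 0%C) 1%C) with (/ 2) by (unfold hP, qA1, qB1, Re; simpl; field). rewrite S6. field. lra. }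
 have T2 : tP (qA2 0%C) (qB2 0%C) 1%C = sqrt 3.
 { unfold tP. rewrite E2. replace (sqn (qA2 0%C)+sqn (qB2 0%C)) with (/ 2) by lra.
  replace (hP (qA2 0%C) (qB2 0%C) 1%C) with (- / 2) by (unfold hP, qA2, qB2, Re; simpl; field). rewrite S6. field. lra. }
 have T3 : tP (qA3 0%C) (qB3 0%C) 1%C = 0.
 { unfold tP. replace (hP (qA3 0%C) (qB3 0%C) 1%C) with 0 by (unfold hP, qA3, qB3, Re; simpl; ring). unfold Rdiv. ring. }
 have P1 : phiP KP = atan (- sqrt 3).
 { rewrite phiP_atan, (cn_lt1 _ m34), A2, cos_PI. f_equal. ring. }
 have P2 : phiP 0 = atan (sqrt 3).
 { rewrite phiP_atan, Rmult_0_r, Z2. f_equal. ring. }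
 have P3 : phiP (KP/2) = atan 0.
 { rewrite phiP_atan. replace (2*(KP/2)) with KP by field. unfold KP. rewrite K2. f_equal. ring. }
 split; [intros E; apply RtoC_inj in E; lra|]. split; [apply base_rad|]. unfold hatP. rewrite T1, T2, T3, P1, P2, P3.
 unfold cP. rewrite E1, E2, E3, F1, F2, F3.
 split; [|split; [|split]].
 - split; [auto|]. unfold phiP1. rewrite (sn_lt1 _ m34), A2, sin_PI. unfold Rdiv. ring.
 - split; [auto|]. unfold phiP1. rewrite Rmult_0_r, Z1. unfold Rdiv. ring.
 - split; [auto|]. unfold phiP1. replace (2*(KP/2)) with KP by field. unfold KP. rewrite K1, K3.
  replace (sqrt (1-3/4)) with (/ 2). { rewrite S6. field. lra. }
  replace (1-3/4) with ((/ 2)^2) by field. rewrite sqrt_pow2; lra.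
 - rewrite atan_opp, atan_0. ring.
Qed.

Definition reachedP (x y u : R) : Prop := exists z w, reach 2 baseP (z, w, (x, y, u)).

Lemma reachedP_lift (x y u x' y' u' : R -> R) :
 (forall t, 0 <= t <= 1 -> locally t (smooth_curve regularP x y u x' y' u')) ->
 reachedP (x 0) (y 0) (u 0) -> reachedP (x 1) (y 1) (u 1).
Proof.
 intros H (z & w & Hr). destruct (stateP_unique _ _ _ _ _ (stateP_reach _ _ stateP_base Hr)) as (_ & -> & ->).
 eexists. eexists. apply (reach_trans _ _ _ _ Hr). apply (lift_P x y u x' y' u' H).
Qed.

Definition cellP (j : Z) (t : R) : Prop := IZR j*KP < t < IZR (j+1)*KP.

Lemma cellP_sign (j : Z) (t : R) : cellP j t -> parity j*phiP1 t < 0.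
Proof.
 intros [H1 H2]. have A : IZR j*PI < am_lt1 (2*t) (3/4) < IZR j*PI+PI.
 { split.
  - replace (IZR j*PI) with (am_lt1 (IZR (2*j)*ellK (3/4)) (3/4)) by (rewrite am_IZR_K by apply m34; rewrite mult_IZR; field).
   apply am_lt; [apply m34|]. rewrite mult_IZR. fold KP. lra.
  - replace (IZR j*PI+PI) with (am_lt1 (IZR (2*(j+1))*ellK (3/4)) (3/4))
    by (rewrite am_IZR_K by apply m34; rewrite mult_IZR, plus_IZR; field).
   apply am_lt; [apply m34|]. rewrite mult_IZR. fold KP. lra. }
 set (v := am_lt1 (2*t) (3/4)-IZR j*PI).
 have Sn : sn (2*t) (3/4) = parity j*sin v.
 { rewrite (sn_lt1 _ m34). destruct (cos_sin_shift j v) as [_ <-]. f_equal. unfold v. ring. }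
 have Sv : 0 < sin v by (apply sin_gt_0; unfold v; lra).
 have Dv := dn_pos _ m34 (2*t). have S3 := sqrt3_pos. unfold phiP1. rewrite Sn.
 replace (parity j*(- (sqrt 3/2)*(parity j*sin v)/dn (2*t) (3/4))) with
  (- ((parity j*parity j)*(sqrt 3*sin v/(2*dn (2*t) (3/4))))) by (field; lra).
 replace (parity j*parity j) with 1 by (destruct (parity_cases j) as [-> | ->]; ring).
 assert (0 < sqrt 3*sin v/(2*dn (2*t) (3/4))) by (apply Rdiv_lt_0_compat; [apply Rmult_lt_0_compat; auto|lra]). lra.
Qed.

Lemma cellP_neq0 (j : Z) (t : R) : cellP j t -> phiP1 t <> 0.
Proof. intros H E. apply cellP_sign in H. rewrite E in H. lra. Qed.

Lemma phiP_open_bound (t : R) : phiP1 t <> 0 -> - (PI/3) < phiP t < PI/3.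
Proof.
 intros H. have B := phiP_bound t. have E := phiP1_sq t. assert (0 < phiP1 t^2) by (apply pow2_gt_0; auto).
 have C : cos (2*(PI/3)) = - (1/2).
 { replace (2*(PI/3)) with (PI-PI/3) by field. rewrite cos_minus, cos_PI, sin_PI, cos_PI3. field. }
 split; apply Rnot_le_lt; intros L.
 - have E' : phiP t = - (PI/3) by lra. rewrite E' in E. replace (2 * - (PI/3)) with (- (2*(PI/3))) in E by ring. rewrite cos_neg in E. lra.
 - have E' : phiP t = PI/3 by lra. rewrite E' in E. lra.
Qed.

Lemma lattice_phiP1 (j : Z) : phiP1 (IZR j*KP) = 0.
Proof.
 unfold phiP1. rewrite (sn_lt1 _ m34). replace (2*(IZR j*KP)) with (IZR (2*j)*ellK (3/4)) by (rewrite mult_IZR; unfold KP; ring).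
 rewrite am_IZR_K by apply m34. rewrite mult_IZR. replace (2*IZR j*(PI/2)) with (0+IZR j*PI) by field.
 destruct (cos_sin_shift j 0) as [_ ->]. rewrite sin_0. unfold Rdiv. ring.
Qed.

Lemma lattice_phiP (j : Z) : phiP (IZR j*KP) <> 0.
Proof.
 intros E. have Q := phiP1_sq (IZR j*KP). rewrite lattice_phiP1, E, Rmult_0_r, cos_0 in Q. lra.
Qed.

Lemma branchP_cell (j : Z) (v : R) : - (PI/3) < v < PI/3 -> cellP j (branchP j v) /\ phiP (branchP j v) = v.
Proof.
 intros H. destruct (branchP_spec j v) as [E [L U]]; [lra|]. split; [|auto].
 have N : forall i, branchP j v <> IZR i*KP.
 { intros i Ei. rewrite Ei in E. have Q := phiP1_sq (IZR i*KP). rewrite lattice_phiP1, E in Q.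
  destruct (cos2_zero_endpoint v); lra. }
 have N1 := N j. have N2 := N (j+1)%Z. split; lra.
Qed.

Lemma branchP_derive (j : Z) (v : R) : - (PI/3) < v < PI/3 -> is_derive (branchP j) v (/ phiP1 (branchP j v)).
Proof.
 intros H. set (s := - parity j). have Es : s*s = 1 by (unfold s; destruct (parity_cases j) as [-> | ->]; ring).
 assert (Hr : forall w, - (PI/3) < w < PI/3 -> - (PI/3) < s*w < PI/3)
  by (intros w Hw; unfold s; destruct (parity_cases j) as [-> | ->]; lra).
 have D := derive_inverse (fun t => s*phiP t) (fun t => s*phiP1 t) (fun w => branchP j (s*w))
  (IZR j*KP) (IZR (j+1)*KP) (- (PI/3)) (PI/3).
 have D' := D ltac:(intros t _; apply (is_derive_scal phiP), is_derive_phiP)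
  ltac:(intros t Ht; have Q := cellP_sign j t Ht; unfold s; lra)
  ltac:(intros w Hw; destruct (branchP_cell j (s*w) (Hr w Hw)) as [B1 B2]; split; [exact B1|rewrite B2, <- Rmult_assoc, Es; ring])
  (s*v) (Hr v H). cbv beta in D'. clear D.
 rewrite <- Rmult_assoc, Es, Rmult_1_l in D'.
 apply (is_derive_ext (fun w => branchP j (s*(s*w)))).
 - intros w. rewrite <- Rmult_assoc, Es, Rmult_1_l. auto.
 - destruct (branchP_cell j v H) as [B1 _]. have N := cellP_neq0 _ _ B1.
  have Ns : s <> 0 by (intros E; rewrite E in Es; lra).
  eapply is_derive_eq; [apply (is_derive_comp_R (fun w => branchP j (s*w)) (fun w => s*w) v (/ (s*phiP1 (branchP j v))) s D')|].
  + auto_derive; auto. ring.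
  + field. auto.
Qed.

(** A curve in a cell that is given by the values of [phiP]. *)
Lemma branch_curve (j : Z) (a a' : R -> R) (t : R) : - (PI/3) < a t < PI/3 -> is_derive a t (a' t) -> continuous a' t ->
 is_derive (fun s => branchP j (a s)) t (a' t/phiP1 (branchP j (a t))) /\
 continuous (fun s => a' s/phiP1 (branchP j (a s))) t.
Proof.
 intros H Ha Hc. have D := branchP_derive j (a t) H. destruct (branchP_cell j (a t) H) as [B _]. have N := cellP_neq0 _ _ B.
 have Db := is_derive_comp_R (branchP j) a t _ _ D Ha. split.
 - eapply is_derive_eq; [exact Db|]. field. auto.
 - have Cb := is_derive_continuous _ _ _ Db. cont. apply (is_derive_continuous _ _ _ (is_derive_phiP1 _)).
Qed.

Lemma regularP_of (x y u : R) : phiP x+phiP y+phiP u = 0 -> phiP1 x <> 0 \/ phiP1 y <> 0 ->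
 ~ (phiP x = 0 /\ phiP y = 0 /\ phiP u = 0) -> regularP x y u.
Proof.
 intros H1 H2 H3. split; [auto|]. split; [|auto]. intros E. have E' : nuP x y u = phiP1 u by lra.
 have Q := norm3_sq (phiP1 x) (phiP1 y) (phiP1 u). fold (nuP x y u) in Q. rewrite E' in Q. have A1 := pow2_ge_0 (phiP1 x). have A2 := pow2_ge_0 (phiP1 y).
 destruct H2 as [N|N]; apply pow2_gt_0 in N; lra.
Qed.

(** The pairs of values that occur in the interior of a cell of P, the third value being
    [- (a + b)]. *)
Definition hexagon (a b : R) : Prop :=
 - (PI/3) < a < PI/3 /\ - (PI/3) < b < PI/3 /\ - (PI/3) < - (a+b) < PI/3.

(** The straight segment of values stays in the convex hexagon, and by the determinant condition it
    misses the origin, the flat point. *)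
Lemma cellP_segment (i j k : Z) (a0 b0 a1 b1 : R) : hexagon a0 b0 -> hexagon a1 b1 -> a0*b1-a1*b0 <> 0 ->
 reachedP (branchP i a0) (branchP j b0) (branchP k (- (a0+b0))) -> reachedP (branchP i a1) (branchP j b1) (branchP k (- (a1+b1))).
Proof.
 intros H0 H1 Hd Hr. pose (a := fun t => a0+t*(a1-a0)). pose (b := fun t => b0+t*(b1-b0)).
 pose (c := fun t => - (a t+b t)).
 have Da : forall t, is_derive a t (a1-a0) by (intros; unfold a; auto_derive; auto; ring).
 have Db : forall t, is_derive b t (b1-b0) by (intros; unfold b; auto_derive; auto; ring).
 have Dc : forall t, is_derive c t (- ((a1-a0)+(b1-b0))) by (intros; unfold c, a, b; auto_derive; auto; ring).
 have Ea : a 0 = a0 /\ a 1 = a1 by (unfold a; split; ring). have Eb : b 0 = b0 /\ b 1 = b1 by (unfold b; split; ring).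
 destruct Ea as [Ea0 Ea1], Eb as [Eb0 Eb1].
 have G := reachedP_lift (fun t => branchP i (a t)) (fun t => branchP j (b t)) (fun t => branchP k (c t))
  (fun t => (a1-a0)/phiP1 (branchP i (a t))) (fun t => (b1-b0)/phiP1 (branchP j (b t)))
  (fun t => (- ((a1-a0)+(b1-b0)))/phiP1 (branchP k (c t))). cbv beta in G. unfold c in G.
 rewrite Ea0, Ea1, Eb0, Eb1 in G. apply G; auto. clear G Hr.
 intros t Ht. fold (c t).
 have Hx : hexagon (a t) (b t).
 { unfold hexagon, a, b in *. have Cv : forall L p q, p < L -> q < L -> p+t*(q-p) < L.
  { intros L p q Hp Hq. destruct (Rle_dec p q); [assert (t*(q-p) <= 1*(q-p)) by (apply Rmult_le_compat_r; lra); lra|].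
   assert (0 <= t*(p-q)) by (apply Rmult_le_pos; lra). lra. }
  have C1 := Cv (PI/3) a0 a1. have C2 := Cv (PI/3) b0 b1. have C3 := Cv (PI/3) (- a0) (- a1). have C4 := Cv (PI/3) (- b0) (- b1).
  have C5 := Cv (PI/3) (a0+b0) (a1+b1). have C6 := Cv (PI/3) (- (a0+b0)) (- (a1+b1)). repeat split; lra. }
 have Hn : 0 < a t^2+b t^2.
 { destruct (Req_dec (a t^2+b t^2) 0) as [E|N].
  - exfalso. apply sum_sq_eq_0 in E. destruct E as [E1 E2]. apply Hd.
   transitivity (a t*(b1-b0)-b t*(a1-a0)); [unfold a, b; ring|]. rewrite E1, E2. ring.
  - have A1 := pow2_ge_0 (a t). have A2 := pow2_ge_0 (b t). lra. }
 have Op : forall f f' : R -> R, (forall s, is_derive f s (f' s)) -> - (PI/3) < f t < PI/3 -> locally t (fun s => - (PI/3) < f s < PI/3).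
 { intros f f' Df Hf. have Cf := is_derive_continuous _ _ _ (Df t). apply filter_and.
  - apply (Cf (fun y => - (PI/3) < y)). apply open_gt, Hf.
  - apply (Cf (fun y => y < PI/3)). apply open_lt, Hf. }
 have O1 := Op a (fun _ => a1-a0) Da (proj1 Hx). have O2 := Op b (fun _ => b1-b0) Db (proj1 (proj2 Hx)).
 have O3 := Op c (fun _ => - ((a1-a0)+(b1-b0))) Dc (proj2 (proj2 Hx)).
 have O4 : locally t (fun s => 0 < a s^2+b s^2).
 { have Cn : continuous (fun s => a s^2+b s^2) t.
  { apply (ex_derive_continuous (K := R_AbsRing) (V := R_NormedModule)). unfold a, b. auto_derive. auto. }
  apply (Cn (fun y => 0 < y)). apply open_gt, Hn. }
 generalize (filter_and _ _ (filter_and _ _ O1 O2) (filter_and _ _ O3 O4)). apply filter_imp. clear O1 O2 O3 O4 Op Hx Hn.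
 intros s [[P1 P2] [P3 P4]].
 destruct (branch_curve i a (fun _ => a1-a0) s P1 (Da s) (continuous_const _ _)) as [X1 X2].
 destruct (branch_curve j b (fun _ => b1-b0) s P2 (Db s) (continuous_const _ _)) as [Y1 Y2].
 destruct (branch_curve k c (fun _ => - ((a1-a0)+(b1-b0))) s P3 (Dc s) (continuous_const _ _)) as [Z1 Z2].
 unfold smooth_curve. split; [exact X1|]. split; [exact Y1|]. split; [exact Z1|]. split; [exact X2|]. split; [exact Y2|]. split; [exact Z2|].
 destruct (branchP_cell i (a s) P1) as [B1 F1], (branchP_cell j (b s) P2) as [B2 F2], (branchP_cell k (c s) P3) as [B3 F3].
 change (- (a s+b s)) with (c s). apply regularP_of; rewrite ?F1, ?F2, ?F3.
 - unfold c. ring.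
 - left. apply (cellP_neq0 _ _ B1).
 - intros (E1 & E2 & _). rewrite E1, E2 in P4. lra.
Qed.

(** Two points collinear with the origin are joined through a point in an orthogonal direction,
    scaled by 1/4 to stay in the hexagon. *)
Lemma cellP_connected (i j k : Z) (a0 b0 a1 b1 : R) : hexagon a0 b0 -> hexagon a1 b1 -> 0 < a0^2+b0^2 -> 0 < a1^2+b1^2 ->
 reachedP (branchP i a0) (branchP j b0) (branchP k (- (a0+b0))) -> reachedP (branchP i a1) (branchP j b1) (branchP k (- (a1+b1))).
Proof.
 intros H0 H1 N0 N1 Hr. destruct (Req_dec (a0*b1-a1*b0) 0) as [E|N]; [|apply (cellP_segment i j k a0 b0 a1 b1); auto].
 have Hp : a0*a1+b0*b1 <> 0.
 { intros E'. have Q : (a0^2+b0^2)*(a1^2+b1^2) = (a0*b1-a1*b0)^2+(a0*a1+b0*b1)^2 by ring.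
  rewrite E, E' in Q. assert (0 < (a0^2+b0^2)*(a1^2+b1^2)) by (apply Rmult_lt_0_compat; auto). lra. }
 have Hm : hexagon (- b0/4) (a0/4) by (unfold hexagon in *; lra).
 apply (cellP_segment i j k (- b0/4) (a0/4)); auto; [lra|].
 apply (cellP_segment i j k a0 b0); auto. lra.
Qed.

Definition full_cellP (i j k : Z) : Prop := forall a b, hexagon a b -> 0 < a^2+b^2 ->
 reachedP (branchP i a) (branchP j b) (branchP k (- (a+b))).

Lemma full_cellP_of (i j k : Z) (x y u : R) : cellP i x -> cellP j y -> cellP k u -> reachedP x y u -> full_cellP i j k.
Proof.
 intros Hx Hy Hu Hr a b Hab Nab. destruct Hr as (z & w & Hr).
 destruct (stateP_unique _ _ _ _ _ (stateP_reach _ _ stateP_base Hr)) as ((Hs & _ & Hf) & _).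
 have Bx := phiP_open_bound x (cellP_neq0 _ _ Hx). have By := phiP_open_bound y (cellP_neq0 _ _ Hy).
 have Bu := phiP_open_bound u (cellP_neq0 _ _ Hu).
 apply (cellP_connected i j k (phiP x) (phiP y)); auto.
 - unfold hexagon. replace (- (phiP x+phiP y)) with (phiP u) by lra. auto.
 - destruct (Req_dec (phiP x^2+phiP y^2) 0) as [E|].
  + exfalso. apply sum_sq_eq_0 in E. apply Hf. lra.
  + have A1 := pow2_ge_0 (phiP x). have A2 := pow2_ge_0 (phiP y). lra.
 - replace (- (phiP x+phiP y)) with (phiP u) by lra. unfold cellP in *. rewrite !branchP_phiP by lra. exists z, w. auto.
Qed.

(** The curves [phi(x) = - 2 phi(y) = - 2 phi(u)] cross from one cell to the next. *)
Lemma crossing_curve (e j k : Z) : exists d, 0 < d < KP /\ forall s0, s0 = 1 \/ s0 = -1 ->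
 let x := fun t => IZR e*KP+s0*d*(1-2*t) in
 let x' := fun _ : R => - 2*(s0*d) in
 let a := fun t => - phiP (x t)/2 in
 let a' := fun t => s0*d*phiP1 (x t) in
 let y := fun t => branchP j (a t) in let u := fun t => branchP k (a t) in
 let y' := fun t => a' t/phiP1 (y t) in let u' := fun t => a' t/phiP1 (u t) in
 forall t, 0 <= t <= 1 -> locally t (fun s => is_derive x s (x' s) /\ is_derive y s (y' s) /\ is_derive u s (u' s) /\
  continuous x' s /\ continuous y' s /\ continuous u' s /\
  phiP (x s)+phiP (y s)+phiP (u s) = 0 /\ phiP1 (y s) <> 0 /\ phiP1 (u s) <> 0 /\ phiP (x s) <> 0).
Proof.
 have Cphi : forall t, continuous phiP t by (intros t; apply (is_derive_continuous _ _ _ (is_derive_phiP t))).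
 have Cphi1 : forall t, continuous phiP1 t by (intros t; apply (is_derive_continuous _ _ _ (is_derive_phiP1 t))).
 have Hn : locally (IZR e*KP) (fun t => phiP t <> 0).
 { apply (Cphi (IZR e*KP) (fun y => y <> 0)). apply open_neq. apply lattice_phiP. }
 destruct Hn as [d0 Hd0]. have K := KP_pos. have P0 := cond_pos d0.
 set (d := Rmin d0 KP/2). have M1 : Rmin d0 KP <= d0 by apply Rmin_l. have M2 : Rmin d0 KP <= KP by apply Rmin_r.
 have M3 : 0 < Rmin d0 KP by (apply Rmin_pos; auto).
 exists d. split; [unfold d; lra|]. intros s0 Hs0 x x' a a' y u y' u' t Ht.
 have Dx : forall s, is_derive x s (x' s) by (intros s; unfold x, x'; auto_derive; auto; ring).
 have Cx : forall s, continuous x s by (intros s; apply (is_derive_continuous _ _ _ (Dx s))).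
 have Nt : phiP (x t) <> 0.
 { apply Hd0. change (Rabs (x t-IZR e*KP) < d0). replace (x t-IZR e*KP) with (s0*d*(1-2*t)) by (unfold x; ring).
  rewrite !Rabs_mult. have E1 : Rabs s0 = 1 by (destruct Hs0 as [-> | ->]; unfold Rabs; destruct (Rcase_abs _); lra).
  have E2 : Rabs (1-2*t) <= 1 by (apply Rabs_le; lra). rewrite E1, Rmult_1_l, (Rabs_pos_eq d) by (unfold d; lra).
  assert (d*Rabs (1-2*t) <= d*1) by (apply Rmult_le_compat_l; unfold d in *; lra). unfold d in *. lra. }
 have Hl : locally t (fun s => phiP (x s) <> 0).
 { apply (continuous_comp x phiP t (Cx t) (Cphi (x t)) (fun y => y <> 0)). apply open_neq. auto. }
 generalize Hl. apply filter_imp. intros s Ns.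
 have Ba : - (PI/3) < a s < PI/3 by (unfold a; have B := phiP_bound (x s); have P := PI_RGT_0; lra).
 have Da : is_derive a s (a' s).
 { have B := is_derive_comp_R phiP x s _ _ (is_derive_phiP (x s)) (Dx s). unfold a, a'.
  apply (is_derive_ext (fun t => (- / 2)*phiP (x t))); [intros v; change (- / 2*phiP (x v) = - phiP (x v)/2); field|].
  eapply is_derive_eq; [apply (is_derive_scal (fun t => phiP (x t)) s (- / 2) _ B)|]. unfold x'. field. }
 have Ca : continuous a' s.
 { unfold a'. cont. }
 destruct (branch_curve j a a' s Ba Da Ca) as [Y1 Y2]. destruct (branch_curve k a a' s Ba Da Ca) as [U1 U2].
 destruct (branchP_cell j (a s) Ba) as [B1 F1], (branchP_cell k (a s) Ba) as [B2 F2].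
 split; [auto|]. split; [exact Y1|]. split; [exact U1|]. split; [apply continuous_const|]. split; [exact Y2|]. split; [exact U2|].
 split; [unfold y, u; rewrite F1, F2; unfold a; field|].
 split; [apply (cellP_neq0 _ _ B1)|]. split; [apply (cellP_neq0 _ _ B2)|auto].
Qed.

Lemma lattice_cells (e : Z) (d s0 : R) : 0 < d < KP -> s0 = 1 \/ s0 = -1 ->
 cellP (if Rlt_dec 0 s0 then e else e-1)%Z (IZR e*KP+s0*d*(1-2*0)) /\
 cellP (if Rlt_dec 0 s0 then e-1 else e)%Z (IZR e*KP+s0*d*(1-2*1)).
Proof.
 intros Hd [-> | ->]; destruct (Rlt_dec 0 _); try lra; unfold cellP; rewrite ?minus_IZR, ?plus_IZR, ?minus_IZR; split; split; nra.
Qed.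

(** The crossing curve starts in the full cell, so its end is reached, and one reached point fills
    the next cell. The three conclusions differ by which coordinate crosses the lattice. *)
Lemma crossingP (e j k : Z) (s0 : R) : s0 = 1 \/ s0 = -1 ->
 let i0 := (if Rlt_dec 0 s0 then e else e-1)%Z in let i1 := (if Rlt_dec 0 s0 then e-1 else e)%Z in
 (full_cellP i0 j k -> full_cellP i1 j k) /\ (full_cellP j i0 k -> full_cellP j i1 k) /\ (full_cellP j k i0 -> full_cellP j k i1).
Proof.
 intros Hs i0 i1. destruct (crossing_curve e j k) as (d & Hd & H). specialize (H s0 Hs). cbv zeta in H.
 set (x := fun t => IZR e*KP+s0*d*(1-2*t)) in *. set (a := fun t => - phiP (x t)/2) in *.
 destruct (lattice_cells e d s0 Hd Hs) as [C0 C1]. fold i0 in C0. fold i1 in C1. change (cellP i0 (x 0)) in C0. change (cellP i1 (x 1)) in C1.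
 have P := PI_RGT_0. set (v := phiP (x 0)).
 have Bv : - (PI/3) < v < PI/3 by (apply phiP_open_bound, (cellP_neq0 _ _ C0)).
 have Nv : v <> 0 by (destruct (locally_singleton _ _ (H 0 ltac:(lra))) as (_ & _ & _ & _ & _ & _ & _ & _ & _ & N); exact N).
 have Nv2 : 0 < v^2 by (apply pow2_gt_0; auto).
 have Ev : branchP i0 v = x 0 by (apply branchP_phiP; destruct C0; lra).
 have Ba : forall t, - (PI/3) < a t < PI/3 by (intros t; unfold a; have B := phiP_bound (x t); lra).
 have A0 : a 0 = - v/2 by reflexivity.
 have Q1 := proj1 (branchP_cell j (a 1) (Ba 1)). have Q2 := proj1 (branchP_cell k (a 1) (Ba 1)).
 have Ex : forall t, phiP (x t) = - 2*a t by (intros; unfold a; field).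
 set (x' := fun _ : R => -2*(s0*d)) in *. set (y' := fun t => s0*d*phiP1 (x t)/phiP1 (branchP j (a t))) in *.
 set (u' := fun t => s0*d*phiP1 (x t)/phiP1 (branchP k (a t))) in *.
 split; [|split]; intros HF.
 - eapply full_cellP_of; [exact C1|exact Q1|exact Q2|].
  apply (reachedP_lift x (fun t => branchP j (a t)) (fun t => branchP k (a t)) x' y' u').
  + intros t Ht. generalize (H t Ht). apply filter_imp. intros s (D1 & D2 & D3 & K1 & K2 & K3 & S & N1 & N2 & N3).
   unfold smooth_curve. do 6 (split; [assumption|]). apply regularP_of; [exact S|right; exact N1|]. intros (E & _). apply N3, E.
  + rewrite A0, <- Ev. replace (branchP k (- v/2)) with (branchP k (- (v + - v/2))) by (f_equal; field). apply HF; [unfold hexagon; lra|].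
   assert (0 <= (- v/2)^2) by apply pow2_ge_0. lra.
 - eapply full_cellP_of; [exact Q1|exact C1|exact Q2|].
  apply (reachedP_lift (fun t => branchP j (a t)) x (fun t => branchP k (a t)) y' x' u').
  + intros t Ht. generalize (H t Ht). apply filter_imp. intros s (D1 & D2 & D3 & K1 & K2 & K3 & S & N1 & N2 & N3).
   unfold smooth_curve. do 6 (split; [assumption|]). apply regularP_of; [rewrite <- S; ring|left; exact N1|]. intros (_ & E & _). apply N3, E.
  + rewrite A0, <- Ev. replace (branchP k (- v/2)) with (branchP k (- (- v/2+v))) by (f_equal; field). apply HF; [unfold hexagon; lra|].
   assert (0 <= (- v/2)^2) by apply pow2_ge_0. lra.
 - eapply full_cellP_of; [exact Q1|exact Q2|exact C1|].
  apply (reachedP_lift (fun t => branchP j (a t)) (fun t => branchP k (a t)) x y' u' x').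
  + intros t Ht. generalize (H t Ht). apply filter_imp. intros s (D1 & D2 & D3 & K1 & K2 & K3 & S & N1 & N2 & N3).
   unfold smooth_curve. do 6 (split; [assumption|]). apply regularP_of; [rewrite <- S; ring|left; exact N1|]. intros (_ & _ & E). apply N3, E.
  + rewrite A0, <- Ev. replace (branchP i0 v) with (branchP i0 (- (- v/2 + - v/2))) by (f_equal; field). apply HF; [unfold hexagon; lra|].
   have E : (- v/2)^2 = v^2/4 by field. lra.
Qed.

Lemma Z_walk (P : Z -> Prop) : (forall e, P e <-> P (e-1)%Z) -> P 0%Z -> forall i, P i.
Proof.
 intros H H0. apply Z.bi_induction; auto; [intros x y ->; tauto|].
 intros n. specialize (H (Z.succ n)). replace (Z.succ n-1)%Z with n in H by lia. tauto.
Qed.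

Lemma full_cells_P : full_cellP 0 0 0 -> forall i j k, full_cellP i j k.
Proof.
 intros H0.
 have C : forall e j k, (full_cellP e j k <-> full_cellP (e-1) j k) /\ (full_cellP j e k <-> full_cellP j (e-1) k) /\
  (full_cellP j k e <-> full_cellP j k (e-1)).
 { intros e j k. destruct (crossingP e j k 1 (or_introl eq_refl)) as (A1 & A2 & A3).
  destruct (crossingP e j k (-1) (or_intror eq_refl)) as (B1 & B2 & B3).
  destruct (Rlt_dec 0 1); [|lra]. destruct (Rlt_dec 0 (-1)); [lra|]. tauto. }
 have H1 : forall i, full_cellP i 0 0 by (apply Z_walk; [intros; apply C|exact H0]).
 have H2 : forall i j, full_cellP i j 0 by (intros i; apply Z_walk; [intros; apply C|apply H1]).
 intros i j. apply Z_walk; [intros; apply C|apply H2].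
Qed.

Lemma within_small (d e : R) : 0 < e < d -> within d (- e, - e) 0%C.
Proof. intros H. split; unfold Re, Im; simpl; apply Rabs_def1; lra. Qed.

(** The base point lies on the boundary of the cell. A short arc to [z = - e - i e] makes all Gauss
    components, hence all slopes, negative; together with the small displacement this locates the
    end in the cell of index 0. *)
Lemma base_cellP : full_cellP 0 0 0.
Proof.
 have K := KP_pos.
 destruct (short_arc 2 0%C (KP/4)) as (d & Hd & H).
 { rewrite <- base_rad. apply Cmult_neq_0; intros E; apply RtoC_inj in E; lra. }
 { lra. }
 set (e := Rmin d 1/2). have M1 : Rmin d 1 <= d by apply Rmin_l. have M2 : Rmin d 1 <= 1 by apply Rmin_r.
 have M3 : 0 < Rmin d 1 by (apply Rmin_pos; lra).
 destruct (H 0%C (- e, - e) 1%C KP 0 (KP/2)) as (w & x & y & u & Hr & Bx & By & Bu).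
 { split; unfold Re, Im; simpl; rewrite Rminus_0_r, Rabs_R0; auto. }
 { apply within_small. unfold e. lra. }
 { apply base_rad. }
 have Hst := stateP_reach _ _ stateP_base Hr. destruct Hst as (Hw & Hsq & [_ C1] & [_ C2] & [_ C3] & _).
 set (z := (- e, - e) : C) in *. destruct (quad_diff z) as (F1 & F2 & F3). have V := v0_pos z.
 have V1 : v1 z < 0 by (unfold v1, z, Re; simpl; unfold e; lra). have V2 : v2 z < 0 by (unfold v2, z, Im; simpl; unfold e; lra).
 have V3 : v3 z < 0 by (unfold v3, z, sqn, Re, Im; simpl; assert (0 < e <= / 2) by (unfold e; lra); nra).
 have Sg : forall A B v, sqn B-sqn A = v0 z*v -> v < 0 -> cP A B w < 0.
 { intros A B v E Hv. unfold cP. rewrite E. have P := DP_pos A B w Hw. have R := sqrt_lt_R0 _ P. have S6 : 0 < sqrt 6 by (apply sqrt_lt_R0; lra).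
  assert (0 < sqrt 6*(v0 z * - v)/sqrt (DP A B w)).
  { apply Rdiv_lt_0_compat; auto. apply Rmult_lt_0_compat; auto. apply Rmult_lt_0_compat; lra. }
  replace (sqrt 6*(v0 z*v)/sqrt (DP A B w)) with (- (sqrt 6*(v0 z * - v)/sqrt (DP A B w))) by (field; lra). lra. }
 have S1 : phiP1 x < 0 by (rewrite C1; apply (Sg _ _ _ F1 V1)). have S2 : phiP1 y < 0 by (rewrite C2; apply (Sg _ _ _ F2 V2)).
 have S3 : phiP1 u < 0 by (rewrite C3; apply (Sg _ _ _ F3 V3)).
 apply Rabs_def2 in Bx, By, Bu.
 have NL : forall j t, phiP1 t < 0 -> t <> IZR j*KP by (intros j t Ht E; rewrite E, lattice_phiP1 in Ht; lra).
 have NC : forall j t, phiP1 t < 0 -> Z.even j = false -> ~ cellP j t.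
 { intros j t Ht Hj Hc. apply cellP_sign in Hc. unfold parity in Hc. rewrite Hj in Hc. lra. }
 apply (full_cellP_of 0 0 0 x y u); [| | |exists z, w; exact Hr]; unfold cellP; simpl (0+1)%Z.
 - have N1 := NL 1%Z x S1. split; [lra|]. apply Rnot_le_lt. intros L. apply (NC 1%Z x S1); auto. unfold cellP. simpl (1+1)%Z. lra.
 - have N1 := NL 0%Z y S2. split; [|lra]. apply Rnot_le_lt. intros L. apply (NC (-1)%Z y S2); auto. unfold cellP. simpl (-1+1)%Z. lra.
 - lra.
Qed.

(** Reached points satisfy the equation, which is closed. Conversely a surface point lies in a
    closed cell, and moving its values towards the interior point [(PI / 12, PI / 12, - PI / 6)]
    approximates it by reached points. *)
Lemma closure_reachedP (p : R3) :
 closure (fun q => let '(x, y, u) := q in reachedP x y u) p <-> surfaceP p.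
Proof.
 destruct p as [[x y] u]. split.
 - intros H. split; [exact I|]. split; [exact I|]. split; [exact I|]. unfold sep_fun.
  destruct (Req_dec (phiP x+phiP y+phiP u) 0) as [|N]; [auto|]. exfalso.
  pose (F := fun q : R3 => phiP (fst (fst q))+phiP (snd (fst q))+phiP (snd q)).
  have Cphi : forall t, continuous phiP t by (intros t; apply (is_derive_continuous _ _ _ (is_derive_phiP t))).
  have CF : continuous F (x, y, u) by (unfold F; cont).
  destruct (H (fun q => F q <> 0)) as ([[x' y'] u'] & NF & (z & w & Hr)).
  + apply (CF (fun v => v <> 0)). apply open_neq. exact N.
  + apply NF. apply (stateP_reach _ _ stateP_base Hr).
 - intros Hs O HO. destruct (surfaceP_closed_cellP _ Hs) as (i & j & k & Hx & Hy & Hu & E).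
  have Bx := phiP_bound x. have By := phiP_bound y. have Bu := phiP_bound u. have P := PI_RGT_0.
  pose (a := fun e => (1-e)*phiP x+e*(PI/12)). pose (b := fun e => (1-e)*phiP y+e*(PI/12)).
  have Ka : forall e0, continuous a e0 by (intros e0; unfold a; cont).
  have Kb : forall e0, continuous b e0 by (intros e0; unfold b; cont).
  have Kc : forall e0, continuous (fun e => - (a e+b e)) e0.
  { intros e0. cont. }
  have A0 : a 0 = phiP x by (unfold a; ring). have B0 : b 0 = phiP y by (unfold b; ring).
  have C0 : - (a 0+b 0) = phiP u by (rewrite A0, B0; lra).
  have Cg : continuous (fun e => (branchP i (a e), branchP j (b e), branchP k (- (a e+b e)))) 0.
  { apply continuous_triple.
   - apply (continuous_comp a (branchP i)); auto. apply branchP_continuous. rewrite A0. lra.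
   - apply (continuous_comp b (branchP j)); auto. apply branchP_continuous. rewrite B0. lra.
   - apply (continuous_comp (fun e => - (a e+b e)) (branchP k)); auto. apply branchP_continuous. rewrite C0. lra. }
  have Hg := Cg O. cbv beta in Hg. rewrite A0, B0 in Hg. replace (- (phiP x+phiP y)) with (phiP u) in Hg by lra.
  rewrite !branchP_phiP in Hg by lra. destruct (Hg HO) as [d Hd].
  have Pd := cond_pos d. set (e := Rmin d 1). have M1 : e <= d by apply Rmin_l. have M2 : e <= 1 by apply Rmin_r.
  have M3 : 0 < e by (apply Rmin_pos; lra).
  have Good : forall t, 0 < t < e -> 0 < a t^2+b t^2 -> exists q, O q /\ (let '(x, y, u) := q in reachedP x y u).
  { intros t Ht Nt. exists (branchP i (a t), branchP j (b t), branchP k (- (a t+b t))). split.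
   - apply (Hd t). change (Rabs (t-0) < d). rewrite Rminus_0_r, Rabs_pos_eq by lra. lra.
   - apply (full_cells_P base_cellP i j k); auto.
    have Cv : forall p q, p <= PI/3 -> q <= PI/6 -> (1-t)*p+t*q < PI/3.
    { intros p q Hp Hq. assert ((1-t)*p <= (1-t)*(PI/3)) by (apply Rmult_le_compat_l; lra).
     assert (t*q <= t*(PI/6)) by (apply Rmult_le_compat_l; lra). assert (0 < t*PI) by (apply Rmult_lt_0_compat; lra). lra. }
    have G1 := Cv (phiP x) (PI/12). have G2 := Cv (- phiP x) (- (PI/12)). have G3 := Cv (phiP y) (PI/12).
    have G4 := Cv (- phiP y) (- (PI/12)). have G5 := Cv (phiP u) (- (PI/6)). have G6 := Cv (- phiP u) (PI/6).
    unfold hexagon. replace (- (a t+b t)) with ((1-t)*phiP u+t * - (PI/6)) by (unfold a, b; replace (phiP u) with (- phiP x-phiP y) by lra; field).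
    unfold a, b. repeat split; lra. }
  (* The flat point has to be avoided: [a] cannot vanish at both [e / 2] and [e / 3]. *)
  destruct (Req_dec (a (e/2)) 0) as [Z|N].
  + apply (Good (e/3)); [lra|]. have N3 : a (e/3) <> 0.
   { intros Z3. unfold a in Z, Z3. have Q : phiP x*(1-e/2) = - (e/2*(PI/12)) by lra.
    have Q3 : phiP x*(1-e/3) = - (e/3*(PI/12)) by lra.
    have E1 : phiP x*(1-e/2)*(1-e/3) = - (e/2*(PI/12))*(1-e/3) by (rewrite Q; auto).
    have E2 : phiP x*(1-e/3)*(1-e/2) = - (e/3*(PI/12))*(1-e/2) by (rewrite Q3; auto).
    assert (0 < e*PI) by (apply Rmult_lt_0_compat; lra). lra. }
   apply pow2_gt_0 in N3. assert (0 <= b (e/3)^2) by apply pow2_ge_0. lra.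
  + apply (Good (e/2)); [lra|]. apply pow2_gt_0 in N. assert (0 <= b (e/2)^2) by apply pow2_ge_0. lra.
Qed.

Lemma surfaceP_connected : connected surfaceP.
Proof.
 have HS : forall z w x y u, stateP (z, w, (x, y, u)) -> surfaceP (x, y, u) by (intros z w x y u H; repeat split; apply H).
 apply (connected_of_paths surfaceP (fun q => let '(x, y, u) := q in reachedP x y u) (snd baseP)).
 - exact (HS _ _ _ _ _ stateP_base).
 - intros [[x y] u] (z1 & w1 & H). destruct (reach_rest _ _ _ H) as (z & dz & w & X & Y & Z & Hl & E0 & E1).
  exists (fun t => (X t, Y t, Z t)). destruct (E0 0) as [B0 _]; [lra|]. destruct (E1 1) as [B1 _]; [lra|].
  rewrite <- B0. injection B1 as _ _ -> -> ->. split; [reflexivity|]. split; [reflexivity|]. intros t.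
  destruct (Hl t) as (_ & _ & _ & _ & _ & DX & DY & DZ). split.
  + apply continuous_triple; eapply is_derive_continuous; eauto.
  + have Q : stateP (state z w X Y Z t).
   { have S0 := stateP_base. destruct (Rle_dec t 0) as [L|L]; [destruct (E0 t L) as [-> _]; auto|].
    rewrite <- B0 in S0. destruct (Rle_dec 1 t) as [L'|L']; [|apply (stateP_lift z dz); auto; lra].
    rewrite (proj1 (E1 t L')), <- (proj1 (E1 1 (Rle_refl 1))). apply (stateP_lift z dz); auto. lra. }
   exact (HS _ _ _ _ _ Q).
 - intros p. apply closure_reachedP.
Qed.

Lemma isotropic_example_P : isotropic_example domP domP domP phiP phiP phiP.
Proof.
 split; [|split; [|split]].
 - apply separable_minimal_P.
 - apply isotropic_diag.
 - apply surfaceP_connected.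
 - intros ([[n1 n2] n3] & d & Hn & Hpl).
  have HPI := PI_RGT_0.
  destruct (branchP_spec 0 0) as [E _]; [lra|]. set (t := branchP 0 0) in *.
  have Hk := KP_pos.
  have Hp : forall x y z, phiP x = 0 -> phiP y = 0 -> phiP z = 0 -> n1*x+n2*y+n3*z = d.
  { intros x y z Ex Ey Ez. apply (Hpl (x, y, z)). unfold sep_surface, sep_fun, domP. repeat split; auto. lra. }
  have E' : phiP (t+2*KP) = 0 by (rewrite phiP_periodic; auto).
  (* A zero of [phiP] and its translates by [2 KP] give points of the surface displaced along each
     axis. *)
  have H0 := Hp t t t E E E. have H1 := Hp _ t t E' E E. have H2 := Hp t _ t E E' E. have H3 := Hp t t _ E E E'.
  apply Hn. assert (n1*KP = 0) by lra. assert (n2*KP = 0) by lra. assert (n3*KP = 0) by lra.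
  f_equal; [f_equal|]; nra.
Qed.

(** * The surface D is the part of the closure of the continuations over its domain *)

(** At [z = 0] and [w = 1] the formulas give [sD = 0] three times and [cD = 1, 1, -1]. *)
Definition baseD : C*C*R3 := (RtoC 0, RtoC 1, (0, 0, KD)).

Lemma vD_lattice (j : Z) : vD (IZR j*KD) = 1.
Proof.
 destruct (Jacobi_D (IZR j*KD)) as (_ & _ & _ & _ & E). destruct (Jacobi_D_lattice j) as [S _]. rewrite S in E.
 have V := vD_pos (IZR j*KD). replace (1 - / 4*0^2) with (1^2) in E by ring. nra.
Qed.

Lemma stateD_base : stateD baseD.
Proof.
 have S2 := sqrt2_pos.
 destruct base_DP as (E1 & E2 & E3). destruct (quad_eD 0%C) as (F1 & F2 & F3).
 have V1 : v1 0%C = 0 by (unfold v1, Re; simpl; ring). have V2 : v2 0%C = 0 by (unfold v2, Im; simpl; ring).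
 rewrite V2 in F1, F3. rewrite V1 in F2.
 have e1 : eD (qA1 0%C) (qB1 0%C) = 0 by lra. have e2 : eD (qA2 0%C) (qB2 0%C) = 0 by lra. have e3 : eD (qA3 0%C) (qB3 0%C) = 0 by lra.
 have D1 := DP_DD (qA1 0%C) (qB1 0%C) 1%C. have D2 := DP_DD (qA2 0%C) (qB2 0%C) 1%C. have D3 := DP_DD (qA3 0%C) (qB3 0%C) 1%C.
 rewrite E1, e1 in D1. rewrite E2, e2 in D2. rewrite E3, e3 in D3. replace (2+8*0^2) with 2 in D1, D2, D3 by ring.
 have G1 : gD (qA1 0%C) (qB1 0%C) 1%C = 2 by (unfold gD, GD, qA1, qB1, Re; simpl; field).
 have G2 : gD (qA2 0%C) (qB2 0%C) 1%C = 2 by (unfold gD, GD, qA2, qB2, Re; simpl; field).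
 have G3 : gD (qA3 0%C) (qB3 0%C) 1%C = -2 by (unfold gD, GD, qA3, qB3, Re; simpl; ring).
 destruct (Jacobi_D_lattice 0) as [L1 L2]. destruct (Jacobi_D_lattice 1) as [L3 L4]. have L5 := vD_lattice 0. have L6 := vD_lattice 1.
 rewrite Rmult_0_l in L1, L2, L5. rewrite Rmult_1_l in L3, L4, L6. unfold parity in L2, L4. simpl in L2, L4.
 split; [intros E; apply RtoC_inj in E; lra|]. split; [apply base_rad|]. unfold hatD, sH, gH.
 rewrite L1, L2, L3, L4, L5, L6, e1, e2, e3, G1, G2, G3, D1, D2, D3.
 split; [|split]; split; field; lra.
Qed.

Definition reachedD (x y u : R) : Prop := exists z w, reach (2*Ci) baseD (z, w, (x, y, u)).

Lemma reachedD_lift (x y u x' y' u' : R -> R) :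
 (forall t, 0 <= t <= 1 -> locally t (smooth_curve regularD x y u x' y' u')) ->
 reachedD (x 0) (y 0) (u 0) -> reachedD (x 1) (y 1) (u 1).
Proof.
 intros H (z & w & Hr). destruct (locally_singleton _ _ (H 0 ltac:(lra))) as (_ & _ & _ & _ & _ & _ & Rs & _).
 destruct (stateD_unique z w (x 0) (y 0) (u 0) (stateD_reach _ _ stateD_base Hr)) as (_ & ep & Hep & -> & ->);
  try (intros E; rewrite E in Rs; lra).
 eexists. eexists. apply (reach_trans _ _ _ _ Hr). apply (lift_D ep x y u x' y' u' Hep H).
Qed.

Definition branchD (j : Z) : R -> R := proj1_sig (constructive_indefinite_description _ (etaD_inverse j)).

Lemma branchD_spec (j : Z) (v : R) : cell j (branchD j v) /\ etaD (branchD j v) = v /\ is_derive (branchD j) v (/ etaD1 (branchD j v)).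
Proof. unfold branchD. destruct (constructive_indefinite_description _ (etaD_inverse j)) as [psi [H1 H2]]. apply H1. Qed.

Lemma branchD_etaD (j : Z) (t : R) : cell j t -> branchD j (etaD t) = t.
Proof. unfold branchD. destruct (constructive_indefinite_description _ (etaD_inverse j)) as [psi [H1 H2]]. apply H2. Qed.

Lemma branchD_curve (j : Z) (a : R -> R) (a' t : R) : is_derive a t a' ->
 is_derive (fun s => branchD j (a s)) t (a'/etaD1 (branchD j (a t))) /\
 continuous (fun s => a'/etaD1 (branchD j (a s))) t.
Proof.
 intros Ha. destruct (branchD_spec j (a t)) as (B & _ & D). have N := etaD1_neq0 _ (cell_sD _ _ B).
 have Db := is_derive_comp_R (branchD j) a t _ _ D Ha. split.
 - eapply is_derive_eq; [exact Db|]. field. auto.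
 - have Cb := is_derive_continuous _ _ _ Db. cont. apply (is_derive_continuous _ _ _ (is_derive_etaD1 _ (cell_sD _ _ B))).
Qed.

Lemma etaD_of_cD0 (t : R) : cD t = 0 -> etaD t = 0.
Proof. intros H. unfold etaD. rewrite H. replace ((1-0)/(1+0)) with 1 by field. rewrite ln_1. ring. Qed.

Lemma parity_product_sD (i j k : Z) (x y u : R) : cell i x -> cell j y -> cell k u ->
 (parity i*parity j*parity k = 1 <-> 0 < sD x*sD y*sD u).
Proof.
 intros Hx Hy Hu. apply parity_sD in Hx, Hy, Hu.
 have P : 0 < (parity i*parity j*parity k)*(sD x*sD y*sD u).
 { replace (parity i*parity j*parity k*(sD x*sD y*sD u)) with (parity i*sD x*(parity j*sD y)*(parity k*sD u)) by ring.
  apply Rmult_lt_0_compat; [apply Rmult_lt_0_compat|]; auto. }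
 have Q : parity i*parity j*parity k = 1 \/ parity i*parity j*parity k = -1.
 { destruct (parity_cases i) as [-> | ->], (parity_cases j) as [-> | ->], (parity_cases k) as [-> | ->]; lra. }
 destruct Q as [E|E]; rewrite E in *; split; intros; lra.
Qed.

Lemma cellD_segment (i j k : Z) (a0 b0 a1 b1 : R) : parity i*parity j*parity k = 1 -> a0*b1-a1*b0 <> 0 ->
 reachedD (branchD i a0) (branchD j b0) (branchD k (- (a0+b0))) -> reachedD (branchD i a1) (branchD j b1) (branchD k (- (a1+b1))).
Proof.
 intros Hpar Hd Hr. pose (a := fun t => a0+t*(a1-a0)). pose (b := fun t => b0+t*(b1-b0)).
 pose (c := fun t => - (a t+b t)).
 have Da : forall t, is_derive a t (a1-a0) by (intros; unfold a; auto_derive; auto; ring).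
 have Db : forall t, is_derive b t (b1-b0) by (intros; unfold b; auto_derive; auto; ring).
 have Dc : forall t, is_derive c t (- ((a1-a0)+(b1-b0))) by (intros; unfold c, a, b; auto_derive; auto; ring).
 have Ea0 : a 0 = a0 by (unfold a; ring). have Ea1 : a 1 = a1 by (unfold a; ring).
 have Eb0 : b 0 = b0 by (unfold b; ring). have Eb1 : b 1 = b1 by (unfold b; ring).
 have G := reachedD_lift (fun t => branchD i (a t)) (fun t => branchD j (b t)) (fun t => branchD k (c t))
  (fun t => (a1-a0)/etaD1 (branchD i (a t))) (fun t => (b1-b0)/etaD1 (branchD j (b t)))
  (fun t => (- ((a1-a0)+(b1-b0)))/etaD1 (branchD k (c t))). cbv beta in G. unfold c in G.
 rewrite Ea0, Ea1, Eb0, Eb1 in G. apply G; auto. clear G Hr.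
 intros t _. fold (c t). apply filter_forall. intros s.
 destruct (branchD_curve i a _ s (Da s)) as [X1 X2]. destruct (branchD_curve j b _ s (Db s)) as [Y1 Y2].
 destruct (branchD_curve k c _ s (Dc s)) as [Z1 Z2].
 unfold smooth_curve. split; [exact X1|]. split; [exact Y1|]. split; [exact Z1|]. split; [exact X2|]. split; [exact Y2|]. split; [exact Z2|].
 change (- (a s+b s)) with (c s).
 destruct (branchD_spec i (a s)) as (B1 & F1 & _), (branchD_spec j (b s)) as (B2 & F2 & _), (branchD_spec k (c s)) as (B3 & F3 & _).
 split; [apply (parity_product_sD i j k); auto|]. split; [rewrite F1, F2, F3; unfold c; ring|].
 intros (E1 & E2 & _). apply etaD_of_cD0 in E1, E2. rewrite F1 in E1. rewrite F2 in E2. apply Hd.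
 transitivity (a s*(b1-b0)-b s*(a1-a0)); [unfold a, b; ring|]. rewrite E1, E2. ring.
Qed.

(** On a cell [etaD] takes every real value, so all pairs except the flat one occur; the parity
    condition is the sign condition of [regularD]. *)
Definition full_cellD (i j k : Z) : Prop := parity i*parity j*parity k = 1 /\
 forall a b, 0 < a^2+b^2 -> reachedD (branchD i a) (branchD j b) (branchD k (- (a+b))).

Lemma full_cellD_of (i j k : Z) (x y u : R) : cell i x -> cell j y -> cell k u -> reachedD x y u -> full_cellD i j k.
Proof.
 intros Hx Hy Hu Hr. destruct Hr as (z & w & Hr).
 destruct (stateD_unique _ _ _ _ _ (stateD_reach _ _ stateD_base Hr)) as ((Hp & Hs & Hf) & _); try (eapply cell_sD; eassumption).
 have Hpar : parity i*parity j*parity k = 1 by (apply (parity_product_sD i j k x y u); auto).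
 split; [auto|]. intros a1 b1 N1.
 set (a0 := etaD x). set (b0 := etaD y).
 have Ec : - (a0+b0) = etaD u by (unfold a0, b0; lra).
 have N0 : 0 < a0^2+b0^2.
 { destruct (Req_dec (a0^2+b0^2) 0) as [E|].
  - exfalso. apply sum_sq_eq_0 in E. apply Hf.
   have Z : forall j t, cell j t -> etaD t = 0 -> cD t = 0.
   { intros l t Ht Et. destruct (sinh_cosh_2eta t (cell_sD _ _ Ht)) as [S _]. rewrite Et, Rmult_0_r, sinh_0 in S.
    have P : 0 < sD t^2 by (apply pow2_gt_0, (cell_sD _ _ Ht)).
    apply (f_equal (fun r => r*sD t^2)) in S. cbv beta in S.
    replace (-2*cD t/sD t^2*sD t^2) with (-2*cD t) in S by (field; apply (cell_sD _ _ Ht)). lra. }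
   split; [|split]; eapply Z; try eassumption; unfold a0, b0 in E; lra.
  - have A1 := pow2_ge_0 a0. have A2 := pow2_ge_0 b0. lra. }
 have Hr0 : reachedD (branchD i a0) (branchD j b0) (branchD k (- (a0+b0))).
 { rewrite Ec. unfold a0, b0. rewrite !branchD_etaD by auto. exists z, w. auto. }
 destruct (Req_dec (a0*b1-a1*b0) 0) as [E|N]; [|apply (cellD_segment i j k a0 b0 a1 b1); auto].
 have Hq : a0*a1+b0*b1 <> 0.
 { intros E'. have Q : (a0^2+b0^2)*(a1^2+b1^2) = (a0*b1-a1*b0)^2+(a0*a1+b0*b1)^2 by ring.
  rewrite E, E' in Q. assert (0 < (a0^2+b0^2)*(a1^2+b1^2)) by (apply Rmult_lt_0_compat; auto). lra. }
 apply (cellD_segment i j k (- b0) a0); auto; [lra|]. apply (cellD_segment i j k a0 b0); auto. lra.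
Qed.

(** * Crossing a line of D *)

(** Along [eta = T tau] with [tau] a permutation of [(1, - 1, 0)] and [T -> + oo] the Gauss map tends to a point of a
    coordinate great circle, where two of the coordinates cross a lattice point: as [tau = 1] drives [cD] to [- 1], the
    lattice index is odd for [tau = 1] and even for [tau = - 1]. *)
Definition crossing (t1 t2 t3 : Z) : Prop :=
 In (t1, t2, t3) ((1, -1, 0) :: (-1, 1, 0) :: (1, 0, -1) :: (-1, 0, 1) :: (0, 1, -1) :: (0, -1, 1) :: nil)%Z.

Definition step (tau j : Z) : Z := if Z.even j then (j+tau)%Z else (j-tau)%Z.

Lemma etaD_monotone (j : Z) (s t : R) : cell j s -> cell j t -> s <= t -> parity j*etaD s <= parity j*etaD t.
Proof.
 intros Hs Ht Hst. apply (nondecreasing_of_derive (fun v => parity j*etaD v) (fun v => parity j*etaD1 v)); auto.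
 - intros v Hv. apply (is_derive_scal etaD). apply is_derive_etaD, (cell_sD j). unfold cell in *. lra.
 - intros v Hv. have Q := parity_sD j v ltac:(unfold cell in *; lra). have V := vD_pos v.
  have N := cell_sD j v ltac:(unfold cell in *; lra).
  replace (parity j*etaD1 v) with (2*vD v*(parity j*sD v)/sD v^2) by (unfold etaD1; field; auto).
  apply Rlt_le, Rdiv_lt_0_compat; [|apply pow2_gt_0; auto]. apply Rmult_lt_0_compat; lra.
Qed.

(** [parity j * etaD] increases along the cell, so a value beyond the one at a quarter point
    confines [x] to the outer quarter next to the lattice point that is approached. *)
Lemma near_endpoint (j tau : Z) : tau = 1%Z \/ tau = (-1)%Z -> exists T0, forall x T, cell j x -> etaD x = T*IZR tau -> T0 < T ->
 Rabs (x-IZR (Z.max j (step tau j))*KD) < KD/2.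
Proof.
 intros Ht. have K := KD_pos. set (l := IZR j*KD). have Er : IZR (j+1)*KD = l+KD by (unfold l; rewrite plus_IZR; ring).
 have C1 : cell j (l+KD/4) by (unfold cell; rewrite Er; fold l; lra).
 have C3 : cell j (l+3/4*KD) by (unfold cell; rewrite Er; fold l; lra).
 have E2 : IZR tau*IZR tau = 1 by (destruct Ht as [-> | ->]; ring).
 have Cs : (step tau j = (j+1)%Z /\ parity j = IZR tau) \/ (step tau j = (j-1)%Z /\ parity j = - IZR tau).
 { unfold step, parity. destruct (Z.even j), Ht as [-> | ->]; [left|right|right|left]; split; try lia; simpl; ring. }
 destruct Cs as [[Es Ep]|[Es Ep]]; rewrite Es.
 - exists (parity j*etaD (l+3/4*KD)). intros x T Hx Hxe HT. replace (Z.max j (j+1)) with (j+1)%Z by lia. rewrite Er.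
  have L : l+3/4*KD < x.
  { apply Rnot_le_lt. intros L. have M := etaD_monotone j _ _ Hx C3 L. rewrite Hxe, Ep in M. rewrite Ep in HT.
   replace (IZR tau*(T*IZR tau)) with (T*(IZR tau*IZR tau)) in M by ring. rewrite E2 in M. lra. }
  unfold cell in Hx. rewrite Er in Hx. apply Rabs_def1; lra.
 - exists (- (parity j*etaD (l+KD/4))). intros x T Hx Hxe HT. replace (Z.max j (j-1)) with j by lia. fold l.
  have L : x < l+KD/4.
  { apply Rnot_le_lt. intros L. have M := etaD_monotone j _ _ C1 Hx L. rewrite Hxe, Ep in M. rewrite Ep in HT.
   replace (- IZR tau*(T*IZR tau)) with (- (T*(IZR tau*IZR tau))) in M by ring. rewrite E2 in M. lra. }
  unfold cell in Hx. fold l in Hx. apply Rabs_def1; lra.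
Qed.

Lemma cell_locate (m : Z) (x : R) : Rabs (x-IZR m*KD) < KD -> sD x <> 0 -> cell (m-1) x \/ cell m x.
Proof.
 intros H N. assert (x <> IZR m*KD) by (intros E; apply N; rewrite E; apply Jacobi_D_lattice).
 apply Rabs_def2 in H. unfold cell. replace (m-1+1)%Z with m by ring. rewrite minus_IZR, plus_IZR.
 destruct (Rlt_dec x (IZR m*KD)); [left|right]; lra.
Qed.

(** A small displacement leaves only neighbouring cells, and the sign of [sD] decides: unchanged for
    [tau = 0], reversed near the endpoint for [tau = 1] and [tau = -1]. *)
Lemma coordinate_step (tau j : Z) (x x' : R) : cell j x -> Rabs (x'-x) < KD/2 ->
 (tau = 0%Z /\ 0 < sD x*sD x') \/
 ((tau = 1%Z \/ tau = (-1)%Z) /\ sD x*sD x' < 0 /\ Rabs (x-IZR (Z.max j (step tau j))*KD) < KD/2) ->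
 cell (step tau j) x'.
Proof.
 intros Hx Hd H. have K := KD_pos.
 have N : sD x' <> 0 by (intros E; rewrite E in H; destruct H as [[_ H]|[_ [H _]]]; lra).
 have Px := parity_sD j x Hx.
 have Sg : forall l, cell l x' -> 0 < parity j*parity l*(sD x*sD x').
 { intros l Hl. apply parity_sD in Hl. replace (parity j*parity l*(sD x*sD x')) with (parity j*sD x*(parity l*sD x')) by ring.
  apply Rmult_lt_0_compat; auto. }
 have Pj : parity j*parity j = 1 by (destruct (parity_cases j) as [-> | ->]; ring).
 have Ps : parity (j+1) = - parity j by apply parity_succ.
 have Pp : parity (j-1) = - parity j by (have Q := parity_succ (j-1); replace (Z.succ (j-1)) with j in Q by lia; lra).
 have Bd : forall l, (l = (j+1)%Z \/ l = (j-1)%Z) -> cell l x' -> sD x*sD x' < 0.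
 { intros l Hl Hc. apply Sg in Hc. destruct Hl as [-> | ->]; [rewrite Ps in Hc|rewrite Pp in Hc];
   replace (parity j * - parity j*(sD x*sD x')) with (- (parity j*parity j*(sD x*sD x'))) in Hc by ring; rewrite Pj in Hc; lra. }
 have Bj : cell j x' -> 0 < sD x*sD x' by (intros Hc; apply Sg in Hc; rewrite Pj in Hc; lra).
 destruct H as [[-> H]|(Ht & H & He)].
 - replace (step 0 j) with j by (unfold step; destruct (Z.even j); lia). apply Rabs_def2 in Hd. unfold cell in Hx. rewrite plus_IZR in Hx.
  destruct (Rlt_dec x' (IZR j*KD)) as [L|L].
  + destruct (cell_locate j x') as [Q|Q]; auto; [apply Rabs_def1; lra|]. have B := Bd _ (or_intror eq_refl) Q. lra.
  + have Nj : x' <> IZR j*KD by (intros E; apply N; rewrite E; apply Jacobi_D_lattice).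
   destruct (cell_locate (j+1) x') as [Q|Q]; auto; [rewrite plus_IZR; apply Rabs_def1; lra| |].
   * replace (j+1-1)%Z with j in Q by lia. auto.
   * have B := Bd _ (or_introl eq_refl) Q. lra.
 - have Cs : step tau j = (j+1)%Z \/ step tau j = (j-1)%Z by (unfold step; destruct (Z.even j), Ht as [-> | ->]; lia).
  have He' : Rabs (x'-IZR (Z.max j (step tau j))*KD) < KD.
  { replace (x'-IZR (Z.max j (step tau j))*KD) with ((x'-x)+(x-IZR (Z.max j (step tau j))*KD)) by ring.
   eapply Rle_lt_trans; [apply Rabs_triang|]. lra. }
  destruct Cs as [E|E]; rewrite E in *.
  + replace (Z.max j (j+1)) with (j+1)%Z in He' by lia. destruct (cell_locate _ _ He' N) as [Q|Q]; auto.
   replace (j+1-1)%Z with j in Q by lia. apply Bj in Q. lra.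
  + replace (Z.max j (j-1)) with j in He' by lia. destruct (cell_locate _ _ He' N) as [Q|Q]; auto. apply Bj in Q. lra.
Qed.

(** A slope at the value [T tau], divided by [M = sqrt (1 + 2 cosh (2 T))] and with [h = / M]: a
    sign for nonzero [tau], and that sign times [sqrt 3 h] for [tau = 0]. The formula extends
    through [h = 0] to the far side of the crossing. *)
Definition lin (k : R) (tau : Z) (h : R) : R := k*(IZR (tau*tau)+IZR (1-tau*tau)*(sqrt 3*h)).

Definition zline (k1 k2 k3 : R) (t1 t2 t3 : Z) (h : R) : C :=
 gauss (lin k1 t1 h) (lin k2 t2 h) (lin k3 t3 h) (sqrt (2+3*h^2)).

Ltac crossing_cases H :=
 unfold crossing, In in H; repeat (destruct H as [H|H]; [injection H as <- <- <-|]); [| | | | | |contradiction].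

Lemma lin_sq (k h : R) (tau : Z) : k^2 = 1 -> (tau = 0%Z -> lin k tau h^2 = 3*h^2) /\ (tau = 1%Z \/ tau = (-1)%Z -> lin k tau h^2 = 1).
Proof.
 intros Hk. have S3 := sqrt3_sq. unfold lin. split.
 - intros ->. simpl. transitivity (k^2*(sqrt 3*sqrt 3)*h^2); [ring|]. rewrite Hk, S3. ring.
 - intros [-> | ->]; simpl; transitivity (k^2); [ring|auto|ring|auto].
Qed.

Lemma lin_mirror (k h : R) (tau : Z) : k^2 = 1 ->
 (tau = 0%Z -> lin k tau h*lin k tau (- h) = - 3*h^2) /\ (tau = 1%Z \/ tau = (-1)%Z -> lin k tau h*lin k tau (- h) = 1).
Proof.
 intros Hk. have S3 := sqrt3_sq. unfold lin. split.
 - intros ->. simpl. transitivity (- (k^2*(sqrt 3*sqrt 3)*h^2)); [ring|]. rewrite Hk, S3. ring.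
 - intros [-> | ->]; simpl; transitivity (k^2); [ring|auto|ring|auto].
Qed.

Lemma lin_sphere (k1 k2 k3 h : R) (t1 t2 t3 : Z) : k1^2 = 1 -> k2^2 = 1 -> k3^2 = 1 -> crossing t1 t2 t3 ->
 lin k1 t1 h^2+lin k2 t2 h^2+lin k3 t3 h^2 = 2+3*h^2 /\ 0 < lin k1 t1 h^2+lin k2 t2 h^2.
Proof.
 intros H1 H2 H3 Hc. destruct (lin_sq k1 h t1 H1) as [A1 A2], (lin_sq k2 h t2 H2) as [B1 B2], (lin_sq k3 h t3 H3) as [C1 C2].
 have P := pow2_ge_0 h.
 crossing_cases Hc; rewrite ?A1, ?B1, ?C1, ?A2, ?B2, ?C2 by auto; split; lra.
Qed.

Lemma zline_denominator (k1 k2 k3 h : R) (t1 t2 t3 : Z) : k1^2 = 1 -> k2^2 = 1 -> k3^2 = 1 -> crossing t1 t2 t3 ->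
 sqrt (2+3*h^2)^2 = lin k1 t1 h^2+lin k2 t2 h^2+lin k3 t3 h^2 /\ 0 < sqrt (2+3*h^2)-lin k3 t3 h.
Proof.
 intros H1 H2 H3 Hc. destruct (lin_sphere k1 k2 k3 h t1 t2 t3 H1 H2 H3 Hc) as [E P]. have Ph := pow2_ge_0 h.
 have S : sqrt (2+3*h^2)^2 = 2+3*h^2 by (apply pow2_sqrt; lra). split; [lra|].
 have N := sqrt_pos (2+3*h^2). destruct (Rle_dec (sqrt (2+3*h^2)-lin k3 t3 h) 0) as [L|]; [|lra].
 exfalso. assert (sqrt (2+3*h^2)^2 <= lin k3 t3 h^2) by (apply pow_incr; lra). lra.
Qed.

Lemma P8_of_square (z s : C) : (z*z)%C = s -> P8 z = (1+14*(s*s)+(s*s)*(s*s))%C.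
Proof. intros <-. unfold P8. ring. Qed.

Lemma P8_real_square (z : C) (s : R) : (z*z)%C = RtoC s -> P8 z <> 0%C.
Proof.
 intros H E. rewrite (P8_of_square _ _ H) in E. apply (f_equal fst) in E. simpl in E.
 have P := pow2_ge_0 s. have Q : 0 <= s^4 by (replace (s^4) with ((s^2)^2) by ring; apply pow2_ge_0). lra.
Qed.

(** At [h = 0] the square [s] of the Gauss coordinate is [i] or [- i] when [t3 = 0], and real
    otherwise; in neither case does [1 + 14 s^2 + s^4] vanish. *)
Lemma zline_P8 (k1 k2 k3 : R) (t1 t2 t3 : Z) : k1^2 = 1 -> k2^2 = 1 -> k3^2 = 1 -> crossing t1 t2 t3 ->
 P8 (zline k1 k2 k3 t1 t2 t3 0) <> 0%C.
Proof.
 intros H1 H2 H3 Hc. have S2 := sqrt2_pos. have Q2 : sqrt 2^2 = 2 by (apply pow2_sqrt; lra).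
 have N3 : sqrt 2-k3 <> 0 by (intros E; have E' : sqrt 2 = k3 by lra; rewrite E' in Q2; lra).
 have Es : sqrt (2+3*0^2) = sqrt 2 by (f_equal; ring).
 have A : t3 = 0%Z -> (t1*t1)%Z = 1%Z -> (t2*t2)%Z = 1%Z -> P8 (zline k1 k2 k3 t1 t2 t3 0) <> 0%C.
 { intros -> T1 T2 E. rewrite (P8_of_square _ (Ci*RtoC (k1*k2))%C) in E.
  - apply (f_equal fst) in E. simpl in E. have K : (k1*k2)^2 = 1 by (rewrite Rpow_mult_distr, H1, H2; ring).
   have K4 : (k1*k2)^4 = 1 by (replace ((k1*k2)^4) with (((k1*k2)^2)^2) by ring; rewrite K; ring). lra.
  - unfold zline, gauss, lin. rewrite T1, T2, Es. simpl. apply injective_projections; simpl.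
   + transitivity ((k1^2-k2^2)/sqrt 2^2); [field; lra|]. rewrite H1, H2. unfold Rdiv. ring.
   + transitivity (2*(k1*k2)/sqrt 2^2); [field; lra|]. rewrite Q2. field. }
 have Bx : (t3*t3)%Z = 1%Z -> (t1*t1)%Z = 1%Z -> t2 = 0%Z -> P8 (zline k1 k2 k3 t1 t2 t3 0) <> 0%C.
 { intros T3 T1 ->. apply (P8_real_square _ ((k1/(sqrt 2-k3))^2)). unfold zline, gauss, lin. rewrite T1, T3, Es. simpl.
  apply injective_projections; simpl; field; auto. }
 have By : (t3*t3)%Z = 1%Z -> (t2*t2)%Z = 1%Z -> t1 = 0%Z -> P8 (zline k1 k2 k3 t1 t2 t3 0) <> 0%C.
 { intros T3 T2 ->. apply (P8_real_square _ (- (k2/(sqrt 2-k3))^2)). unfold zline, gauss, lin. rewrite T2, T3, Es. simpl.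
  apply injective_projections; simpl; field; auto. }
 crossing_cases Hc; auto.
Qed.

Lemma zline_near (k1 k2 k3 d : R) (t1 t2 t3 : Z) : k1^2 = 1 -> k2^2 = 1 -> k3^2 = 1 -> crossing t1 t2 t3 -> 0 < d ->
 exists h0, 0 < h0 /\ forall h, Rabs h < h0 -> within d (zline k1 k2 k3 t1 t2 t3 h) (zline k1 k2 k3 t1 t2 t3 0).
Proof.
 intros H1 H2 H3 Hc Hd. destruct (zline_denominator k1 k2 k3 0 t1 t2 t3 H1 H2 H3 Hc) as [_ P].
 have Cx : forall k t, continuous (fun h => lin k t h/(sqrt (2+3*h^2)-lin k3 t3 h)) 0.
 { intros k t. apply (ex_derive_continuous (K := R_AbsRing) (V := R_NormedModule)). unfold lin in *. auto_derive.
  split; [lra|]. split; [|auto]. apply Rgt_not_eq. replace (2+3*(0*(0*1))) with (2+3*0^2) by ring. unfold Rminus in P. exact P. }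
 have L : forall k t, exists h0, 0 < h0 /\ forall h, Rabs h < h0 ->
  Rabs (lin k t h/(sqrt (2+3*h^2)-lin k3 t3 h)-lin k t 0/(sqrt (2+3*0^2)-lin k3 t3 0)) < d.
 { intros k t. destruct (Cx k t (ball (lin k t 0/(sqrt (2+3*0^2)-lin k3 t3 0)) (mkposreal d Hd))) as [h0 Hh0]; [apply locally_ball|].
  exists h0. split; [apply cond_pos|]. intros h Hh. apply (Hh0 h). change (Rabs (h-0) < h0). rewrite Rminus_0_r. auto. }
 destruct (L k1 t1) as (a & Ha & La), (L k2 t2) as (b & Hb & Lb). exists (Rmin a b). split; [apply Rmin_pos; auto|].
 intros h Hh. have M1 := Rmin_l a b. have M2 := Rmin_r a b. split; [apply La|apply Lb]; lra.
Qed.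

Lemma gauss_scale (k a b c nu : R) : k <> 0 -> nu-c <> 0 -> gauss (k*a) (k*b) (k*c) (k*nu) = gauss a b c nu.
Proof.
 intros Hk Hn. unfold gauss. replace (k*nu-k*c) with (k*(nu-c)) by ring. apply injective_projections; simpl; field; auto.
Qed.

Lemma etaD1_branch (j tau : Z) (x T : R) : cell j x -> etaD x = T*IZR tau -> tau = 0%Z \/ tau = 1%Z \/ tau = (-1)%Z ->
 let M := sqrt (1+2*cosh (2*T)) in 0 < M /\ etaD1 x = M*lin (parity j) tau (/ M).
Proof.
 intros Hx He Ht M. have C1 := cosh_ge1 (2*T). have HM : 0 < M by (apply sqrt_lt_R0; lra). split; [auto|].
 have N := cell_sD j x Hx. have Q := etaD1_sq x N. rewrite He in Q.
 have Sg : 0 < parity j*etaD1 x.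
 { have P := parity_sD j x Hx. have V := vD_pos x.
  replace (parity j*etaD1 x) with (2*vD x*(parity j*sD x)/sD x^2) by (unfold etaD1; field; auto).
  apply Rdiv_lt_0_compat; [|apply pow2_gt_0; auto]. apply Rmult_lt_0_compat; lra. }
 have Pj : parity j^2 = 1 by (destruct (parity_cases j) as [-> | ->]; ring).
 have E : forall v, 0 <= v -> v^2 = etaD1 x^2 -> etaD1 x = parity j*v.
 { intros v Hv Ev. have E1 : (parity j*etaD1 x)^2 = v^2 by (rewrite Rpow_mult_distr, Pj, Ev; ring).
  have Hv' : parity j*etaD1 x = v by (apply Rsqr_inj; [apply (Rlt_le _ _ Sg)|auto|rewrite !Rsqr_pow2; auto]).
  rewrite <- Hv'. transitivity (parity j^2*etaD1 x); [rewrite Pj|]; ring. }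
 destruct Ht as [-> |Ht].
 - rewrite Rmult_0_r, Rmult_0_r, cosh_0 in Q. rewrite (E (sqrt 3)).
  + unfold lin. simpl. field. lra.
  + apply sqrt_pos.
  + rewrite Q, pow2_sqrt; lra.
 - rewrite (E M).
  + unfold lin. destruct Ht as [-> | ->]; simpl; ring.
  + lra.
  + unfold M. rewrite Q, pow2_sqrt by lra. destruct Ht as [-> | ->].
   * do 3 f_equal. ring.
   * replace (2*(T * -1)) with (- (2*T)) by ring. rewrite cosh_neg. ring.
Qed.

Lemma zD_zline (ep T x y u : R) (i j k t1 t2 t3 : Z) : ep^2 = 1 -> crossing t1 t2 t3 -> cell i x -> cell j y -> cell k u ->
 etaD x = T*IZR t1 -> etaD y = T*IZR t2 -> etaD u = T*IZR t3 ->
 zD ep x y u = zline (ep*parity i) (ep*parity j) (ep*parity k) t1 t2 t3 (/ sqrt (1+2*cosh (2*T))).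
Proof.
 intros Hep Hc Hx Hy Hu E1 E2 E3.
 have P : forall j, (ep*parity j)^2 = 1 by (intros l; rewrite Rpow_mult_distr, Hep; destruct (parity_cases l) as [-> | ->]; ring).
 assert (Ht : (t1 = 0 \/ t1 = 1 \/ t1 = -1)%Z /\ (t2 = 0 \/ t2 = 1 \/ t2 = -1)%Z /\ (t3 = 0 \/ t3 = 1 \/ t3 = -1)%Z)
  by (generalize Hc; intros Hc'; crossing_cases Hc'; auto 10).
 destruct Ht as (T1 & T2 & T3).
 destruct (etaD1_branch i t1 x T Hx E1 T1) as [HM F1]. destruct (etaD1_branch j t2 y T Hy E2 T2) as [_ F2].
 destruct (etaD1_branch k t3 u T Hu E3 T3) as [_ F3]. set (M := sqrt (1+2*cosh (2*T))) in *.
 destruct (zline_denominator (ep*parity i) (ep*parity j) (ep*parity k) (/ M) t1 t2 t3 (P i) (P j) (P k) Hc) as [D1 D2].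
 have L : forall l t, ep*(M*lin (parity l) t (/ M)) = M*lin (ep*parity l) t (/ M) by (intros; unfold lin; ring).
 unfold zD, gauss_of, norm3. rewrite F1, F2, F3, !L.
 replace ((M*lin (ep*parity i) t1 (/ M))^2+(M*lin (ep*parity j) t2 (/ M))^2+(M*lin (ep*parity k) t3 (/ M))^2) with
  ((M*sqrt (2+3*(/ M)^2))^2) by (rewrite Rpow_mult_distr, D1; ring).
 rewrite sqrt_pow2 by (apply Rmult_le_pos; [lra|apply sqrt_pos]). apply gauss_scale; lra.
Qed.

Lemma near_endpoint' (j tau : Z) : tau = 0%Z \/ tau = 1%Z \/ tau = (-1)%Z -> exists T0, forall x T, cell j x -> etaD x = T*IZR tau -> T0 < T ->
 tau = 0%Z \/ ((tau = 1%Z \/ tau = (-1)%Z) /\ Rabs (x-IZR (Z.max j (step tau j))*KD) < KD/2).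
Proof.
 intros [-> |Ht]; [exists 0; auto|]. destruct (near_endpoint j tau Ht) as [T0 H]. exists T0. intros x T Hx He HT. right. split; auto. apply (H x T); auto.
Qed.

Lemma sD_sign (qA qB : C -> C) (z w : C) (x v v' : R) : w <> 0%C -> hatD qA qB z w x -> 2*eD (qA z) (qB z) = - (v*v') ->
 exists m, 0 < m /\ sD x = m*(v*v').
Proof.
 intros Hw [Hs _] E. have Q := sqrt_lt_R0 _ (DD_pos (qA z) (qB z) w Hw). have S2 := sqrt2_pos.
 exists (2*sqrt 2/sqrt (DD (qA z) (qB z) w)). split; [apply Rdiv_lt_0_compat; lra|].
 rewrite Hs. unfold sH. replace (- (4*sqrt 2*eD (qA z) (qB z))) with (- (2*sqrt 2*(2*eD (qA z) (qB z)))) by ring. rewrite E. field. lra.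
Qed.

(** Passing from [h] to [- h] reverses only the Gauss component with [tau = 0]. As [sD] has the sign
    of the product of the other two components, it changes sign exactly in the coordinates with
    nonzero [tau]. *)
Lemma mirror_signs (k1 k2 k3 h : R) (t1 t2 t3 : Z) (w w' : C) (x y u x' y' u' : R) :
 k1^2 = 1 -> k2^2 = 1 -> k3^2 = 1 -> crossing t1 t2 t3 -> 0 < h ->
 stateD (zline k1 k2 k3 t1 t2 t3 h, w, (x, y, u)) -> stateD (zline k1 k2 k3 t1 t2 t3 (- h), w', (x', y', u')) ->
 let sg t s := (t = 0%Z /\ 0 < s) \/ ((t = 1%Z \/ t = (-1)%Z) /\ s < 0) in
 sg t1 (sD x*sD x') /\ sg t2 (sD y*sD y') /\ sg t3 (sD u*sD u').
Proof.
 intros H1 H2 H3 Hc Hh (W & _ & A1 & A2 & A3) (W' & _ & B1 & B2 & B3) sg.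
 set (z := zline k1 k2 k3 t1 t2 t3 h) in *. set (z' := zline k1 k2 k3 t1 t2 t3 (- h)) in *.
 destruct (quad_eD z) as (E1 & E2 & E3). destruct (quad_eD z') as (F1 & F2 & F3).
 destruct (zline_denominator k1 k2 k3 h t1 t2 t3 H1 H2 H3 Hc) as [D1 D2].
 destruct (zline_denominator k1 k2 k3 (- h) t1 t2 t3 H1 H2 H3 Hc) as [D1' D2'].
 set (m := 2/(sqrt (2+3*h^2)-lin k3 t3 h)). set (m' := 2/(sqrt (2+3*(- h)^2)-lin k3 t3 (- h))).
 have V : v1 z = m*lin k1 t1 h /\ v2 z = m*lin k2 t2 h /\ v3 z = m*lin k3 t3 h by apply (gauss_v _ _ _ _ D1 (Rgt_not_eq _ _ D2)).
 assert (V' : v1 z' = m'*lin k1 t1 (- h) /\ v2 z' = m'*lin k2 t2 (- h) /\ v3 z' = m'*lin k3 t3 (- h))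
  by apply (gauss_v _ _ _ _ D1' (Rgt_not_eq _ _ D2')).
 destruct V as (V1 & V2 & V3). destruct V' as (V1' & V2' & V3').
 have Hm : 0 < m by (apply Rdiv_lt_0_compat; lra). have Hm' : 0 < m' by (apply Rdiv_lt_0_compat; lra). clearbody m m'.
 destruct (sD_sign _ _ _ _ _ _ _ W A1 E1) as (p1 & Q1 & G1). destruct (sD_sign _ _ _ _ _ _ _ W A2 E2) as (p2 & Q2 & G2).
 destruct (sD_sign _ _ _ _ _ _ _ W A3 E3) as (p3 & Q3 & G3). destruct (sD_sign _ _ _ _ _ _ _ W' B1 F1) as (q1 & Q1' & G1').
 destruct (sD_sign _ _ _ _ _ _ _ W' B2 F2) as (q2 & Q2' & G2'). destruct (sD_sign _ _ _ _ _ _ _ W' B3 F3) as (q3 & Q3' & G3').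
 destruct (lin_mirror k1 h t1 H1) as [L1 L1'], (lin_mirror k2 h t2 H2) as [L2 L2'], (lin_mirror k3 h t3 H3) as [L3 L3'].
 rewrite V2, V3 in G1. rewrite V1, V3 in G2. rewrite V1, V2 in G3. rewrite V2', V3' in G1'. rewrite V1', V3' in G2'. rewrite V1', V2' in G3'.
 clear-G1 G2 G3 G1' G2' G3' Q1 Q2 Q3 Q1' Q2' Q3' L1 L1' L2 L2' L3 L3' Hm Hm' Hh Hc.
 set (a := lin k1 t1 h) in *. set (b := lin k2 t2 h) in *. set (c := lin k3 t3 h) in *.
 set (a' := lin k1 t1 (- h)) in *. set (b' := lin k2 t2 (- h)) in *. set (c' := lin k3 t3 (- h)) in *.
 have K : forall p q, 0 < p -> 0 < q -> 0 < p*q*m^2*m'^2.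
 { intros p q Hp Hq. apply Rmult_lt_0_compat; [apply Rmult_lt_0_compat; [apply Rmult_lt_0_compat; auto|]|]; apply pow_lt; auto. }
 have K1 := K p1 q1 Q1 Q1'. have K2 := K p2 q2 Q2 Q2'. have K3 := K p3 q3 Q3 Q3'.
 have Ex : sD x*sD x' = p1*q1*m^2*m'^2*((b*b')*(c*c')) by (rewrite G1, G1'; ring).
 have Ey : sD y*sD y' = p2*q2*m^2*m'^2*((a*a')*(c*c')) by (rewrite G2, G2'; ring).
 have Eu : sD u*sD u' = p3*q3*m^2*m'^2*((a*a')*(b*b')) by (rewrite G3, G3'; ring).
 rewrite Ex, Ey, Eu. clear-K1 K2 K3 L1 L1' L2 L2' L3 L3' Hh Hc.
 have P : 0 < h^2 by (apply pow_lt; auto).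
 have Neg : forall s, 0 < s -> s*(1*(-3*h^2)) < 0 by (intros s Hs; assert (0 < s*h^2) by (apply Rmult_lt_0_compat; auto); lra).
 have Neg' : forall s, 0 < s -> s*(-3*h^2*1) < 0 by (intros s Hs; assert (0 < s*h^2) by (apply Rmult_lt_0_compat; auto); lra).
 have Pos : forall s, 0 < s -> 0 < s*(1*1) by (intros; lra).
 unfold sg. crossing_cases Hc; rewrite ?L1, ?L2, ?L3, ?L1', ?L2', ?L3' by auto; split; [|split| |split| |split| |split| |split| |split];
  solve [left; split; [reflexivity|auto]|right; split; [auto|auto]].
Qed.

(** For large [T] the point with values [T (t1, t2, t3)] has Gauss coordinate on [zline] with a
    small parameter [/ M]. A short arc leads to the parameter [- / M], and [mirror_signs] with
    [coordinate_step] tells in which cell it ends. *)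
Lemma crossingD (i j k t1 t2 t3 : Z) : crossing t1 t2 t3 -> full_cellD i j k -> full_cellD (step t1 i) (step t2 j) (step t3 k).
Proof.
 intros Hc [Hpar Hf].
 assert (Ht : (t1 = 0 \/ t1 = 1 \/ t1 = -1)%Z /\ (t2 = 0 \/ t2 = 1 \/ t2 = -1)%Z /\ (t3 = 0 \/ t3 = 1 \/ t3 = -1)%Z)
  by (generalize Hc; intros Hc'; crossing_cases Hc'; auto 10).
 have Hsum : (t1+t2+t3 = 0)%Z /\ (t1*t1+t2*t2 > 0)%Z by (generalize Hc; intros Hc'; crossing_cases Hc'; split; reflexivity).
 destruct Ht as (T1 & T2 & T3). destruct Hsum as [Hsum Hnz].
 destruct (near_endpoint' i t1 T1) as (Ta & Na). destruct (near_endpoint' j t2 T2) as (Tb & Nb). destruct (near_endpoint' k t3 T3) as (Tc & Nc).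
 have K := KD_pos.
 have P : forall ep l, ep^2 = 1 -> (ep*parity l)^2 = 1 by (intros ep l Hep; rewrite Rpow_mult_distr, Hep; destruct (parity_cases l) as [-> | ->]; ring).
 have Arc : forall ep, ep^2 = 1 -> exists h0, 0 < h0 /\ forall h, 0 < h < h0 -> forall w x y u,
  let zl := zline (ep*parity i) (ep*parity j) (ep*parity k) t1 t2 t3 in
  (w*w)%C = P8 (zl h) -> exists w' x' y' u', reach (2*Ci) (zl h, w, (x, y, u)) (zl (- h), w', (x', y', u')) /\
   Rabs (x'-x) < KD/2 /\ Rabs (y'-y) < KD/2 /\ Rabs (u'-u) < KD/2.
 { intros ep Hep. set (zl := zline (ep*parity i) (ep*parity j) (ep*parity k) t1 t2 t3).
  destruct (short_arc (2*Ci) (zl 0) (KD/2)) as (d & Hd & Hs); [apply zline_P8; auto|lra|].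
  destruct (zline_near (ep*parity i) (ep*parity j) (ep*parity k) d t1 t2 t3) as (h0 & Hh0 & Hn); auto.
  exists h0. split; [auto|]. intros h Hh w x y u zl' Hw. apply Hs; auto; apply Hn.
  - rewrite Rabs_pos_eq; lra.
  - rewrite Rabs_Ropp, Rabs_pos_eq; lra. }
 (* Both orientations are prepared, because the one carried by the lift is known only after [T] has
    been fixed. *)
 destruct (Arc 1 ltac:(ring)) as (ha & Ha & Arca). destruct (Arc (-1) ltac:(ring)) as (hb & Hb & Arcb). clear Arc.
 have Hh0 : 0 < Rmin ha hb by (apply Rmin_pos; auto). have M1 := Rmin_l ha hb. have M2 := Rmin_r ha hb. set (h0 := Rmin ha hb) in *.
 (* Beyond all endpoint thresholds; the last term gives [/ M < h0], because [M^2 = 1 + 2 cosh (2 T)]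
    exceeds [T]. *)
 set (T := 1+Rabs Ta+Rabs Tb+Rabs Tc + / h0^2).
 have Hh2 : 0 < / h0^2 by (apply Rinv_0_lt_compat, pow_lt; auto).
 have R1 := Rle_abs Ta. have R2 := Rle_abs Tb. have R3 := Rle_abs Tc. have Q1 := Rabs_pos Ta. have Q2 := Rabs_pos Tb. have Q3 := Rabs_pos Tc.
 set (M := sqrt (1+2*cosh (2*T))).
 have HT : 0 < T by (unfold T; lra).
 have HM2 : M^2 = 1+2*cosh (2*T) by (apply pow2_sqrt; have C1 := cosh_ge1 (2*T); lra).
 have HM : 0 < M by (apply sqrt_lt_R0; have C1 := cosh_ge1 (2*T); lra).
 have HMh : 0 < / M < h0.
 { split; [apply Rinv_0_lt_compat; auto|]. have G : / h0^2 < M^2.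
  { rewrite HM2. unfold cosh. have X1 := exp_ineq1_le (2*T). have X2 := exp_pos (- (2*T)).
   assert (/ h0^2 < T) by (unfold T; lra). lra. }
  apply (Rmult_lt_reg_r M); auto. rewrite Rinv_l by lra. apply Rnot_le_lt. intros L.
  have L' : (h0*M)^2 <= 1^2 by (apply pow_incr; split; [apply Rmult_le_pos; lra|auto]).
  rewrite Rpow_mult_distr in L'. assert (0 < h0^2) by (apply pow_lt; auto).
  assert (h0^2 * / h0^2 < h0^2*M^2) by (apply Rmult_lt_compat_l; auto). rewrite Rinv_r in H0 by lra. lra. }
 set (x := branchD i (T*IZR t1)). set (y := branchD j (T*IZR t2)). set (u := branchD k (T*IZR t3)).
 have Hr : reachedD x y u.
 { have Et : - (T*IZR t1+T*IZR t2) = T*IZR t3.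
  { replace t3 with (- (t1+t2))%Z by lia. rewrite opp_IZR, plus_IZR. ring. }
  unfold u. rewrite <- Et. apply Hf. rewrite !Rpow_mult_distr, <- Rmult_plus_distr_l. apply Rmult_lt_0_compat; [apply pow_lt; auto|].
  apply IZR_lt in Hnz || idtac. replace (IZR t1^2+IZR t2^2) with (IZR (t1*t1+t2*t2)) by (rewrite plus_IZR, !mult_IZR; ring).
  apply IZR_lt. lia. }
 destruct (branchD_spec i (T*IZR t1)) as (Cx & Ex & _). destruct (branchD_spec j (T*IZR t2)) as (Cy & Ey & _).
 destruct (branchD_spec k (T*IZR t3)) as (Cu & Eu & _). fold x in Cx, Ex. fold y in Cy, Ey. fold u in Cu, Eu.
 destruct Hr as (z & w & Hr). have Hst := stateD_reach _ _ stateD_base Hr.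
 destruct (stateD_unique _ _ _ _ _ Hst) as (_ & ep & Hep & Ez & _); try (eapply cell_sD; eassumption).
 rewrite (zD_zline ep T x y u i j k t1 t2 t3 Hep Hc Cx Cy Cu Ex Ey Eu) in Ez. fold M in Ez. subst z.
 have Arc : exists w' x' y' u', let zl := zline (ep*parity i) (ep*parity j) (ep*parity k) t1 t2 t3 in
  reach (2*Ci) (zl (/ M), w, (x, y, u)) (zl (- / M), w', (x', y', u')) /\
   Rabs (x'-x) < KD/2 /\ Rabs (y'-y) < KD/2 /\ Rabs (u'-u) < KD/2.
 { have Ep : ep = 1 \/ ep = -1.
  { have Z : (ep-1)*(ep+1) = 0 by lra. apply Rmult_integral in Z. destruct Z; [left|right]; lra. }
  have Wsq := proj1 (proj2 Hst). destruct Ep as [-> | ->]; [apply Arca|apply Arcb]; auto; lra. }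
 destruct Arc as (w' & x' & y' & u' & Hr' & Bx & By & Bu). have Hr2 := reach_trans _ _ _ _ Hr Hr'.
 have Hst' := stateD_reach _ _ stateD_base Hr2.
 destruct (mirror_signs _ _ _ _ _ _ _ _ _ _ _ _ _ _ _ (P ep i Hep) (P ep j Hep) (P ep k Hep) Hc (proj1 HMh) Hst Hst') as (S1 & S2 & S3).
 have TT : Ta < T /\ Tb < T /\ Tc < T by (unfold T; lra).
 apply (full_cellD_of _ _ _ x' y' u'); [| | |eexists; eexists; exact Hr2].
 - apply (coordinate_step t1 i x x' Cx Bx). destruct (Na x T Cx Ex (proj1 TT)) as [Z|[Z Z']]; destruct S1 as [[S S']|[S S']]; auto; try (exfalso; lia).
 - apply (coordinate_step t2 j y y' Cy By). destruct (Nb y T Cy Ey (proj1 (proj2 TT))) as [Z|[Z Z']]; destruct S2 as [[S S']|[S S']]; auto; try (exfalso; lia).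
 - apply (coordinate_step t3 k u u' Cu Bu). destruct (Nc u T Cu Eu (proj2 (proj2 TT))) as [Z|[Z Z']]; destruct S3 as [[S S']|[S S']]; auto; try (exfalso; lia).
Qed.

Lemma cell0_of_sD (m : Z) (t : R) : m = 0%Z \/ m = 1%Z -> Rabs (t-IZR m*KD) < KD -> 0 < sD t -> cell 0 t.
Proof.
 intros Hm Ht Hs. destruct (cell_locate m t Ht) as [H|H]; [lra| |]; have P := parity_sD _ _ H;
  destruct Hm as [-> | ->]; auto; unfold parity in P; simpl in P; lra.
Qed.

(** * All cells of D over its domain are reached *)

Lemma base_cellD : full_cellD 0 0 0.
Proof.
 have K := KD_pos. destruct (short_arc (2*Ci) 0%C KD) as (d & Hd & H).
 { rewrite <- base_rad. apply Cmult_neq_0; intros E; apply RtoC_inj in E; lra. }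
 { lra. }
 set (e := Rmin d 1/2). have M1 : Rmin d 1 <= d by apply Rmin_l. have M2 : Rmin d 1 <= 1 by apply Rmin_r.
 have M3 : 0 < Rmin d 1 by (apply Rmin_pos; lra).
 destruct (H 0%C (- e, - e) 1%C 0 0 KD) as (w & x & y & u & Hr & Bx & By & Bu).
 { split; unfold Re, Im; simpl; rewrite Rminus_0_r, Rabs_R0; auto. }
 { apply within_small. unfold e. lra. }
 { apply base_rad. }
 have Hst := stateD_reach _ _ stateD_base Hr. destruct Hst as (Hw & _ & A1 & A2 & A3).
 set (z := (- e, - e) : C) in *. destruct (quad_eD z) as (F1 & F2 & F3).
 have V1 : v1 z < 0 by (unfold v1, z, Re; simpl; unfold e; lra). have V2 : v2 z < 0 by (unfold v2, z, Im; simpl; unfold e; lra).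
 have V3 : v3 z < 0 by (unfold v3, z, sqn, Re, Im; simpl; assert (0 < e <= / 2) by (unfold e; lra); nra).
 have Sg : forall qA qB t v v', hatD qA qB z w t -> 2*eD (qA z) (qB z) = - (v*v') -> v < 0 -> v' < 0 -> 0 < sD t.
 { intros qA qB t v v' Ht E Hv Hv'. destruct (sD_sign _ _ _ _ _ _ _ Hw Ht E) as (m & Hm & ->).
  replace (v*v') with (- v * - v') by ring. apply Rmult_lt_0_compat; [|apply Rmult_lt_0_compat]; lra. }
 apply (full_cellD_of 0 0 0 x y u); [| | |exists z, w; exact Hr].
 - apply (cell0_of_sD 0); [auto|rewrite Rmult_0_l; auto|]. apply (Sg _ _ _ _ _ A1 F1); auto.
 - apply (cell0_of_sD 0); [auto|rewrite Rmult_0_l; auto|]. apply (Sg _ _ _ _ _ A2 F2); auto.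
 - apply (cell0_of_sD 1); [auto|rewrite Rmult_1_l; auto|]. apply (Sg _ _ _ _ _ A3 F3); auto.
Qed.

Lemma step_even (t n : Z) : step t (2*n) = (2*n+t)%Z.
Proof. unfold step. rewrite Z.even_mul. reflexivity. Qed.

Lemma step_odd (t n : Z) : step t (2*n+1) = (2*n+1-t)%Z.
Proof. unfold step. rewrite Z.even_add, Z.even_mul. reflexivity. Qed.

Lemma step_involutive (t j : Z) : t = 0%Z \/ t = 1%Z \/ t = (-1)%Z -> step t (step t j) = j.
Proof.
 intros Ht. destruct (Z.Even_or_Odd j) as [[n ->]|[n ->]].
 - rewrite step_even. destruct Ht as [-> |[-> | ->]].
  + rewrite Z.add_0_r, step_even. lia.
  + rewrite step_odd. lia.
  + replace (2*n + -1)%Z with (2*(n-1)+1)%Z by lia. rewrite step_odd. lia.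
 - rewrite step_odd. destruct Ht as [-> |[-> | ->]].
  + rewrite Z.sub_0_r, step_odd. lia.
  + replace (2*n+1-1)%Z with (2*n)%Z by lia. rewrite step_even. lia.
  + replace (2*n+1 - -1)%Z with (2*(n+1))%Z by lia. rewrite step_even. lia.
Qed.

Lemma crossingD_iff (i j k t1 t2 t3 : Z) : crossing t1 t2 t3 -> (full_cellD i j k <-> full_cellD (step t1 i) (step t2 j) (step t3 k)).
Proof.
 intros Hc. split; [apply crossingD; auto|]. intros H. apply (crossingD _ _ _ t1 t2 t3 Hc) in H.
 rewrite !step_involutive in H; auto; generalize Hc; intros Hc'; crossing_cases Hc'; auto.
Qed.

(** Three crossings compose to a shift of one index by 2 with the other two indices restored. *)
Lemma full_cellD_shift (l m n : Z) :
 (full_cellD (2*l) (2*m) (2*n) <-> full_cellD (2*(l-1)) (2*m) (2*n)) /\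
 (full_cellD (2*l) (2*m) (2*n) <-> full_cellD (2*l) (2*(m-1)) (2*n)) /\
 (full_cellD (2*l) (2*m) (2*n) <-> full_cellD (2*l) (2*m) (2*(n-1))).
Proof.
 split; [|split].
 - rewrite (crossingD_iff (2*l) (2*m) (2*n) (-1) 1 0) by (unfold crossing; simpl; auto 10). rewrite !step_even.
  replace (2*l + -1)%Z with (2*(l-1)+1)%Z by lia. rewrite Z.add_0_r.
  rewrite (crossingD_iff _ _ _ 1 0 (-1)) by (unfold crossing; simpl; auto 10). rewrite step_even, !step_odd.
  replace (2*n + -1)%Z with (2*(n-1)+1)%Z by lia. rewrite Z.sub_0_r.
  rewrite (crossingD_iff _ _ _ 0 1 (-1)) by (unfold crossing; simpl; auto 10).
  replace (2*(l-1)+1-1)%Z with (2*(l-1))%Z by lia. rewrite step_even, !step_odd.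
  replace (2*(l-1)+0)%Z with (2*(l-1))%Z by lia. replace (2*m+1-1)%Z with (2*m)%Z by lia.
  replace (2*(n-1)+1 - -1)%Z with (2*n)%Z by lia. reflexivity.
 - rewrite (crossingD_iff (2*l) (2*m) (2*n) 1 (-1) 0) by (unfold crossing; simpl; auto 10). rewrite !step_even.
  replace (2*m + -1)%Z with (2*(m-1)+1)%Z by lia. rewrite Z.add_0_r.
  rewrite (crossingD_iff _ _ _ 0 1 (-1)) by (unfold crossing; simpl; auto 10). rewrite step_even, !step_odd.
  replace (2*n + -1)%Z with (2*(n-1)+1)%Z by lia. rewrite Z.sub_0_r.
  rewrite (crossingD_iff _ _ _ 1 0 (-1)) by (unfold crossing; simpl; auto 10).
  replace (2*(m-1)+1-1)%Z with (2*(m-1))%Z by lia. rewrite step_even, !step_odd.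
  replace (2*(m-1)+0)%Z with (2*(m-1))%Z by lia. replace (2*l+1-1)%Z with (2*l)%Z by lia.
  replace (2*(n-1)+1 - -1)%Z with (2*n)%Z by lia. reflexivity.
 - rewrite (crossingD_iff (2*l) (2*m) (2*n) 1 0 (-1)) by (unfold crossing; simpl; auto 10). rewrite !step_even.
  replace (2*n + -1)%Z with (2*(n-1)+1)%Z by lia. rewrite Z.add_0_r.
  rewrite (crossingD_iff _ _ _ 0 (-1) 1) by (unfold crossing; simpl; auto 10). rewrite step_even, !step_odd.
  replace (2*m + -1)%Z with (2*(m-1)+1)%Z by lia. rewrite Z.sub_0_r.
  rewrite (crossingD_iff _ _ _ 1 (-1) 0) by (unfold crossing; simpl; auto 10).
  replace (2*(n-1)+1-1)%Z with (2*(n-1))%Z by lia. rewrite step_even, !step_odd.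
  replace (2*(n-1)+0)%Z with (2*(n-1))%Z by lia. replace (2*l+1-1)%Z with (2*l)%Z by lia.
  replace (2*(m-1)+1 - -1)%Z with (2*m)%Z by lia. reflexivity.
Qed.

Lemma full_cells_D (l m n : Z) : full_cellD (2*l) (2*m) (2*n).
Proof.
 revert n. apply Z_walk; [intros; apply full_cellD_shift|].
 revert m. apply Z_walk; [intros m; exact (proj1 (proj2 (full_cellD_shift l m 0)))|].
 revert l. apply Z_walk; [intros l; exact (proj1 (full_cellD_shift l 0 0))|]. exact base_cellD.
Qed.

Lemma branchD_continuous (j : Z) (v : R) : continuous (branchD j) v.
Proof. apply (is_derive_continuous _ _ _ (proj2 (proj2 (branchD_spec j v)))). Qed.

(** Over [domD] only cells with even indices occur, and all of them are full; a small change of the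
    values avoids the flat point. Conversely the equation of the complete surface passes to the
    closure and, where [sD] is positive, is the logarithmic one by [eta_sum]. *)
Lemma closure_reachedD (x y u : R) :
 surfaceD (x, y, u) <-> closure (fun q => let '(x, y, u) := q in reachedD x y u) (x, y, u) /\ domD x /\ domD y /\ domD u.
Proof.
 split.
 - intros (Dx & Dy & Du & E). unfold sep_fun in E. split; [|auto]. rewrite !phiD_eta in E by auto.
  destruct (domD_cell _ Dx) as (i & Hi & Cx), (domD_cell _ Dy) as (j & Hj & Cy), (domD_cell _ Du) as (k & Hk & Cu).
  apply Z.even_spec in Hi, Hj, Hk. destruct Hi as [l ->], Hj as [m ->], Hk as [n ->].
  have Full := proj2 (full_cells_D l m n).
  have Eu : etaD u = - (etaD x+etaD y) by lra.
  have Ex := branchD_etaD _ _ Cx. have Ey := branchD_etaD _ _ Cy. have Eu' := branchD_etaD _ _ Cu. rewrite Eu in Eu'.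
  intros O HO.
  pose (g := fun t => (branchD (2*l) (etaD x+t), branchD (2*m) (etaD y), branchD (2*n) (- (etaD x+t+etaD y)))).
  have Cg : continuous g 0.
  { apply continuous_triple.
   - apply (continuous_comp (fun t => etaD x+t) (branchD (2*l))); [|apply branchD_continuous].
    by_derivative. auto.
   - apply continuous_const.
   - apply (continuous_comp (fun t => - (etaD x+t+etaD y)) (branchD (2*n))); [|apply branchD_continuous].
    by_derivative. auto. }
  specialize (Cg O). unfold g in Cg at 1. rewrite Rplus_0_r, Ex, Ey, Eu' in Cg. destruct (Cg HO) as [d Hd]. have P := cond_pos d.
  have Hg : forall t, 0 <= t < d -> 0 < (etaD x+t)^2+etaD y^2 -> exists q, O q /\ let '(x, y, u) := q in reachedD x y u.
  { intros t Ht Nt. exists (g t). split; [|apply Full; auto].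
   apply (Hd t). change (Rabs (t-0) < d). rewrite Rminus_0_r, Rabs_pos_eq; lra. }
  have A1 := pow2_ge_0 (etaD y).
  destruct (Req_dec (etaD x) 0) as [Z|N].
  + apply (Hg (d/2)); [lra|]. rewrite Z, Rplus_0_l. assert (0 < (d/2)^2) by (apply pow_lt; lra). lra.
  + apply (Hg 0); [lra|]. rewrite Rplus_0_r. apply pow2_gt_0 in N. lra.
 - intros (H & Dx & Dy & Du). split; [auto|]. split; [auto|]. split; [auto|]. unfold sep_fun. rewrite !phiD_eta by auto.
  apply domD_iff in Dx, Dy, Du. apply eta_sum; try lra.
  pose (F := fun q : R3 => cD (fst (fst q))+cD (snd (fst q))+cD (snd q)+cD (fst (fst q))*cD (snd (fst q))*cD (snd q)).
  change (F (x, y, u) = 0). destruct (Req_dec (F (x, y, u)) 0) as [|N]; [auto|]. exfalso.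
  have CF : continuous F (x, y, u) by (have Cc := cD_continuous; unfold F; cont).
  destruct (H (fun q => F q <> 0)) as ([[x' y'] u'] & NF & (z & w & Hr)).
  + apply (CF (fun v => v <> 0)). apply open_neq. exact N.
  + apply NF. apply (stateD_equation _ _ _ _ _ (stateD_reach _ _ stateD_base Hr)).
Qed.

(** * Homotheties of the Weierstrass representation, and conjugacy *)

Lemma closure_ext (S S' : R3 -> Prop) (p : R3) : (forall q, S q <-> S' q) -> closure S p <-> closure S' p.
Proof. intros H. split; intros Hp O HO; destruct (Hp O HO) as (q & Hq & Sq); exists q; split; auto; apply H; auto. Qed.

Definition weierstrassP8 (k : C) (p0 : R3) : R3 -> Prop :=
 weierstrass P8 (fun z => k*n1 z)%C (fun z => k*n2 z)%C (fun z => k*n3 z)%C 0%C 1%C p0.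

Lemma weierstrassP8_reach (k : C) (p0 p : R3) :
 weierstrassP8 k p0 p <-> closure (fun q => exists z w, reach k (RtoC 0, RtoC 1, p0) (z, w, q)) p.
Proof. apply closure_ext. intros q. apply continuation_reach. Qed.

Lemma weierstrassP8_rescale (mu : R) (k k' : C) (p0 q0 p : R3) : k' = (mu*k)%C ->
 weierstrassP8 k p0 p -> weierstrassP8 k' q0 (rescale mu p0 q0 p).
Proof. intros ->. apply (weierstrass_rescale mu k); intros z; (split; [|split]); ring. Qed.

Lemma rescale_similarity (mu : R) (p0 q0 : R3) : 0 < mu -> similarity (rescale mu p0 q0).
Proof.
 intros Hmu. destruct p0 as [[x0 y0] u0], q0 as [[x1 y1] u1].
 exists mu, (x1-mu*x0, y1-mu*y0, u1-mu*u0), (1, 0, 0), (0, 1, 0), (0, 0, 1).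
 split; [auto|]. split; [simpl; ring|]. split; [simpl; ring|]. split; [simpl; ring|]. split.
 - apply injective_projections; [apply injective_projections|]; simpl; ring.
 - intros x y u. rewrite rescale_E. apply injective_projections; [apply injective_projections|]; simpl; unfold plus, scal, mult; simpl;
   unfold plus, mult; simpl; ring.
Qed.

Lemma rescale_inverse (mu : R) (p0 q0 p : R3) : mu <> 0 -> rescale (/ mu) q0 p0 (rescale mu p0 q0 p) = p.
Proof.
 intros H. destruct p0 as [[x0 y0] u0], q0 as [[x1 y1] u1], p as [[x y] u]. rewrite !rescale_E. f_equal; [f_equal|]; field; auto.
Qed.

Lemma weierstrassP8_similar (mu : R) (k k' : C) (p0 q0 : R3) : 0 < mu -> k' = (mu*k)%C ->
 similar (weierstrassP8 k p0) (weierstrassP8 k' q0).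
Proof.
 intros Hmu Hk. exists (rescale mu p0 q0). split; [apply rescale_similarity; auto|]. intros p. split.
 - apply weierstrassP8_rescale; auto.
 - intros H. rewrite <- (rescale_inverse mu p0 q0 p) by lra. apply (weierstrassP8_rescale (/ mu) k'); auto.
  rewrite Hk. replace k with (RtoC (/ mu*mu)*k)%C at 1 by (rewrite Rinv_l by lra; ring). rewrite RtoC_mult. ring.
Qed.

Lemma schwarz_weierstrassP8 (c : C) : schwarz c = weierstrassP8 c (0, 0, 0).
Proof. reflexivity. Qed.

Lemma surfaceP_weierstrass (p : R3) : surfaceP p <-> weierstrassP8 2%C (KP, 0, KP/2) p.
Proof.
 rewrite weierstrassP8_reach, <- closure_reachedP. apply closure_ext. intros [[x y] u]. reflexivity.
Qed.

Lemma surfaceD_weierstrass (x y u : R) :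
 surfaceD (x, y, u) <-> weierstrassP8 (2*Ci)%C (0, 0, KD) (x, y, u) /\ domD x /\ domD y /\ domD u.
Proof.
 rewrite weierstrassP8_reach, closure_reachedD.
 rewrite (closure_ext _ (fun q => exists z w, reach (2*Ci) (RtoC 0, RtoC 1, (0, 0, KD)) (z, w, q))); [reflexivity|].
 intros [[x' y'] u']. reflexivity.
Qed.

(** Only the norms of the two structures on the codomain enter, and these are equal. *)
Lemma is_derive_C_AbsRing (f : C -> C) (z l : C) :
 is_derive (K := C_AbsRing) (V := AbsRing_NormedModule C_AbsRing) f z l <-> is_derive (K := C_AbsRing) (V := C_NormedModule) f z l.
Proof. split; intros [[H1 H2 H3] H]; (split; [constructor; [exact H1|exact H2|exact H3]|exact H]). Qed.

Lemma entire_pow (n : nat) : entire (fun z => z^n)%C.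
Proof.
 intros z. induction n as [|n [l Hl]].
 - exists (zero : C_NormedModule). apply (is_derive_const (K := C_AbsRing) (V := C_NormedModule) (RtoC 1 : C_NormedModule) z).
 - exists (plus (mult (one : C_AbsRing) (z^n)%C) (mult (z : C_AbsRing) l)). apply is_derive_C_AbsRing. apply is_derive_C_AbsRing in Hl.
  apply (is_derive_mult (K := C_AbsRing) (fun z : C_AbsRing => z) (fun z : C_AbsRing => (z^n)%C) z one l);
   [apply (is_derive_id (K := C_AbsRing))|exact Hl|intros a b; apply Cmult_comm].
Qed.

Lemma entire_plus (a b : C -> C) : entire a -> entire b -> entire (fun z => a z+b z)%C.
Proof. intros Ha Hb z. apply (ex_derive_plus (K := C_AbsRing) (V := C_NormedModule)); auto. Qed.

Lemma entire_scal (c : C) (a : C -> C) : entire a -> entire (fun z => c*a z)%C.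
Proof.
 intros Ha z. destruct (Ha z) as [l Hl]. exists (plus (mult (zero : C_AbsRing) (a z)) (mult (c : C_AbsRing) l)).
 apply is_derive_C_AbsRing. apply is_derive_C_AbsRing in Hl.
 apply (is_derive_mult (K := C_AbsRing) (fun _ : C_AbsRing => c : C_AbsRing) a z zero l);
  [apply (is_derive_const (K := C_AbsRing) (V := AbsRing_NormedModule C_AbsRing))|exact Hl|intros x y; apply Cmult_comm].
Qed.

Lemma entire_monomial (c : C) (n : nat) : entire (fun z => c*z^n)%C.
Proof. apply (entire_scal c (fun z => z^n)%C). apply entire_pow. Qed.

Lemma entire_ext (a b : C -> C) : (forall z, a z = b z) -> entire a -> entire b.
Proof. intros E H z. apply (ex_derive_ext a); auto. Qed.

Lemma weierstrass_data_P8 (k : C) : k <> 0%C ->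
 weierstrass_data P8 (fun z => k*n1 z)%C (fun z => k*n2 z)%C (fun z => k*n3 z)%C 0%C 1%C.
Proof.
 intros Hk. split; [|split; [|split; [|split; [|split; [|split; [|split]]]]]].
 - apply (entire_ext (fun z => 1*z^0+(14*z^4+1*z^8))%C); [intros; unfold P8; ring|].
  apply (entire_plus (fun z => 1*z^0)%C); [apply entire_monomial|]. apply (entire_plus (fun z => 14*z^4)%C); apply entire_monomial.
 - apply (entire_ext (fun z => k*z^0 + - k*z^2)%C); [intros; unfold n1; ring|].
  apply (entire_plus (fun z => k*z^0)%C); apply entire_monomial.
 - apply (entire_ext (fun z => k*Ci*z^0+k*Ci*z^2)%C); [intros; unfold n2; ring|].
  apply (entire_plus (fun z => k*Ci*z^0)%C); apply entire_monomial.
 - apply (entire_ext (fun z => k*2*z^1)%C); [intros; unfold n3; ring|]. apply entire_monomial.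
 - intros z. transitivity (k*k*((1-z^2)^2+(Ci*(1+z^2))^2+(2*z)^2))%C; [unfold n1, n2, n3; ring|].
  rewrite null_vector_null. ring.
 - intros z (E1 & _ & E3). have Z : z = 0%C.
  { destruct (Ceq_dec z 0%C) as [|N]; auto. exfalso. revert E3. unfold n3. apply Cmult_neq_0; auto.
   apply Cmult_neq_0; auto. intros E. apply RtoC_inj in E. lra. }
  revert E1. rewrite Z. unfold n1. replace (k*(1-0^2))%C with k by ring. auto.
 - intros E. apply RtoC_inj in E. lra.
 - apply base_rad.
Qed.

(** Multiplication by [- i] turns the constant [2 i] of D into the constant 2 of P. *)
Lemma adjoint_D_P : adjoint (weierstrassP8 (2*Ci)%C (0, 0, KD)) surfaceP.
Proof.
 exists P8, (fun z => 2*Ci*n1 z)%C, (fun z => 2*Ci*n2 z)%C, (fun z => 2*Ci*n3 z)%C, 0%C, 1%C, (0, 0, KD), (KP, 0, KP/2), (- Ci)%C.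
 split; [|split; [|split]].
 - apply weierstrass_data_P8. apply Cmult_neq_0; intros E; apply (f_equal (fun z => fst z+snd z)) in E; simpl in E; lra.
 - right. reflexivity.
 - intros p. reflexivity.
 - intros p. rewrite surfaceP_weierstrass.
  have E : forall z, (- Ci*(2*Ci*z) = 2*z)%C.
  { intros z. apply injective_projections; simpl; ring. }
  have I : forall q, rescale 1 (KP, 0, KP/2) (KP, 0, KP/2) q = q.
  { intros [[x y] u]. rewrite rescale_E. f_equal; [f_equal|]; ring. }
  split; intros H; rewrite <- I.
  + apply (weierstrass_rescale 1 2%C (fun z => 2*n1 z)%C (fun z => 2*n2 z)%C (fun z => 2*n3 z)%C); auto.
   intros z. rewrite !E, !Cmult_1_l. auto.
  + eapply (weierstrass_rescale 1 2%C); [| |exact H]; intros z; cbv beta; rewrite ?E, ?Cmult_1_l; auto.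
Qed.

Theorem theorem2p1 :
  (* the explicit formulas for P *)
  (shiftP = sqrt 3 / 2 * ellK (3 / 4) /\
   forall t, phiP t = atan (sqrt 3 * cn (2 * t) (3 / 4))) /\
  (* both are non-planar isotropic separable minimal surfaces, with separation
     constants 4 and -4 and unit coefficients *)
  (isotropic_example cellD cellD cellD phiD phiD phiD /\
   (forall t, cellD t -> domD t) /\
   separable_minimal domD domD domD phiD phiD phiD /\
   separation_constant domD domD domD phiD phiD phiD 4 /\
   forall t, domD t -> (Derive phiD t) ^ 2 = 1 + 2 * cosh (2 * phiD t)) /\
  (isotropic_example domP domP domP phiP phiP phiP /\
   separation_constant domP domP domP phiP phiP phiP (-4) /\
   forall t, (Derive phiP t) ^ 2 = 1 + 2 * cos (2 * phiP t)) /\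
  (* every example has a separation constant, which is nonzero, and is normalized to
     one of the two equations and similar to a piece of one of the two surfaces
     according to its sign *)
  (forall (A B C : R -> Prop) (f g h : R -> R),
     isotropic_example A B C f g h ->
     (exists kappa, separation_constant A B C f g h kappa) /\
     forall kappa, separation_constant A B C f g h kappa ->
       kappa <> 0 /\
       (0 < kappa ->
          normalizes_to X_pos A B C f g h /\
          similar_to_piece (sep_surface A B C f g h) surfaceD) /\
       (kappa < 0 ->
          normalizes_to X_neg A B C f g h /\
          similar_to_piece (sep_surface A B C f g h) surfaceP)) /\
  (* no piece of the first surface is similar to a piece of the second *)
  (~ exists (T : R3 -> R3) (O : R3 -> Prop),
       similarity T /\ open O /\ (exists p, O p /\ surfaceD p) /\
       forall p, O p -> surfaceD p -> surfaceP (T p)) /\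
  (* identification with Schwarz's surfaces, and conjugacy; the logarithm restricts
     the equation of D to the part of the complete surface SD lying over domD *)
  (exists SD : R3 -> Prop,
     similar SD schwarzD /\
     (forall x y z, surfaceD (x, y, z) <->
        SD (x, y, z) /\ domD x /\ domD y /\ domD z) /\
     similar surfaceP schwarzP /\
     adjoint SD surfaceP).
Proof.
 split; [|split; [|split; [|split; [|split]]]].
 - split; [apply shiftP_eq|apply phiP_atan].
 - split; [apply isotropic_example_D|]. split; [apply cellD_domD|]. split; [apply separable_minimal_D; [apply domD_open|auto]|].
  split; [apply separation_constant_D|]. intros t Ht. rewrite (is_derive_unique _ _ _ (is_derive_phiD t Ht)). apply phiD1_sq. auto.
 - split; [apply isotropic_example_P|]. split; [apply separation_constant_P|].
  intros t. rewrite (is_derive_unique _ _ _ (is_derive_phiP t)). apply phiP1_sq.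
 - apply classification.
 - apply no_similar_piece.
 (* The complete surface D carries the constant [2 i] and P the constant 2; the homothety of ratio
    1/2 reaches Schwarz's normalizations [i] and 1. *)
 - exists (weierstrassP8 (2*Ci)%C (0, 0, KD)). split; [|split; [|split]].
  + unfold schwarzD. rewrite schwarz_weierstrassP8. apply (weierstrassP8_similar (/ 2)); [lra|].
   apply injective_projections; simpl; field.
  + intros x y u. apply surfaceD_weierstrass.
  + unfold schwarzP. rewrite schwarz_weierstrassP8. destruct (weierstrassP8_similar (/ 2) 2%C 1%C (KP, 0, KP/2) (0, 0, 0)) as (T & HT & H).
   * lra.
   * apply injective_projections; simpl; field.
   * exists T. split; [auto|]. intros p. rewrite surfaceP_weierstrass. apply H.
  + apply adjoint_D_P.
Qed.
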